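(* Let $n\ge2$ and $\psi,\psi'\in A$. (i) If $\Gamma$ and $\Gamma'$ are lattices in $G(\psi)$ then the following are equivalent (condition (a) being considered when $\Gamma,\Gamma'$ are torsion-free, so that the quotients are manifolds): (a) $\Omega(\psi)/\Gamma$ and $\Omega(\psi)/\Gamma'$ are equivalent generalized cusps; (b) $\Gamma$ and $\Gamma'$ are conjugate in $\mathrm{PGL}(n+1,\mathbb R)$; (c) $\Gamma$ and $\Gamma'$ are conjugate in $\mathrm{PGL}(\Omega(\psi))$. (ii) A lattice in $G(\psi)$ is conjugate in $\mathrm{PGL}(n+1,\mathbb R)$ into $G(\psi')$ if and only if $G(\psi)$ is conjugate (in $\mathrm{PGL}(n+1,\mathbb R)$) to $G(\psi')$. (iii) $G(\psi)$ is conjugate in $\mathrm{PGL}(n+1,\mathbb R)$ to $G(\psi')$ if and only if $\psi'=t\cdot\psi$ for some $t>0$. (iv) $\mathrm{PGL}(\Omega(\psi))=G(\psi)$ when $\psi\neq0$. (v) When $\psi\ne0$, the map $$\Theta:\mathcal T(\mathrm{Isom}(\mathbb E^{n-1}),\psi)\times\big(O(n-1)/O(\psi)\big)\longrightarrow\mathcal T(G(\psi)),\qquad \Theta([\theta],g\,O(\psi))=[g^{-1}\cdot\sigma([\theta])\cdot g]$$ is a bijection.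
   Context: A subset $\Omega\subset\mathbb{RP}^n$ is properly convex if its intersection with every projective line is connected and omits at least two points. $\partial\Omega=\Omega\setminus\operatorname{int}\Omega$. For $X\subset\mathbb{RP}^n$, $\mathrm{PGL}(X)\subset\mathrm{PGL}(n+1,\mathbb R)$ is the group of projective transformations preserving $X$. A generalized cusp is a properly convex manifold $C=\Omega/\Gamma$ ($\Omega\subset\mathbb{RP}^n$ properly convex, $\Gamma\subset\mathrm{PGL}(n+1,\mathbb R)$ discrete, acting freely, preserving $\Omega$) with $\Gamma$ virtually abelian, $\partial C=\partial\Omega/\Gamma$ compact, connected and strictly convex ($\partial\Omega$ contains no line segment), and $C$ diffeomorphic to $\partial C\times[0,\infty)$. Generalized cusps $C,C'$ are equivalent if there is a generalized cusp $C''$ and projective embeddings, that are also homotopy equivalences, of $C''$ into both $C$ and $C'$, and all three are diffeomorphic. $A=\{\psi\in\mathrm{Hom}(\mathbb R^n,\mathbb R): \psi_i:=\psi(e_i),\ \psi_1\ge\cdots\ge\psi_n\ge 0\}$. For $\psi\in A$ the type is $\mathbf t=|\{i:\psi_i>0\}|$; $V_\psi=\mathbb R_+^{\mathbf t}\times\mathbb R^{n-\mathbf t}$ with $\mathbb R_+=(0,\infty)$; $h_\psi:V_\psi\to\mathbb R$ is $$h_\psi(x)=-x_{\mathbf t+1}-\sum_{i=1}^{\mathbf t}\psi_i\log x_i+\tfrac12\sum_{i=\mathbf t+2}^n x_i^2\ (\mathbf t<n),\qquad h_\psi(x)=-\Big(\sum_{i=1}^n\psi_i\Big)^{-1}\sum_{i=1}^n\psi_i\log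 x_i\ (\mathbf t=n).$$ $\Omega(\psi)=h_\psi^{-1}((-\infty,0])\subset\mathbb R^n\subset\mathbb{RP}^n$ via $x\mapsto[x_1:\cdots:x_n:1]$. Horospheres are the level sets of $h_\psi$; $G(\psi)\subset\mathrm{PGL}(n+1,\mathbb R)$ is the subgroup preserving each horosphere. The basepoint is $b_\psi=e_1+\cdots+e_{\mathbf t}\in\partial\Omega(\psi)$ and $O(\psi)\subset G(\psi)$ is its stabilizer. A lattice in a Lie group $G$ is a discrete subgroup $H$ with $G/H$ compact. Euclidean identification of $G(\psi)$: $\partial\Omega(\psi)$ carries a flat Riemannian metric, complete and simply connected, preserved by $G(\psi)$, namely the restriction to each tangent space $T_q\partial\Omega(\psi)$ of the Hessian quadratic form $D^2_qh_\psi$. Choosing an isometry from $\partial\Omega(\psi)$ to $\mathbb E^{n-1}$ taking $b_\psi$ to $0$ identifies $G(\psi)$ with a subgroup $\mathbb R^{n-1}\rtimes O(\psi)$ of $\mathrm{Isom}(\mathbb E^{n-1})=\mathbb R^{n-1}\rtimes O(n-1)$, where $O(\psi)$ is identified with a closed subgroup of $O(n-1)$. Marked lattices: fix a collection $\mathcal H$ of groups containing exactly one representative of each isomorphism class of lattices (in $\mathrm{Isom}(\mathbb E^{n-1})$; this covers lattices in $G(\psi)$). A marked lattice in $G$ is an injective homomorphism $\theta:H\to G$, $H\in\mathcal H$, whose image is a lattice in $G$; $\mathrm{Lat}_m(G)$ is the set of these. Two marked lattices $\theta_1,\theta_2:H\to G$ are conjugate if $\theta_2=g^{-1}\cdot\theta_1\cdot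 g$ for some $g\in G$, and $\mathcal T(G)=\mathrm{Lat}_m(G)/G$ is the set of conjugacy classes. $\mathcal T(\mathrm{Isom}(\mathbb E^{n-1}),\psi)\subset\mathcal T(\mathrm{Isom}(\mathbb E^{n-1}))$ is the subset of conjugacy classes of marked lattices whose rotational part is, up to conjugacy, contained in $O(\psi)$. Since every lattice in $G(\psi)$ is a lattice in $\mathrm{Isom}(\mathbb E^{n-1})$ there is a natural surjection $\pi:\mathrm{Lat}_m(G(\psi))\to\mathcal T(\mathrm{Isom}(\mathbb E^{n-1}),\psi)$, and $\sigma:\mathcal T(\mathrm{Isom}(\mathbb E^{n-1}),\psi)\to\mathrm{Lat}_m(G(\psi))$ is a chosen right inverse, $\pi\circ\sigma=\mathrm{id}$.
   Formalization: In (v), g⁻¹·σ([θ])·g need not lie in G(ψ) (e.g. n=3, ψ=(1,1,0), a Klein bottle lattice), so Θ is taken only on the pairs ([θ], gO(ψ)) for which it is a marked lattice in G(ψ), and is shown to be a bijection from these pairs onto T(G(ψ)). *)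

(* Defs.v *)
From HB Require Import structures.
From mathcomp Require Import all_boot all_order all_algebra generic_quotient.
From mathcomp Require Import all_classical all_reals.
From mathcomp Require Import topology normedtype derive exp.

Set Implicit Arguments.
Unset Strict Implicit.
Unset Printing Implicit Defensive.

Import Order.TTheory GRing.Theory Num.Theory.
Import numFieldNormedType.Exports.

Local Open Scope classical_set_scope.
Local Open Scope quotient_scope.
Local Open Scope ring_scope.

(* The quotient of a topological space by the relation "f x = f y", with the
   quotient topology.  Projective space, PGL, orbit spaces and coset spaces are
   all obtained this way, f sending a point to its equivalence class. *)
Section FiberSpace.
Variables (T : topologicalType) (U : Type) (f : T -> U).

Definition fiber_rel : rel T := fun x y => `[< f x = f y >].

Lemma fiber_relP x y : reflect (f x = f y) (fiber_rel x y).
Proof. exact: asboolP. Qed.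

Lemma fiber_rel_equiv : equiv_class_of fiber_rel.
Proof.
split=> [x|x y|y x z]; first by apply/fiber_relP.
  by apply/fiber_relP/fiber_relP.
by move=> /fiber_relP xy /fiber_relP yz; apply/fiber_relP; rewrite xy.
Qed.

Canonical fiber_equiv := EquivRelPack fiber_rel_equiv.

Definition fiber_space : Type := quotient_topology {eq_quot fiber_equiv}.

HB.instance Definition _ := Topological.on fiber_space.

Definition fiber_pi (x : T) : fiber_space := (\pi_({eq_quot fiber_equiv}) x)%qT.
Definition fiber_repr (c : fiber_space) : T := repr (c : {eq_quot fiber_equiv}).

Lemma fiber_reprK : cancel fiber_repr fiber_pi.
Proof. exact: reprK. Qed.

Lemma fiber_piP x y : fiber_pi x = fiber_pi y <-> f x = f y.
Proof.
split=> [/eqmodP/fiber_relP //|xy].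
by apply/eqmodP; apply/fiber_relP.
Qed.

Lemma fiber_piK x : f (fiber_repr (fiber_pi x)) = f x.
Proof. by apply/fiber_piP; rewrite fiber_reprK. Qed.

End FiberSpace.

(* A group law and a topology on the same type, with no compatibility axiom:
   both instances below are topological groups, but this is not recorded. *)
#[short(type="groupTopType")]
HB.structure Definition GroupTop := {G of Group G & Topological G}.

Section Projective.
Variables (R : realType) (n : nat).

Definition nonzero_vec := set_type [set v : 'cV[R]_(n + 1) | v != 0].
Definition gl_mx := set_type [set A : 'M[R]_(n + 1) | A \in unitmx].

Definition punctured_line (v : nonzero_vec) : set 'cV[R]_(n + 1) :=
  [set a *: val v | a in [set a : R | a != 0]].
Definition scalar_class (A : gl_mx) : set 'M[R]_(n + 1) :=
  [set a *: val A | a in [set a : R | a != 0]].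

Definition RP : Type := fiber_space punctured_line.
HB.instance Definition _ := Topological.on RP.

Definition PGL : Type := fiber_space scalar_class.
HB.instance Definition _ := Topological.on PGL.

Definition pt (v : 'cV[R]_(n + 1)) (v0 : v != 0) : RP :=
  fiber_pi punctured_line (exist _ v (mem_set v0)).
Definition pgl (A : 'M[R]_(n + 1)) (uA : A \in unitmx) : PGL :=
  fiber_pi scalar_class (exist _ A (mem_set uA)).

Definition vec_of (x : RP) : 'cV[R]_(n + 1) := val (fiber_repr x).
Definition mx_of (g : PGL) : 'M[R]_(n + 1) := val (fiber_repr g).

Lemma vec_of_neq0 x : vec_of x != 0.
Proof. by rewrite /vec_of; case: (fiber_repr x) => v /= /set_mem. Qed.

Lemma mx_of_unit g : mx_of g \in unitmx.
Proof. by rewrite /mx_of; case: (fiber_repr g) => v /= /set_mem. Qed.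

Lemma mulmx_neq0 (A : 'M[R]_(n + 1)) (v : 'cV[R]_(n + 1)) :
  A \in unitmx -> v != 0 -> A *m v != 0.
Proof.
move=> uA; apply: contra_neq => Av0.
by rewrite -[v]mul1mx -(mulVmx uA) -mulmxA Av0 mulmx0.
Qed.

Lemma mulmx_unit (A B : 'M[R]_(n + 1)) :
  A \in unitmx -> B \in unitmx -> A *m B \in unitmx.
Proof. by rewrite unitmx_mul => -> ->. Qed.

Lemma invmx_unit (A : 'M[R]_(n + 1)) : A \in unitmx -> invmx A \in unitmx.
Proof. by rewrite unitmx_inv. Qed.

Lemma pgl_eqP A B (uA : A \in unitmx) (uB : B \in unitmx) :
  pgl uA = pgl uB <-> exists2 a : R, a != 0 & B = a *: A.
Proof.
rewrite /pgl fiber_piP /scalar_class /=; split=> [/seteqP[_ BA]|[a a0 ->]].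
  have [] : [set a *: B | a in [set a : R | a != 0]] B.
    by exists 1; [exact: oner_neq0|rewrite scale1r].
  move=> c c0 _.
  have [|b b0 <-] := BA B.
    by exists 1; [exact: oner_neq0|rewrite scale1r].
  by exists b.
apply/seteqP; split=> _ [c c0 <-].
  by exists (c / a); [rewrite /= mulf_neq0 ?invr_eq0|rewrite scalerA divfK].
by exists (c * a); [rewrite /= mulf_neq0|rewrite scalerA].
Qed.

Lemma pgl_mx_of g : pgl (mx_of_unit g) = g.
Proof.
rewrite -[RHS]fiber_reprK /pgl; congr fiber_pi.
exact: val_inj.
Qed.

Lemma mx_of_pgl A (uA : A \in unitmx) :
  exists2 a : R, a != 0 & mx_of (pgl uA) = a *: A.
Proof. by apply/(pgl_eqP uA (mx_of_unit _)); rewrite pgl_mx_of. Qed.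

Lemma pt_eqP v w (v0 : v != 0) (w0 : w != 0) :
  pt v0 = pt w0 <-> exists2 a : R, a != 0 & w = a *: v.
Proof.
rewrite /pt fiber_piP /punctured_line /=; split=> [/seteqP[_ BA]|[a a0 ->]].
  have [|b b0 <-] := BA w.
    by exists 1; [exact: oner_neq0|rewrite scale1r].
  by exists b.
apply/seteqP; split=> _ [c c0 <-].
  by exists (c / a); [rewrite /= mulf_neq0 ?invr_eq0|rewrite scalerA divfK].
by exists (c * a); [rewrite /= mulf_neq0|rewrite scalerA].
Qed.

Definition pgl_mul (g h : PGL) : PGL :=
  pgl (mulmx_unit (mx_of_unit g) (mx_of_unit h)).
Definition pgl_one : PGL := pgl (unitmx1 R (n + 1)).
Definition pgl_inv (g : PGL) : PGL := pgl (invmx_unit (mx_of_unit g)).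

Lemma pgl_mulA : associative pgl_mul.
Proof.
move=> g h k; apply/pgl_eqP.
have [a a0 ->] := mx_of_pgl (mulmx_unit (mx_of_unit h) (mx_of_unit k)).
have [b b0 ->] := mx_of_pgl (mulmx_unit (mx_of_unit g) (mx_of_unit h)).
exists (b / a); first by rewrite mulf_neq0 ?invr_eq0.
by rewrite -scalemxAr -scalemxAl scalerA divfK// mulmxA.
Qed.

Lemma pgl_mul1 : left_id pgl_one pgl_mul.
Proof.
move=> g; rewrite -[RHS]pgl_mx_of; apply/pgl_eqP.
have [a a0 ->] := mx_of_pgl (unitmx1 R (n + 1)).
exists a^-1; first by rewrite invr_eq0.
by rewrite -scalemxAl mul1mx scalerA mulVf// scale1r.
Qed.

Lemma pgl_1mul : right_id pgl_one pgl_mul.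
Proof.
move=> g; rewrite -[RHS]pgl_mx_of; apply/pgl_eqP.
have [a a0 ->] := mx_of_pgl (unitmx1 R (n + 1)).
exists a^-1; first by rewrite invr_eq0.
by rewrite -scalemxAr mulmx1 scalerA mulVf// scale1r.
Qed.

Lemma pgl_mulV : left_inverse pgl_one pgl_inv pgl_mul.
Proof.
move=> g; apply/pgl_eqP.
have [a a0 ->] := mx_of_pgl (invmx_unit (mx_of_unit g)).
exists a^-1; first by rewrite invr_eq0.
by rewrite -scalemxAl mulVmx ?mx_of_unit// scalerA mulVf// scale1r.
Qed.

Lemma pgl_Vmul : right_inverse pgl_one pgl_inv pgl_mul.
Proof.
move=> g; apply/pgl_eqP.
have [a a0 ->] := mx_of_pgl (invmx_unit (mx_of_unit g)).
exists a^-1; first by rewrite invr_eq0.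
by rewrite -scalemxAr mulmxV ?mx_of_unit// scalerA mulVf// scale1r.
Qed.

HB.instance Definition _ :=
  isGroup.Build PGL pgl_mulA pgl_mul1 pgl_1mul pgl_mulV pgl_Vmul.

Definition act (g : PGL) (x : RP) : RP :=
  pt (mulmx_neq0 (mx_of_unit g) (vec_of_neq0 x)).

Definition PGL_of (X : set RP) : set PGL := [set g | act g @` X = X].

End Projective.

Section Lattices.
Variable G : groupTopType.
Implicit Types (K L : set G) (g : G).

Definition is_subgroup L :=
  [/\ L 1%g, (forall x y, L x -> L y -> L (x * y)%g) &
      (forall x, L x -> L x^-1%g)].

Definition discrete L :=
  forall x, L x -> exists2 U, nbhs x U & U `&` L = [set x].

Definition lcoset g L : set G := [set (g * x)%g | x in L].

Definition coset_space K L :=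
  fiber_space (fun x : set_type K => lcoset (val x) L).

Definition lattice K L :=
  [/\ is_subgroup L, L `<=` K, discrete L &
      compact [set: coset_space K L]].

Definition conjset g L : set G := [set (g * x * g^-1)%g | x in L].

Definition conjugate_in K L L' := exists2 g, K g & conjset g L = L'.

Definition torsion_free L :=
  forall x k, L x -> (0 < k)%N -> (x ^+ k)%g = 1%g -> x = 1%g.

Definition virtually_abelian L :=
  exists K, [/\ is_subgroup K, K `<=` L,
    (forall x y, K x -> K y -> (x * y)%g = (y * x)%g) &
    exists s : seq G, forall x, L x -> exists2 g, g \in s & lcoset g K x].

End Lattices.

(* For V of finite dimension this is the usual class C^k on the open set U. *)
Fixpoint Ck (R : realType) (V W : normedModType R) (k : nat) (U : set V)
    (f : V -> W) {struct k} : Prop :=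
  match k with
  | 0%N => forall x, U x -> {for x, continuous f}
  | k'.+1 => (forall x, U x -> differentiable f x) /\
             forall v, Ck k' U ('D_v f)
  end.

Definition smooth_on (R : realType) (V W : normedModType R) (U : set V)
  (f : V -> W) := forall k, Ck k U f.

(* The smooth structure of a space P is described by a relation "v represents
   p" between vectors v of a normed space E and points p of P (homogeneous
   coordinates, for instance); the space itself is the set of represented
   points.  A map is smooth when it lifts locally to smooth maps between open
   sets of the spaces of representatives.  When the representation has local
   smooth sections this is the usual notion, smoothness on a set that is not
   open meaning local extendability to a smooth map. *)
Section Smooth.
Variables (R : realType) (E1 E2 : normedModType R) (P1 P2 : Type).
Variables (r1 : E1 -> P1 -> Prop) (r2 : E2 -> P2 -> Prop).

Definition smooth_map (f : P1 -> P2) :=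
  forall v p, r1 v p -> exists (U : set E1) (F : E1 -> E2),
    [/\ open U, U v, smooth_on U F &
        forall w q, U w -> r1 w q -> r2 (F w) (f q)].

End Smooth.

Definition diffeomorphic (R : realType) (E1 E2 : normedModType R)
    (P1 P2 : Type) (r1 : E1 -> P1 -> Prop) (r2 : E2 -> P2 -> Prop) :=
  exists (f : P1 -> P2) (g : P2 -> P1),
    [/\ smooth_map r1 r2 f, smooth_map r2 r1 g,
        (forall v p, r1 v p -> g (f p) = p) &
        (forall w q, r2 w q -> f (g q) = q)].

Definition homotopic (R : realType) (X Y : topologicalType) (f g : X -> Y) :=
  exists F : X * R -> Y,
    [/\ {within [set p | 0 <= p.2 <= 1], continuous F},
        (forall x, F (x, 0) = f x) & (forall x, F (x, 1) = g x)].

Definition homotopy_equivalence (R : realType) (X Y : topologicalType)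
    (f : X -> Y) :=
  continuous f /\ exists g : Y -> X,
    [/\ continuous g, homotopic R (g \o f) idfun & homotopic R (f \o g) idfun].

Definition topological_embedding (X Y : topologicalType) (f : X -> Y) :=
  [/\ continuous f, injective f &
      forall U : set X, open U -> exists2 V : set Y, open V & U = f @^-1` V].

Section Cusps.
Variables (R : realType) (n : nat).
Implicit Types (Omega X : set (RP R n)) (Gamma : set (PGL R n)).

Definition independent (u v : 'cV[R]_(n + 1)) := \rank (row_mx u v) = 2%N.

Definition proj_line (u v : 'cV[R]_(n + 1)) : set (RP R n) :=
  [set x | exists (a b : R) (h : a *: u + b *: v != 0), x = pt h].

Definition proj_segment (u v : 'cV[R]_(n + 1)) : set (RP R n) :=
  [set x | exists (a b : R) (h : a *: u + b *: v != 0),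
             [/\ 0 <= a, 0 <= b & x = pt h]].

Definition properly_convex Omega :=
  forall u v, independent u v ->
    connected (Omega `&` proj_line u v) /\
    exists x y, [/\ x <> y, (proj_line u v `\` Omega) x &
                    (proj_line u v `\` Omega) y].

Definition bdry Omega : set (RP R n) := Omega `\` interior Omega.

Definition contains_no_segment X :=
  forall u v, independent u v -> ~ (proj_segment u v `<=` X).

(* The quotient X / Gamma: Gamma x = Gamma y as subsets of RP^n. *)
Definition orbit_space Gamma X :=
  fiber_space (fun x : set_type X => [set act g (val x) | g in Gamma]).

Definition orbit_pi Gamma X (x : set_type X) : orbit_space Gamma X :=
  fiber_pi _ x.

Definition rep_proj X (v : 'cV[R]_(n + 1)) (x : RP R n) :=
  X x /\ exists v0 : v != 0, x = pt v0.

Definition rep_orbit Gamma X (v : 'cV[R]_(n + 1)) (c : orbit_space Gamma X) :=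
  exists2 x : set_type X, rep_proj X v (val x) & c = orbit_pi Gamma x.

(* X / Gamma x [0, oo) *)
Definition rep_orbit_ray Gamma X (w : 'cV[R]_(n + 1) * R)
    (p : orbit_space Gamma X * R) :=
  [/\ rep_orbit w.1 p.1, w.2 = p.2 & 0 <= p.2].

(* W intersected with the closed half-space R^(n-1) x [0, oo) *)
Definition rep_half (W : set ('cV[R]_n.-1 * R)) (w p : 'cV[R]_n.-1 * R) :=
  [/\ w = p, W p & 0 <= p.2].

(* Omega is a smooth n-manifold with boundary, on which Gamma acts as the
   group of deck transformations of a covering with Hausdorff quotient. *)
Definition properly_convex_manifold Omega Gamma :=
  [/\ properly_convex Omega,
      [/\ is_subgroup Gamma, discrete Gamma & Gamma `<=` PGL_of Omega],
      (forall g x, Gamma g -> Omega x -> act g x = x -> g = 1%g),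
      (forall x, Omega x -> exists U : set (RP R n), [/\ open U, U x &
         forall g y, Gamma g -> (Omega `&` U) y -> U (act g y) -> g = 1%g]) /\
      hausdorff_space (orbit_space Gamma Omega) &
      forall x, Omega x ->
        exists (U : set (RP R n)) (W : set ('cV[R]_n.-1 * R)),
          [/\ open U, U x, open W &
              diffeomorphic (rep_proj (Omega `&` U)) (rep_half W)]].

Definition generalized_cusp Omega Gamma :=
  [/\ properly_convex_manifold Omega Gamma,
      virtually_abelian Gamma,
      compact [set: orbit_space Gamma (bdry Omega)] /\
      connected [set: orbit_space Gamma (bdry Omega)],
      contains_no_segment (bdry Omega) &
      diffeomorphic (@rep_orbit Gamma Omega)
                    (@rep_orbit_ray Gamma (bdry Omega))].

Definition projective_embedding Gamma Omega Gamma' Omega'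
    (f : orbit_space Gamma Omega -> orbit_space Gamma' Omega') :=
  topological_embedding f /\
  forall x : set_type Omega, exists (U : set (RP R n)) (g : PGL R n),
    [/\ open U, U (val x) &
        forall y : set_type Omega, U (val y) ->
          exists2 z : set_type Omega', val z = act g (val y) &
            f (orbit_pi Gamma y) = orbit_pi Gamma' z].

Definition cusp_embeds Omega Gamma Omega' Gamma' :=
  exists f : orbit_space Gamma Omega -> orbit_space Gamma' Omega',
    projective_embedding f /\ homotopy_equivalence R f.

Definition cusp_diffeo Omega Gamma Omega' Gamma' :=
  diffeomorphic (@rep_orbit Gamma Omega) (@rep_orbit Gamma' Omega').

Definition equivalent_cusps Omega Gamma Omega' Gamma' :=
  [/\ generalized_cusp Omega Gamma, generalized_cusp Omega' Gamma' &
      exists (Omega'' : set (RP R n)) (Gamma'' : set (PGL R n)),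
        [/\ generalized_cusp Omega'' Gamma'',
            cusp_embeds Omega'' Gamma'' Omega Gamma,
            cusp_embeds Omega'' Gamma'' Omega' Gamma' &
            [/\ cusp_diffeo Omega'' Gamma'' Omega Gamma,
                cusp_diffeo Omega'' Gamma'' Omega' Gamma' &
                cusp_diffeo Omega Gamma Omega' Gamma']]].

End Cusps.

(* Hom(R^n, R) is the space of row vectors.  Indices start at 0, so that the
   coordinate x_(t+1) is the one of index t. *)
Section Models.
Variables (R : realType) (n : nat).
Implicit Types (psi : 'rV[R]_n) (x : 'cV[R]_n).

Definition weyl : set 'rV[R]_n :=
  [set psi | (forall i j : 'I_n, (i <= j)%N -> psi 0 j <= psi 0 i) /\
             (forall i, 0 <= psi 0 i)].

Definition ctype psi : nat := #|[pred i : 'I_n | 0 < psi 0 i]|.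

Definition dom_h psi : set 'cV[R]_n :=
  [set x | forall i : 'I_n, (i < ctype psi)%N -> 0 < x i 0].

Definition horo_fun psi x : R :=
  if (ctype psi < n)%N then
    - \sum_(i < n | (i == ctype psi :> nat)%N) x i 0
    - \sum_(i < n | (i < ctype psi)%N) psi 0 i * ln (x i 0)
    + 2^-1 * \sum_(i < n | (ctype psi < i)%N) x i 0 ^+ 2
  else - (\sum_i psi 0 i)^-1 * \sum_i psi 0 i * ln (x i 0).

Lemma affine_neq0 x : col_mx x (1%:M : 'M[R]_1) != 0.
Proof.
apply/eqP => /matrixP/(_ (rshift n 0) 0).
by rewrite col_mxEd !mxE eqxx => /eqP; rewrite oner_eq0.
Qed.

Definition affine x : RP R n := pt (affine_neq0 x).

Definition Omega psi : set (RP R n) :=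
  affine @` [set x | dom_h psi x /\ horo_fun psi x <= 0].

Definition horosphere psi (c : R) : set (RP R n) :=
  affine @` [set x | dom_h psi x /\ horo_fun psi x = c].

Definition Gpsi psi : set (PGL R n) :=
  [set g | forall c, act g @` horosphere psi c = horosphere psi c].

Definition basepoint psi : 'cV[R]_n := \col_i ((i < ctype psi)%N)%:R.

Definition Opsi psi : set (PGL R n) :=
  [set g | Gpsi psi g /\ act g (affine (basepoint psi)) = affine (basepoint psi)].

End Models.

Section Isometries.
Variables (R : realType) (m : nat).

(* Isom(E^m), the pair (A, v) acting as y |-> A y + v *)
Definition isom : Type :=
  set_type [set p : 'M[R]_m * 'cV[R]_m | p.1^T *m p.1 = 1%:M].
HB.instance Definition _ := Topological.on isom.

Definition rot (a : isom) : 'M[R]_m := (val a).1.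
Definition trans (a : isom) : 'cV[R]_m := (val a).2.

Lemma rotTK a : (rot a)^T *m rot a = 1%:M.
Proof. by rewrite /rot; case: a => p /= /set_mem. Qed.

Lemma rotKT a : rot a *m (rot a)^T = 1%:M.
Proof. by apply: mulmx1C; exact: rotTK. Qed.

Definition mk_isom (A : 'M[R]_m) (v : 'cV[R]_m) (h : A^T *m A = 1%:M) : isom :=
  exist _ (A, v) (mem_set (h : [set p | p.1^T *m p.1 = 1%:M] (A, v))).

Lemma isom_eq (a b : isom) : rot a = rot b -> trans a = trans b -> a = b.
Proof.
move=> r t; apply: val_inj; move: r t; rewrite /rot /trans.
by case: (val a) (val b) => [A v] [B w] /= -> ->.
Qed.

Lemma isom_mul_subproof (a b : isom) :
  (rot a *m rot b)^T *m (rot a *m rot b) = 1%:M.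
Proof. by rewrite trmx_mul mulmxA -(mulmxA _ _ (rot a)) rotTK mulmx1 rotTK. Qed.

Lemma isom_one_subproof : (1%:M : 'M[R]_m)^T *m 1%:M = 1%:M.
Proof. by rewrite trmx1 mulmx1. Qed.

Lemma isom_inv_subproof (a : isom) : ((rot a)^T)^T *m (rot a)^T = 1%:M.
Proof. by rewrite trmxK rotKT. Qed.

Definition isom_mul (a b : isom) : isom :=
  mk_isom (rot a *m trans b + trans a) (isom_mul_subproof a b).
Definition isom_one : isom := mk_isom 0 isom_one_subproof.
Definition isom_inv (a : isom) : isom :=
  mk_isom (- ((rot a)^T *m trans a)) (isom_inv_subproof a).

Lemma isom_mulA : associative isom_mul.
Proof.
move=> a b c; apply: isom_eq; first exact: mulmxA.
by rewrite /trans /= -!/(trans _) -!/(rot _) mulmxDr mulmxA addrA.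
Qed.

Lemma isom_mul1 : left_id isom_one isom_mul.
Proof.
move=> a; apply: isom_eq; first exact: mul1mx.
by rewrite /trans /rot /= mul1mx addr0.
Qed.

Lemma isom_1mul : right_id isom_one isom_mul.
Proof.
move=> a; apply: isom_eq; first exact: mulmx1.
by rewrite /trans /rot /= mulmx0 add0r.
Qed.

Lemma isom_mulV : left_inverse isom_one isom_inv isom_mul.
Proof.
move=> a; apply: isom_eq; first exact: rotTK.
by rewrite /trans /rot /= subrr.
Qed.

Lemma isom_Vmul : right_inverse isom_one isom_inv isom_mul.
Proof.
move=> a; apply: isom_eq; first exact: rotKT.
by rewrite /trans /= -!/(trans _) -!/(rot _) mulmxN mulmxA rotKT mul1mx addNr.
Qed.

HB.instance Definition _ :=
  isGroup.Build isom isom_mulA isom_mul1 isom_1mul isom_mulV isom_Vmul.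

Definition isom_act (a : isom) (y : 'cV[R]_m) : 'cV[R]_m :=
  rot a *m y + trans a.

(* O(m), as the stabilizer of 0 in Isom(E^m) *)
Definition orth : set isom := [set a | trans a = 0].

Definition rotational_part (a : isom) : isom := mk_isom 0 (rotTK a).

End Isometries.

Arguments orth {R m}.

Section Identification.
Variables (R : realType) (n : nat).
Implicit Types (psi : 'rV[R]_n) (phi : 'cV[R]_n.-1 -> 'cV[R]_n).

Definition hessian psi (q u v : 'cV[R]_n) : R := 'D_u ('D_v (horo_fun psi)) q.

(* phi is the inverse of an isometry from the boundary of Omega(psi), with the
   metric D^2 h, to E^(n-1) taking the basepoint to 0. *)
Definition euclidean_chart psi phi :=
  [/\ smooth_on setT phi, injective phi,
      (@affine R n \o phi) @` setT = bdry (Omega psi),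
      phi 0 = basepoint psi &
      forall y u v,
        hessian psi (phi y) ('D_u phi y) ('D_v phi y) = (u^T *m v) 0 0].

(* Image in Isom(E^(n-1)) of a group K of projective transformations that
   preserve the boundary of Omega(psi). *)
Definition euclidean phi (K : set (PGL R n)) : set (isom R n.-1) :=
  [set a | exists2 g, K g &
     forall y, act g (affine (phi y)) = affine (phi (isom_act a y))].

End Identification.

Definition is_hom (G K : groupType) (f : G -> K) :=
  forall x y, f (x * y)%g = (f x * f y)%g.

Section Marked.
Variables (I : Type) (H : I -> groupType) (K : groupTopType).

Definition marking : Type := {i : I & H i -> K}.

Definition mfun (m : marking) : H (projT1 m) -> K := projT2 m.
Arguments mfun : clear implicits.

Definition marked_lattices (G : set K) : set marking :=
  [set m : marking | [/\ is_hom (mfun m), injective (mfun m) &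
                          lattice G (range (mfun m))]].

(* g^-1 . theta . g *)
Definition conj_marking (g : K) (m : marking) : marking :=
  existT _ (projT1 m) (fun x => (g^-1 * mfun m x * g)%g).

Definition conj_class (G : set K) (m : marking) : set marking :=
  [set conj_marking g m | g in G].

Definition teich (G : set K) : set (set marking) :=
  conj_class G @` marked_lattices G.

(* (H i)_i contains exactly one representative of each isomorphism class of
   lattices in K *)
Definition represents_lattices :=
  [/\ (forall i, exists theta : H i -> K,
         marked_lattices setT (existT _ i theta)),
      (forall L, lattice setT L -> exists m : marking,
         marked_lattices setT m /\ range (mfun m) = L) &
      (forall i j (f : H i -> H j), bijective f ->
         is_hom f -> i = j)].

End Marked.

Arguments mfun {I H K} m.
Arguments teich {I} H {K} G.

Section Theta.
Variables (R : realType) (n : nat) (I : Type) (H : I -> groupType).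
Variables (psi : 'rV[R]_n) (phi : 'cV[R]_n.-1 -> 'cV[R]_n).
Notation marking := (marking H (isom R n.-1)).

(* G(psi) and O(psi), as subgroups of Isom(E^(n-1)) *)
Definition GE : set (isom R n.-1) := euclidean phi (Gpsi psi).
Definition OE : set (isom R n.-1) := euclidean phi (Opsi psi).

(* T(Isom(E^(n-1)), psi) *)
Definition teich_psi : set (set marking) :=
  conj_class setT @`
    [set m : marking | marked_lattices setT m /\
       exists2 k, orth k &
         forall x, OE (k^-1 * rotational_part (mfun m x) * k)%g].

(* sigma is a right inverse of
   pi : Lat_m(G(psi)) -> T(Isom(E^(n-1)), psi), theta |-> [theta] *)
Definition right_inverse_pi (sigma : set marking -> marking) :=
  forall c, teich_psi c ->
    marked_lattices GE (sigma c) /\ conj_class setT (sigma c) = c.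

(* O(n-1)/O(psi) *)
Definition orth_cosets : set (set (isom R n.-1)) :=
  [set lcoset g OE | g in orth].

(* For g in O(n-1), the marking g^-1 . sigma([theta]) . g always takes its
   values in Isom(E^(n-1)), but it takes them in G(psi) only if g conjugates
   the rotational part of sigma([theta]) into O(psi).  The formula for Theta
   defines a class in T(G(psi)) exactly on the following pairs. *)
Definition Theta_dom (sigma : set marking -> marking) :
    set (set marking * set (isom R n.-1)) :=
  [set p | (teich_psi `*` orth_cosets) p /\
     forall g, orth g -> p.2 = lcoset g OE ->
       marked_lattices GE (conj_marking g (sigma p.1))].

Definition is_Theta (sigma : set marking -> marking)
    (Theta : set marking * set (isom R n.-1) -> set marking) :=
  forall c g, orth g -> Theta_dom sigma (c, lcoset g OE) ->
    Theta (c, lcoset g OE) = conj_class GE (conj_marking g (sigma c)).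

End Theta.

(* Main.v *)
(* In the logarithmic coordinates [lg] the horospheres become the translates of
   a graph over R^(n-1), and G(psi) acts on [Omega psi] = R^(n-1) x [0, oo) as a
   group of isometries of the first factor, containing all translations.  The
   affine shape of an element of PGL(Omega) is read off the recession cone of
   Omega, which gives (iv).

   A lattice contains, by Bieberbach's argument, a coarsely dense set of
   translations.  Rescaled limits of the conjugated translations are rank-one
   matrices, from which psi is recovered up to scaling and the conjugating matrix
   up to one that acts trivially by conjugation.  This gives (ii), (iii) and the
   equivalence of (b) and (c).

   For (a) => (b), a projective embedding of quotients of properly convex sets
   lifts to a single projective map g, because a projective map fixing an open
   piece of a convex domain is trivial; lifting the homotopy from id to f o h
   shows that g conjugates the one group onto the other, and not only into it.

   For (v), a chart with orthonormal Hessian differs from the logarithmic one by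
   a local isometry of R^(n-1), which is affine, so G(psi) is a group of
   isometries containing all translations, whereas the centralizer of a lattice
   consists of translations. *)
From Pilot Require Import Defs.
From HB Require Import structures.
From mathcomp Require Import all_boot all_order all_algebra.
From mathcomp Require Import all_classical all_reals.
From mathcomp Require Import topology normedtype sequences derive realfun exp.
From mathcomp Require landau.
From mathcomp Require Import ring lra zify.
(* [rot] and [trans] must be those of [Defs]. *)
Import Pilot.Defs.

Set Implicit Arguments.
Unset Strict Implicit.
Unset Printing Implicit Defensive.
Import Order.TTheory GRing.Theory Num.Theory.
Import numFieldNormedType.Exports.
Local Open Scope classical_set_scope.
Local Open Scope ring_scope.

(** * Euclidean isometries and Bieberbach's argument *)

(** The conjugating matrix in (ii), (iii) and (b) => (c) is not known to be affine, and the
    conjugates are known only up to a scalar. This dictates the use of limits: the matrices of the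
    group and their multiples satisfy homogeneous closed conditions, which pass to rescaled limits
    of conjugated translations, and a rank-one matrix that satisfies them is a multiple of an
    elementary matrix. Each limit thus fixes a row or a column of the conjugator. Only a coarse set
    of translations is available, so the later comparisons of coefficients rest on one fact: a
    linear form that vanishes on a coarse set is zero. A conjugator may still flip signs of positive
    coordinates and shift h by a constant; both defects commute with the lattice, and removing them
    gives (b) => (c). For psi = 0 there are dilations of [Omega psi] that multiply h by a factor,
    hence the exception in (iv). The abelian subgroup in Bieberbach's argument is a double
    centralizer instead of a generated subgroup. For the homotopy in (a) => (b), whole sets of lifts
    are followed instead of paths. *)

Section MatrixEntries.
Variables (R : comRingType) (p q : nat).
Implicit Types (A B : 'M[R]_(p, q)).
Lemma mxDE A B i j : (A + B) i j = A i j + B i j. Proof. by rewrite mxE. Qed.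
Lemma mxNE A i j : (- A) i j = - A i j. Proof. by rewrite mxE. Qed.
Lemma mxZE a A i j : (a *: A) i j = a * A i j. Proof. by rewrite mxE. Qed.
Lemma mx0E i j : (0 : 'M[R]_(p, q)) i j = 0. Proof. by rewrite mxE. Qed.
End MatrixEntries.

(** For identities that are linear in the matrices involved: matrix products stay atoms for
    [ring]. *)
Ltac mxring :=
  apply/matrixP => ? ?; rewrite ?(mxDE, mxNE, mxZE, mx0E); ring.

Definition dotv (R : realType) m (u v : 'cV[R]_m) : R := (u^T *m v) 0 0.

Lemma dotv_mulmx (R : realType) m p (A : 'M[R]_(p, m)) u v :
  dotv (A *m u) v = dotv u (A^T *m v).
Proof. by rewrite /dotv trmx_mul mulmxA. Qed.

Section Euclid.
Variables (R : realType) (m : nat).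
Implicit Types (u v w : 'cV[R]_m) (A B C : 'M[R]_m).

Definition en u : R := Num.sqrt (dotv u u).

Lemma dotvE u v : dotv u v = \sum_i u i 0 * v i 0.
Proof. by rewrite /dotv mxE; apply: eq_bigr => i _; rewrite mxE. Qed.
Lemma dotvC u v : dotv u v = dotv v u.
Proof. by rewrite !dotvE; apply: eq_bigr => i _; rewrite mulrC. Qed.
Lemma dotvDl u v w : dotv (u + v) w = dotv u w + dotv v w.
Proof. by rewrite /dotv linearD mulmxDl mxE. Qed.
Lemma dotvDr u v w : dotv u (v + w) = dotv u v + dotv u w.
Proof. by rewrite /dotv mulmxDr mxE. Qed.
Lemma dotvNl u v : dotv (- u) v = - dotv u v.
Proof. by rewrite /dotv linearN mulNmx mxE. Qed.
Lemma dotvNr u v : dotv u (- v) = - dotv u v.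
Proof. by rewrite /dotv mulmxN mxE. Qed.
Lemma dotvZl a u v : dotv (a *: u) v = a * dotv u v.
Proof. by rewrite /dotv linearZ -scalemxAl mxE. Qed.
Lemma dotvZr a u v : dotv u (a *: v) = a * dotv u v.
Proof. by rewrite /dotv -scalemxAr mxE. Qed.
Lemma dotv_ge0 u : 0 <= dotv u u.
Proof. by rewrite dotvE sumr_ge0// => i _; rewrite -expr2 sqr_ge0. Qed.
Lemma dotv_eq0 u : dotv u u = 0 -> u = 0.
Proof.
rewrite dotvE => /eqP; rewrite psumr_eq0; last by move=> i _; rewrite -expr2 sqr_ge0.
move=> /allP u0; apply/colP => i; rewrite mxE.
by have := u0 i (mem_index_enum _); rewrite mulf_eq0 orbb => /eqP.
Qed.

Lemma en_ge0 u : 0 <= en u. Proof. exact: sqrtr_ge0. Qed.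
Lemma en_sqr u : en u ^+ 2 = dotv u u.
Proof. by rewrite sqr_sqrtr// dotv_ge0. Qed.
Lemma en0 : en 0 = 0.
Proof. by rewrite /en /dotv mulmx0 mxE sqrtr0. Qed.
Lemma en_eq0 u : en u = 0 -> u = 0.
Proof. by move=> u0; apply: dotv_eq0; rewrite -en_sqr u0 expr0n. Qed.
Lemma en_gt0 u : u != 0 -> 0 < en u.
Proof. by move=> u0; rewrite lt_def en_ge0 andbT; apply: contra_neq u0 => /en_eq0. Qed.
Lemma enN u : en (- u) = en u.
Proof. by rewrite /en dotvNl dotvNr opprK. Qed.
Lemma enZ a u : en (a *: u) = `|a| * en u.
Proof. by rewrite /en dotvZl dotvZr mulrA sqrtrM ?sqr_ge0// -expr2 sqrtr_sqr. Qed.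
Lemma enB u v : en (u - v) = en (v - u).
Proof. by rewrite -enN opprB. Qed.

Lemma dotv_CS u v : dotv u v <= en u * en v.
Proof.
have [->|u0] := eqVneq u 0; first by rewrite en0 mul0r /dotv trmx0 mul0mx mxE.
have up : 0 < dotv u u by rewrite -en_sqr exprn_gt0// en_gt0.
(* The squared length of this vector is |u|^2 times the Gram determinant of u and v. *)
have : 0 <= dotv (dotv u u *: v - dotv u v *: u) (dotv u u *: v - dotv u v *: u).
  exact: dotv_ge0.
rewrite !(dotvDl, dotvDr, dotvNl, dotvNr, dotvZl, dotvZr) (dotvC v u).
set a := dotv u u; set b := dotv u v; set c := dotv v v => H.
have : 0 <= a * (a * c - b ^+ 2) by move: H; rewrite /a; lra.
rewrite pmulr_rge0// subr_ge0 => H2.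
apply: le_trans (ler_norm _) _; rewrite -[leLHS]sqrtr_sqr -sqrtrM ?dotv_ge0//.
by rewrite ler_sqrt// mulr_ge0// dotv_ge0.
Qed.

Lemma en_triangle u v : en (u + v) <= en u + en v.
Proof.
rewrite -ler_sqr ?nnegrE ?addr_ge0 ?en_ge0// en_sqr sqrrD !en_sqr.
rewrite dotvDl !dotvDr (dotvC v u).
by have := dotv_CS u v; rewrite -mulr_natl; lra.
Qed.

Lemma en_triangleB u v : en (u - v) <= en u + en v.
Proof. by apply: le_trans (en_triangle _ _) _; rewrite enN. Qed.
Lemma en_lerB u v : en u - en v <= en (u - v).
Proof. by rewrite lerBlDr -{1}(subrK v u) en_triangle. Qed.

Lemma coord_le_en u i : `|u i 0| <= en u.
Proof.
rewrite -[leLHS]sqrtr_sqr ler_sqrt ?dotv_ge0// dotvE (bigD1 i)//= expr2.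
by rewrite lerDl sumr_ge0// => j _; rewrite -expr2 sqr_ge0.
Qed.

Lemma en_le_sum u : en u <= \sum_i `|u i 0|.
Proof.
have -> : en u = Num.sqrt ((\sum_i `|u i 0| ^+ 2)).
  by congr Num.sqrt; rewrite dotvE; apply: eq_bigr => i _; rewrite real_normK ?num_real// expr2.
have s0 : 0 <= \sum_i `|u i 0| by apply: sumr_ge0.
rewrite -[leRHS]ger0_norm// -sqrtr_sqr ler_sqrt ?sqr_ge0// expr2 mulr_suml.
apply: ler_sum => i _; rewrite expr2 ler_wpM2l//.
by rewrite (bigD1 i)//= lerDl sumr_ge0.
Qed.

Lemma en_orth A u : A^T *m A = 1%:M -> en (A *m u) = en u.
Proof. by move=> AA; rewrite /en dotv_mulmx mulmxA AA mul1mx. Qed.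

(** A bound on the operator norm of A - 1, phrased on vectors with the Euclidean norm. *)
Definition nearI (r : R) A := forall x, en (A *m x - x) <= r * en x.

Lemma nearI_le r s A : r <= s -> nearI r A -> nearI s A.
Proof. by move=> rs H x; apply: le_trans (H x) _; rewrite ler_wpM2r ?en_ge0. Qed.

(* No small subgroups. *)
Lemma nearI_expr_eq1 (r : R) C : r < 1 ->
  (forall k, nearI r (iter k (mulmx C) 1%:M)) -> C = 1%:M.
Proof.
move=> r1 H; pose P k := iter k (mulmx C) 1%:M.
have PD k l : P (k + l)%N = P k *m P l.
  by elim: k => [|k IH]; rewrite ?mul1mx// addSn /P /= -/(P _) IH mulmxA.
(* With Q = C^(2^j) one has Q^2 - 1 = (Q - 1)(Q - 1) + 2 (Q - 1), so each squaring stretches the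
   displacement of x by at least 2 - r > 1. Unless it vanishes, it eventually exceeds the uniform
   bound r |x|. *)
have step j x : en (P (2 ^ j)%N *m x - x) >= (2 - r) ^+ j * en (C *m x - x).
  elim: j => [|j IH]; first by rewrite expr0 mul1r /P /= mulmx1.
  rewrite expnS mul2n -addnn PD; set Q := P (2 ^ j)%N.
  set y := Q *m x - x in IH *.
  have -> : Q *m Q *m x - x = Q *m y - y + y *+ 2.
    by rewrite mulr2n addrA subrK /y mulmxBr mulmxA addrA subrK.
  have := en_lerB (y *+ 2) (- (Q *m y - y)); rewrite opprK addrC enN.
  have -> : en (y *+ 2) = 2 * en y by rewrite -scaler_nat enZ ger0_norm.
  have Hy : en (Q *m y - y) <= r * en y by exact: (H (2 ^ j)%N).
  rewrite [y *+ 2 + _]addrC => H3; rewrite exprS -mulrA.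
  have : (2 - r) * ((2 - r) ^+ j * en (C *m x - x)) <= (2 - r) * en y.
    by rewrite ler_wpM2l// subr_ge0; lra.
  by lra.
have bern j : 1 + j%:R * (1 - r) <= (2 - r) ^+ j.
  elim: j => [|j IH]; first by rewrite expr0 mul0r addr0.
  rewrite exprS -natr1; have : (2 - r) * (1 + j%:R * (1 - r)) <= (2 - r) * (2 - r) ^+ j.
    by rewrite ler_wpM2l//; lra.
  have : 0 <= j%:R * (1 - r) * (1 - r) by rewrite !mulr_ge0//; lra.
  by lra.
have key (x : 'cV[R]_m) : C *m x - x = 0.
  apply: en_eq0; apply/eqP; rewrite eq_le en_ge0 andbT leNgt; apply/negP => c0.
  set c := en (C *m x - x) in c0 *.
  pose j := Num.bound `|r * en x / ((1 - r) * c)|.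
  have r0 : 0 < (1 - r) * c by rewrite mulr_gt0// subr_gt0.
  have : r * en x < j%:R * ((1 - r) * c).
    rewrite -ltr_pdivrMr//; apply: le_lt_trans (ler_norm _) _.
    exact/archi_boundP/normr_ge0.
  have := le_trans (step j x) (H (2 ^ j)%N x).
  have := bern j; have : 0 <= (2 - r) ^+ j by rewrite exprn_ge0//; lra.
  move=> h0 h1 h2 h3.
  have : (1 + j%:R * (1 - r)) * c <= (2 - r) ^+ j * c by rewrite ler_pM2r.
  move: h2 h3 c0; rewrite -/c; move: (j%:R : R) (en x) ((2 - r) ^+ j) => jj ex X h2 h3 c0 h4.
  move: (le_lt_trans (le_trans h4 h2) h3); rewrite mulrDl mul1r -mulrA gtrDr => c1.
  by have := lt_trans c0 c1; rewrite ltxx.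
apply/matrixP => i j.
have := key (delta_mx j 0) => /subr0_eq /colP/(_ i).
by rewrite -colE !mxE andbT eq_sym => ->; rewrite eq_sym.
Qed.

End Euclid.

Section IsomBasics.
Variables (R : realType) (m : nat).
Implicit Types (a b : isom R m).

Lemma rotM a b : rot (a * b)%g = rot a *m rot b. Proof. by []. Qed.
Lemma transM a b : trans (a * b)%g = rot a *m trans b + trans a. Proof. by []. Qed.
Lemma rotV a : rot a^-1%g = (rot a)^T. Proof. by []. Qed.
Lemma transV a : trans a^-1%g = - ((rot a)^T *m trans a). Proof. by []. Qed.
Lemma rot1 : rot (1%g : isom R m) = 1%:M. Proof. by []. Qed.
Lemma trans1 : trans (1%g : isom R m) = 0. Proof. by []. Qed.
Lemma isom_actM a b y : isom_act (a * b)%g y = isom_act a (isom_act b y).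
Proof. by rewrite /isom_act rotM transM mulmxDr mulmxA addrA. Qed.
Lemma isom_act1 y : isom_act (1%g : isom R m) y = y.
Proof. by rewrite /isom_act rot1 trans1 mul1mx addr0. Qed.
Lemma isom_actVK a : cancel (isom_act a) (isom_act a^-1%g).
Proof. by move=> y; rewrite -isom_actM mulVg isom_act1. Qed.
Lemma isom_actKV a : cancel (isom_act a^-1%g) (isom_act a).
Proof. by move=> y; rewrite -isom_actM mulgV isom_act1. Qed.
Lemma isom_act_dist a x y : en (isom_act a x - isom_act a y) = en (x - y).
Proof. by rewrite /isom_act opprD addrACA subrr addr0 -mulmxBr en_orth// rotTK. Qed.
Lemma en_rot a x : en (rot a *m x) = en x. Proof. by rewrite en_orth// rotTK. Qed.
Lemma isom_act_inj a b : (forall y, isom_act a y = isom_act b y) -> a = b.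
Proof.
move=> H; have t : trans a = trans b by have := H 0; rewrite /isom_act !mulmx0 !add0r.
apply: isom_eq => //; apply/matrixP => i j.
have := H (delta_mx j 0); rewrite /isom_act t => /addIr /colP/(_ i).
by rewrite -!colE !mxE.
Qed.
Definition tr_isom (v : 'cV[R]_m) : isom R m := mk_isom v (isom_one_subproof R m).
Lemma rot_tr v : rot (tr_isom v) = 1%:M. Proof. by []. Qed.
Lemma trans_tr v : trans (tr_isom v) = v. Proof. by []. Qed.
Lemma isom_act_tr v y : isom_act (tr_isom v) y = y + v.
Proof. by rewrite /isom_act rot_tr mul1mx trans_tr. Qed.
End IsomBasics.

Section Bieberbach.
Variables (R : realType) (m : nat).
Implicit Types (a b c : isom R m) (L : set (isom R m)).

Definition near1 (r : R) a := nearI r (rot a).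
Definition comm a b := (a * b * a^-1 * b^-1)%g.

(** Expressing the commutator through a b and b a keeps inverses out of the estimates, which are
    made at the point (b a)^-1 x. *)
Lemma commK a b : (comm a b * (b * a))%g = (a * b)%g.
Proof. by rewrite /comm !mulgA mulgVK mulgVK. Qed.

(* C - 1 = (A - 1)(B - 1) A^-1 B^-1 - (B - 1)(A - 1) A^-1 B^-1. *)
Lemma near1_comm (r s : R) a b : 0 <= r -> 0 <= s -> near1 r a -> near1 s b ->
  near1 (2 * r * s) (comm a b).
Proof.
move=> r0 s0 ha hb x; set y := rot (b * a)^-1%g *m x.
have xE : x = rot (b * a)%g *m y by rewrite /y mulmxA -rotM mulgV rot1 mul1mx.
have -> : en x = en y by rewrite xE en_rot.
rewrite {1}xE mulmxA -rotM commK xE.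
pose u := rot b *m y - y; pose v := rot a *m y - y.
have -> : rot (a * b)%g *m y - rot (b * a)%g *m y = (rot a *m u - u) - (rot b *m v - v).
  by rewrite !rotM /u /v !mulmxBr -!mulmxA; mxring.
apply: le_trans (en_triangleB _ _) _.
have h1 : en (rot a *m u - u) <= r * (s * en y).
  exact: le_trans (ha u) (ler_wpM2l r0 (hb y)).
have h2 : en (rot b *m v - v) <= s * (r * en y).
  exact: le_trans (hb v) (ler_wpM2l s0 (ha y)).
by apply: le_trans (lerD h1 h2) _; lra.
Qed.

(** AB - BA = (A - 1) B - B (A - 1) and B is an isometry, so the bound is independent of b. This
    matters because it is applied to the powers b^k, which may be far from 1. *)
Lemma rot_comm_bound (r : R) a b : 0 <= r -> near1 r a -> near1 (2 * r) (comm a b).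
Proof.
move=> r0 ha x; set y := rot (b * a)^-1%g *m x.
have xE : x = rot (b * a)%g *m y by rewrite /y mulmxA -rotM mulgV rot1 mul1mx.
have -> : en x = en y by rewrite xE en_rot.
rewrite {1}xE mulmxA -rotM commK xE.
have -> : rot (a * b)%g *m y - rot (b * a)%g *m y
   = (rot a *m (rot b *m y) - rot b *m y) - rot b *m (rot a *m y - y).
  by rewrite !rotM mulmxBr !mulmxA opprB addrA subrK.
apply: le_trans (en_triangleB _ _) _; rewrite en_rot.
have := ha (rot b *m y); rewrite en_rot; have := ha y; lra.
Qed.

(** Solved from [a, b] (b a) = a b and arranged so that every bracket has the form (M - 1) v with M
    the rotation of a, of b or of [a, b]; these are the quantities that [near1] controls. *)
Lemma trans_comm a b : trans (comm a b) =
  (rot a *m trans b - trans b) - (rot (comm a b) *m trans b - trans b)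
  - ((rot (comm a b) *m (rot b *m trans a) - rot b *m trans a)
     + (rot b *m trans a - trans a)).
Proof.
move: (comm a b) (commK a b) => c /(congr1 (@trans R m)).
rewrite !transM mulmxDr => H.
have -> : trans c = rot a *m trans b + trans a
   - (rot c *m (rot b *m trans a) + rot c *m trans b).
  by rewrite -H; mxring.
by mxring.
Qed.

(** The translation part of a is halved, and that of b enters only with the weight 2 r, which tends
    to 0 along the iteration of commutators. *)
Lemma trans_comm_bound (r : R) a b : 0 <= r -> r <= 4^-1 -> near1 r a -> near1 4^-1 b ->
  en (trans (comm a b)) <= 2^-1 * en (trans a) + 2 * r * en (trans b).
Proof.
move=> r0 r4 ha hb; have hc : near1 (2^-1 * r) (comm a b).
  by have := near1_comm r0 _ ha hb; rewrite (_ : 2 * r * 4^-1 = 2^-1 * r); [apply; lra|lra].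
rewrite trans_comm; apply: le_trans (en_triangleB _ _) _.
have h1 := en_triangleB (rot a *m trans b - trans b) (rot (comm a b) *m trans b - trans b).
have h2 := en_triangle (rot (comm a b) *m (rot b *m trans a) - rot b *m trans a)
   (rot b *m trans a - trans a).
have := ha (trans b); have := hc (trans b); have := hb (trans a).
have := hc (rot b *m trans a); rewrite en_rot => h3 h4 h5 h6.
have : r * en (trans a) <= 4^-1 * en (trans a) by rewrite ler_wpM2r ?en_ge0.
have : 0 <= r * en (trans b) by rewrite mulr_ge0 ?en_ge0.
have : 0 <= en (trans a) by exact: en_ge0.
move: h1 h2 h3 h4 h5 h6; lra.
Qed.

(** Discreteness at the identity in metric terms: rotations are measured by [nearI], translations by
    their length. *)
Definition metrically_discrete L :=
  exists2 e : R, 0 < e & forall a, L a -> near1 e a -> en (trans a) <= e -> a = 1%g.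

(** Each commutator with b halves the bound on the distance of the rotation to 1 and makes the
    translation decay geometrically, so the chain enters the ball in which discreteness leaves only
    1. *)
Lemma iter_comm1 L a b : is_subgroup L -> metrically_discrete L -> L a -> L b ->
  near1 4^-1 a -> near1 4^-1 b -> exists k, iter k (comm^~ b) a = 1%g.
Proof.
move=> [L1 LM LV] [e e0 He] La Lb ha hb.
pose f k := iter k (comm^~ b) a.
have Lf k : L (f k) by elim: k => // k IH; rewrite /f /= -/(f _); exact: LM (LM _ _ (LM _ _ IH Lb) (LV _ IH)) (LV _ Lb).
have nf k : near1 (4^-1 * 2^-1 ^+ k) (f k).
  elim: k => [|k IH]; first by rewrite expr0 mulr1.
  have := near1_comm _ _ IH hb.
  rewrite (_ : 2 * (4^-1 * 2^-1 ^+ k) * 4^-1 = 4^-1 * 2^-1 ^+ k.+1).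
    by apply; rewrite ?mulr_ge0 ?exprn_ge0 ?invr_ge0.
  by rewrite exprS; lra.
pose K := en (trans a) + 4 * en (trans b).
have pos (q : R) k : 0 <= q -> 0 <= q ^+ k by move=> ?; rewrite exprn_ge0.
(* The recursion is p' <= p / 2 + 2^-k |trans b| / 2. Any ratio strictly between 1/2 and 1 absorbs
   the second term, given enough room in [K]; for the ratio 3/4 the factor 4 in [K] suffices. *)
have tf k : en (trans (f k)) <= (3/4) ^+ k * K.
  elim: k => [|k IH]; first by rewrite expr0 mul1r /K lerDl mulr_ge0 ?en_ge0.
  have h2 : (2^-1 : R) ^+ k <= (3/4) ^+ k by apply: lerXn2r; rewrite ?nnegrE//; lra.
  have h1 : (2^-1 : R) ^+ k <= 1 by apply: exprn_ile1; lra.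
  have h0 : 0 <= (2^-1 : R) ^+ k by apply: pos; lra.
  have p0 : 0 <= 4^-1 * (2^-1 : R) ^+ k by rewrite mulr_ge0// invr_ge0.
  have p4 : 4^-1 * (2^-1 : R) ^+ k <= 4^-1 by lra.
  apply: le_trans (trans_comm_bound p0 p4 (nf k) hb) _.
  move: IH (en_ge0 (trans a)) (en_ge0 (trans b)); rewrite exprS /K {K}.
  move: (en _) (en _) (en _) (_ ^+ k) (_ ^+ k) h0 h1 h2 => p q s x y y0 y1 yx IH q0 p0'.
  have : y * p <= x * p by rewrite ler_wpM2r.
  have : 0 <= x * q by rewrite mulr_ge0// (le_trans y0).
  have : 0 <= x * p by rewrite mulr_ge0// (le_trans y0).
  by move: IH; lra.
have ev (q c : R) : 0 <= q -> q < 1 -> \forall k \near \oo, q ^+ k * c <= e.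
  move=> q0 q1; have : (fun k => q ^+ k * c) @ \oo --> (0 : R).
    rewrite -(mul0r c); apply: cvgMl; apply: cvg_expr; by rewrite ger0_norm.
  move=> /cvgrPdist_le /(_ e e0); apply: filterS => k; rewrite sub0r normrN.
  exact: le_trans (ler_norm _).
have E1 : \forall k \near \oo, (3/4 : R) ^+ k * K <= e by apply: ev; lra.
have E2 : \forall k \near \oo, (2^-1 : R) ^+ k * 4^-1 <= e by apply: ev; lra.
have [k [h1 h2]] := filter_ex (filterI E1 E2).
exists k; apply: He; first exact: Lf.
  by apply: nearI_le (nf k); rewrite mulrC.
exact: le_trans (tf k) h1.
Qed.

Lemma near1_iter_comm a b k : near1 4^-1 a -> near1 4^-1 b ->
  near1 4^-1 (iter k (comm^~ b) a).
Proof.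
move=> ha hb; elim: k => [//|k IH] /=.
have p4 : 0 <= (4^-1 : R) by rewrite invr_ge0.
by apply: nearI_le (near1_comm p4 p4 IH hb); lra.
Qed.

(* [C = ABA^-1B^-1] commutes with [B], so [C^k = AB^kA^-1B^-k] is within
   [2|A - 1|] of the identity for every [k]. *)
Lemma rot_comm_eq1 a b : near1 4^-1 a ->
  rot (comm (comm a b) b) = 1%:M -> rot (comm a b) = 1%:M.
Proof.
move=> ha; set c := comm a b => h.
have cb : rot c *m rot b = rot b *m rot c.
  by rewrite -!rotM -(commK c b) (rotM (comm c b)) h mul1mx.
have cbk k : rot c *m rot (b ^+ k)%g = rot (b ^+ k)%g *m rot c.
  elim: k => [|k IH]; first by rewrite expg0 mulmx1 mul1mx.
  by rewrite expgS (rotM b) mulmxA cb -mulmxA IH mulmxA.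
pose P k := iter k (mulmx (rot c)) 1%:M.
have Pb k : P k *m rot b = rot b *m P k.
  elim: k => [|k IH]; first by rewrite mulmx1 mul1mx.
  by rewrite /P /= -/(P k) -mulmxA IH mulmxA cb mulmxA.
have key k : rot (a * b ^+ k * a^-1)%g = P k *m rot (b ^+ k)%g.
  elim: k => [|k IH]; first by rewrite expg0 mulg1 mulgV mulmx1.
  have -> : (a * b ^+ k.+1 * a^-1 = (c * b) * (a * b ^+ k * a^-1))%g.
    by rewrite /c /comm mulgVK expgS !mulgA mulgVK.
  rewrite (rotM (c * b)%g) IH (rotM c) expgS (rotM b) /P /= -/(P k).
  move: (rot c) (P k) (rot b) (Pb k) => C Q B QB.
  by rewrite -!mulmxA (mulmxA B) -QB !mulmxA.
apply: (@nearI_expr_eq1 _ _ 2^-1); first by lra.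
move=> k; rewrite -/(P k).
have -> : P k = rot (comm a (b ^+ k)%g).
  by rewrite /comm (rotM _ (b ^+ k)^-1%g) key -mulmxA -rotM mulgV rot1 mulmx1.
have -> : (2^-1 = 2 * 4^-1 :> R) by lra.
by apply: rot_comm_bound ha; rewrite invr_ge0.
Qed.

(** The chain of commutators with b reaches 1, and triviality is carried back along it: for the
    rotations by [rot_comm_eq1], for the translations t_(j+1) = (1 - B) t_j because (1 - B)^2 v = 0
    implies (1 - B) v = 0 when B is orthogonal. *)
Lemma near_fixed L a b : is_subgroup L -> metrically_discrete L -> L a -> L b ->
  near1 4^-1 a -> near1 4^-1 b ->
  rot (comm a b) = 1%:M /\ rot b *m trans (comm a b) = trans (comm a b).
Proof.
move=> sL dL La Lb ha hb; pose f k := iter k (comm^~ b) a.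
have [[|k] fk] := iter_comm1 sL dL La Lb ha hb.
  by rewrite /= in fk; rewrite /comm fk mul1g invg1 mulg1 mulgV rot1 trans1 mulmx0.
have fk1 : f k.+1 = 1%g by [].
have rf1 : rot (f 1%N) = 1%:M.
  have : rot (f k.+1) = 1%:M by rewrite fk1.
  elim: k {fk fk1} => [//|k IH] h; apply: IH.
  by apply: rot_comm_eq1 h; apply: near1_iter_comm.
have rfS j : rot (f j.+1) = 1%:M.
  elim: j => [//|j IH]; have -> : f j.+2 = comm (f j.+1) b by [].
  move: (f j.+1) IH => c IH.
  by rewrite /comm !rotM IH mul1mx !rotV IH trmx1 mulmx1 rotKT.
have tfS j : trans (f j.+2) = trans (f j.+1) - rot b *m trans (f j.+1).
  have -> : f j.+2 = comm (f j.+1) b by [].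
  have rc : rot (comm (f j.+1) b) = 1%:M := rfS j.+1.
  move: (f j.+1) rc (rfS j) => c rc rc'.
  by rewrite trans_comm rc rc' !mul1mx; mxring.
(* If v1 = u - B u is fixed by B, then |v1|^2 = <u, v1> - <B u, B v1> = 0. *)
have main j : trans (f j.+2) = 0 -> trans (f 2%N) = 0.
  elim: j => [//|j IH]; rewrite tfS => h; apply: IH; move: h => /subr0_eq.
  set v1 := trans (f j.+2) => v1E.
  apply: dotv_eq0; rewrite {1}/v1 tfS -/v1 dotvDl dotvNl {2}v1E.
  by rewrite dotv_mulmx mulmxA rotTK mul1mx subrr.
have : trans (f 2%N) = 0.
  case: k fk fk1 => [|k] _ fk1; last by apply: (main k); rewrite fk1.
  by rewrite tfS fk1 trans1 mulmx0 subr0.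
by rewrite tfS => /subr0_eq <-.
Qed.

(** The commutator is a translation by a vector w that both rotations A and B fix, while
    [trans_comm] gives w = (A - 1) tb - (B - 1) ta with ta, tb the translation parts. Such a vector
    is orthogonal to everything that A and B fix, in particular to w itself. *)
Lemma near_commute L a b : is_subgroup L -> metrically_discrete L -> L a -> L b ->
  near1 4^-1 a -> near1 4^-1 b -> (a * b = b * a)%g.
Proof.
move=> sL dL La Lb ha hb.
have [rc Bw] := near_fixed sL dL La Lb ha hb.
have [_ Aw] := near_fixed sL dL Lb La hb ha.
have cV : comm b a = (comm a b)^-1%g.
  apply: (@mulgI _ (comm a b)); rewrite mulgV /comm !mulgA mulgVK mulgVK.
  by rewrite -!mulgA (mulgA b) mulgV mul1g mulgV.
have {}Aw : rot a *m trans (comm a b) = trans (comm a b).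
  move: Aw; rewrite cV transV rc trmx1 mul1mx mulmxN => /eqP; rewrite eqr_opp.
  by move/eqP.
suff w0 : trans (comm a b) = 0.
  rewrite -(commK a b) (_ : comm a b = 1%g) ?mul1g//.
  exact: isom_eq.
have wE := trans_comm a b; rewrite rc !mul1mx !subrr subr0 add0r in wE.
apply: dotv_eq0; rewrite {1}wE !(dotvDl, dotvNl).
rewrite -{1}Aw -{3}Bw !dotv_mulmx !mulmxA !rotTK !mul1mx.
by rewrite !subrr.
Qed.

End Bieberbach.
Section Bieberbach2.
Variables (R : realType) (m : nat).
Implicit Types (a b c : isom R m) (L K : set (isom R m)).

(** Cocompactness of the action, as a metric statement about orbits and a ball centred at 0. *)
Definition coarse L := exists D : R, forall y, exists2 a, L a & en (isom_act a y) <= D.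

Lemma natmul_bounded_le0 (x B : R) : (forall k : nat, k%:R * x <= B) -> x <= 0.
Proof.
move=> H; rewrite leNgt; apply/negP => x0.
have := H (Num.bound `|B / x|); apply/negP; rewrite -ltNge -ltr_pdivrMr//.
exact: le_lt_trans (ler_norm _) (archi_boundP (normr_ge0 _)).
Qed.

Lemma mx_act_inj (A B : 'M[R]_m) : (forall y : 'cV[R]_m, A *m y = B *m y) -> A = B.
Proof.
move=> H; apply/matrixP => i j.
by have /colP/(_ i) := H (delta_mx j 0); rewrite -!colE !mxE.
Qed.

(** At the points k y the displacement is k (A - 1) y up to a constant, so boundedness forces A =
    1. *)
Lemma bounded_displacement c (B : R) :
  (forall y, en (isom_act c y - y) <= B) -> rot c = 1%:M.
Proof.
move=> H; apply: mx_act_inj => y; rewrite mul1mx; apply/subr0_eq/en_eq0.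
apply/eqP; rewrite eq_le en_ge0 andbT.
apply: (@natmul_bounded_le0 _ (B + en (trans c))) => k.
have -> : k%:R * en (rot c *m y - y)
   = en ((isom_act c (k%:R *: y) - k%:R *: y) - trans c).
  rewrite -[k%:R in LHS]ger0_norm ?ler0n// -enZ; congr en.
  by rewrite /isom_act -scalemxAr; mxring.
by apply: le_trans (en_triangleB _ _) _; rewrite lerD2r.
Qed.

(** An isometry commuting with a displaces y and a y by the same amount; since a y can be taken in a
    fixed ball, the displacement is bounded. *)
Lemma coarse_centralizer L c : coarse L ->
  (forall a, L a -> (a * c = c * a)%g) -> rot c = 1%:M.
Proof.
move=> [D HD] cc; apply: (@bounded_displacement c (2 * D + en (trans c))) => y.
have [a La Hy] := HD y; rewrite -(isom_act_dist a) -isom_actM cc// isom_actM.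
rewrite {1}/isom_act; set z := isom_act a y in Hy *.
have -> : rot c *m z + trans c - z = (rot c *m z - z) + trans c by mxring.
apply: le_trans (en_triangle _ _) _; rewrite lerD2r.
by apply: le_trans (en_triangleB _ _) _; rewrite en_rot; lra.
Qed.

(** Pigeonhole on the rotational parts: their entries lie in [-1, 1], the cube of matrices is cut
    into cells of side 1/N, and one element of L is chosen in each cell that L meets. *)
Lemma near_cosets L : exists2 s : seq (isom R m), (forall g, g \in s -> L g \/ g = 1%g) &
  forall x, L x -> exists2 g, g \in s & L g /\ near1 4^-1 (g^-1 * x)%g.
Proof.
(* Two rotations in one cell differ by at most m^2 / N <= 1/4 in operator norm; the summand 4 keeps
   N positive when m = 0. *)
pose N := (4 * m * m + 4)%N.
have N0 : 0 < N%:R :> R by rewrite ltr0n /N addn4.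
pose q a (p : 'I_m * 'I_m) := (rot a p.1 p.2 + 1) * N%:R.
have entry a i j : `|rot a i j| <= 1.
  have := coord_le_en (col j (rot a)) i; rewrite mxE => /le_trans; apply.
  rewrite colE en_rot /en dotvE (bigD1 j)//= big1 => [|k kj].
    by rewrite !mxE !eqxx mulr1 addr0 sqrtr1.
  by rewrite !mxE (negbTE kj) mul0r.
have q0 a p : 0 <= q a p.
  by rewrite mulr_ge0 ?(ltW N0)//; have := entry a p.1 p.2; rewrite ler_norml; lra.
pose cell a := [ffun p : 'I_m * 'I_m => (inord (Num.truncn (q a p)) : 'I_(2 * N).+1)].
have cellE a b p : cell a = cell b -> `|rot a p.1 p.2 - rot b p.1 p.2| <= N%:R^-1.
  move=> /ffunP/(_ p); rewrite !ffunE => /(congr1 val) /=.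
  have tr c : (Num.truncn (q c p) < (2 * N).+1)%N.
    rewrite truncn_lt_nat// /q -natr1 natrM.
    have : (rot c p.1 p.2 + 1) * N%:R <= 2 * N%:R.
      by rewrite ler_pM2r//; have := entry c p.1 p.2; rewrite ler_norml; lra.
    lra.
  rewrite !inordK// => e.
  have := truncn_itv (q0 a p); have := truncn_itv (q0 b p); rewrite e -natr1.
  move=> /andP[b1 b2] /andP[a1 a2].
  rewrite -(ler_pM2r N0) mulVf ?gt_eqF// -[X in _ * X](gtr0_norm N0) -normrM mulrBl.
  have -> : rot a p.1 p.2 * N%:R - rot b p.1 p.2 * N%:R = q a p - q b p.
    by rewrite /q; ring.
  by rewrite ler_norml; lra.
pose T : finType := {ffun 'I_m * 'I_m -> 'I_(2 * N).+1}.
pose P (f : T) := [set x | L x /\ cell x = f].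
(* Cells without an element of L contribute the default value 1, hence the second alternative for
   the members of the list. *)
exists [seq xget 1%g (P f) | f <- enum T].
  move=> g /mapP[f _ ->]; case: (xgetP 1%g (P f)) => [x -> [Lx _]|]; first by left.
  by move=> _; right.
move=> x Lx; have [Lg ce] : P (cell x) (xget 1%g (P (cell x))) by apply: xgetPex; exists x.
exists (xget 1%g (P (cell x))); first by apply/map_f; rewrite mem_enum.
split=> // y; move: (xget _ _) Lg ce => g Lg ce.
rewrite rotM rotV -[in X in _ - X](mul1mx y) -(rotTK g) -!mulmxA -mulmxBr.
rewrite en_orth ?trmxK ?rotKT//; apply: le_trans (en_le_sum _) _.
rewrite -mulmxBl.
have le1 i : `|((rot x - rot g) *m y) i 0| <= m%:R * (N%:R^-1 * en y).
  rewrite mxE; apply: le_trans (ler_norm_sum _ _ _) _.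
  have -> : m%:R * (N%:R^-1 * en y) = \sum_(j < m) N%:R^-1 * en y.
    by rewrite mulr_natl sumr_const card_ord.
  apply: ler_sum => j _; rewrite normrM ler_pM// ?coord_le_en// mxDE mxNE distrC.
  exact: (cellE g x (i, j) ce).
apply: le_trans (ler_sum _ (fun i _ => le1 i)) _.
have -> (c : R) : \sum_(i < m) c = m%:R * c by rewrite mulr_natl sumr_const card_ord.
rewrite !mulrA ler_wpM2r ?en_ge0//.
rewrite ler_pdivrMr// -ler_pdivrMl ?invr_gt0// invrK /N natrD !natrM; lra.
Qed.

(** The double centralizer in L of the elements close to 1. It is visibly a subgroup and contains
    these elements; it is abelian because they commute with one another and hence belong to their
    own centralizer. *)
Definition bicommutant L : set (isom R m) := [set x | L x /\
  forall y, L y -> (forall z, L z -> near1 4^-1 z -> (y * z = z * y)%g) ->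
    (x * y = y * x)%g].

Lemma bicommutant_subgroup L : is_subgroup L -> is_subgroup (bicommutant L).
Proof.
move=> [L1 LM LV]; split.
- by split=> // y _ _; rewrite mul1g mulg1.
- move=> x y [Lx Hx] [Ly Hy]; split; first exact: LM.
  by move=> z Lz Hz; rewrite -mulgA Hy// mulgA Hx// mulgA.
- move=> x [Lx Hx]; split; first exact: LV.
  move=> y Ly Hy; apply: (@mulgI _ x); rewrite !mulgA mulgV mul1g Hx//.
  by rewrite -mulgA mulgV mulg1.
Qed.

Lemma near_bicommutant L x : L x -> near1 4^-1 x -> bicommutant L x.
Proof. by move=> Lx nx; split=> // y Ly /(_ x Lx nx). Qed.

Lemma bicommutant_abelian L x y : is_subgroup L -> metrically_discrete L ->
  bicommutant L x -> bicommutant L y -> (x * y = y * x)%g.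
Proof.
move=> sL dL [Lx Hx] [Ly Hy]; apply: Hx => // z Lz nz; apply: Hy => // w Lw nw.
exact: near_commute sL dL Lz Lw nz nw.
Qed.

Lemma bicommutant_finite_index L : is_subgroup L ->
  exists2 s : seq (isom R m), (forall g, g \in s -> L g) &
    forall x, L x -> exists2 g, g \in s & bicommutant L (g^-1 * x)%g.
Proof.
move=> [L1 LM LV]; have [s sL Hs] := near_cosets L; exists s.
  by move=> g /sL[//|->].
move=> x Lx; have [g gs [Lg ng]] := Hs x Lx; exists g => //.
by apply: near_bicommutant => //; apply: LM => //; exact: LV.
Qed.

Lemma bicommutant_coarse L : is_subgroup L -> coarse L -> coarse (bicommutant L).
Proof.
move=> sL [D HD]; have [s sS Hs] := bicommutant_finite_index sL.
(* The sum over all representatives serves as a bound for the translation length of any one of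
   them. *)
exists (D + \sum_(g <- s) en (trans g)) => y.
have [a La Ha] := HD y; have [g gs Kg] := Hs a La.
exists (g^-1 * a)%g => //; rewrite isom_actM.
have le : en (trans g) <= \sum_(g <- s) en (trans g).
  rewrite (big_rem g)//= lerDl sumr_ge0// => ? _; exact: en_ge0.
apply: le_trans (_ : en (isom_act a y) + en (trans g) <= _); last by rewrite lerD.
rewrite {1}/isom_act rotV transV -mulmxBr en_orth ?trmxK ?rotKT//.
exact: en_triangleB.
Qed.

(** The double centralizer is abelian and still coarse, so each of its elements centralizes a coarse
    set. *)
Lemma bicommutant_translation L x : is_subgroup L -> metrically_discrete L ->
  coarse L -> bicommutant L x -> rot x = 1%:M.
Proof.
move=> sL dL cL Kx; apply: coarse_centralizer (bicommutant_coarse sL cL) _ => a Ka.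
exact: bicommutant_abelian sL dL Ka Kx.
Qed.

End Bieberbach2.

(** * Projective space *)

Section RPBasics.
Variables (R : realType) (n : nat).
Implicit Types (g h : PGL R n) (p : RP R n) (x : 'cV[R]_n) (v : 'cV[R]_(n + 1)).

Lemma pt_vec_of p : pt (vec_of_neq0 p) = p.
Proof. by rewrite -[RHS]fiber_reprK /pt; congr fiber_pi; exact: val_inj. Qed.

Lemma vec_of_pt v (v0 : v != 0) : exists2 a : R, a != 0 & vec_of (pt v0) = a *: v.
Proof. by apply/(pt_eqP v0 (vec_of_neq0 _)); rewrite pt_vec_of. Qed.

Lemma act_pgl_pt A (uA : A \in unitmx) v (v0 : v != 0) :
  act (pgl uA) (pt v0) = pt (mulmx_neq0 uA v0).
Proof.
apply/esym/pt_eqP; have [a a0 ->] := vec_of_pt v0; have [b b0 ->] := mx_of_pgl uA.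
by exists (b * a); rewrite ?mulf_neq0// -scalemxAl -scalemxAr scalerA.
Qed.

Lemma pt_congr v w (v0 : v != 0) (w0 : w != 0) : v = w -> pt v0 = pt w0.
Proof. by move=> vw; apply/pt_eqP; exists 1; rewrite ?oner_eq0// scale1r. Qed.

Lemma actM g h p : act (g * h)%g p = act g (act h p).
Proof.
rewrite -{1}(pt_vec_of p) -{2}(pgl_mx_of g).
by rewrite !act_pgl_pt; apply: pt_congr; rewrite mulmxA.
Qed.

Lemma act1 p : act 1%g p = p.
Proof.
rewrite -{1}(pt_vec_of p) act_pgl_pt -[RHS]pt_vec_of; apply: pt_congr.
by rewrite mul1mx.
Qed.

Lemma actVK g : cancel (act g) (act g^-1%g).
Proof. by move=> p; rewrite -actM mulVg act1. Qed.
Lemma actKV g : cancel (act g^-1%g) (act g).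
Proof. by move=> p; rewrite -actM mulgV act1. Qed.

Definition hc x : 'cV[R]_(n + 1) := col_mx x 1%:M.

Lemma hc_eq (a : R) x y : hc y = a *: hc x -> a = 1 /\ y = x.
Proof.
rewrite /hc scale_col_mx => /eq_col_mx[e1 /matrixP/(_ 0 0)].
rewrite !mxE eqxx !mulr1n mulr1 => a1; move: e1; rewrite -a1 scale1r => ->.
by split.
Qed.

Lemma affine_inj : injective (@affine R n).
Proof. by move=> x y /pt_eqP[a _ /hc_eq[]]. Qed.

Lemma act_affineP g x y : act g (affine x) = affine y <->
  exists2 a : R, a != 0 & mx_of g *m hc x = a *: hc y.
Proof.
rewrite -{1}(pgl_mx_of g) act_pgl_pt; split=> [/pt_eqP[a a0 e]|[a a0 e]].
  by exists a^-1; rewrite ?invr_eq0// /hc e scalerA mulVf// scale1r.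
by apply/pt_eqP; exists a^-1; rewrite ?invr_eq0// e scalerA mulVf// scale1r.
Qed.

Implicit Types (w : 'cV[R]_n).
Definition aff_mx (N : 'M[R]_n) (v : 'cV[R]_n) : 'M[R]_(n + 1) :=
  block_mx N v 0 1%:M.

Lemma aff_mx_hc N w x : aff_mx N w *m hc x = hc (N *m x + w).
Proof. by rewrite /aff_mx mul_block_col mulmx1 mul0mx mul1mx add0r. Qed.

Lemma aff_mx_unit N w : (aff_mx N w \in unitmx) = (N \in unitmx).
Proof.
by rewrite !unitmxE /aff_mx det_ublock det1 mulr1.
Qed.

Lemma act_aff N w (u : aff_mx N w \in unitmx) x :
  act (pgl u) (affine x) = affine (N *m x + w).
Proof. by rewrite act_pgl_pt; apply: pt_congr; exact: aff_mx_hc. Qed.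

Lemma aff_mx_eq N w N' w' : (forall x, N *m x + w = N' *m x + w') -> N = N' /\ w = w'.
Proof.
move=> H; have vv : w = w' by have := H 0; rewrite !mulmx0 !add0r.
by split=> //; apply: mx_act_inj => x; have := H x; rewrite vv => /addIr.
Qed.

Lemma aff_inv_unit N w N' w' : (forall x, N *m (N' *m x + w') + w = x) -> N \in unitmx.
Proof.
move=> H; have [|e _] := @aff_mx_eq (N *m N') (N *m w' + w) 1%:M 0.
  by move=> x; rewrite mul1mx addr0 -[RHS]H mulmxDr mulmxA addrA.
by have [] := mulmx1_unit e.
Qed.

End RPBasics.

(** * Orthonormal complement of a unit vector *)

Section Householder.
Variable R : realType.

(* The last columns of the reflection exchanging [e_0] and [w]. *)
Lemma orthonormal_complement n (w : 'cV[R]_n) : dotv w w = 1 ->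
  exists U : 'M[R]_(n, n.-1), U^T *m U = 1%:M /\ U *m U^T = 1%:M - w *m w^T.
Proof.
case: n w => [w|n w w1].
  by rewrite dotvE big_ord0 => /eqP; rewrite eq_sym oner_eq0.
have ww : w^T *m w = 1%:M by rewrite [LHS]mx11_scalar -/(dotv w w) w1.
suff [H [HT HH He]] : exists H : 'M[R]_n.+1,
    [/\ H^T = H, H *m H = 1%:M & H *m delta_mx 0 0 = w].
  pose E : 'M[R]_(n.+1, n) := \matrix_(i, j) (i == lift ord0 j)%:R.
  have EE : E^T *m E = 1%:M.
    apply/matrixP => i j; rewrite !mxE (bigD1 (lift ord0 i))//= big1 => [|k ki].
      by rewrite !mxE eqxx mul1r addr0 (inj_eq lift_inj).
    by rewrite !mxE (negbTE ki) mul0r.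
  have EE' : E *m E^T = 1%:M - delta_mx 0 0 *m (delta_mx 0 0 : 'cV_n.+1)^T.
    apply/matrixP => i j; rewrite !mxE big_ord1 !mxE andbT.
    have [->|[i' ->]] : i = ord0 \/ exists i', i = lift ord0 i'.
      by case: (unliftP ord0 i) => [i' ->|->]; [right; exists i'|left].
    rewrite big1 => [|k _]; last by rewrite !mxE (negbTE (neq_lift _ _)) mul0r.
      by rewrite eqxx mul1r eq_sym; case: eqP => _; rewrite ?subrr// subr0.
    rewrite (bigD1 i')//= big1 => [|k ki].
      by rewrite !mxE eqxx mul1r addr0 mul0r subr0 eq_sym.
    by rewrite !mxE (inj_eq lift_inj) eq_sym (negbTE ki) mul0r.
  exists (H *m E); rewrite trmx_mul HT; split.
    by rewrite -mulmxA (mulmxA H) HH mul1mx.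
  rewrite -mulmxA (mulmxA E) EE' mulmxBl mulmxBr mul1mx HH; congr (_ - _).
  by rewrite -!mulmxA -{2}HT -trmx_mul He mulmxA He.
(* In this case the vector v below would be 0 and define no reflection. *)
have [->|we] := eqVneq w (delta_mx 0 0).
  by exists 1%:M; rewrite trmx1 !mul1mx.
pose v := w - delta_mx 0 0; pose a := dotv v v.
have a0 : a != 0 by apply: contra_neq we => /dotv_eq0 /subr0_eq.
have e1 : dotv (delta_mx 0 0 : 'cV[R]_n.+1) (delta_mx 0 0) = 1.
  by rewrite dotvE (bigD1 0)//= big1 => [|i /negbTE i0]; rewrite !mxE ?i0 ?mul0r// eqxx mulr1 addr0.
have vv : v^T *m v = a%:M by rewrite [LHS]mx11_scalar.
exists (1%:M - (2 / a) *: (v *m v^T)); split.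
- by rewrite linearB /= linearZ /= trmx1 trmx_mul trmxK.
- have QQ : (v *m v^T) *m (v *m v^T) = a *: (v *m v^T).
    by rewrite mulmxA -(mulmxA v) vv mul_mx_scalar -scalemxAl.
  move: (v *m v^T) QQ => Q QQ.
  rewrite mulmxBl mul1mx mulmxBr mulmx1 -scalemxAl -scalemxAr QQ !scalerA.
  by rewrite (_ : 2 / a * (2 / a) * a = 2 / a + 2 / a) ?scalerDl; [mxring|field].
rewrite mulmxBl mul1mx -scalemxAl -mulmxA.
have -> : v^T *m delta_mx 0 0 = (- (a / 2))%:M.
  rewrite [LHS]mx11_scalar -/(dotv v (delta_mx 0 0)); congr (_%:M).
  rewrite /a /v !(dotvDl, dotvDr, dotvNl, dotvNr) w1 e1 (dotvC (delta_mx 0 0) w).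
  by field.
rewrite mul_mx_scalar scalerA (_ : 2 / a * - (a / 2) = -1); last by field.
by rewrite /v; mxring.
Qed.

End Householder.

(** * Logarithmic coordinates *)

Section LogCoordinates.
Variables (R : realType) (n : nat) (psi : 'rV[R]_n).
Hypothesis Apsi : weyl psi.
Implicit Types (x u z : 'cV[R]_n) (i j k l : 'I_n).
Local Notation t := (ctype psi).

Lemma ctype_le : (t <= n)%N.
Proof. by rewrite -[n in leqRHS]card_ord /ctype max_card. Qed.

Lemma card_ord_lt (k : nat) : (k <= n)%N -> #|[pred j : 'I_n | (j < k)%N]| = k.
Proof.
move=> kn; rewrite -sum1_card -[RHS]card_ord -sum1_card (big_ord_widen n (fun=> 1%N) kn).
by apply: eq_bigl => i; rewrite inE.
Qed.

(** As psi is nonincreasing, its positive coordinates form an initial segment, whose length is found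
    by counting. *)
Lemma psi_gt0 i : (i < t)%N = (0 < psi 0 i).
Proof.
have [sorted_psi pos_psi] := Apsi.
have [p0|p0] := ltP 0 (psi 0 i).
  suff: (i < t)%N by []; rewrite /ctype -[i.+1](card_ord_lt (ltn_ord i)).
  by apply/subset_leq_card/fintype.subsetP => j; rewrite !inE => /sorted_psi; apply: lt_le_trans.
apply/negbTE; rewrite -leqNgt /ctype.
rewrite -[leqRHS](card_ord_lt (ltnW (ltn_ord i))).
apply/subset_leq_card/fintype.subsetP => j; rewrite !inE => pj; rewrite ltnNge.
by apply/negP => /sorted_psi; rewrite leNgt (le_lt_trans p0).
Qed.

Lemma psi_eq0 i : (t <= i)%N -> psi 0 i = 0.
Proof.
move=> ti; apply/eqP; rewrite eq_le (proj2 Apsi) andbT leNgt -psi_gt0.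
by rewrite -leqNgt.
Qed.

Lemma psi_neq0 : (psi != 0) = (0 < t)%N.
Proof.
apply/idP/idP => [p0|]; last first.
  move=> t0; have n0 := leq_trans t0 ctype_le; apply/eqP => p0.
  by have := psi_gt0 (Ordinal n0); rewrite /= t0 p0 mxE ltxx.
rewrite lt0n; apply: contra_neq p0 => t0; apply/rowP => i.
by rewrite mxE psi_eq0// t0.
Qed.

(* In the case [t = n] the normalization of [horo_fun] makes the weights sum
   to [1]. *)
Definition cw i : R := if (t < n)%N then psi 0 i else psi 0 i / \sum_j psi 0 j.

Lemma sum_psi_gt0 : (0 < t)%N -> 0 < \sum_j psi 0 j.
Proof.
move=> t0; have n0 : (0 < n)%N by apply: leq_trans ctype_le.
rewrite (bigD1 (Ordinal n0))//= ltr_pwDl -?psi_gt0//.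
by apply: sumr_ge0 => i _; exact: (proj2 Apsi).
Qed.

Lemma cw_gt0 i : (i < t)%N -> 0 < cw i.
Proof.
move=> it; rewrite /cw; case: ifP => _; first by rewrite -psi_gt0.
by rewrite divr_gt0 -?psi_gt0// sum_psi_gt0// (leq_ltn_trans _ it).
Qed.

Lemma sum_cw : (0 < n)%N -> (n <= t)%N -> \sum_i cw i = 1.
Proof.
move=> n0 nt; rewrite /cw ltnNge nt /= -mulr_suml divff// gt_eqF//.
by rewrite sum_psi_gt0// (leq_trans n0).
Qed.

Definition sw i : R := Num.sqrt (cw i).
Lemma sw_gt0 i : (i < t)%N -> 0 < sw i.
Proof. by move=> it; rewrite sqrtr_gt0 cw_gt0. Qed.
Lemma sw_sqr i : (i < t)%N -> sw i ^+ 2 = cw i.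
Proof. by move=> it; rewrite sqr_sqrtr// ltW// cw_gt0. Qed.

(** The factor sqrt(c_i) turns the Hessian term c_i dx_i^2 / x_i^2 of [horo_fun] into du_i^2. *)
Definition lg x : 'cV[R]_n :=
  \col_i (if (i < t)%N then sw i * ln (x i 0) else x i 0).
Definition ex u : 'cV[R]_n :=
  \col_i (if (i < t)%N then expR (u i 0 / sw i) else u i 0).

Lemma lgE x i : lg x i 0 = if (i < t)%N then sw i * ln (x i 0) else x i 0.
Proof. by rewrite mxE. Qed.
Lemma exE u i : ex u i 0 = if (i < t)%N then expR (u i 0 / sw i) else u i 0.
Proof. by rewrite mxE. Qed.
Lemma ex_dom u : dom_h psi (ex u).
Proof. by move=> i it; rewrite exE it expR_gt0. Qed.
Lemma exK : cancel ex lg.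
Proof.
move=> u; apply/colP => i; rewrite lgE exE; case: ifP => it; rewrite ?it//.
by rewrite expRK mulrC divfK// gt_eqF// sw_gt0.
Qed.
Lemma lgK x : dom_h psi x -> ex (lg x) = x.
Proof.
move=> dx; apply/colP => i; rewrite exE lgE; case: ifP => it; rewrite ?it//.
by rewrite mulrC mulKf ?gt_eqF ?sw_gt0// lnK// posrE dx.
Qed.

(** The linear part of -[horo_fun] in the coordinates [lg]. The coordinate of index t is written as
    a sum over i == t, which is empty when t = n and so treats all types at once. *)
Definition ell u : R := \sum_(i < n | (i == t :> nat)%N) u i 0 + \sum_(i < n | (i < t)%N) sw i * u i 0.
Definition hq u : R := - ell u + 2^-1 * \sum_(i < n | (t < i)%N) u i 0 ^+ 2.
Lemma hq_def u : hq u = - ell u + 2^-1 * \sum_(i < n | (t < i)%N) u i 0 ^+ 2.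
Proof. by []. Qed.

Lemma ellD u z : ell (u + z) = ell u + ell z.
Proof.
rewrite /ell addrACA -!big_split; congr (_ + _); apply: eq_bigr => i _.
  by rewrite mxE.
by rewrite mxE mulrDr.
Qed.
Lemma ellZ a u : ell (a *: u) = a * ell u.
Proof.
rewrite /ell mulrDr !mulr_sumr; congr (_ + _); apply: eq_bigr => i _.
  by rewrite mxE.
by rewrite mxE mulrCA.
Qed.

Lemma horo_funE x : horo_fun psi x = hq (lg x).
Proof.
rewrite /horo_fun /hq /ell opprD.
have -> : \sum_(i < n | (t < i)%N) lg x i 0 ^+ 2 = \sum_(i < n | (t < i)%N) x i 0 ^+ 2.
  by apply: eq_bigr => i ti; rewrite lgE ltnNge ltnW.
have -> : \sum_(i < n | (i == t :> nat)%N) lg x i 0 = \sum_(i < n | (i == t :> nat)%N) x i 0.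
  by apply: eq_bigr => i /eqP it; rewrite lgE it ltnn.
have -> : \sum_(i < n | (i < t)%N) sw i * lg x i 0 = \sum_(i < n | (i < t)%N) cw i * ln (x i 0).
  by apply: eq_bigr => i it; rewrite lgE it mulrA -expr2 sw_sqr.
case: ifP => tn; first by congr (_ - _ + _); apply: eq_bigr => i _; rewrite /cw tn.
rewrite [\sum_(i < n | (i == t :> nat)%N) _]big1 ?oppr0 ?sub0r; last first.
  by move=> i /eqP it; move: tn; rewrite -it ltn_ord.
rewrite [\sum_(i < n | (t < i)%N) _]big1 ?mulr0 ?addr0; last first.
  by move=> i ti; move: tn; rewrite (ltn_trans ti (ltn_ord i)).
rewrite mulNr; congr (- _); rewrite mulr_sumr.
have tE : t = n by apply/eqP; rewrite eqn_leq ctype_le leqNgt tn.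
apply: eq_big => [i|i _]; first by rewrite tE ltn_ord.
by rewrite /cw tn mulrA (mulrC _ (psi 0 i)).
Qed.

(** The unit vector along which [hq] decreases at unit speed: the basis vector of index t if t < n,
    the vector of square roots of the weights if t = n, where the weights sum to 1. *)
Definition wv : 'cV[R]_n :=
  \col_i (if (t < n)%N then (i == t :> nat)%:R else sw i).

Lemma wv_gt i : (t < i)%N -> wv i 0 = 0.
Proof.
by move=> ti; rewrite mxE (ltn_trans ti)// gtn_eqF.
Qed.

Hypothesis n0 : (0 < n)%N.

Lemma wv1 : dotv wv wv = 1.
Proof.
rewrite dotvE; case: (ltnP t n) => tn.
  rewrite (bigD1 (Ordinal tn))//= big1 => [|i it]; rewrite !mxE tn /=.
    by rewrite eqxx mulr1 addr0.
  by rewrite (_ : (i == t :> nat) = false) ?mul0r//; apply: contraNF it => /eqP it; apply/eqP/val_inj.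
rewrite -(sum_cw n0 tn); apply: eq_bigr => i _; rewrite !mxE ltnNge tn /=.
by rewrite -expr2 sw_sqr// (leq_trans (ltn_ord i)).
Qed.

Lemma ell_wv : ell wv = 1.
Proof.
rewrite /ell; case: (ltnP t n) => tn.
  rewrite (bigD1 (Ordinal tn))//= big1 => [|i /andP[/eqP it ik]]; last first.
    by case/eqP: ik; apply: val_inj.
  rewrite big1 => [|i it]; first by rewrite mxE tn /= eqxx !addr0.
  by rewrite mxE tn ltn_eqF// mulr0.
rewrite big1 => [|i /eqP it]; last by move: tn; rewrite -it leqNgt ltn_ord.
rewrite add0r -(sum_cw n0 tn); apply: eq_big => [i|i it].
  by rewrite (leq_trans (ltn_ord i)).
by rewrite mxE ltnNge tn /= -expr2 sw_sqr.
Qed.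

Lemma hq_flow a u : hq (u + a *: wv) = hq u - a.
Proof.
rewrite /hq ellD ellZ ell_wv mulr1 opprD addrAC; congr (_ + _ - _); congr (_ * _).
by apply: eq_bigr => i ti; rewrite mxDE mxZE wv_gt// mulr0 addr0.
Qed.

(** The radial flow, which permutes the horospheres: a translation along the coordinate of index t
    if t < n, a homothety if t = n. *)
Definition flow a x := ex (lg x + a *: wv).

Lemma flow_dom a x : dom_h psi (flow a x). Proof. exact: ex_dom. Qed.
Lemma lg_flow a x : lg (flow a x) = lg x + a *: wv. Proof. by rewrite /flow exK. Qed.
Lemma horo_flow a x : horo_fun psi (flow a x) = horo_fun psi x - a.
Proof. by rewrite !horo_funE lg_flow hq_flow. Qed.
Lemma flow_flow a b x : flow a (flow b x) = flow (a + b) x.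
Proof. by rewrite /flow exK -addrA -scalerDl (addrC b). Qed.
Lemma flow0 x : dom_h psi x -> flow 0 x = x.
Proof. by move=> dx; rewrite /flow scale0r addr0 lgK. Qed.

Implicit Types y : 'cV[R]_n.-1.

(** An isometry of R^(n-1) onto the hyperplane orthogonal to [wv], chosen once and for all; the
    default 0 of [xget] never occurs. *)
Definition Um : 'M[R]_(n, n.-1) := xget 0
  [set U | U^T *m U = 1%:M /\ U *m U^T = 1%:M - wv *m wv^T].

Lemma UmP : Um^T *m Um = 1%:M /\ Um *m Um^T = 1%:M - wv *m wv^T.
Proof.
have [U HU] := orthonormal_complement wv1.
by rewrite /Um; case: xgetP => [V _|/(_ U)].
Qed.
Lemma UmTK : Um^T *m Um = 1%:M. Proof. by case: UmP. Qed.
Lemma UmKT u : Um *m (Um^T *m u) = u - dotv wv u *: wv.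
Proof.
rewrite mulmxA (proj2 UmP) mulmxBl mul1mx -mulmxA; congr (_ - _).
by rewrite (mx11_scalar (wv^T *m u)) mul_mx_scalar.
Qed.
Lemma Um_wv : Um^T *m wv = 0.
Proof.
by have := congr1 (mulmx Um^T) (UmKT wv); rewrite wv1 scale1r subrr mulmx0 mulmxA UmTK mul1mx.
Qed.
Lemma wv_Um y : dotv wv (Um *m y) = 0.
Proof. by rewrite dotvC dotv_mulmx Um_wv /dotv mulmx0 mxE. Qed.

Definition Yc x := Um^T *m lg x.
(** Inverse of x |-> (Yc x, - h x). Points with the same y form a flow line, and s = -h, so that
    [Omega psi] becomes s >= 0 and its boundary s = 0. *)
Definition Ph (y : 'cV[R]_n.-1) (s : R) :=
  ex (Um *m y + (s + hq (Um *m y)) *: wv).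

Lemma Ph_dom y s : dom_h psi (Ph y s). Proof. exact: ex_dom. Qed.
Lemma horo_Ph y s : horo_fun psi (Ph y s) = - s.
Proof. by rewrite horo_funE exK hq_flow opprD addrC subrK. Qed.
Lemma Yc_Ph y s : Yc (Ph y s) = y.
Proof. by rewrite /Yc exK mulmxDr mulmxA UmTK mul1mx -scalemxAr Um_wv scaler0 addr0. Qed.
Lemma Ph_Yc x : dom_h psi x -> Ph (Yc x) (- horo_fun psi x) = x.
Proof.
move=> dx; rewrite /Ph /Yc UmKT horo_funE -[in RHS](lgK dx); congr ex.
rewrite -scaleNr hq_flow opprK addKr scaleNr.
by rewrite subrK.
Qed.
Lemma dist_Yc x x' : dotv (Yc x - Yc x') (Yc x - Yc x') =
  dotv (lg x - lg x') (lg x - lg x') - dotv wv (lg x - lg x') ^+ 2.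
Proof.
rewrite /Yc -mulmxBr dotv_mulmx trmxK UmKT dotvDr dotvNr dotvZr.
by rewrite (dotvC _ wv) expr2.
Qed.

Lemma lg_basepoint : lg (basepoint psi) = 0.
Proof.
by apply/colP => i; rewrite lgE !mxE; case: (i < t)%N; rewrite ?ln1 ?mulr0.
Qed.
Lemma basepoint_dom : dom_h psi (basepoint psi).
Proof. by move=> i it; rewrite mxE it ltr01. Qed.
Lemma Yc_basepoint : Yc (basepoint psi) = 0.
Proof. by rewrite /Yc lg_basepoint mulmx0. Qed.
Lemma hq0 : hq 0 = 0.
Proof.
rewrite -[0](scale0r wv) -[_ *: _]add0r hq_flow subr0 /hq /ell.
by rewrite !big1 ?mulr0 ?addr0 ?oppr0// => i _; rewrite mxE ?mulr0// expr0n.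
Qed.
Lemma horo_basepoint : horo_fun psi (basepoint psi) = 0.
Proof. by rewrite horo_funE lg_basepoint hq0. Qed.
Lemma Ph00 : Ph 0 0 = basepoint psi.
Proof. by rewrite -(Ph_Yc basepoint_dom) Yc_basepoint horo_basepoint oppr0. Qed.

Lemma Um_vertical y i : (i == t :> nat) -> (Um *m y) i 0 = 0.
Proof.
move=> /eqP it; have tn : (t < n)%N by rewrite -it ltn_ord.
have := wv_Um y; rewrite dotvE (bigD1 i)//= big1 ?addr0 => [|j ji].
  by rewrite [wv _ _]mxE tn it eqxx mul1r.
rewrite [wv _ _]mxE tn -it (_ : (j == i :> nat) = false) ?mul0r//.
by apply: contraNF ji => /eqP ji; apply/eqP/val_inj.
Qed.

Lemma Um_ell y : (n <= t)%N -> ell (Um *m y) = 0.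
Proof.
move=> nt; rewrite -[RHS](wv_Um y) /ell big1 ?add0r => [|i /eqP it].
  rewrite dotvE; apply: eq_big => [i|i it]; first by rewrite (leq_trans (ltn_ord i)).
  by rewrite [wv _ _]mxE ltnNge nt.
by move: nt; rewrite -it leqNgt ltn_ord.
Qed.

(** The translation group of the cusp: diagonal on the positive coordinates, the parabolic group of
    a paraboloid on the others. The coordinate of index t absorbs the change of all other terms of
    h. *)
Definition tr_mx (z : 'cV[R]_n) : 'M[R]_n := \matrix_(i, j)
  if (i < t)%N then (i == j)%:R * expR (z i 0 / sw i)
  else (i == j)%:R + (i == t :> nat)%:R * (t < j)%:R * z j 0.
Definition tr_vec (z : 'cV[R]_n) : 'cV[R]_n := \col_i
  if (i < t)%N then 0 else if i == t :> nat then hq z else z i 0.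
Definition tr_map z x := tr_mx z *m x + tr_vec z.

Lemma tr_mapE z x i : tr_map z x i 0 = if (i < t)%N then expR (z i 0 / sw i) * x i 0
  else if i == t :> nat then x i 0 + hq z + \sum_(j < n | (t < j)%N) x j 0 * z j 0
  else x i 0 + z i 0.
Proof.
rewrite mxDE [tr_vec _ _ _]mxE !mxE; case: ifP => it.
  rewrite addr0 (bigD1 i)//= big1 ?addr0 => [|j ji].
    by rewrite mxE it eqxx mul1r.
  by rewrite mxE it eq_sym (negbTE ji) !mul0r.
have -> : \sum_j tr_mx z i j * x j 0
   = x i 0 + (i == t :> nat)%:R * \sum_(j < n | (t < j)%N) x j 0 * z j 0.
  transitivity (\sum_j ((i == j)%:R * x j 0 + (i == t :> nat)%:R * ((t < j)%:R * (x j 0 * z j 0)))).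
    by apply: eq_bigr => j _; rewrite mxE it; ring.
  rewrite big_split /=; congr (_ + _).
    rewrite (bigD1 i)//= eqxx mul1r big1 ?addr0// => j ji.
    by rewrite eq_sym (negbTE ji) mul0r.
  rewrite -mulr_sumr [in RHS]big_mkcond; congr (_ * _); apply: eq_bigr => j _.
  by case: ifP => _; rewrite ?mul1r ?mul0r.
by case: ifP => _; [rewrite mul1r addrAC|rewrite mul0r addr0].
Qed.

Lemma lg_tr z x : dom_h psi x -> lg (tr_map z x) = lg x + z +
  \col_i ((i == t :> nat)%:R * (hq z - z i 0 + \sum_(j < n | (t < j)%N) x j 0 * z j 0)).
Proof.
move=> dx; apply/colP => i; rewrite lgE tr_mapE !mxDE [RHS in _ = _ + RHS]mxE lgE.
case: (boolP (i < t)%N) => it.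
  rewrite ltn_eqF// mul0r addr0 lnM ?posrE ?expR_gt0 ?dx// expRK mulrDr.
  by rewrite addrC mulrCA divff ?mulr1// gt_eqF// sw_gt0.
by case: ifP => _; rewrite ?mul1r ?mul0r; ring.
Qed.

Lemma tr_dom z x : dom_h psi x -> dom_h psi (tr_map z x).
Proof. by move=> dx i it; rewrite tr_mapE it mulr_gt0 ?expR_gt0 ?dx. Qed.

Lemma Yc_tr y x : dom_h psi x -> Yc (tr_map (Um *m y) x) = Yc x + y.
Proof.
move=> dx; rewrite /Yc lg_tr// !mulmxDr (mulmxA _ _ y) UmTK mul1mx.
rewrite [X in _ + X](_ : _ = 0) ?addr0//.
case: (ltnP t n) => tn; last first.
  rewrite (_ : \col_i _ = 0) ?mulmx0//; apply/colP => i; rewrite !mxE.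
  by rewrite ltn_eqF ?mul0r// (leq_trans (ltn_ord i)).
rewrite (_ : \col_i _ = (hq (Um *m y) + \sum_(j < n | (t < j)%N) x j 0 * (Um *m y) j 0) *: wv).
  by rewrite -scalemxAr Um_wv scaler0.
apply/colP => i; rewrite mxE mxZE [wv _ _]mxE tn mulrC; case: (boolP (_ == _)) => [it|].
  by rewrite Um_vertical// subr0.
by rewrite !mulr0.
Qed.

(** The cross term of (x_j + z_j)^2 is cancelled by the sum that [tr_mx] adds to the coordinate of
    index t. When t = n both are absent, and [ell] vanishes on the hyperplane orthogonal to [wv]. *)
Lemma horo_tr y x : dom_h psi x -> horo_fun psi (tr_map (Um *m y) x) = horo_fun psi x.
Proof.
move=> dx; rewrite !horo_funE lg_tr//; set z := Um *m y.
have e2 (a b : R) (F : 'I_n -> R) : \sum_(i < n | (t < i)%N) (F i + a * b) = \sum_(i < n | (t < i)%N) (F i + a * b) by [].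
case: (ltnP t n) => tn; last first.
  rewrite (_ : \col_i _ = 0) ?addr0; last first.
    apply/colP => i; rewrite !mxE.
    by rewrite ltn_eqF ?mul0r// (leq_trans (ltn_ord i)).
  have nosum (F : 'I_n -> R) : \sum_(i < n | (t < i)%N) F i = 0.
    by rewrite big1// => i ti; have := leq_trans (ltn_ord i) tn; rewrite ltnNge (ltnW ti).
  by rewrite /hq !nosum ellD Um_ell// addr0.
rewrite (_ : \col_i _ = (hq z + \sum_(j < n | (t < j)%N) x j 0 * z j 0) *: wv); last first.
  apply/colP => i; rewrite mxE mxZE [wv _ _]mxE tn mulrC; case: (boolP (_ == _)) => [it|].
    by rewrite Um_vertical// subr0.
  by rewrite !mulr0.
rewrite hq_flow /hq ellD.
have -> : \sum_(i < n | (t < i)%N) (lg x + z) i 0 ^+ 2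
  = \sum_(i < n | (t < i)%N) lg x i 0 ^+ 2 + \sum_(i < n | (t < i)%N) z i 0 ^+ 2
   + 2 * \sum_(j < n | (t < j)%N) x j 0 * z j 0.
  rewrite mulr_sumr -!big_split; apply: eq_bigr => i ti.
  by rewrite mxDE lgE ltnNge ltnW//=; ring.
by field.
Qed.

Lemma tr_Ph y y' s : tr_map (Um *m y) (Ph y' s) = Ph (y' + y) s.
Proof.
rewrite -(Ph_Yc (tr_dom _ (Ph_dom _ _))) Yc_tr ?horo_tr; try exact: Ph_dom.
by rewrite Yc_Ph horo_Ph opprK.
Qed.

Lemma tr_mapK y : cancel (tr_map (Um *m y)) (tr_map (Um *m (- y))).
Proof.
move=> x; apply/colP => i; rewrite mulmxN !tr_mapE !mxNE; case: (boolP (i < t)%N) => it.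
  by rewrite mulrA -expRD mulNr addNr expR0 mul1r.
case: (boolP (i == t :> nat)) => it'; last by rewrite addrK.
rewrite (_ : \sum_(j < n | (t < j)%N) tr_map (Um *m y) x j 0 * (- (Um *m y)) j 0 =
  - (\sum_(j < n | (t < j)%N) x j 0 * (Um *m y) j 0)
  - \sum_(j < n | (t < j)%N) (Um *m y) j 0 ^+ 2); last first.
  rewrite -!sumrN -big_split; apply: eq_bigr => j tj.
  by rewrite tr_mapE ltnNge ltnW//= gtn_eqF// mxNE; ring.
rewrite /hq -(scaleN1r (Um *m y)) ellZ.
have -> : \sum_(j < n | (t < j)%N) (-1 *: (Um *m y)) j 0 ^+ 2
    = \sum_(j < n | (t < j)%N) (Um *m y) j 0 ^+ 2.
  by apply: eq_bigr => j _; rewrite mxZE mulN1r sqrrN.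
by field.
Qed.

Lemma tr_mx_unit y : tr_mx (Um *m y) \in unitmx.
Proof.
apply: (@aff_inv_unit _ _ _ (tr_vec (Um *m y)) (tr_mx (Um *m - y)) (tr_vec (Um *m - y))) => x.
by have := tr_mapK (- y) x; rewrite opprK.
Qed.

Lemma tr_aff_unit y : aff_mx (tr_mx (Um *m y)) (tr_vec (Um *m y)) \in unitmx.
Proof. by rewrite aff_mx_unit tr_mx_unit. Qed.

Definition tr_pgl (y : 'cV[R]_n.-1) : PGL R n := pgl (tr_aff_unit y).

Lemma act_tr_pgl y x : act (tr_pgl y) (affine x) = affine (tr_map (Um *m y) x).
Proof. exact: act_aff. Qed.

Lemma act_tr_Ph y y' s : act (tr_pgl y) (affine (Ph y' s)) = affine (Ph (y' + y) s).
Proof. by rewrite act_tr_pgl tr_Ph. Qed.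

Lemma horosphereE c : horosphere psi c = [set affine (Ph y (- c)) | y in setT].
Proof.
apply/seteqP; split=> [_ [x [dx hx] <-]|_ [y _ <-]].
  by exists (Yc x) => //; rewrite -hx Ph_Yc.
by exists (Ph y (- c)) => //; split; [exact: Ph_dom|rewrite horo_Ph opprK].
Qed.

Lemma tr_pgl_Gpsi y : Gpsi psi (tr_pgl y).
Proof.
move=> c; rewrite horosphereE; apply/seteqP; split=> [_ [_ [y' _ <-] <-]|_ [y' _ <-]].
  by exists (y' + y) => //; rewrite act_tr_Ph.
exists (affine (Ph (y' - y) (- c))); first by exists (y' - y).
by rewrite act_tr_Ph subrK.
Qed.

End LogCoordinates.

(** * Convexity of the domain and its recession cone *)

Section Structure.
Variables (R : realType) (n : nat) (psi : 'rV[R]_n).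
Hypothesis Apsi : weyl psi.
Hypothesis n2 : (1 < n)%N.
Implicit Types (x u w p : 'cV[R]_n) (i j k l : 'I_n) (N : 'M[R]_n).
Local Notation t := (ctype psi).
Local Notation h := (horo_fun psi).
Local Notation cw := (cw psi).
Local Notation sw := (sw psi).
Local Notation lg := (lg psi).
Local Notation ex := (ex psi).
Local Notation hq := (hq psi).
Local Notation dv i := (delta_mx i 0 : 'cV[R]_n).
Let n0 : (0 < n)%N := ltnW n2.

Definition Om : set 'cV[R]_n := [set x | dom_h psi x /\ h x <= 0].

Lemma horo_xE x : h x = - \sum_(i < n | (i == t :> nat)%N) x i 0
   - \sum_(i < n | (i < t)%N) cw i * ln (x i 0)
   + 2^-1 * \sum_(i < n | (t < i)%N) x i 0 ^+ 2.
Proof.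
rewrite horo_funE// /hq /ell opprD; congr (- _ - _ + _ * _); apply: eq_bigr => i.
- by move=> /eqP it; rewrite lgE it ltnn.
- by move=> it; rewrite lgE it mulrA -expr2 sw_sqr.
- by move=> ti; rewrite lgE ltnNge ltnW.
Qed.

(** The differential of h at p in the direction w, given by its formula so that convexity reduces to
    inequalities between explicit terms. *)
Definition Dh p w : R := - \sum_(i < n | (i == t :> nat)%N) w i 0
   - \sum_(i < n | (i < t)%N) cw i * (w i 0 / p i 0)
   + \sum_(i < n | (t < i)%N) p i 0 * w i 0.

Lemma DhZ p a w : Dh p (a *: w) = a * Dh p w.
Proof.
rewrite /Dh mulrDr mulrBr mulrN !mulr_sumr.
congr (- _ - _ + _); apply: eq_bigr => i _; rewrite mxZE//; first by ring.
by rewrite mulrCA.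
Qed.

Lemma Dh_delta_le p i : dom_h psi p -> (i <= t)%N -> Dh p (dv i) <= 0.
Proof.
move=> dp it; rewrite /Dh [X in _ + X]big1 ?addr0 => [|j tj]; last first.
  by rewrite !mxE (_ : (j == i) = false) ?mulr0// -val_eqE /= gtn_eqF// (leq_ltn_trans it).
rewrite -opprD oppr_le0 addr_ge0//; apply: sumr_ge0 => j jt; rewrite !mxE ?ler0n//.
by rewrite mulr_ge0 ?(ltW (cw_gt0 _ _))// divr_ge0 ?ler0n// ltW// dp.
Qed.

Lemma ln_le_sub1 (y : R) : 0 < y -> ln y <= y - 1.
Proof. by move=> y0; have := expR_ge1Dx (ln y); rewrite lnK ?posrE//; lra. Qed.

(** Convexity of h, term by term: ln y <= y - 1 for the logarithms, a square for the quadratic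
    part. *)
Lemma horo_grad p u : dom_h psi p -> dom_h psi u -> h p + Dh p (u - p) <= h u.
Proof.
move=> dp du; rewrite !horo_xE /Dh.
have e1 : \sum_(i < n | (i == t :> nat)%N) u i 0 = \sum_(i < n | (i == t :> nat)%N) p i 0
   + \sum_(i < n | (i == t :> nat)%N) (u - p) i 0.
  by rewrite -big_split /=; apply: eq_bigr => i _; rewrite /= mxDE mxNE addrC subrK.
have e2 : \sum_(i < n | (i < t)%N) cw i * ln (u i 0) <= \sum_(i < n | (i < t)%N) cw i * ln (p i 0)
   + \sum_(i < n | (i < t)%N) cw i * ((u - p) i 0 / p i 0).
  rewrite -big_split /=; apply: ler_sum => i it; rewrite -mulrDr ler_pM2l ?cw_gt0//.
  have pi : 0 < p i 0 by exact: dp.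
  have ui : 0 < u i 0 by exact: du.
  have := ln_le_sub1 (divr_gt0 ui pi); rewrite ln_div ?posrE// !mxE mulrBl divff ?gt_eqF//.
  by rewrite lerBlDl.
have e3 : 2^-1 * (\sum_(i < n | (t < i)%N) p i 0 ^+ 2) + \sum_(i < n | (t < i)%N) p i 0 * (u - p) i 0
   <= 2^-1 * (\sum_(i < n | (t < i)%N) u i 0 ^+ 2).
  rewrite !mulr_sumr -big_split /=; apply: ler_sum => i _; rewrite !mxE.
  have := sqr_ge0 (u i 0 - p i 0); rewrite !expr2; lra.
by move: e1 e2 e3; lra.
Qed.

Lemma Om_rec x i (s : R) : Om x -> (i <= t)%N -> 0 <= s -> Om (x + s *: dv i).
Proof.
move=> [dx hx] it s0.
have d' : dom_h psi (x + s *: dv i).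
  by move=> l lt; rewrite mxDE mxZE mxE ltr_wpDr ?dx// mulr_ge0.
split=> //; apply: le_trans hx; apply: le_trans (horo_grad d' dx).
rewrite lerDl opprD addrA subrr add0r -scaleNr DhZ mulNr oppr_ge0.
by rewrite mulr_ge0_le0// Dh_delta_le.
Qed.

Lemma Om_basepoint : Om (basepoint psi).
Proof. by split; [exact: basepoint_dom|rewrite horo_basepoint]. Qed.

Lemma small_le0 (a c : R) : (forall e : R, 0 < e -> e < 1 -> a <= e * c) -> a <= 0.
Proof.
move=> H; rewrite leNgt; apply/negP => a0.
have c0 : 0 < c by have := H 2^-1 ltac:(lra) ltac:(lra); lra.
have d0 : 0 < 2 * c + a by lra.
have e0 : 0 < a / (2 * c + a) by rewrite divr_gt0.
have e1 : a / (2 * c + a) < 1 by rewrite ltr_pdivrMr// mul1r; lra.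
have := H _ e0 e1; rewrite mulrAC ler_pdivlMr// mulrDr.
have : 0 < a * a by rewrite mulr_gt0.
have : 0 < a * c by rewrite mulr_gt0.
lra.
Qed.

(** The danger is an endpoint p with p_l = 0 for some l < t, which lies outside the domain of h. But
    -ln tends to infinity on the way there, against h <= 0. *)
Lemma Om_seg_closed x p :
  (forall th : R, 0 <= th -> th < 1 -> Om (x + th *: (p - x))) -> Om p.
Proof.
move=> H; have [dx hx] : Om x by have := H 0; rewrite scale0r addr0; apply.
have uE (th : R) i : (x + th *: (p - x)) i 0 = (1 - th) * x i 0 + th * p i 0.
  by rewrite !mxE; ring.
have p0 i : (i < t)%N -> 0 <= p i 0.
  move=> it; rewrite -oppr_le0; apply: (@small_le0 _ (x i 0 + `|p i 0|)) => e e0 e1.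
  have [/(_ i it) + _] := H (1 - e) ltac:(lra) ltac:(lra); rewrite uE => h1.
  have : e * - `|p i 0| <= e * p i 0 by rewrite ler_pM2l// lerNl ler_normr lexx orbT.
  lra.
have [dp|ndp] := pselect (dom_h psi p).
  split=> //; apply: (@small_le0 _ (Dh p (p - x))) => e e0 e1.
  have [du hu] := H (1 - e) ltac:(lra) ltac:(lra).
  have := horo_grad dp du.
  have -> : x + (1 - e) *: (p - x) - p = (- e) *: (p - x) by mxring.
  by rewrite DhZ; lra.
exfalso; have [l [lt pl]] : exists l, (l < t)%N /\ p l 0 = 0.
  apply: contra_notP ndp => /forallNP nl i it.
  rewrite lt_def p0// andbT; apply/eqP => pi; exact: (nl i).
pose F (i : 'I_n) := cw i * (x i 0 + `|p i 0|).
pose A : R := \sum_(i < n | (i == t :> nat)%N) (`|x i 0| + `|p i 0|)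
   + \sum_(i < n | (i < t)%N && (i != l)) F i + cw l * ln (x l 0).
suff : forall K : nat, K%:R * cw l <= A.
  by move=> /natmul_bounded_le0; rewrite leNgt cw_gt0.
(* At parameter 1 - e the l-th coordinate is e x_l, which contributes K c_l to h, while [A] bounds
   the remaining terms independently of K. *)
move=> K; pose e := expR (- K%:R : R).
have e0 : 0 < e by exact: expR_gt0.
have e1 : e <= 1 by rewrite -expR0 ler_expR oppr_le0.
have [du hu] := H (1 - e) ltac:(lra) ltac:(lra).
move: hu; rewrite horo_xE.
set u := x + _ in du *.
have ub i : `|u i 0| <= `|x i 0| + `|p i 0|.
  rewrite uE (_ : 1 - (1 - e) = e); last by ring.
  apply: le_trans (ler_normD _ _) _; rewrite !normrM lerD//.
    by rewrite (ger0_norm (ltW e0)) ler_piMl.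
  by rewrite ger0_norm ?ler_piMl//; lra.
have h1 : \sum_(i < n | (i == t :> nat)%N) u i 0 <= \sum_(i < n | (i == t :> nat)%N) (`|x i 0| + `|p i 0|).
  by apply: ler_sum => i _; apply: le_trans (ler_norm _) (ub i).
have h2 : 0 <= \sum_(i < n | (t < i)%N) u i 0 ^+ 2.
  by apply: sumr_ge0 => i _; exact: sqr_ge0.
rewrite [\sum_(i < n | (i < t)%N) _](bigD1 l)//=.
have -> : ln (u l 0) = ln (x l 0) - K%:R.
  rewrite uE pl mulr0 addr0 (_ : 1 - (1 - e) = e); last by ring.
  by rewrite lnM ?posrE ?dx// expRK addrC.
have h3 : \sum_(i < n | (i < t)%N && (i != l)) cw i * ln (u i 0)
   <= \sum_(i < n | (i < t)%N && (i != l)) F i.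
  apply: ler_sum => i /andP[it _]; rewrite ler_pM2l ?cw_gt0//.
  apply: le_trans (ln_le_sub1 (du _ it)) _; have := ub i.
  by rewrite (gtr0_norm (dx _ it)); have := ler_norm (u i 0); lra.
by rewrite /A; move: h1 h2 h3; lra.
Qed.

Lemma Om_rec_cone x w : Om x -> (forall s, 0 <= s -> Om (x + s *: w)) ->
  (forall l, (l <= t)%N -> 0 <= w l 0) /\ (forall j, (t < j)%N -> w j 0 = 0).
Proof.
move=> [dx hx] H.
have w0 l : (l < t)%N -> 0 <= w l 0.
  move=> lt; rewrite -oppr_le0; apply: (@natmul_bounded_le0 _ _ (x l 0)) => K.
  have [/(_ l lt) + _] := H K%:R (ler0n _ _); rewrite mxDE mxZE; lra.
have D0 (r : R) : 0 <= r -> Dh (x + r *: w) w <= 0.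
  move=> r0; set q := x + r *: w; have [dq _] := H r r0.
  apply: (@natmul_bounded_le0 _ _ (- h q)) => K.
  have [du hu] := H (K%:R + r) (addr_ge0 (ler0n _ _) r0).
  have := horo_grad dq du; rewrite (_ : _ - q = K%:R *: w); last by rewrite /q; mxring.
  by rewrite DhZ; lra.
pose W := \sum_(i < n | (t < i)%N) w i 0 ^+ 2.
pose S := \sum_(i < n | (i == t :> nat)%N) w i 0.
pose B := \sum_(i < n | (t < i)%N) x i 0 * w i 0.
pose C := \sum_(i < n | (i < t)%N) cw i.
(* The differential at x + r w in the direction w is nonpositive. As r tends to infinity this forces
   W = 0; once W and B vanish it reads S >= -C / r, hence S >= 0. *)
have main (r : R) : 0 < r -> r * W + B <= S + C / r.
  move=> r0; have := D0 r (ltW r0); rewrite /Dh -/S.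
  have -> : \sum_(i < n | (t < i)%N) (x + r *: w) i 0 * w i 0 = r * W + B.
    by rewrite mulr_sumr -big_split /=; apply: eq_bigr => i _; rewrite !mxE; ring.
  have : \sum_(i < n | (i < t)%N) cw i * (w i 0 / (x + r *: w) i 0) <= C / r.
    rewrite mulr_suml; apply: ler_sum => i it; rewrite ler_pM2l ?cw_gt0// !mxE.
    have xi := dx _ it; have wi := w0 _ it.
    rewrite ler_pdivrMr; last by rewrite ltr_pwDl// mulr_ge0// ltW.
    by rewrite mulrDr mulrA mulVf ?gt_eqF// mul1r lerDr mulr_ge0 ?invr_ge0 ?ltW.
  lra.
have C0 : 0 <= C by apply: sumr_ge0 => i it; rewrite ltW// cw_gt0.
have W0 : W <= 0.
  apply: (@natmul_bounded_le0 _ _ (`|S| + C + `|B|)) => -[|K].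
    by rewrite mul0r !addr_ge0.
  have r0 : 0 < K.+1%:R :> R by [].
  have := main _ r0; have : C / K.+1%:R <= C.
    by rewrite ler_pdivrMr// ler_peMr// ler1n.
  have := ler_norm S; have := ler_norm (- B); rewrite normrN.
  by move: (C / _) (_ * W) => a b; lra.
have wj j : (t < j)%N -> w j 0 = 0.
  move=> tj; have : W == 0 by rewrite eq_le W0 sumr_ge0// => i _; exact: sqr_ge0.
  rewrite psumr_eq0; last by move=> i _; exact: sqr_ge0.
  move=> /allP/(_ j (mem_index_enum _)); rewrite tj /= expf_eq0 /= => /eqP //.
split=> // l lt; have [lt'|tl] := ltnP l t; first exact: w0.
have lE : (l == t :> nat)%N by rewrite eqn_leq lt.
have SE : S = w l 0.
  rewrite /S (bigD1 l)//= big1 ?addr0// => i /andP[/eqP it il]; case/eqP: il.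
  by apply: val_inj; rewrite /= it (eqP lE).
have BE : B = 0 by rewrite /B big1// => i ti; rewrite wj// mulr0.
have WE : W = 0 by rewrite /W big1// => i ti; rewrite wj// expr0n.
rewrite -oppr_le0; apply: (@small_le0 _ C) => e e0 e1.
have := main e^-1; rewrite invr_gt0 => /(_ e0); rewrite WE BE SE invrK; lra.
Qed.

End Structure.

(** * Projective automorphisms of the domain are affine *)

Section Structure2.
Variables (R : realType) (n : nat) (psi : 'rV[R]_n).
Hypothesis Apsi : weyl psi.
Hypothesis n2 : (1 < n)%N.
Implicit Types (x u v w p d y : 'cV[R]_n) (i j k l : 'I_n) (N : 'M[R]_n).
Local Notation t := (ctype psi).
Local Notation h := (horo_fun psi).
Local Notation cw := (cw psi).
Local Notation sw := (sw psi).
Local Notation lg := (lg psi).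
Local Notation ex := (ex psi).
Local Notation hq := (hq psi).
Local Notation Om := (Om psi).
Local Notation dv i := (delta_mx i 0 : 'cV[R]_n).
Let n0 : (0 < n)%N := ltnW n2.

Definition aff_pres N v := N \in unitmx /\ forall x, Om x <-> Om (N *m x + v).

Lemma horo_shift x d : (forall i, (i < t)%N -> d i 0 = 0) ->
  h (x + d) = h x - \sum_(i < n | (i == t :> nat)%N) d i 0
    + \sum_(i < n | (t < i)%N) x i 0 * d i 0
    + 2^-1 * \sum_(i < n | (t < i)%N) d i 0 ^+ 2.
Proof.
move=> d0; rewrite !horo_xE//.
have -> : \sum_(i < n | (i == t :> nat)%N) (x + d) i 0 =
   \sum_(i < n | (i == t :> nat)%N) x i 0 + \sum_(i < n | (i == t :> nat)%N) d i 0.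
  by rewrite -big_split /=; apply: eq_bigr => i _; rewrite mxDE.
have -> : \sum_(i < n | (i < t)%N) cw i * ln ((x + d) i 0) =
   \sum_(i < n | (i < t)%N) cw i * ln (x i 0).
  by apply: eq_bigr => i it; rewrite mxDE d0// addr0.
have -> : \sum_(i < n | (t < i)%N) (x + d) i 0 ^+ 2 = \sum_(i < n | (t < i)%N) x i 0 ^+ 2
   + 2 * (\sum_(i < n | (t < i)%N) x i 0 * d i 0) + \sum_(i < n | (t < i)%N) d i 0 ^+ 2.
  by rewrite mulr_sumr -!big_split /=; apply: eq_bigr => i _; rewrite mxDE; ring.
by field.
Qed.

(** The domain is unbounded both ways in every quadratic coordinate: a displacement a is paid for by
    a^2 / 2 in the coordinate of index t. *)
Lemma Om_gt_shift j (a : R) : (t < j)%N -> exists2 b : R,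
  forall k, (k == t :> nat) -> Om (basepoint psi + (a *: dv j + b *: dv k)) & b = 2^-1 * a ^+ 2.
Proof.
move=> tj; exists (2^-1 * a ^+ 2) => // k /eqP kt.
have jk : j != k by rewrite -val_eqE /= kt gtn_eqF.
have z i : (i < t)%N -> (a *: dv j + (2^-1 * a ^+ 2) *: dv k) i 0 = 0.
  move=> it; have e1 : (i == j) = false by rewrite -val_eqE ltn_eqF// (ltn_trans it).
  have e2 : (i == k) = false by rewrite -val_eqE /= kt ltn_eqF.
  by rewrite !mxE e1 e2 !mulr0 addr0.
split.
  by move=> i it; rewrite mxDE z// addr0; apply: basepoint_dom.
rewrite horo_shift// horo_basepoint// (bigD1 k) ?kt//= big1 => [|i /andP[/eqP it ik]]; last first.
  by case/eqP: ik; apply: val_inj; rewrite /= it.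
rewrite big1 => [|i ti]; last by rewrite [basepoint _ _ _]mxE ltnNge ltnW ?mul0r.
rewrite (bigD1 j)//= big1 => [|i /andP[ti ij]]; last first.
  rewrite !mxE (negbTE ij) (_ : (i == k) = false) ?mulr0 ?addr0 ?expr0n//.
  by rewrite -val_eqE /= kt gtn_eqF.
rewrite !mxE !eqxx eq_sym (negbTE jk) /=.
by rewrite !mulr0 !mulr1 !addr0 !add0r addNr.
Qed.

(** The denominator f of the projective map has no zero on the domain. Its linear part r has to
    vanish along the recession directions, and consequently also along the quadratic ones. *)
Lemma PGL_Omega_affine g : PGL_of (Omega psi) g ->
  exists N v (u : aff_mx N v \in unitmx), g = pgl u /\ aff_pres N v.
Proof.
rewrite /PGL_of /= => gO; set M := mx_of g.
pose A := ulsubmx M; pose b := ursubmx M; pose r := dlsubmx M; pose d := drsubmx M.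
have ME x : M *m hc x = col_mx (A *m x + b) (r *m x + d).
  by rewrite -{1}(submxK M) mul_block_col !mulmx1.
pose f x : R := (r *m x + d) 0 0.
have Mf x y a : M *m hc x = a *: hc y -> A *m x + b = f x *: y /\ f x = a.
  rewrite ME /hc scale_col_mx => /eq_col_mx[-> e]; rewrite /f e !mxE eqxx mulr1n mulr1.
  by [].
have Minj (y : 'cV[R]_(n + 1)) : M *m y = 0 -> y = 0.
  by move=> My; rewrite -[y]mul1mx -(mulVmx (mx_of_unit g)) -mulmxA My mulmx0.
have H1 x : Om x -> exists2 x', Om x' & [/\ f x != 0, A *m x + b = f x *: x' & act g (affine x) = affine x'].
  move=> Ox; have : (Omega psi) (act g (affine x)) by rewrite -gO; exists (affine x) => //; exists x.
  move=> [x' Ox' e]; exists x' => //.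
  by have /act_affineP[a a0 /Mf[-> ->]] := esym e.
have H2 x' : Om x' -> exists2 x, Om x & act g (affine x) = affine x'.
  move=> Ox; have : (Omega psi) (affine x') by exists x'.
  by rewrite -gO => -[_ [x Ox'' <-] e]; exists x.
clear gO; have f0 x : Om x -> f x != 0 by move=> /H1[x' _ []].
have fD x s y : f (x + s *: y) = f x + s * (r *m y) 0 0.
  by rewrite /f mulmxDr -scalemxAr !mxDE mxZE addrAC.
have rdv i : (r *m dv i) 0 0 = r 0 i by rewrite -colE mxE.
pose x0 := basepoint psi; have Ox0 : Om x0 by exact: Om_basepoint.
(* If r_i != 0, the image of the ray in the direction e_i ends at a finite point p. The domain is
   closed along the image segment, so p is the image of a point of the domain; it is also the image
   of the point at infinity of the ray, against injectivity. *)
have r_le i : (i <= t)%N -> r 0 i = 0.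
  move=> it; apply/eqP; apply/negPn/negP => ri0; pose q := r 0 i / f x0.
  have q0 : q != 0 by rewrite mulf_neq0 ?invr_eq0// f0.
  have fE s : f (x0 + s *: dv i) = f x0 * (1 + s * q).
    by rewrite fD rdv /q; field; rewrite f0.
  have qp : 0 < q.
    rewrite lt_def q0 /= leNgt; apply/negP => qn.
    have : Om (x0 - q^-1 *: dv i).
      by rewrite -scaleNr; apply: Om_rec => //; rewrite oppr_ge0 ltW// invr_lt0.
    by move/f0; rewrite -scaleNr fE mulNr mulVf// subrr mulr0 eqxx.
  pose p := (r 0 i)^-1 *: (A *m dv i).
  have [x'0 Ox'0 [_ Ex'0 _]] := H1 _ Ox0.
  have Op : Om p.
    apply: (@Om_seg_closed _ _ _ Apsi x'0) => th th0 th1.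
    (* The parameter at which the image of the ray has covered the proportion th of the segment from
       x'0 to p. *)
    pose s := th / ((1 - th) * q).
    have s0 : 0 <= s by rewrite divr_ge0// mulr_ge0 ?ltW//; lra.
    have [x' Ox' [_ Ex' _]] := H1 _ (Om_rec Apsi Ox0 it s0).
    rewrite (_ : _ + _ = x')//.
    have th1' : 1 - th != 0 by rewrite gt_eqF; lra.
    have fx : f (x0 + s *: dv i) = f x0 / (1 - th).
      by rewrite fE /s; field; rewrite q0 th1'.
    have fx0 : f (x0 + s *: dv i) != 0 by rewrite fx mulf_neq0 ?invr_eq0 ?f0.
    apply: (scalerI fx0); rewrite -Ex' mulmxDr addrAC Ex'0 -scalemxAr.
    have -> : A *m dv i = r 0 i *: p by rewrite /p scalerA divff// scale1r.
    rewrite fx /s; apply/colP => l; rewrite !(mxDE, mxNE, mxZE).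
    have -> : r 0 i = q * f x0 by rewrite /q divfK// f0.
    by field; rewrite q0 th1' (f0 _ Ox0).
  have [x1 Ox1 /act_affineP[c c0 Ec]] := H2 _ Op.
  have Mi : M *m col_mx (dv i) 0 = r 0 i *: hc p.
    rewrite -{1}(submxK M) mul_block_col !mulmx0 !addr0 /hc scale_col_mx; congr col_mx.
      by rewrite scalerA divff// scale1r.
    by rewrite [LHS]mx11_scalar rdv scalemx1.
  have /eqP : hc x1 - (c / r 0 i) *: col_mx (dv i) 0 = 0.
    apply: Minj; rewrite mulmxBr Ec -scalemxAr Mi scalerA divfK// subrr//.
  rewrite subr_eq0 /hc scale_col_mx scaler0 => /eqP /eq_col_mx[_ /matrixP/(_ 0 0)].
  by rewrite !mxE eqxx => /eqP; rewrite oner_eq0.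
have r0 : r = 0.
  apply/rowP => j; rewrite [RHS]mxE; have [/r_le//|tj] := leqP j t.
  apply/eqP; apply/negPn/negP => rj0.
  have tn : (t < n)%N := ltn_trans tj (ltn_ord j).
  (* The displacement is chosen so that f would vanish at the point; the compensation in the
     coordinate of index t leaves f unchanged by [r_le]. *)
  have [bb /(_ (Ordinal tn) (eqxx _)) + _] := Om_gt_shift (- (f x0 / r 0 j)) tj.
  move/f0; rewrite addrA fD fD !rdv (r_le (Ordinal tn))// mulr0 addr0 mulNr divfK//.
  by rewrite subrr eqxx.
have fc x : f x = d 0 0 by rewrite /f r0 mul0mx add0r.
have d0 : d 0 0 != 0 by rewrite -(fc x0) f0.
pose N := (d 0 0)^-1 *: A; pose v := (d 0 0)^-1 *: b.
have MNv : M = d 0 0 *: aff_mx N v.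
  rewrite /aff_mx scale_block_mx !scalerA !divff// !scale1r scaler0 scalemx1.
  by rewrite -(mx11_scalar d) -{1}(submxK M) -r0.
have uNv : aff_mx N v \in unitmx.
  by have := mx_of_unit g; rewrite -/M MNv unitmxZ ?unitfE.
exists N, v, uNv; have gE : g = pgl uNv.
  rewrite -(pgl_mx_of g); apply/pgl_eqP; exists (d 0 0)^-1; rewrite ?invr_eq0//.
  by rewrite -/M MNv scalerA mulVf// scale1r.
split=> //; split; first by rewrite -(aff_mx_unit N v).
move=> x; split=> [/H1[x' Ox' [_ _]]|/H2[x' Ox']].
  by rewrite gE act_aff => /affine_inj ->.
by rewrite gE -(act_aff uNv) => /(can_inj (actVK _))/affine_inj <-.
Qed.

Lemma aff_pres_inv N v : aff_pres N v -> aff_pres (invmx N) (- (invmx N *m v)).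
Proof.
move=> [uN H]; split=> [|x]; first by rewrite unitmx_inv.
rewrite (H (_ + _)) mulmxDr mulmxN !mulmxA mulmxV// !mul1mx subrK.
by [].
Qed.

End Structure2.

(** * Monomial normal form of the automorphisms *)

Section Structure3.
Variables (R : realType) (n : nat) (psi : 'rV[R]_n).
Hypothesis Apsi : weyl psi.
Hypothesis n2 : (1 < n)%N.
Implicit Types (x u v w p d y : 'cV[R]_n) (i j k l : 'I_n) (N : 'M[R]_n).
Local Notation t := (ctype psi).
Local Notation h := (horo_fun psi).
Local Notation cw := (cw psi).
Local Notation sw := (sw psi).
Local Notation lg := (lg psi).
Local Notation ex := (ex psi).
Local Notation hq := (hq psi).
Local Notation ell := (ell psi).
Local Notation Om := (Om psi).
Local Notation dv i := (delta_mx i 0 : 'cV[R]_n).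
Let n0 : (0 < n)%N := ltnW n2.

(** The map permutes and rescales the positive coordinates, preserves the vertical direction and
    multiplies h by [be]. The matching of weights in [af_cw] is what later forces [be] = 1 when psi
    is nonzero. *)
Record aff_form N v (rho : 'I_n -> 'I_n) (al : 'I_n -> R) (be : R) : Prop := AffForm {
  af_be : 0 < be;
  af_rho_lt : forall l, (l < t)%N -> (rho l < t)%N;
  af_rho_inj : forall l l', (l < t)%N -> (l' < t)%N -> rho l = rho l' -> l = l';
  af_al : forall l, (l < t)%N -> 0 < al l;
  af_row : forall l x, (l < t)%N -> (N *m x + v) l 0 = al l * x (rho l) 0;
  af_low : forall j i, (t < j)%N -> (i <= t)%N -> N j i = 0;
  af_vert : forall k i, k == t :> nat -> (i <= t)%N -> N k i = be * (i == k)%:R;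
  af_dom : forall x, dom_h psi x -> dom_h psi (N *m x + v);
  af_horo : forall x, dom_h psi x -> h (N *m x + v) = be * h x;
  af_cw : forall l, (l < t)%N -> cw l = be * cw (rho l) }.

Lemma mul_dv N i l : (N *m dv i) l 0 = N l i.
Proof. by rewrite -colE mxE. Qed.

(** A nonnegative matrix with a nonnegative inverse is monomial: an off-diagonal entry of the
    product is a sum of nonnegative terms, so each of them is 0. The vanishing of the rows j > t
    confines the argument to the recession cone. *)
Lemma monomial_col N N' i : N' *m N = 1%:M ->
  (forall i l, (i <= t)%N -> (l <= t)%N -> 0 <= N l i) ->
  (forall i l, (i <= t)%N -> (l <= t)%N -> 0 <= N' l i) ->
  (forall i j, (i <= t)%N -> (t < j)%N -> N j i = 0) ->
  (forall i j, (i <= t)%N -> (t < j)%N -> N' j i = 0) -> (i <= t)%N ->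
  exists l a, [/\ (l <= t)%N, 0 < a & N *m dv i = a *: dv l].
Proof.
move=> NN N0 N'0 Nz N'z it.
have [l Nl] : exists l, N l i != 0.
  apply: contrapT => /forallNP H.
  have : (1%:M : 'M[R]_n) i i = 0.
    rewrite -NN mxE big1// => l _; have /negP := H l.
    by rewrite negbK => /eqP ->; rewrite mulr0.
  by rewrite mxE eqxx => /eqP; rewrite oner_eq0.
have lt : (l <= t)%N by rewrite leqNgt; apply: contraNN Nl => /(Nz i l it) ->.
have Nl0 : 0 < N l i by rewrite lt_def Nl N0.
exists l, (N l i); split=> //.
have N'm m : m != i -> N' m l = 0.
  move=> mi; have [mt|tm] := leqP m t; last exact: N'z.
  have : (N' *m N) m i = 0 by rewrite NN mxE (negbTE mi).
  rewrite mxE => /eqP; rewrite psumr_eq0 => [/allP/(_ l (mem_index_enum _))|k _].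
    by rewrite /= mulf_eq0 (negbTE Nl) orbF => /eqP.
  by have [kt|tk] := leqP k t; [rewrite mulr_ge0 ?N0 ?N'0|rewrite (Nz _ _ it tk) mulr0].
have N'l : N' *m dv l = N' i l *: dv i.
  apply/colP => m; rewrite mul_dv mxZE mxE andbT.
  by have [->|mi] := eqVneq m i; rewrite ?mulr1// N'm// mulr0.
have e : dv l = N' i l *: (N *m dv i).
  by rewrite scalemxAr -N'l mulmxA (mulmx1C NN) mul1mx.
have N'il : N' i l * N l i = 1.
  by have /colP/(_ l) := e; rewrite mxZE mul_dv !mxE !eqxx => <-.
by rewrite e scalerA mulrC N'il scale1r.
Qed.

Lemma hq_le u : (forall j, (t < j)%N -> u j 0 = 0) -> hq u = - ell u.
Proof.
move=> H; rewrite /hq [\sum_(i < n | (t < i)%N) _]big1 ?mulr0 ?addr0// => i ti.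
by rewrite H// expr0n.
Qed.

Lemma ell_dv_lt i : (i < t)%N -> ell (dv i) = sw i.
Proof.
move=> it; rewrite /ell big1 => [|j /eqP jt]; last first.
  by rewrite mxE (_ : (j == i) = false)// -val_eqE /= jt gtn_eqF.
rewrite (bigD1 i)//= big1 => [|j /andP[jt ji]]; last by rewrite mxE (negbTE ji) mulr0.
by rewrite mxE !eqxx mulr1 addr0 add0r.
Qed.

Lemma ell_dv_eq k : (k == t :> nat) -> ell (dv k) = 1.
Proof.
move=> /eqP kt; rewrite /ell (bigD1 k) ?kt//= big1 => [|j /andP[/eqP jt jk]]; last first.
  by rewrite mxE (negbTE jk).
rewrite big1 => [|j jt]; last first.
  by rewrite mxE (_ : (j == k) = false) ?mulr0// -val_eqE /= kt ltn_eqF.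
by rewrite mxE !eqxx !addr0.
Qed.

Lemma Om_ex u : hq u <= 0 -> Om (ex u).
Proof. by move=> hu; split; [exact: ex_dom|rewrite horo_funE// exK]. Qed.

Lemma dv_gt i j (a : R) : (i <= t)%N -> (t < j)%N -> (a *: dv i) j 0 = 0.
Proof.
move=> it tj; rewrite !mxE (_ : (j == i) = false) ?mulr0// -val_eqE gtn_eqF//.
exact: leq_ltn_trans it tj.
Qed.

(** A change of one positive coordinate can be compensated in h by a second coordinate m <= t, which
    exists because n >= 2. *)
Lemma Om_coord i (a : R) : (i < t)%N -> exists2 x, Om x & x i 0 = expR a.
Proof.
move=> it; pose b := a * sw i.
have [m mi mt] : exists2 m : 'I_n, m != i & (m <= t)%N.
  have [tn|nt] := ltnP t n.
    by exists (Ordinal tn) => //; rewrite -val_eqE gtn_eqF.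
  have [i0|i0] := eqVneq (i : nat) 0%N.
    exists (Ordinal n2); first by rewrite -val_eqE /= i0.
    by rewrite (leq_trans _ nt)//= ltnW.
  by exists (Ordinal n0) => //; rewrite -val_eqE /= eq_sym.
have em : ell (dv m) != 0.
  move: mt; rewrite leq_eqVlt => /orP[mt|mt]; first by rewrite ell_dv_eq// oner_eq0.
  by rewrite ell_dv_lt// gt_eqF// sw_gt0.
exists (ex (b *: dv i - (b * sw i / ell (dv m)) *: dv m)).
  apply: Om_ex; rewrite hq_le => [|j tj]; last first.
    by rewrite mxDE mxNE !dv_gt// ?subr0// ltnW.
  by rewrite -scaleNr ellD !ellZ ell_dv_lt// mulNr divfK// subrr oppr0.
rewrite exE it !mxE eq_sym (negbTE mi) !eqxx mulr0 subr0 mulr1 /b.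
by rewrite mulfK// gt_eqF// sw_gt0.
Qed.

Section Given.
Variables (N : 'M[R]_n) (v : 'cV[R]_n).
Hypothesis NP : aff_pres psi N v.

Let N' := invmx N.
Let uN : N \in unitmx. Proof. by case: NP. Qed.
Let OmG x : Om x -> Om (N *m x + v). Proof. by case: NP => _ H /H. Qed.
Let NK x : N' *m (N *m x) = x.
Proof. by rewrite mulmxA mulVmx// mul1mx. Qed.
Let OmG' y : Om y -> exists2 x, Om x & N *m x + v = y.
Proof.
case: NP => _ H Oy; have e : N *m (N' *m (y - v)) + v = y.
  by rewrite mulmxA mulmxV// mul1mx subrK.
by exists (N' *m (y - v)) => //; rewrite H e.
Qed.

Lemma aff_pres_rec N1 v1 : aff_pres psi N1 v1 -> forall i, (i <= t)%N ->
  (forall l, (l <= t)%N -> 0 <= N1 l i) /\ (forall j, (t < j)%N -> N1 j i = 0).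
Proof.
move=> [_ H] i it; have Ob := Om_basepoint Apsi n2.
have [||H1 H2] := @Om_rec_cone _ _ _ Apsi (N1 *m basepoint psi + v1) (N1 *m dv i).
- exact: (H _).1 Ob.
- move=> s s0; rewrite addrAC scalemxAr -mulmxDr; apply: (H _).1.
  exact: Om_rec.
by split=> [l lt|j tj]; rewrite -(mul_dv N1); [exact: H1|exact: H2].
Qed.

Let col i : (i <= t)%N -> exists l a, [/\ (l <= t)%N, 0 < a & N *m dv i = a *: dv l].
Proof.
have P' := aff_pres_inv NP.
apply: (@monomial_col N N' i); first exact: mulVmx.
- by move=> a b at_ bt; apply: (proj1 (aff_pres_rec NP at_)).
- by move=> a b at_ bt; apply: (proj1 (aff_pres_rec P' at_)).
- by move=> a b at_ bt; apply: (proj2 (aff_pres_rec NP at_)).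
- by move=> a b at_ bt; apply: (proj2 (aff_pres_rec P' at_)).
Qed.

Let col' l : (l <= t)%N -> exists i a, [/\ (i <= t)%N, 0 < a & N *m dv i = a *: dv l].
Proof.
have P' := aff_pres_inv NP => lt.
have [||||||i [a [it a0 e]]] := @monomial_col N' N l.
- exact: mulmxV.
- by move=> a b at_ bt; apply: (proj1 (aff_pres_rec P' at_)).
- by move=> a b at_ bt; apply: (proj1 (aff_pres_rec NP at_)).
- by move=> a b at_ bt; apply: (proj2 (aff_pres_rec P' at_)).
- by move=> a b at_ bt; apply: (proj2 (aff_pres_rec NP at_)).
- by [].
exists i, a^-1; split; rewrite ?invr_gt0//.
apply: (scalerI (lt0r_neq0 a0)); rewrite scalerA divff ?gt_eqF// scale1r.
by rewrite scalemxAr -e mulmxA mulmxV// mul1mx.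
Qed.

Let col_uniq i i' l a a' : 0 < a -> 0 < a' ->
  N *m dv i = a *: dv l -> N *m dv i' = a' *: dv l -> i = i'.
Proof.
move=> a0 a'0 e e'.
have : dv i' = (a' / a) *: dv i.
  rewrite -[LHS]NK e' -[dv i]NK e -scalemxAr -scalemxAr scalerA divfK ?gt_eqF//.
case: (eqVneq i' i) => [-> //|ni] /colP/(_ i').
by rewrite !mxE (negbTE ni) eqxx mulr0 => /eqP; rewrite oner_eq0.
Qed.

Let rowE l : (l < t)%N -> exists i a, [/\ (i < t)%N, 0 < a, N *m dv i = a *: dv l &
  forall x, (N *m x + v) l 0 = a * x i 0].
Proof.
move=> lt; have [i [a [it a0 e]]] := col' (ltnW lt).
have Nli : N l i = a by rewrite -(mul_dv N) e !mxE !eqxx mulr1.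
have Nl0 i' : (i' <= t)%N -> i' != i -> N l i' = 0.
  move=> i't i'i; have [l' [a' [l't a'0 e']]] := col i't.
  rewrite -(mul_dv N) e' !mxE; case: eqVneq => [ll'|]; last by rewrite mulr0.
  by case/eqP: i'i; apply: (col_uniq a'0 a0 e'); rewrite e ll'.
have pos x : Om x -> 0 < (N *m x + v) l 0 by move=> /OmG[/(_ l lt)].
have rE x : (N *m x + v) l 0 = a * x i 0 + \sum_(j < n | (t < j)%N) N l j * x j 0 + v l 0.
  rewrite mxDE mxE (bigD1 i)//= Nli; congr (_ + _ + _).
  rewrite big_mkcond [RHS]big_mkcond; apply: eq_bigr => j _ /=.
  case: eqVneq => [->|ji] /=; first by rewrite ltnNge it.
  by case: leqP => // jt; rewrite Nl0// mul0r.
have sum0 u : (forall j, (t < j)%N -> u j 0 = 0) ->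
    \sum_(j < n | (t < j)%N) N l j * ex u j 0 = 0.
  by move=> H; rewrite big1// => j tj; rewrite exE ltnNge ltnW// H// mulr0.
(* If i were t, moving by K in the l-th logarithmic coordinate and by -K sw_l in the vertical one
   would stay in the domain, yet send the positive l-th coordinate of the image to -infinity. *)
have it' : (i < t)%N.
  rewrite ltn_neqAle it andbT; apply/negP => iE.
  have : a * sw l <= 0.
    apply: (@natmul_bounded_le0 _ _ (v l 0)) => K.
    pose u := K%:R *: dv l - (K%:R * sw l) *: dv i.
    have ugt j : (t < j)%N -> u j 0 = 0.
      by move=> tj; rewrite mxDE mxNE !dv_gt ?subrr// ltnW.
    have Ou : Om (ex u).
      apply: Om_ex; rewrite hq_le// /u -scaleNr ellD !ellZ ell_dv_lt// ell_dv_eq//.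
      by rewrite mulr1 subrr oppr0.
    have := pos _ Ou; have ntt : (i < t)%N = false by rewrite (eqP iE) ltnn.
    rewrite rE sum0// addr0 exE ntt /u !mxE.
    rewrite (_ : (i == l) = false); last by rewrite -val_eqE /= (eqP iE) gtn_eqF.
    by rewrite !eqxx mulr0 mulr1; lra.
  by rewrite leNgt mulr_gt0// sw_gt0.
have Nlj j : (t < j)%N -> N l j = 0.
  move=> tj; have tn := ltn_trans tj (ltn_ord j).
  apply/eqP; apply/negPn/negP => Nj.
  (* At this displacement the l-th coordinate of the image would be 0. *)
  have [b /(_ (Ordinal tn) (eqxx _)) Ob _] := Om_gt_shift Apsi n2 (- ((a + v l 0) / N l j)) tj.
  have := pos _ Ob; rewrite rE (bigD1 j)//= big1 => [|m /andP[tm mj]].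
    rewrite !mxE it' (_ : (i == j) = false); last first.
      by rewrite -val_eqE ltn_eqF// (ltn_trans it' tj).
    rewrite (_ : (i == Ordinal tn) = false); last by rewrite -val_eqE /= ltn_eqF.
    rewrite (_ : (j == Ordinal tn) = false); last by rewrite -val_eqE /= gtn_eqF.
    have jt : (j < t)%N = false by rewrite ltnNge (ltnW tj).
    rewrite !eqxx jt !mulr0 !addr0 !mulr1 add0r.
    rewrite mulrN mulrCA divff// mulr1; lra.
  have mt : (m < t)%N = false by rewrite ltnNge (ltnW tm).
  rewrite !mxE (negbTE mj) mt.
  rewrite (_ : (m == Ordinal tn) = false); last by rewrite -val_eqE /= gtn_eqF.
  by rewrite !mulr0 !addr0 mulr0.
have {}rE x : (N *m x + v) l 0 = a * x i 0 + v l 0.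
  by rewrite rE [\sum_(j < n | _) _]big1 ?addr0// => j tj; rewrite Nlj// mul0r.
have expK (K : R) : 0 < K -> exists e : R, expR e = K.
  by move=> K0; exists (ln K); rewrite lnK// posrE.
(* On the domain x_i takes arbitrarily small positive values, and so does the l-th coordinate of the
   image, which leaves only 0 for the constant term. *)
have v0 : 0 <= v l 0.
  rewrite -oppr_le0; apply: (@small_le0 _ _ a) => c c0 _.
  have [e' e'E] := expK c c0.
  by have [x Ox xi] := Om_coord e' it'; have := pos x Ox; rewrite rE xi e'E; lra.
have vl : v l 0 = 0.
  apply/eqP; rewrite eq_le v0 andbT leNgt; apply/negP => vp.
  have [e' e'E] := expK _ vp; have [y Oy yl] := Om_coord e' lt.
  have [x Ox xE] := OmG' Oy; have := rE x; rewrite xE yl e'E.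
  have : 0 < a * x i 0 by rewrite mulr_gt0//; case: Ox => dx _; exact: dx.
  lra.
by exists i, a; split=> // x; rewrite rE vl addr0.
Qed.

Let rho l : 'I_n := xget l [set i : 'I_n | (i < t)%N /\ exists a : R, [/\ 0 < a,
  N *m dv i = a *: dv l & forall x, (N *m x + v) l 0 = a * x i 0]].
Let al l : R := N l (rho l).

Let rhoP l : (l < t)%N -> [/\ (rho l < t)%N, 0 < al l, N *m dv (rho l) = al l *: dv l &
  forall x, (N *m x + v) l 0 = al l * x (rho l) 0].
Proof.
move=> lt; have [i [a [it a0 e r]]] := rowE lt.
rewrite /al /rho; case: xgetP => [i' _ [i't [a' [a'0 e' r']]]|/(_ i)]; last first.
  by case; split=> //; exists a.
have -> : N l i' = a' by rewrite -(mul_dv N) e' !mxE !eqxx mulr1.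
by [].
Qed.

Let rho_inj l l' : (l < t)%N -> (l' < t)%N -> rho l = rho l' -> l = l'.
Proof.
move=> /rhoP[_ a0 e _] /rhoP[_ a'0 e' _] r; move: e'; rewrite -r e => /colP/(_ l).
rewrite !mxE eqxx mulr1 andbT; case: eqVneq => // _ /eqP.
by rewrite mulr0 gt_eqF.
Qed.

Let vert_col k : k == t :> nat -> exists2 be : R, 0 < be & N *m dv k = be *: dv k.
Proof.
move=> kt; have kle : (k <= t)%N by rewrite (eqP kt).
have [l [a [lt a0 e]]] := col kle; exists a => //.
suff kl : k = l by rewrite [in RHS]kl.
apply/val_inj/eqP; rewrite /= (eqP kt) eq_sym; move: lt; rewrite leq_eqVlt => /orP[//|lt].
have [rt a'0 e' _] := rhoP lt; have := col_uniq a0 a'0 e e' => kr.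
by move: rt; rewrite -kr (eqP kt) ltnn.
Qed.

(** [insub t] has a value exactly when t < n, and then [be] is the factor on the vertical direction.
    When t = n there is no such direction and the factor is 1. *)
Let be : R := if insub t is Some k then N (k : 'I_n) k else 1.

(** Automorphisms conjugate the radial flow to itself with time scaled by [be], which reduces their
    effect on h to their effect on the boundary. *)
Let beP : 0 < be /\ forall x a, dom_h psi x ->
  dom_h psi (N *m x + v) -> N *m (flow psi a x) + v = flow psi (be * a) (N *m x + v).
Proof.
rewrite /be; case: insubP => [k tn kt|]; last first.
  rewrite -leqNgt => nt; split=> [|x a dx dGx]; first exact: ltr01.
  apply/colP => l; have lt : (l < t)%N by rewrite (leq_trans (ltn_ord l)).
  have [rt _ _ rE] := rhoP lt; rewrite mul1r rE /flow !exE lt rt !mxDE !mxZE.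
  rewrite !lgE lt rt [wv _ _ _]mxE [X in _ = expR ((_ + _ * X) / _)]mxE ltnNge nt /=.
  rewrite !mulrDl !expRD !mulfK ?gt_eqF ?sw_gt0//.
  rewrite !(mulrC (sw _)) !mulfK ?gt_eqF ?sw_gt0//.
  have xr : x (rho l) 0 \is Num.pos by rewrite posrE dx.
  have yr : (N *m x + v) l 0 \is Num.pos by rewrite posrE dGx.
  by rewrite (lnK xr) (lnK yr) rE mulrA.
have kt' : k == t :> nat by rewrite kt.
have [b b0 e] := vert_col kt'.
have -> : N k k = b by rewrite -(mul_dv N) e !mxE !eqxx mulr1.
split=> // x a dx dGx.
have fE c y : dom_h psi y -> flow psi c y = y + c *: dv k.
  move=> dy; apply/colP => i; rewrite /flow exE !mxDE lgE !mxZE [wv _ _ _]mxE tn.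
  rewrite [dv k _ _]mxE andbT -val_eqE /= kt.
  have [it|ti] := ltnP i t.
    rewrite ltn_eqF// !mulr0 !addr0 (mulrC (sw _)) mulfK ?gt_eqF ?sw_gt0//.
    by rewrite lnK// posrE; exact: dy.
  by [].
by rewrite !fE// mulmxDr -scalemxAr e scalerA addrAC (mulrC b).
Qed.

Lemma aff_form_exists : exists rho al be, aff_form N v rho al be.
Proof.
exists rho, al, be; have [be0 beF] := beP.
have domG x : dom_h psi x -> dom_h psi (N *m x + v).
  move=> dx l lt; have [rt a0 _ ->] := rhoP lt; by rewrite mulr_gt0// dx.
have horoG x : dom_h psi x -> h (N *m x + v) = be * h x.
  move=> dx; pose s := h x; pose x1 := flow psi s x.
  have dx1 : dom_h psi x1 by exact: flow_dom.
  have hx1 : h x1 = 0 by rewrite horo_flow// subrr.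
  have [dG hG] : Om (N *m x1 + v) by apply: OmG; split=> //; rewrite hx1.
  (* A boundary point mapped to h < 0 could be pushed out of the domain by the flow while its image
     stays in the domain. *)
  have hG0 : h (N *m x1 + v) = 0.
    apply/eqP; rewrite eq_le hG /= leNgt; apply/negP => hn.
    pose e := - h (N *m x1 + v) / be.
    have e0 : 0 < e by rewrite divr_gt0// oppr_gt0.
    have : Om (flow psi (- e) x1).
      case: (NP) => _ H; apply/(H _).2; rewrite beF//; split; first exact: flow_dom.
      by rewrite horo_flow// /e mulrN mulrC divfK ?gt_eqF// opprK subrr.
    by case=> _; rewrite horo_flow// hx1 sub0r opprK leNgt e0.
  have xE : x = flow psi (- s) x1 by rewrite /x1 flow_flow// addNr flow0.
  by rewrite {1}xE beF// horo_flow// hG0 sub0r mulrN opprK.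
split=> //.
- by move=> l /rhoP[].
- by move=> l /rhoP[].
- by move=> l x /rhoP[].
- by move=> j i tj it; apply: (proj2 (aff_pres_rec NP it)).
- move=> k i kt it; have [b b0 e] := vert_col kt.
  have tn : (t < n)%N by rewrite -(eqP kt).
  have -> : be = b.
    rewrite /be; case: insubP => [k' _ k't|]; last by rewrite tn.
    have -> : k' = k by apply: val_inj; rewrite /= k't (eqP kt).
    by rewrite -(mul_dv N) e !mxE !eqxx mulr1.
  rewrite -(mul_dv N); have [l [a [lt a0 e']]] := col it.
  case: eqVneq => [->|ik]; first by rewrite e !mxE !eqxx.
  rewrite e' !mxE; case: eqVneq => [kl|]; last by rewrite !mulr0.
  by case/eqP: ik; apply: (col_uniq a0 b0 e'); rewrite e kl.
- move=> l lt; have [rt a0 e _] := rhoP lt.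
  (* Multiplying the coordinate rho l of the basepoint by exp 1 lowers h by cw (rho l), and lowers h
     at the image by cw l. *)
  pose u := sw (rho l) *: dv (rho l); pose x := ex u; pose x0 := basepoint psi.
  have dx : dom_h psi x by exact: ex_dom.
  have dx0 : dom_h psi x0 by exact: basepoint_dom.
  have xE : x = x0 + (expR 1 - 1) *: dv (rho l).
    apply/colP => i; rewrite exE !mxE andbT; case: (eqVneq i (rho l)) => [->|_].
      by rewrite rt !mulr1 divff ?gt_eqF ?sw_gt0// addrC subrK.
    by rewrite !mulr0 mul0r expR0 addr0; case: ifP.
  have GxE : N *m x + v = N *m x0 + v + ((expR 1 - 1) * al l) *: dv l.
    by rewrite xE mulmxDr -scalemxAr e scalerA addrAC.
  have G0l : (N *m x0 + v) l 0 = al l.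
    by have [_ _ _ ->] := rhoP lt; rewrite [x0 _ _]mxE rt mulr1.
  pose y0 := N *m x0 + v; rewrite -/y0 in GxE G0l.
  have Gxi i : (N *m x + v) i 0 = y0 i 0 + ((expR 1 - 1) * al l) * (i == l)%:R.
    by rewrite GxE [LHS]mxDE mxZE [dv l _ _]mxE andbT.
  have lgG : lg (N *m x + v) = lg y0 + sw l *: dv l.
    apply/colP => i; rewrite [RHS]mxDE !lgE mxZE Gxi.
    rewrite [dv l _ _]mxE andbT; case: (eqVneq i l) => [->|il]; last by rewrite !mulr0 !addr0.
    rewrite lt G0l !mulr1 (_ : al l + _ = al l * expR 1); last by ring.
    by rewrite lnM ?posrE ?expR_gt0// expRK mulrDr mulr1.
  have := horoG _ dx; rewrite horo_funE// lgG.
  have hqD i c y : (i < t)%N -> hq (y + c *: dv i) = hq y - c * sw i.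
    move=> it; rewrite /hq ellD ellZ ell_dv_lt// opprD addrAC; congr (_ + _ * _ - _).
    by apply: eq_bigr => j tj; rewrite mxDE dv_gt ?addr0// ltnW.
  rewrite hqD// -horo_funE// horoG// horo_basepoint// mulr0 sub0r.
  rewrite horo_funE// exK// -[u]add0r hqD// hq0// sub0r mulrN => /oppr_inj.
  by rewrite -!expr2 !sw_sqr.
Qed.

End Given.
End Structure3.

Section DistancePreserving.
Variables (R : realType) (m : nat).

(** Polarization gives preservation of inner products; the matrix A of the images of the basis
    vectors is compared with the map by expanding |A y - f0 y|^2. *)
Lemma dist_preserving_isom (f : 'cV[R]_m -> 'cV[R]_m) :
  (forall x y, en (f x - f y) = en (x - y)) -> exists a : isom R m, f =1 isom_act a.
Proof.
move=> fd.
have [f0 f0E] : exists g : 'cV[R]_m -> 'cV[R]_m, forall x, g x = f x - f 0.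
  by exists (fun x => f x - f 0).
have f0d x y : dotv (f0 x - f0 y) (f0 x - f0 y) = dotv (x - y) (x - y).
  by rewrite -!en_sqr -(fd x y) !f0E opprB addrA subrK.
have f00 : f0 0 = 0 by rewrite f0E subrr.
have f0n x : dotv (f0 x) (f0 x) = dotv x x.
  by have := f0d x 0; rewrite f00 !subr0.
have f0p x y : dotv (f0 x) (f0 y) = dotv x y.
  have := f0d x y; rewrite !(dotvDl, dotvDr, dotvNl, dotvNr) !f0n.
  by rewrite (dotvC (f0 y)) (dotvC y); lra.
pose A : 'M[R]_m := \matrix_(i, j) f0 (delta_mx j 0) i 0.
have Ay y : A *m y = \sum_j y j 0 *: f0 (delta_mx j 0).
  apply/colP => i; rewrite mxE summxE; apply: eq_bigr => j _.
  by rewrite mxZE mxE mulrC.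
have dvy i (y : 'cV[R]_m) : dotv (delta_mx i 0) y = y i 0.
  rewrite dotvE (bigD1 i)//= big1 => [|j ji]; rewrite !mxE ?eqxx ?mul1r ?addr0//.
  by rewrite (negbTE ji) mul0r.
have dsum (x : 'cV[R]_m) (F : 'I_m -> 'cV[R]_m) : dotv x (\sum_j F j) = \sum_j dotv x (F j).
  by rewrite /dotv mulmx_sumr summxE.
have key x y : dotv (f0 x) (A *m y) = dotv x y.
  rewrite Ay dsum dotvE; apply: eq_bigr => j _.
  by rewrite dotvZr f0p dotvC dvy mulrC.
have AAy y : dotv (A *m y) (A *m y) = dotv y y.
  rewrite {1}Ay dotvC dsum dotvE; apply: eq_bigr => j _.
  by rewrite dotvZr dotvC key dvy.
have AA y : A *m y = f0 y.
  apply/subr0_eq/dotv_eq0; rewrite !(dotvDl, dotvDr, dotvNl, dotvNr) f0n AAy.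
  by rewrite (dotvC (A *m y)) key; lra.
have ATA : A^T *m A = 1%:M.
  apply: mx_act_inj => y; apply/colP => i.
  by rewrite -dvy -mulmxA -dotv_mulmx AA key dvy mul1mx.
exists (mk_isom (f 0) ATA) => y.
by rewrite /isom_act /Defs.rot /Defs.trans /= AA f0E subrK.
Qed.

End DistancePreserving.

(** * The group of a cusp as a group of Euclidean isometries *)

Section GroupStructure.
Variables (R : realType) (n : nat) (psi : 'rV[R]_n).
Hypothesis Apsi : weyl psi.
Hypothesis n2 : (1 < n)%N.
Implicit Types (x u v w p d : 'cV[R]_n) (y : 'cV[R]_n.-1) (i j k l : 'I_n) (N : 'M[R]_n) (g : PGL R n).
Local Notation t := (ctype psi).
Local Notation h := (horo_fun psi).
Local Notation cw := (cw psi).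
Local Notation sw := (sw psi).
Local Notation lg := (lg psi).
Local Notation ex := (ex psi).
Local Notation Ph := (Ph psi).
Local Notation Yc := (Yc psi).
Local Notation Om := (Om psi).
Local Notation dv i := (delta_mx i 0 : 'cV[R]_n).
Let n0 : (0 < n)%N := ltnW n2.

Lemma PGL_Omega_form g : PGL_of (Omega psi) g -> exists N v (uNv : aff_mx N v \in unitmx),
  g = pgl uNv /\ exists rho al be, aff_form psi N v rho al be.
Proof.
move=> /(PGL_Omega_affine Apsi n2)[N [v [uNv [gE NP]]]].
by exists N, v, uNv; split=> //; apply: aff_form_exists.
Qed.

Lemma PGL_of_inv (X : set (RP R n)) g : PGL_of X g -> PGL_of X g^-1%g.
Proof.
rewrite /PGL_of /= => gX; rewrite -{1}gX; apply/seteqP; split=> [_ [_ [p Xp <-] <-]|p Xp].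
  by rewrite actVK.
by exists (act g p); [exists p|rewrite actVK].
Qed.

Lemma PGL_Omega_scale g : PGL_of (Omega psi) g -> exists2 be : R, 0 < be &
  forall x, dom_h psi x -> exists2 x', dom_h psi x' &
    act g (affine x) = affine x' /\ h x' = be * h x.
Proof.
move=> /PGL_Omega_form[N [v [uNv [-> [rho [al [be A]]]]]]].
exists be; first exact: af_be A.
move=> x dx; exists (N *m x + v); first exact: (af_dom A).
by rewrite act_aff (af_horo A).
Qed.

Lemma Gpsi_Omega g : Gpsi psi g -> PGL_of (Omega psi) g.
Proof.
move=> Gg; apply/seteqP; split=> [_ [_ [x [dx hx] <-] <-]|_ [x [dx hx] <-]].
  have : (horosphere psi (h x)) (act g (affine x)) by rewrite -Gg; exists (affine x) => //; exists x.
  by move=> [x' [dx' hx'] <-]; exists x' => //; split=> //; rewrite hx'.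
have : (horosphere psi (h x)) (affine x) by exists x.
rewrite -Gg => -[_ [x' [dx' hx'] <-] <-].
by exists (affine x') => //; exists x' => //; split=> //; rewrite hx'.
Qed.

Lemma Ph_surj x : dom_h psi x -> exists y (s : R), x = Ph y s.
Proof. by move=> dx; exists (Yc x), (- h x); rewrite Ph_Yc. Qed.

Lemma PGL_Omega_Gpsi g : PGL_of (Omega psi) g ->
  (Gpsi psi g <-> forall x, dom_h psi x -> exists2 x', dom_h psi x' &
    act g (affine x) = affine x' /\ h x' = h x).
Proof.
move=> Og; split=> [Gg x dx|H c].
  have : (horosphere psi (h x)) (act g (affine x)) by rewrite -Gg; exists (affine x) => //; exists x.
  by move=> [x' [dx' hx'] <-]; exists x'.
have [be be0 Hb] := PGL_Omega_scale (PGL_of_inv Og).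
(* Evaluated at a point where h = -1, since the factor cannot be seen on h = 0. *)
have be1 : be = 1.
  pose x := Ph 0 1; have dx : dom_h psi x by exact: Ph_dom.
  have hx : h x = -1 by rewrite horo_Ph.
  have [x1 dx1 [gx1 hx1]] := Hb x dx; have [x2 dx2 [gx2 hx2]] := H x1 dx1.
  have : x2 = x by apply: (@affine_inj R n); rewrite -gx2 -gx1 actKV.
  by move=> xx; move: hx2; rewrite xx hx1 hx; lra.
apply/seteqP; split=> [_ [_ [x [dx hx] <-] <-]|_ [x [dx hx] <-]].
  by have [x' dx' [-> hx']] := H x dx; exists x' => //; split=> //; rewrite hx'.
have [x1 dx1 [gx1 hx1]] := Hb x dx; exists (affine x1); last by rewrite -gx1 actKV.
by exists x1 => //; split=> //; rewrite hx1 be1 mul1r.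
Qed.

(** The weights are nonincreasing and cw l = be cw (rho l). At the smallest weight, l = t - 1, this
    gives be <= 1; at the largest, l = 0, it gives be >= 1. *)
Lemma aff_form_be1 N v rho al be : psi != 0 -> aff_form psi N v rho al be -> be = 1.
Proof.
rewrite psi_neq0// => t0 A; have be0 := af_be A.
have cws i j : (i <= j)%N -> (j < t)%N -> cw j <= cw i.
  move=> ij jt; rewrite /cw; case: ifP => _; first exact: (proj1 Apsi).
  by rewrite ler_pM2r ?invr_gt0 ?sum_psi_gt0//; exact: (proj1 Apsi).
have tle := ctype_le psi; have t1 : (t.-1 < n)%N by rewrite (leq_trans _ tle)// prednK.
apply/eqP; rewrite eq_le; apply/andP; split.
  pose l := Ordinal t1; have lt : (l < t)%N by rewrite /= prednK.
  have rl : (rho l <= l)%N by rewrite /= -ltnS prednK// (af_rho_lt A).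
  have := cws _ _ rl lt; rewrite {1}(af_cw A lt) => H.
  by rewrite -(ler_pM2r (cw_gt0 Apsi (af_rho_lt A lt))) mul1r.
pose l := Ordinal n0; have lt : (l < t)%N by [].
have := cws l (rho l) (leq0n _) (af_rho_lt A lt); rewrite (af_cw A lt) => H.
by rewrite -(ler_pM2r (cw_gt0 Apsi (af_rho_lt A lt))) mul1r.
Qed.

Theorem PGL_Omega_eq_Gpsi : psi != 0 -> PGL_of (Omega psi) = Gpsi psi.
Proof.
move=> p0; apply/seteqP; split=> g; last exact: Gpsi_Omega.
move=> Og; apply/(PGL_Omega_Gpsi Og).
have [N [v [uNv [-> [rho [al [be A]]]]]]] := PGL_Omega_form Og => x dx.
exists (N *m x + v); first exact: (af_dom A).
by rewrite act_aff (af_horo A)// (aff_form_be1 p0 A) mul1r.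
Qed.

Lemma Gpsi_form g : Gpsi psi g -> exists N v (uNv : aff_mx N v \in unitmx),
  g = pgl uNv /\ exists rho al, aff_form psi N v rho al 1.
Proof.
move=> Gg; have Og := Gpsi_Omega Gg; have H := (PGL_Omega_Gpsi Og).1 Gg.
have [N [v [uNv [gE [rho [al [be A]]]]]]] := PGL_Omega_form Og.
exists N, v, uNv; split=> //; exists rho, al; rewrite -[1](_ : be = 1)//.
have dx : dom_h psi (Ph 0 1) by exact: Ph_dom.
have [x' dx' []] := H _ dx; rewrite gE act_aff => /affine_inj <-.
by rewrite (af_horo A)// horo_Ph//; lra.
Qed.

(** The second difference of h at the basepoint, in a direction supported on the quadratic
    coordinates, isolates the quadratic part, which N multiplies by [be]. *)
Lemma aff_form_orth N v rho al be (z : 'cV[R]_n) : aff_form psi N v rho al be ->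
  \sum_(j < n | (t < j)%N) (N *m z) j 0 ^+ 2 = be * \sum_(j < n | (t < j)%N) z j 0 ^+ 2.
Proof.
move=> A; pose z' : 'cV[R]_n := \col_i ((t < i)%N%:R * z i 0).
have z'E j : (t < j)%N -> z' j 0 = z j 0 by move=> tj; rewrite mxE tj mul1r.
have z'0 i : (i <= t)%N -> z' i 0 = 0 by move=> it; rewrite mxE ltnNge it mul0r.
have Nz j : (t < j)%N -> (N *m z) j 0 = (N *m z') j 0.
  move=> tj; rewrite !mxE; apply: eq_bigr => i _.
  by have [it|ti] := leqP i t; [rewrite (af_low A)// !mul0r|rewrite z'E].
have vl l : (l < t)%N -> v l 0 = 0.
  by move=> lt; have := af_row A 0 lt; rewrite mulmx0 add0r mxE mulr0.
have Nz0 l : (l < t)%N -> (N *m z') l 0 = 0.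
  move=> lt; have := af_row A z' lt.
  by rewrite mxDE vl// addr0 z'0 ?mulr0// ltnW// (af_rho_lt A).
pose x0 := basepoint psi; have d0 : dom_h psi x0 by exact: basepoint_dom.
have dpm (s : R) : dom_h psi (x0 + s *: z').
  by move=> i it; rewrite mxDE mxZE z'0 ?mulr0 ?addr0 ?d0// ltnW.
have E (s : R) : h (x0 + s *: z') = h x0 - \sum_(i < n | (i == t :> nat)%N) (s *: z') i 0
    + \sum_(i < n | (t < i)%N) x0 i 0 * (s *: z') i 0
    + 2^-1 * \sum_(i < n | (t < i)%N) (s *: z') i 0 ^+ 2.
  by apply: horo_shift => // i it; rewrite mxZE z'0 ?mulr0// ltnW.
have E' (s : R) : h (N *m (x0 + s *: z') + v) = h (N *m x0 + v)
    - \sum_(i < n | (i == t :> nat)%N) (s *: (N *m z')) i 0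
    + \sum_(i < n | (t < i)%N) (N *m x0 + v) i 0 * (s *: (N *m z')) i 0
    + 2^-1 * \sum_(i < n | (t < i)%N) (s *: (N *m z')) i 0 ^+ 2.
  rewrite mulmxDr -scalemxAr addrAC; apply: horo_shift => // i it.
  by rewrite mxZE Nz0 ?mulr0.
have S1 (P : pred 'I_n) (w : 'cV[R]_n) (s : R) : \sum_(i < n | P i) (s *: w) i 0 = s * \sum_(i < n | P i) w i 0.
  by rewrite mulr_sumr; apply: eq_bigr => i _; rewrite mxZE.
have S2 (w y : 'cV[R]_n) (s : R) : \sum_(i < n | (t < i)%N) y i 0 * (s *: w) i 0
   = s * \sum_(i < n | (t < i)%N) y i 0 * w i 0.
  by rewrite mulr_sumr; apply: eq_bigr => i _; rewrite mxZE mulrCA.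
have S3 (w : 'cV[R]_n) (s : R) : \sum_(i < n | (t < i)%N) (s *: w) i 0 ^+ 2
   = s ^+ 2 * \sum_(i < n | (t < i)%N) w i 0 ^+ 2.
  by rewrite mulr_sumr; apply: eq_bigr => i _; rewrite mxZE exprMn.
have e1 := af_horo A (dpm 1); have e2 := af_horo A (dpm (-1)); have e0 := af_horo A d0.
move: e1 e2; rewrite !E !E' e0 !S3 !S1 !S2 sqrrN !expr1n !mul1r !mulN1r.
have -> : \sum_(j < n | (t < j)%N) (N *m z) j 0 ^+ 2 = \sum_(j < n | (t < j)%N) (N *m z') j 0 ^+ 2.
  by apply: eq_bigr => j tj; rewrite Nz.
have -> : \sum_(j < n | (t < j)%N) z j 0 ^+ 2 = \sum_(j < n | (t < j)%N) z' j 0 ^+ 2.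
  by apply: eq_bigr => j tj; rewrite z'E.
lra.
Qed.

(** By [dist_Yc] the squared distance is |u|^2 - <wv, u>^2 for a difference u of logarithmic
    coordinates. The factors [al] drop out of u, and [rho] permutes coordinates of equal weight. *)
Lemma aff_form_dist N v rho al x x' : aff_form psi N v rho al 1 ->
  dom_h psi x -> dom_h psi x' ->
  en (Yc (N *m x + v) - Yc (N *m x' + v)) = en (Yc x - Yc x').
Proof.
move=> A dx dx'; rewrite /en; congr Num.sqrt; rewrite !dist_Yc//.
have form u : dotv u u - dotv (wv psi) u ^+ 2 = \sum_(l < n | (l < t)%N) u l 0 ^+ 2
    + \sum_(j < n | (t < j)%N) u j 0 ^+ 2
    - (if (t < n)%N then 0 else (\sum_(l < n | (l < t)%N) sw l * u l 0) ^+ 2).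
  have -> : dotv u u = \sum_(l < n | (l < t)%N) u l 0 ^+ 2
    + \sum_(j < n | (t < j)%N) u j 0 ^+ 2 + \sum_(k < n | (k == t :> nat)%N) u k 0 ^+ 2.
    rewrite dotvE (bigID (fun l : 'I_n => (l < t)%N))/= -addrA; congr (_ + _).
    rewrite (bigID (fun l : 'I_n => (t < l)%N))/=; congr (_ + _); apply: eq_big => i;
      rewrite -?expr2//; first by case: ltngtP.
    by rewrite -!leqNgt eqn_leq andbC.
  case: ifP => tn.
    have -> : \sum_(k < n | (k == t :> nat)%N) u k 0 ^+ 2 = u (Ordinal tn) 0 ^+ 2.
      rewrite (bigD1 (Ordinal tn))//= big1 ?addr0// => k /andP[/eqP kt].
      by case/eqP; apply: val_inj.
    have -> : dotv (wv psi) u = u (Ordinal tn) 0.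
      rewrite dotvE (bigD1 (Ordinal tn))//= big1 => [|k kn].
        by rewrite [wv _ _ _]mxE tn eqxx mul1r addr0.
      by move: kn; rewrite -val_eqE [wv _ _ _]mxE tn => /negbTE /= ->; rewrite mul0r.
    by rewrite addrK subr0.
  rewrite [\sum_(k < n | (k == t :> nat)%N) _]big1 ?addr0 => [|k /eqP kt]; last first.
    by move: tn; rewrite -kt ltn_ord.
  congr (_ - _ ^+ 2); rewrite dotvE; apply: eq_big => i.
    by rewrite (leq_trans (ltn_ord i))// leqNgt tn.
  by rewrite [wv _ _ _]mxE tn.
rewrite !form; set D' := lg _ - _; set D := lg x - _.
have sr l : (l < t)%N -> sw l = sw (rho l).
  by move=> lt; rewrite /sw (af_cw A lt) mul1r.
have D'l l : (l < t)%N -> D' l 0 = D (rho l) 0.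
  move=> lt; have rt := af_rho_lt A lt; rewrite /D' /D !mxDE !mxNE !lgE lt rt.
  rewrite !(af_row A _ lt) !lnM ?posrE ?(af_al A)// ?dx ?dx'// sr//; ring.
(* [rho] is extended by the identity to a permutation of all indices so that sums can be
   reindexed. *)
pose f l : 'I_n := if (l < t)%N then rho l else l.
have f_inj : injective f.
  move=> l l'; rewrite /f; case: ifP => lt; case: ifP => l't.
  - exact: (af_rho_inj A lt l't).
  - by move=> e; move: l't; rewrite -e (af_rho_lt A).
  - by move=> e; move: lt; rewrite e (af_rho_lt A).
  - by [].
have ft l : (f l < t)%N = (l < t)%N.
  by rewrite /f; case: ifP => [lt|//]; rewrite (af_rho_lt A).
have reind (F : 'I_n -> R) : \sum_(l < n | (l < t)%N) F (rho l) = \sum_(l < n | (l < t)%N) F l.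
  rewrite [RHS](reindex_inj f_inj); apply: eq_big => [l|l lt]; first by rewrite ft.
  by rewrite /f lt.
congr (_ + _ - _).
- rewrite -(reind (fun l => D l 0 ^+ 2)); apply: eq_bigr => l lt; by rewrite D'l.
- have Dj (y y' : 'cV[R]_n) j : (t < j)%N -> (lg y - lg y') j 0 = (y - y') j 0.
    by move=> tj; rewrite !mxDE !mxNE !lgE ltnNge ltnW.
  rewrite (eq_bigr (fun j => (N *m (x - x')) j 0 ^+ 2)) => [|j tj]; last first.
    by rewrite Dj// mulmxBr opprD addrACA subrr addr0.
  rewrite (aff_form_orth _ A) mul1r; apply: eq_bigr => j tj.
  by rewrite /D Dj.
- case: ifP => // _; congr (_ ^+ 2).
  rewrite -(reind (fun l => sw l * D l 0)); apply: eq_bigr => l lt.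
  by rewrite D'l// sr.
Qed.

(** Kept as a relation between g and a: uniqueness determines a, and compatibility with products and
    inverses is immediate. *)
Definition isoP (g : PGL R n) (a : isom R n.-1) :=
  forall y s, act g (affine (Ph y s)) = affine (Ph (isom_act a y) s).

Lemma Gpsi_isoP g : Gpsi psi g -> exists a, isoP g a.
Proof.
move=> Gg; have [N [v [uNv [-> [rho [al A]]]]]] := Gpsi_form Gg.
pose f y := Yc (N *m Ph y 0 + v).
have fE y s : Yc (N *m Ph y s + v) = f y.
  apply/subr0_eq/en_eq0; rewrite (aff_form_dist A); try exact: Ph_dom.
  by rewrite !Yc_Ph// subrr en0.
have [|a fa] := @dist_preserving_isom _ _ f.
  move=> y y'; rewrite (aff_form_dist A); try exact: Ph_dom.
  by rewrite !Yc_Ph.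
exists a => y s; rewrite act_aff; congr affine.
have dG : dom_h psi (N *m Ph y s + v) by apply: (af_dom A); exact: Ph_dom.
rewrite -{1}(Ph_Yc Apsi n0 dG) fE fa (af_horo A) ?horo_Ph ?mul1r ?opprK//.
exact: Ph_dom.
Qed.

Lemma isoP_Gpsi g a : isoP g a -> Gpsi psi g.
Proof.
move=> H c; rewrite horosphereE//; apply/seteqP; split=> [_ [_ [y _ <-] <-]|_ [y _ <-]].
  by exists (isom_act a y).
exists (affine (Ph (isom_act a^-1%g y) (- c))); first by exists (isom_act a^-1%g y).
by rewrite H isom_actKV.
Qed.

Lemma affine_Ph_inj y y' s s' : affine (Ph y s) = affine (Ph y' s') -> y = y' /\ s = s'.
Proof.
move=> /affine_inj e; split; first by rewrite -(Yc_Ph Apsi n0 y s) e Yc_Ph.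
by apply: oppr_inj; rewrite -(horo_Ph Apsi n0 y) e horo_Ph.
Qed.

Lemma isoP_uniq g a b : isoP g a -> isoP g b -> a = b.
Proof.
move=> Ha Hb; apply: isom_act_inj => y.
by have := Ha y 0; rewrite Hb => /affine_Ph_inj[].
Qed.

Lemma isoPM g g' a a' : isoP g a -> isoP g' a' -> isoP (g * g')%g (a * a')%g.
Proof. by move=> H H' y s; rewrite actM H' H isom_actM. Qed.

Lemma isoPV g a : isoP g a -> isoP g^-1%g a^-1%g.
Proof.
move=> H y s; apply: (can_inj (actVK g)); rewrite actKV H isom_actKV.
by [].
Qed.

Lemma isoP1 : isoP 1%g 1%g.
Proof. by move=> y s; rewrite act1 isom_act1. Qed.

Lemma isoP_tr y : isoP (tr_pgl psi y) (tr_isom y).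
Proof. by move=> y' s; rewrite act_tr_Ph// isom_act_tr. Qed.

End GroupStructure.

(** * Homogeneous closed conditions on the matrices of the group *)

Section Cone.
Variables (R : realType) (n : nat) (psi : 'rV[R]_n).
Hypothesis Apsi : weyl psi.
Hypothesis n2 : (1 < n)%N.
Implicit Types (i j k l a b : 'I_n) (N : 'M[R]_n) (v : 'cV[R]_n) (X : 'M[R]_(n + 1)).
Local Notation t := (ctype psi).
Local Notation h := (horo_fun psi).
Local Notation cw := (cw psi).
Local Notation dv i := (delta_mx i 0 : 'cV[R]_n).
Local Notation L := (lshift 1).
Local Notation Z := (rshift n (0 : 'I_1)).
Let n0 : (0 < n)%N := ltnW n2.

Lemma aff_mxE N v : (forall i j, aff_mx N v (L i) (L j) = N i j) /\
  [/\ forall i, aff_mx N v (L i) Z = v i 0, forall j, aff_mx N v Z (L j) = 0 &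
    aff_mx N v Z Z = 1].
Proof.
split=> [i j|]; first by rewrite /aff_mx block_mxEul.
split=> [i|j|]; rewrite /aff_mx ?block_mxEur ?block_mxEdl ?block_mxEdr// mxE//.
Qed.

Lemma split_ord (P : 'I_(n + 1) -> Prop) : (forall i, P (L i)) -> P Z -> forall b : 'I_(n + 1), P b.
Proof.
move=> PL PZ b; rewrite -(fintype.splitK b); case: (fintype.split b) => [i|i] /=; first exact: PL.
by rewrite (ord1 i).
Qed.

Section Form.
Variables (N : 'M[R]_n) (v : 'cV[R]_n) (rho : 'I_n -> 'I_n) (al : 'I_n -> R) (be : R).
Hypothesis A : aff_form psi N v rho al be.

Lemma form_v l : (l < t)%N -> v l 0 = 0.
Proof. by move=> lt; have := af_row A 0 lt; rewrite mulmx0 add0r mxE mulr0. Qed.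

Lemma form_N l i : (l < t)%N -> N l i = al l * (i == rho l)%:R.
Proof.
move=> lt; have := af_row A (dv i) lt; rewrite mxDE form_v// addr0 mul_dv => ->.
by rewrite mxE andbT eq_sym.
Qed.

Lemma form_col j i : (i < t)%N -> (t <= j)%N -> N j i = 0.
Proof.
move=> it; rewrite leq_eqVlt => /orP[jt|tj]; last by rewrite (af_low A)// ltnW.
rewrite eq_sym in jt; rewrite (af_vert A jt (ltnW it)) (_ : (i == j) = false) ?mulr0//.
by rewrite -val_eqE /= (eqP jt) ltn_eqF.
Qed.

Lemma form_orth a b : (t < a)%N -> (t < b)%N ->
  \sum_(j < n | (t < j)%N) N j a * N j b = be * (a == b)%:R.
Proof.
move=> ta tb.
have S (x : 'cV[R]_n) := aff_form_orth Apsi x A.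
have E (y : 'I_n) : (t < y)%N -> \sum_(j < n | (t < j)%N) (dv y) j 0 ^+ 2 = 1 :> R.
  move=> ty; rewrite (bigD1 y)//= big1 => [|j /andP[_ /negbTE jy]].
    by rewrite !mxE !eqxx expr1n addr0.
  by rewrite !mxE jy expr0n.
have [->|ab] := eqVneq a b.
  have := S (dv b); rewrite E// => <-; apply: eq_bigr => j _.
  by rewrite mul_dv expr2.
have := S (dv a + dv b); have := S (dv a); have := S (dv b); rewrite !E//.
have -> : \sum_(j < n | (t < j)%N) (dv a + dv b) j 0 ^+ 2 = 2 :> R.
  have -> : \sum_(j < n | (t < j)%N) (dv a + dv b) j 0 ^+ 2 =
     \sum_(j < n | (t < j)%N) (dv a) j 0 ^+ 2 + \sum_(j < n | (t < j)%N) (dv b) j 0 ^+ 2 :> R.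
    rewrite -big_split; apply: eq_bigr => j _ /=; rewrite !mxE.
    by have [->|] := eqVneq j a; rewrite ?(negbTE ab) ?addr0 ?add0r /= ?expr0n /= ?addr0 ?add0r.
  by rewrite !E.
have -> : \sum_(j < n | (t < j)%N) (N *m (dv a + dv b)) j 0 ^+ 2 =
  \sum_(j < n | (t < j)%N) (N *m dv a) j 0 ^+ 2 + \sum_(j < n | (t < j)%N) (N *m dv b) j 0 ^+ 2
   + 2 * \sum_(j < n | (t < j)%N) N j a * N j b.
  rewrite mulr_sumr -!big_split; apply: eq_bigr => j _ /=.
  by rewrite mulmxDr mxDE !mul_dv; ring.
by rewrite mulr0; lra.
Qed.

(** The quadratic block of N, completed by sqrt(be) times the identity to a square matrix, so that
    orthogonality of its columns yields orthogonality of its rows. *)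
Let Bf : 'M[R]_n := \matrix_(i, j) if (t < i)%N && (t < j)%N then N i j else
  (Num.sqrt be) * (i == j)%:R.

Let Bf1 : Bf^T *m Bf = be%:M.
Proof.
have sb : Num.sqrt be * Num.sqrt be = be.
  by rewrite -expr2 sqr_sqrtr// ltW// (af_be A).
apply/matrixP => a b; rewrite !mxE.
have [ta|ta] := boolP (t < a)%N; last first.
  rewrite (bigD1 a)//= big1 => [|i ia].
    by rewrite !mxE (negbTE ta) andbF eqxx mulr1 /= mulrA sb addr0 mulr_natr.
  by rewrite !mxE (negbTE ta) andbF (negbTE ia) !mulr0 mul0r.
have [tb|tb] := boolP (t < b)%N; last first.
  have ab : (a == b) = false by apply: contraNF tb => /eqP <-.
  rewrite ab mulr0n big1// => i _; rewrite !mxE (negbTE tb) andbF.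
  have [->|ib] := eqVneq i b; last by rewrite !mulr0.
  by rewrite (negbTE tb) /= eq_sym ab mulr0 mul0r.
rewrite (bigID (fun i : 'I_n => (t < i)%N))/= [X in _ + X]big1 ?addr0 => [|i ti].
  rewrite -mulr_natr -form_orth//; apply: eq_bigr => i ti.
  by rewrite !mxE ti ta tb.
rewrite !mxE (negbTE ti) /= (_ : (i == a) = false) ?mulr0 ?mul0r//.
by apply: contraNF ti => /eqP ->.
Qed.

Lemma form_orthT i j : (t < i)%N -> (t < j)%N ->
  \sum_(a < n | (t < a)%N) N i a * N j a = be * (i == j)%:R.
Proof.
move=> ti tj; have b0 := af_be A.
have /matrixP/(_ i j) : Bf *m Bf^T = be%:M.
  have e : (be^-1 *: Bf^T) *m Bf = 1%:M.
    by rewrite -scalemxAl Bf1 scale_scalar_mx mulVf ?gt_eqF.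
  have := mulmx1C e; rewrite -scalemxAr => /(congr1 (GRing.scale be)).
  by rewrite scalerA mulfV ?gt_eqF// scale1r scale_scalar_mx mulr1.
rewrite !mxE mulr_natr => <-.
rewrite [RHS](bigID (fun a : 'I_n => (t < a)%N))/= [X in _ = _ + X]big1 ?addr0 => [|a ta].
  by apply: eq_bigr => a ta; rewrite !mxE ti tj ta.
rewrite !mxE (negbTE ta) !andbF (_ : (i == a) = false) ?mulr0 ?mul0r//.
by apply: contraNF ta => /eqP <-.
Qed.

(** h (x0 + s e_a) = s^2 / 2 is even in s, so the linear term in s at the image has to vanish. *)
Lemma form_shift k a : k == t :> nat -> (t < a)%N ->
  N k a = \sum_(j < n | (t < j)%N) v j 0 * N j a.
Proof.
move=> kt ta; pose x0 := basepoint psi.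
have d0 : dom_h psi x0 by exact: basepoint_dom.
have z0 l (s : R) : (l <= t)%N -> (s *: dv a) l 0 = 0.
  move=> lt; rewrite !mxE (_ : (l == a) = false) ?mulr0//.
  by rewrite -val_eqE ltn_eqF// (leq_ltn_trans lt).
have dpm (s : R) : dom_h psi (x0 + s *: dv a).
  by move=> i it; rewrite mxDE z0 ?addr0 ?d0// ltnW.
have bigk (F : 'I_n -> R) : \sum_(i < n | (i == t :> nat)%N) F i = F k.
  rewrite (bigD1 k)//= big1 ?addr0// => i /andP[/eqP it]; case/eqP; apply: val_inj.
  by rewrite /= it (eqP kt).
have E (s : R) : h (x0 + s *: dv a) = 2^-1 * s ^+ 2.
  rewrite horo_shift// => [|i it]; last by rewrite z0// ltnW.
  rewrite horo_basepoint// bigk z0 ?(eqP kt)// big1 => [|i ti]; last first.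
    by rewrite [x0 _ _]mxE ltnNge ltnW// mul0r.
  rewrite (bigD1 a)//= big1 => [|i /andP[_ /negbTE ia]].
    by rewrite !mxE !eqxx mulr1 subrr add0r addr0 add0r.
  by rewrite !mxE ia mulr0 expr0n.
have Nx0 j : (t <= j)%N -> (N *m x0) j 0 = 0.
  move=> tj; rewrite mxE big1// => i _; rewrite [x0 _ _]mxE.
  by case: (boolP (i < t)%N) => it; [rewrite form_col ?mul0r|rewrite mulr0].
have E' (s : R) : h (N *m (x0 + s *: dv a) + v) = h (N *m x0 + v) - s * N k a
    + s * \sum_(j < n | (t < j)%N) v j 0 * N j a + 2^-1 * s ^+ 2 * be.
  rewrite mulmxDr -scalemxAr addrAC horo_shift// => [|l lt]; last first.
    rewrite mxZE mul_dv form_N// (_ : (a == rho l) = false) ?mulr0//.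
    by rewrite -val_eqE gtn_eqF// (ltn_trans (af_rho_lt A lt)).
  rewrite bigk mxZE mul_dv -mulrA; congr (_ - _ + _ + _).
    rewrite mulr_sumr; apply: eq_bigr => j tj; rewrite mxDE Nx0 1?ltnW// add0r mxZE mul_dv.
    by rewrite mulrCA.
  congr (_ * _); have := form_orth ta ta; rewrite eqxx mulr1 => <-; rewrite mulr_sumr.
  by apply: eq_bigr => j _; rewrite mxZE mul_dv exprMn expr2.
have e0 := af_horo A d0; have e1 := af_horo A (dpm 1); have e2 := af_horo A (dpm (-1)).
move: e1 e2; rewrite !E' !E e0 horo_basepoint// sqrrN expr1n; lra.
Qed.

(** By [form_shift] the row of index t is obtained from v through the quadratic block, which is
    orthogonal up to scale. Being homogeneous when [be] = 1, this relation survives rescaled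
    limits. *)
Lemma form_norm k : k == t :> nat ->
  \sum_(a < n | (t < a)%N) N k a ^+ 2 = be * \sum_(j < n | (t < j)%N) v j 0 ^+ 2.
Proof.
move=> kt; rewrite (eq_bigr (fun a => \sum_(i < n | (t < i)%N) \sum_(j < n | (t < j)%N)
   v i 0 * v j 0 * (N i a * N j a))) => [|a ta]; last first.
  rewrite (form_shift kt ta) expr2 mulr_suml; apply: eq_bigr => i _.
  by rewrite mulr_sumr; apply: eq_bigr => j _; ring.
rewrite exchange_big mulr_sumr; apply: eq_bigr => i ti /=; rewrite exchange_big.
rewrite (eq_bigr (fun j => v i 0 * v j 0 * (be * (i == j)%:R))) => [|j tj]; last first.
  by rewrite -form_orthT// mulr_sumr.
rewrite (bigD1 i)//= big1 => [|j /andP[_ /negbTE ji]]; last by rewrite eq_sym ji !mulr0.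
by rewrite eqxx addr0 mulr1 mulrC expr2.
Qed.

Lemma form_vert_v k : k == t :> nat ->
  v k 0 = - \sum_(l < n | (l < t)%N) cw l * ln (al l) + 2^-1 * \sum_(j < n | (t < j)%N) v j 0 ^+ 2.
Proof.
move=> kt; pose x0 := basepoint psi.
have d0 : dom_h psi x0 by exact: basepoint_dom.
have Nx0 j : (t <= j)%N -> (N *m x0) j 0 = 0.
  move=> tj; rewrite mxE big1// => i _; rewrite [x0 _ _]mxE.
  by case: (boolP (i < t)%N) => it; [rewrite form_col ?mul0r|rewrite mulr0].
have := af_horo A d0; rewrite horo_basepoint// mulr0 horo_xE// (bigD1 k)//= big1 => [|i]; last first.
  by move=> /andP[/eqP it]; case/eqP; apply: val_inj; rewrite /= it (eqP kt).
rewrite mxDE Nx0 ?(eqP kt)// add0r addr0.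
have -> : \sum_(i < n | (i < t)%N) cw i * ln ((N *m x0 + v) i 0) =
    \sum_(l < n | (l < t)%N) cw l * ln (al l).
  apply: eq_bigr => l lt; rewrite (af_row A _ lt) [x0 _ _]mxE (af_rho_lt A lt) mulr1.
  by [].
have -> : \sum_(i < n | (t < i)%N) (N *m x0 + v) i 0 ^+ 2 = \sum_(j < n | (t < j)%N) v j 0 ^+ 2.
  by apply: eq_bigr => j tj; rewrite mxDE Nx0 1?ltnW// add0r.
lra.
Qed.

Lemma form_full : (n <= t)%N -> \sum_l cw l * ln (al l) = 0.
Proof.
move=> nt; pose x0 := basepoint psi.
have d0 : dom_h psi x0 by exact: basepoint_dom.
have lt l : (l < t)%N by exact: leq_trans (ltn_ord l) nt.
have := af_horo A d0; rewrite horo_basepoint// mulr0 horo_xE//.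
rewrite [\sum_(i < n | (i == t :> nat)%N) _]big1 => [|i /eqP it]; last first.
  by have := lt i; rewrite it ltnn.
rewrite [\sum_(i < n | (t < i)%N) _]big1 => [|i ti]; last by have := lt i; rewrite ltnNge ltnW.
rewrite oppr0 sub0r mulr0 addr0 => /eqP; rewrite oppr_eq0 => /eqP e; rewrite -[RHS]e.
apply: eq_big => [l|l _]; first by rewrite lt.
by rewrite (af_row A _ (lt l)) [x0 _ _]mxE (af_rho_lt A (lt l)) mulr1.
Qed.

End Form.

(** The scalar [ka] is there because an element of PGL determines its matrix only up to a factor. *)
Definition cone X := exists (ka : R) N v rho al, ka != 0 /\ aff_form psi N v rho al 1 /\ X = ka *: aff_mx N v.

(** Conditions that are closed and homogeneous, hence inherited by limits of rescaled elements of
    [cone]. [cc_full] replaces the relation sum cw ln al = 0, which has no meaning for degenerate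
    limits, by the consequence that some al is at least 1. *)
Record cone_closed X : Prop := ConeClosed {
  cc_row : forall l (b : 'I_(n + 1)), (l < t)%N -> (forall i, (i < t)%N -> b <> L i) -> X (L l) b = 0;
  cc_col : forall l (b : 'I_(n + 1)), (l < t)%N -> (forall i, (i < t)%N -> b <> L i) -> X b (L l) = 0;
  cc_monr : forall l i i', (l < t)%N -> i != i' -> X (L l) (L i) * X (L l) (L i') = 0;
  cc_monc : forall l l' i, (l < t)%N -> (l' < t)%N -> l != l' -> X (L l) (L i) * X (L l') (L i) = 0;
  cc_diag : forall k, k == t :> nat -> X (L k) (L k) = X Z Z;
  cc_last : forall b : 'I_(n + 1), b != Z -> X Z b = 0;
  cc_vert : forall k (b : 'I_(n + 1)), k == t :> nat -> b != L k -> X b (L k) = 0;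
  cc_mid : forall a, (t < a)%N -> \sum_(j < n | (t < j)%N) X (L j) (L a) ^+ 2 = X Z Z ^+ 2;
  cc_norm : forall k, k == t :> nat -> \sum_(a < n | (t < a)%N) X (L k) (L a) ^+ 2 =
     \sum_(j < n | (t < j)%N) X (L j) Z ^+ 2;
  cc_full : (n <= t)%N -> `|X Z Z| <= \sum_(i < n) \sum_(j < n) `|X (L i) (L j)| }.

Lemma cone_is_closed X : cone X -> cone_closed X.
Proof.
move=> [ka [N [v [rho [al [ka0 [A XE]]]]]]].
have [ELL [ELZ EZL EZZ]] := aff_mxE N v.
have XLL i j : X (L i) (L j) = ka * N i j by rewrite XE mxZE ELL.
have XLZ i : X (L i) Z = ka * v i 0 by rewrite XE mxZE ELZ.
have XZL j : X Z (L j) = 0 by rewrite XE mxZE EZL mulr0.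
have XZZ : X Z Z = ka by rewrite XE mxZE EZZ mulr1.
split.
- move=> l b lt; elim/split_ord: b => [i H|_]; last by rewrite XLZ (form_v A)// mulr0.
  have ti : (t <= i)%N by rewrite leqNgt; apply/negP => /H.
  rewrite XLL (form_N A)// (_ : (i == rho l) = false) ?mulr0//.
  by rewrite -val_eqE gtn_eqF// (leq_trans (af_rho_lt A lt)).
- move=> l b lt; elim/split_ord: b => [i H|_]; last exact: XZL.
  have ti : (t <= i)%N by rewrite leqNgt; apply/negP => /H.
  by rewrite XLL (form_col A)// mulr0.
- move=> l i i' lt ii'; rewrite !XLL !(form_N A)//.
  have [<-|] := eqVneq i (rho l); last by rewrite !mulr0 mul0r.
  by rewrite eq_sym (negbTE ii') !mulr0.
- move=> l l' i lt l't ll'; rewrite !XLL !(form_N A)//.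
  have [->|] := eqVneq i (rho l); last by rewrite !mulr0 mul0r.
  have [e|] := eqVneq (rho l) (rho l'); last by rewrite !mulr0.
  by case/eqP: ll'; apply: (af_rho_inj A).
- by move=> k kt; rewrite XLL XZZ (af_vert A)// ?(eqP kt)// eqxx !mulr1.
- by move=> b; elim/split_ord: b => [i _|]; [exact: XZL|rewrite eqxx].
- move=> k b kt; elim/split_ord: b => [i|_]; last exact: XZL.
  rewrite (inj_eq (@lshift_inj _ _)) => ik.
  rewrite XLL; have [it|ti] := ltnP i t.
    rewrite (form_N A)// (_ : (k == rho i) = false) ?mulr0//.
    by rewrite -val_eqE /= (eqP kt) gtn_eqF// (af_rho_lt A).
  rewrite (af_low A) ?mulr0// ?(eqP kt)//.
  by rewrite ltn_neqAle ti andbT -(eqP kt) eq_sym.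
- move=> a ta; rewrite XZZ -[RHS]mulr1 -[1 in RHS](_ : 1 * (a == a)%:R = 1); last by rewrite eqxx mulr1.
  rewrite -(form_orth A ta ta) mulr_sumr; apply: eq_bigr => j _.
  by rewrite XLL exprMn (expr2 (N _ _)).
- move=> k kt; have := form_norm A kt; rewrite mul1r => /(congr1 (GRing.mul (ka ^+ 2))).
  rewrite !mulr_sumr => e; under eq_bigr do rewrite XLL exprMn.
  by rewrite e; apply: eq_bigr => j _; rewrite XLZ exprMn.
- move=> nt; have lt l : (l < t)%N by exact: leq_trans (ltn_ord l) nt.
  have [l al1] : exists l, 1 <= al l.
    apply: contrapT => /forallNP H.
    have : \sum_l cw l * ln (al l) < 0.
      rewrite (bigD1 (Ordinal n0))//= ltr_nwDl//.
        rewrite pmulr_rlt0 ?(cw_gt0 Apsi (lt _))// ln_lt0// (af_al A (lt _)) /=.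
        by rewrite ltNge; apply/negP/H.
      apply: sumr_le0 => l _; rewrite pmulr_rle0 ?(cw_gt0 Apsi (lt _))// ln_le0//.
      by rewrite ltW// ltNge; apply/negP/H.
    by rewrite (form_full A nt) ltxx.
  rewrite XZZ (bigD1 l)//= (bigD1 (rho l))//= XLL (form_N A)// eqxx mulr1 normrM.
  rewrite -addrA; apply: le_trans (_ : `|ka| * `|al l| <= _).
    by rewrite ler_peMr// ger0_norm// ltW// (af_al A).
  rewrite lerDl addr_ge0//; apply: sumr_ge0 => // i _; apply: sumr_ge0 => //.
Qed.

End Cone.

(** * Rescaled limits of translations *)

Section TranslationLimits.
Variables (R : realType) (n : nat) (psi : 'rV[R]_n).
Hypothesis Apsi : weyl psi.
Hypothesis n2 : (1 < n)%N.
Implicit Types (i j l a b : 'I_n) (z d : 'cV[R]_n) (y : 'cV[R]_n.-1) (Delta : set 'cV[R]_n.-1).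
Local Notation t := (ctype psi).
Local Notation sw := (sw psi).
Local Notation hq := (hq psi).
Local Notation ell := (ell psi).
Local Notation dv i := (delta_mx i 0 : 'cV[R]_n).
Local Notation L := (lshift 1).
Local Notation Z := (rshift n (0 : 'I_1)).
Let n0 : (0 < n)%N := ltnW n2.

Definition Tm y := aff_mx (tr_mx psi (Um psi *m y)) (tr_vec psi (Um psi *m y)).

Definition coarse_set Delta := exists D : R, forall y, exists2 l, Delta l & en (y - l) <= D.

(** In both limits below the normalization r grows at least quadratically in k, while all entries
    but the dominant one grow at most linearly. *)
Lemma growth_cvg0 (u r : nat -> R) (A B A' B' C : R) (K : nat) : 0 < C ->
  (forall k, 0 < r k) -> (forall k, `|u k| <= A + B * k%:R) ->
  (forall k, (K <= k)%N -> C * k%:R ^+ 2 - B' * k%:R - A' <= r k) ->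
  (fun k => u k / r k) @ \oo --> (0 : R).
Proof.
move=> C0 r0 uA rC.
have B0 (c : R) : \forall k \near \oo, c <= k%:R.
  exists (Num.bound `|c|) => // k /= ck.
  apply: le_trans (ler_norm _) _; apply/ltW; apply: lt_le_trans (archi_boundP (normr_ge0 _)) _.
  by rewrite ler_nat.
apply/cvgrPdist_le => e e0.
have H1 := B0 (2 * (`|B'| + `|A'|) / C + 1).
have H2 := B0 (2 * (`|A| + `|B|) / (C * e) + 1).
have H3 : \forall k \near \oo, (K <= k)%N by exists K.
apply: (filterS _ (filterI H1 (filterI H2 H3))) => k [h1 [h2 h3]].
have k1 : 1 <= k%:R :> R.
  by apply: le_trans h1; rewrite lerDr divr_ge0 ?mulr_ge0 ?addr_ge0// ltW.
have k0 : 0 < k%:R :> R by apply: lt_le_trans k1.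
have rk := rC k h3.
rewrite sub0r normrN normrM normfV (gtr0_norm (r0 k)) ler_pdivrMr//.
apply: le_trans (uA k) _; apply: le_trans (_ : e * (C / 2 * k%:R ^+ 2) <= _); last first.
  rewrite ler_pM2l//; apply: le_trans rk.
  have : (2 * (`|B'| + `|A'|) / C) * C <= k%:R * C.
    by rewrite ler_pM2r//; lra.
  rewrite divfK ?gt_eqF// => h4.
  have : 2 * (`|B'| + `|A'|) * k%:R <= k%:R * C * k%:R by rewrite ler_pM2r.
  have : B' * k%:R <= `|B'| * k%:R by rewrite ler_pM2r// ler_norm.
  have : A' <= `|A'| * k%:R.
    by apply: le_trans (ler_norm _) _; rewrite ler_peMr.
  rewrite expr2; lra.
have Ce : 0 < C * e by rewrite mulr_gt0.
have : (2 * (`|A| + `|B|) / (C * e)) * (C * e) <= k%:R * (C * e).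
  by rewrite ler_pM2r//; lra.
rewrite divfK ?gt_eqF// => h4.
have : 2 * (`|A| + `|B|) * k%:R <= k%:R * (C * e) * k%:R by rewrite ler_pM2r.
have : B * k%:R <= `|B| * k%:R by rewrite ler_pM2r// ler_norm.
have : A <= `|A| * k%:R by apply: le_trans (ler_norm _) _; rewrite ler_peMr.
rewrite expr2; lra.
Qed.

Lemma en_Um y : en (Um psi *m y) = en y.
Proof. by rewrite /en dotv_mulmx mulmxA UmTK// mul1mx. Qed.

(** A coarse set follows any sequence of points s_k d at bounded distance, so limits may be taken
    along directions d chosen at will in the hyperplane orthogonal to [wv]. *)
Lemma coarse_direction Delta d (s : nat -> R) : coarse_set Delta -> dotv (wv psi) d = 0 ->
  exists D : R, exists lam : nat -> 'cV[R]_n.-1, (forall k, Delta (lam k)) /\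
    forall k, en (Um psi *m lam k - s k *: d) <= D.
Proof.
move=> [D HD] wd; exists D.
have /choice[lam Hl] : forall k, exists l : 'cV[R]_n.-1, Delta l /\ en (s k *: ((Um psi)^T *m d) - l) <= D.
  by move=> k; have [l] := HD (s k *: ((Um psi)^T *m d)); exists l.
exists lam; split=> [k|k]; first by case: (Hl k).
have [_ H] := Hl k; apply: le_trans H; rewrite enB -en_Um mulmxBr -scalemxAr UmKT//.
by rewrite wd scale0r subr0.
Qed.

Lemma ell_bound z : `|ell z| <= (\sum_(i < n | (i == t :> nat)%N) 1 + \sum_(i < n | (i < t)%N) sw i) * en z.
Proof.
rewrite /ell mulrDl; apply: le_trans (ler_normD _ _) _; apply: lerD.
  apply: le_trans (ler_norm_sum _ _ _) _; rewrite mulr_suml; apply: ler_sum => i _.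
  by rewrite mul1r coord_le_en.
apply: le_trans (ler_norm_sum _ _ _) _; rewrite mulr_suml; apply: ler_sum => i it.
by rewrite normrM (gtr0_norm (sw_gt0 Apsi it)) ler_pM2l ?sw_gt0// coord_le_en.
Qed.

Lemma TmE y : let z := Um psi *m y in
  [/\ forall a b, (a < t)%N -> Tm y (L a) (L b) = (a == b)%:R * expR (z a 0 / sw a),
     forall a b, (t <= a)%N -> Tm y (L a) (L b) = (a == b)%:R + (a == t :> nat)%:R * (t < b)%:R * z b 0,
     forall a, Tm y (L a) Z = if (a < t)%N then 0 else if a == t :> nat then hq z else z a 0,
     forall b, Tm y Z (L b) = 0 & Tm y Z Z = 1].
Proof.
have [ELL [ELZ EZL EZZ]] := aff_mxE (tr_mx psi (Um psi *m y)) (tr_vec psi (Um psi *m y)).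
split=> //.
- by move=> a b at_; rewrite ELL mxE at_.
- by move=> a b ta; rewrite ELL mxE ltnNge ta.
- by move=> a; rewrite ELZ mxE.
Qed.

Let cvg_const0 (r : nat -> R) : (fun k => 0 / r k) @ \oo --> (0 : R).
Proof. by under eq_fun do rewrite mul0r; exact: cvg_cst. Qed.

Lemma cvg_eventually_eq (u : nat -> R) (c : R) K : (forall k, (K <= k)%N -> u k = c) ->
  u @ \oo --> c.
Proof.
move=> H; apply: (@cvg_trans _ ((fun=> c) @ \oo)); last exact: cvg_cst.
by apply: near_eq_cvg; exists K => // k /= Kk; rewrite H.
Qed.

Lemma expR_ge_sqr (x : R) : 0 <= x -> x ^+ 2 / 4 <= expR x.
Proof.
move=> x0; have -> : expR x = expR (x / 2) ^+ 2 by rewrite expr2 -expRD -splitr.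
have -> : x ^+ 2 / 4 = (x / 2) ^+ 2 by field.
rewrite lerXn2r ?nnegrE ?expR_ge0 ?divr_ge0//.
by apply: le_trans (expR_ge1Dx _); lra.
Qed.

(** In the direction d the i-th logarithmic coordinate grows like k and no other positive coordinate
    grows, so exp (z_i / sw_i) dominates every other entry of the matrix. *)
Lemma Tm_limit_diag Delta i : coarse_set Delta -> (i < t)%N ->
  exists (lam : nat -> 'cV[R]_n.-1) (r : nat -> R), [/\ forall k, Delta (lam k),
    forall k, 0 < r k & forall a b : 'I_(n + 1),
      (fun k => Tm (lam k) a b / r k) @ \oo --> (delta_mx (L i) (L i) : 'M[R]_(n + 1)) a b].
Proof.
move=> cD it; have s0 := sw_gt0 Apsi it.
(* When t = n the direction must be made orthogonal to [wv], so another coordinate m decreases in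
   exchange; it exists because n >= 2. *)
have [d [wd di dl dj]] : exists d, [/\ dotv (wv psi) d = 0, d i 0 = 1,
    forall l, (l < t)%N -> l != i -> d l 0 <= 0 & forall j, (t <= j)%N -> d j 0 = 0].
  have [tn|nt] := ltnP t n.
    exists (dv i); split.
    - rewrite dotvE big1// => l _; rewrite !mxE tn andbT.
      have [->|_] := eqVneq l i; last by rewrite mulr0.
      by rewrite ltn_eqF// mul0r.
    - by rewrite mxE !eqxx.
    - by move=> l lt li; rewrite mxE (negbTE li).
    - by move=> j tj; rewrite mxE (_ : (j == i) = false)// -val_eqE gtn_eqF// (leq_trans it).
  have lt l : (l < t)%N by exact: leq_trans (ltn_ord l) nt.
  have [m mi] : exists m : 'I_n, m != i.
    have [i0|i0] := eqVneq (i : nat) 0%N.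
      by exists (Ordinal n2); rewrite -val_eqE /= i0.
    by exists (Ordinal n0); rewrite -val_eqE /= eq_sym.
  have sm := sw_gt0 Apsi (lt m).
  exists (dv i - (sw i / sw m) *: dv m); split.
  - rewrite dotvDr dotvNr dotvZr.
    have de l : dotv (wv psi) (dv l) = sw l.
      rewrite dotvE (bigD1 l)//= big1 => [|l' /negbTE ll']; last by rewrite !mxE ll' mulr0.
      by rewrite !mxE !eqxx mulr1 addr0 ltnNge nt.
    by rewrite !de divfK ?gt_eqF// subrr.
  - by rewrite !mxE eqxx eq_sym (negbTE mi) mulr0 subr0.
  - move=> l _ li; rewrite !mxE (negbTE li) sub0r oppr_le0 mulr_ge0// divr_ge0// ltW//.
  - by move=> j; rewrite leqNgt lt.
have [D [lam [Dl Hl]]] := coarse_direction (fun k => k%:R) cD wd.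
pose z k := Um psi *m lam k.
have zE k l : `|z k l 0 - k%:R * d l 0| <= D.
  by apply: le_trans (Hl k); have := coord_le_en (z k - k%:R *: d) l; rewrite mxDE mxNE mxZE.
have D0 : 0 <= D by apply: le_trans (Hl 0%N); exact: en_ge0.
pose r k := expR (z k i 0 / sw i).
have r0 k : 0 < r k by exact: expR_gt0.
exists lam, r; split=> // a b.
pose C := (4 * sw i ^+ 2)^-1.
have C0 : 0 < C by rewrite invr_gt0 mulr_gt0// exprn_gt0.
have growth (u : nat -> R) A B : (forall k, `|u k| <= A + B * k%:R) -> (fun k => u k / r k) @ \oo --> (0 : R).
  move=> uA; apply: (@growth_cvg0 u r A B 0 (C * (2 * D)) C (Num.bound `|D|)) => // k Kk.
  have kD : D <= k%:R.
    apply: le_trans (ler_norm _) _; apply/ltW; apply: lt_le_trans (archi_boundP (normr_ge0 _)) _.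
    by rewrite ler_nat.
  have zi : k%:R - D <= z k i 0 by have := zE k i; rewrite di mulr1 ler_norml; lra.
  have x0 : 0 <= (k%:R - D) / sw i by rewrite divr_ge0 ?subr_ge0// ltW.
  apply: le_trans (_ : expR ((k%:R - D) / sw i) <= _); last by rewrite ler_expR ler_pM2r ?invr_gt0.
  apply: le_trans (expR_ge_sqr x0).
  have -> : ((k%:R - D) / sw i) ^+ 2 / 4 = C * (k%:R - D) ^+ 2.
    by rewrite /C; field; rewrite gt_eqF.
  have : 0 <= C * D ^+ 2 by rewrite mulr_ge0 ?sqr_ge0// ltW.
  rewrite !expr2; lra.
have zb k l : (t <= l)%N -> `|z k l 0| <= D.
  by move=> tl; have := zE k l; rewrite dj// mulr0 subr0.
have zu k l : (l < t)%N -> l != i -> z k l 0 <= D.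
  move=> lt li; have := zE k l; rewrite ler_norml.
  have : k%:R * d l 0 <= 0 by rewrite mulr_ge0_le0// dl.
  lra.
elim/split_ord: a => [a|].
  elim/split_ord: b => [b|].
    rewrite mxE !(inj_eq (@lshift_inj _ _)).
    have [at_|ta] := ltnP a t.
      have E k : Tm (lam k) (L a) (L b) / r k = (a == b)%:R * expR (z k a 0 / sw a) / r k.
        by have [-> // _ _ _ _] := TmE (lam k).
      under eq_fun do rewrite E.
      have [ab|ab] := eqVneq a b; last first.
        rewrite (_ : _ && _ = false); last by apply: contraNF ab => /andP[/eqP-> /eqP->].
        by under eq_fun do rewrite mul0r; exact: cvg_const0.
      rewrite -ab andbb; have [->|ai] := eqVneq a i.
        by apply: (@cvg_eventually_eq _ _ 0%N) => k _; rewrite mulr1n mul1r divff// gt_eqF ?expR_gt0.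
      under eq_fun do rewrite mulr1n mul1r.
      apply: (@growth _ (expR (D / sw a)) 0) => k; rewrite mul0r addr0 ger0_norm ?expR_ge0//.
      by rewrite ler_expR ler_pM2r ?invr_gt0 ?sw_gt0// zu.
    have ai : (a == i) = false by rewrite -val_eqE gtn_eqF// (leq_trans it).
    rewrite ai /=; apply: (@growth _ (1 + D) 0) => k.
    have [_ -> // _ _ _] := TmE (lam k); rewrite mul0r addr0.
    apply: le_trans (ler_normD _ _) _; apply: lerD; first by case: (a == b); rewrite ?normr1 ?normr0.
    case: (boolP (t < b)%N) => tb; last by rewrite mulr0 mul0r normr0.
    rewrite mulr1 normrM; have := zb k _ (ltnW tb) => h.
    by case: (a == t :> nat); rewrite ?normr1 ?mul1r// normr0 mul0r.
  rewrite mxE (_ : (Z == L i) = false) ?andbF//; last by rewrite -val_eqE /= gtn_eqF// addn0.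
  pose E1 := (\sum_(i < n | (i == t :> nat)%N) 1 + \sum_(i < n | (i < t)%N) sw i) * D.
  pose E2 := 2^-1 * \sum_(j < n | (t < j)%N) D ^+ 2.
  have hqb k : `|hq (z k)| <= E1 + E2 + `|ell d| * k%:R.
    rewrite hq_def; apply: le_trans (ler_normD _ _) _; rewrite normrN.
    have -> : ell (z k) = ell (z k - k%:R *: d) + k%:R * ell d.
      by rewrite -ellZ -ellD subrK.
    have h1 : `|ell (z k - k%:R *: d)| <= E1.
      apply: le_trans (ell_bound _) _; rewrite ler_wpM2l// ?Hl//.
      by rewrite addr_ge0 ?sumr_ge0// => l lt; rewrite ltW// sw_gt0.
    have h2 : `|2^-1 * \sum_(j < n | (t < j)%N) z k j 0 ^+ 2| <= E2.
      rewrite ger0_norm; last by apply: mulr_ge0; rewrite ?invr_ge0// sumr_ge0// => j _; exact: sqr_ge0.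
      rewrite ler_pM2l ?invr_gt0//; apply: ler_sum => j tj; rewrite -[leLHS]real_normK ?num_real//.
      by rewrite lerXn2r ?nnegrE// zb// ltnW.
    have := ler_normD (ell (z k - k%:R *: d)) (k%:R * ell d).
    rewrite normrM (ger0_norm (ler0n _ k)); lra.
  have E0 : 0 <= E1 + E2 by have := hqb 0%N; rewrite mulr0 addr0; apply: le_trans.
  have [at_|ta] := ltnP a t.
    have E k : Tm (lam k) (L a) Z / r k = 0 / r k by have [_ _ -> _ _] := TmE (lam k); rewrite at_.
    by under eq_fun do rewrite E; exact: cvg_const0.
  apply: (@growth _ (E1 + E2 + D) `|ell d|) => k.
  have [_ _ -> _ _] := TmE (lam k); rewrite ltnNge ta /=; case: ifP => _.
    by apply: le_trans (hqb k) _; rewrite lerD2r lerDl.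
  apply: le_trans (zb _ _ ta) _; have : 0 <= `|ell d| * k%:R by rewrite mulr_ge0.
  lra.
rewrite mxE (_ : (Z == L i) = false) /=; last by rewrite -val_eqE /= gtn_eqF// addn0.
elim/split_ord: b => [b|].
  have E k : Tm (lam k) Z (L b) / r k = 0 / r k by have [_ _ _ -> _] := TmE (lam k).
  by under eq_fun do rewrite E; exact: cvg_const0.
apply: (@growth _ 1 0) => k; have [_ _ _ _ ->] := TmE (lam k).
by rewrite mul0r addr0 normr1.
Qed.

(** Here the entry [hq z], in the row of index t and the last column, dominates. It lies off the
    diagonal, so this limit is nilpotent. *)
Lemma Tm_limit_vert Delta (k0 : 'I_n) : coarse_set Delta -> k0 = t :> nat ->
  exists (lam : nat -> 'cV[R]_n.-1) (r : nat -> R), [/\ forall k, Delta (lam k),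
    forall k, 0 < r k & forall a b : 'I_(n + 1),
      (fun k => Tm (lam k) a b / r k) @ \oo --> (delta_mx (L k0) Z : 'M[R]_(n + 1)) a b].
Proof.
move=> cD k0t; have tn : (t < n)%N by rewrite -k0t.
have wvE l : wv psi l 0 = (l == k0)%:R.
  by rewrite mxE tn -k0t -val_eqE.
have ellE z : ell z = z k0 0 + \sum_(i < n | (i < t)%N) sw i * z i 0.
  congr (_ + _); rewrite (eq_bigl (pred1 k0)) ?big_pred1_eq// => i /=.
  by rewrite -k0t -val_eqE.
have [lam [D [D0 Dl [F1 F2 [C [B' [A' [K [C0 F3]]]]]]]]] : exists (lam : nat -> 'cV[R]_n.-1) (D : R),
    let z k := Um psi *m lam k in
    [/\ 0 <= D, forall k, Delta (lam k) &
       [/\ forall k l, (l < t)%N -> z k l 0 <= D,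
          forall k l, (t <= l)%N -> `|z k l 0| <= D + k%:R &
          exists C B' A' K, 0 < C /\ forall k, (K <= k)%N -> C * k%:R ^+ 2 - B' * k%:R - A' <= hq (z k)]].
  (* If t = 0, [hq] grows like k^2 / 2 along the quadratic coordinate of index 1. If t > 0, letting
     all logarithmic coordinates behave like -k^2 makes [hq] grow while the exponentials stay
     bounded. *)
  have [t0|t0] := posnP t.
    pose j := Ordinal n2.
    have jt : (t < j)%N by rewrite t0.
    have wd : dotv (wv psi) (dv j) = 0.
      rewrite dotvE big1// => l _; rewrite wvE !mxE; have [->|_] := eqVneq l k0; last by rewrite mul0r.
      by rewrite (_ : (k0 == j) = false) ?mulr0// -val_eqE /= k0t t0.
    have [D [lam [Dl Hl]]] := coarse_direction (fun k => k%:R) cD wd.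
    have D0 : 0 <= D by apply: le_trans (Hl 0%N); exact: en_ge0.
    have zE k l : `|(Um psi *m lam k) l 0 - k%:R * (l == j)%:R| <= D.
      by apply: le_trans (Hl k); have := coord_le_en (Um psi *m lam k - k%:R *: dv j) l; rewrite mxDE mxNE mxZE (_ : dv j l 0 = (l == j)%:R)// mxE eqxx andbT.
    exists lam, D; split=> //; split=> [k l|k l _|]; first by rewrite t0.
      have := zE k l; rewrite !ler_norml; have : 0 <= k%:R :> R by [].
      by case: (l == j); rewrite ?mulr1 ?mulr0; lra.
    exists 2^-1, D, D, (Num.bound `|D|); split; first by rewrite invr_gt0.
    move=> k Kk.
    have kD : D <= k%:R.
      apply: le_trans (ler_norm _) _; apply/ltW; apply: lt_le_trans (archi_boundP (normr_ge0 _)) _.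
      by rewrite ler_nat.
    rewrite hq_def ellE big1 ?addr0 => [|l]; last by rewrite t0.
    have h0 := zE k k0; have hj := zE k j.
    rewrite (_ : (k0 == j) = false) in h0; last by rewrite -val_eqE /= k0t t0.
    rewrite eqxx mulr1 in hj; rewrite mulr0 in h0.
    set z := Um psi *m lam k in h0 hj *.
    have : z j 0 ^+ 2 <= \sum_(j < n | (t < j)%N) z j 0 ^+ 2.
      by rewrite (bigD1 j)//= lerDl sumr_ge0// => l _; exact: sqr_ge0.
    have : (k%:R - D) ^+ 2 <= z j 0 ^+ 2.
      by rewrite lerXn2r ?nnegrE; move: hj; rewrite ?ler_norml; lra.
    move: h0; rewrite subr0 ler_norml !expr2.
    have := sqr_ge0 D; rewrite expr2; lra.
  pose d : 'cV[R]_n := \col_l - (l < t)%N%:R.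
  have wd : dotv (wv psi) d = 0.
    rewrite dotvE big1// => l _; rewrite wvE !mxE; have [->|_] := eqVneq l k0; last by rewrite mul0r.
    by rewrite k0t ltnn oppr0 mulr0.
  have [D [lam [Dl Hl]]] := coarse_direction (fun k => k%:R ^+ 2) cD wd.
  have D0 : 0 <= D by apply: le_trans (Hl 0%N); exact: en_ge0.
  have zE k l : `|(Um psi *m lam k) l 0 + k%:R ^+ 2 * (l < t)%N%:R| <= D.
    by apply: le_trans (Hl k); have := coord_le_en (Um psi *m lam k - k%:R ^+ 2 *: d) l; rewrite mxDE mxNE mxZE (_ : d l 0 = - (l < t)%N%:R) ?mulrN ?opprK// mxE.
  exists lam, D; split=> //; split=> [k l lt|k l tl|].
  - have := zE k l; rewrite lt mulr1 ler_norml; have := sqr_ge0 (k%:R : R); lra.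
  - by have := zE k l; rewrite ltnNge tl mulr0 addr0 => h; apply: le_trans h _; rewrite lerDl.
  pose s := \sum_(i < n | (i < t)%N) sw i.
  have s0 : 0 < s.
    rewrite /s (bigD1 (Ordinal n0))//=; apply: ltr_pwDl; first exact: sw_gt0.
    by apply: sumr_ge0 => i /andP[it _]; rewrite ltW// sw_gt0.
  exists s, 0, ((\sum_(i < n | (i == t :> nat)%N) 1 + \sum_(i < n | (i < t)%N) sw i) * D), 0%N.
  split=> // k _; set z := Um psi *m lam k.
  have ed : ell d = - s.
    rewrite ellE !mxE k0t ltnn oppr0 add0r -sumrN; apply: eq_bigr => i it.
    by rewrite mxE it mulrN1.
  have h : `|ell (z - k%:R ^+ 2 *: d)| <= (\sum_(i < n | (i == t :> nat)%N) 1 + \sum_(i < n | (i < t)%N) sw i) * D.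
    apply: le_trans (ell_bound _) _; rewrite ler_wpM2l// ?Hl//.
    by rewrite addr_ge0 ?sumr_ge0// => l lt; rewrite ltW// sw_gt0.
  have ez : ell z = ell (z - k%:R ^+ 2 *: d) - k%:R ^+ 2 * s.
    by rewrite -mulrN -ed -ellZ -ellD subrK.
  rewrite hq_def ez; move: h; rewrite ler_norml.
  have : 0 <= 2^-1 * \sum_(j < n | (t < j)%N) z j 0 ^+ 2.
    by apply: mulr_ge0; rewrite ?invr_ge0// sumr_ge0// => j _; exact: sqr_ge0.
  by rewrite mul0r; lra.
pose z k := Um psi *m lam k.
(* The maximum with 1 keeps the normalization positive; eventually it is [hq (z k)] itself. *)
pose r k := Num.max (hq (z k)) 1.
have r0 k : 0 < r k by rewrite /r lt_max ltr01 orbT.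
have growth (u : nat -> R) A B : (forall k, `|u k| <= A + B * k%:R) -> (fun k => u k / r k) @ \oo --> (0 : R).
  move=> uA; apply: (@growth_cvg0 u r A B A' B' C K) => // k Kk.
  by apply: le_trans (F3 k Kk) _; rewrite /r le_max lexx.
exists lam, r; split=> // a b.
elim/split_ord: a => [a|].
  elim/split_ord: b => [b|].
    rewrite mxE (_ : (L b == Z) = false) ?andbF; last by rewrite -val_eqE /= ltn_eqF// addn0.
    have [at_|ta] := ltnP a t.
      apply: (@growth _ (expR (D / sw a)) 0) => k; have [-> // _ _ _ _] := TmE (lam k).
      rewrite mul0r addr0 ger0_norm ?mulr_ge0 ?expR_ge0//.
      apply: le_trans (_ : expR (z k a 0 / sw a) <= _); first by rewrite ler_piMl ?expR_ge0// lern1 leq_b1.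
      by rewrite ler_expR ler_pM2r ?invr_gt0 ?sw_gt0// F1.
    apply: (@growth _ (1 + D) 1) => k; have [_ -> // _ _ _] := TmE (lam k); rewrite mul1r -addrA.
    apply: le_trans (ler_normD _ _) _; apply: lerD; first by case: (a == b); rewrite ?normr1 ?normr0.
    have h0 : 0 <= D + k%:R by rewrite addr_ge0.
    case: (boolP (t < b)%N) => tb; last by rewrite mulr0 mul0r normr0.
    rewrite mulr1 normrM; have := F2 k _ (ltnW tb) => h.
    by case: (a == t :> nat); rewrite ?normr1 ?mul1r// normr0 mul0r.
  rewrite mxE eqxx andbT (inj_eq (@lshift_inj _ _)).
  have E k : Tm (lam k) (L a) Z = if (a < t)%N then 0 else if a == t :> nat then hq (z k) else z k a 0.
    by have [_ _ -> _ _] := TmE (lam k).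
  have [ak|ak] := eqVneq a k0.
    have := @growth (fun=> 1) 1 0 _ => /(_ _)/cvgrPdist_lt H.
    apply: (@cvg_trans _ ((fun=> 1) @ \oo)); last exact: cvg_cst.
    apply: near_eq_cvg; have h1 : \forall k \near \oo, `|0 - 1 / r k| < 1.
      by apply: H => // k; rewrite normr1 mul0r addr0.
    apply: filterS h1 => k; rewrite sub0r normrN div1r normfV (gtr0_norm (r0 k)) => rk.
    have : 1 < r k by rewrite -invf_lt1.
    rewrite /r lt_max ltxx orbF => h; rewrite E ak k0t ltnn eqxx.
    by rewrite max_l ?divff// ?ltW// gt_eqF// (lt_trans ltr01).
  have [at_|ta] := ltnP a t.
    apply: (@growth _ 0 0) => k; rewrite E at_ normr0 mul0r addr0//.
  apply: (@growth _ D 1) => k; rewrite E ltnNge ta /= -k0t (_ : (a == k0 :> nat) = false) ?mul1r ?F2//.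
  by apply/negbTE: ak.
rewrite mxE (_ : (Z == L k0) = false) /=; last by rewrite -val_eqE /= gtn_eqF// addn0.
elim/split_ord: b => [b|].
  by apply: (@growth _ 0 0) => k; have [_ _ _ -> _] := TmE (lam k); rewrite normr0 mul0r addr0.
apply: (@growth _ 1 0) => k; have [_ _ _ _ ->] := TmE (lam k).
by rewrite mul0r addr0 normr1.
Qed.

End TranslationLimits.

Section ConeLimits.
Variables (R : realType) (n : nat) (psi : 'rV[R]_n).
Implicit Types (u v : nat -> R) (x y : R).
Local Notation L := (lshift 1).
Local Notation Z := (rshift n (0 : 'I_1)).

Lemma seq_lim_eq u v x y : u @ \oo --> x -> v @ \oo --> y -> (forall k, u k = v k) -> x = y.
Proof.
move=> ux vy uv; have e : u = v by exact/funext.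
by rewrite -e in vy; exact: (cvg_unique _ ux vy).
Qed.

Lemma seq_sum (J : finType) (P : pred J) (F : J -> nat -> R) (l : J -> R) :
  (forall j, P j -> F j @ \oo --> l j) ->
  (fun k => \sum_(j | P j) F j k) @ \oo --> \sum_(j | P j) l j.
Proof. by move=> H; apply: cvg_big => //; exact: add_continuous. Qed.

Lemma cone_closed_lim (X : nat -> 'M[R]_(n + 1)) (Y : 'M[R]_(n + 1)) : (forall k, cone_closed psi (X k)) ->
  (forall a b, (fun k => X k a b) @ \oo --> Y a b) -> cone_closed psi Y.
Proof.
move=> C c; have c0 := cvg_cst (0 : R); have sq a b : (fun k => X k a b ^+ 2) @ \oo --> Y a b ^+ 2.
  exact: (cvgM (c a b) (c a b)).
split.
- by move=> l b lt H; apply: (seq_lim_eq (c _ _) (c0 _ _ _)) => k; apply: (cc_row (C k)).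
- by move=> l b lt H; apply: (seq_lim_eq (c _ _) (c0 _ _ _)) => k; apply: (cc_col (C k)).
- move=> l i i' lt ii; apply: (seq_lim_eq (cvgM (c _ _) (c _ _)) (c0 _ _ _)) => k.
  exact: (cc_monr (C k)).
- move=> l l' i lt lt' ll; apply: (seq_lim_eq (cvgM (c _ _) (c _ _)) (c0 _ _ _)) => k.
  exact: (cc_monc (C k)).
- by move=> k kt; apply: (seq_lim_eq (c _ _) (c _ _)) => j; apply: (cc_diag (C j)).
- by move=> b bZ; apply: (seq_lim_eq (c _ _) (c0 _ _ _)) => j; apply: (cc_last (C j)).
- by move=> k b kt bk; apply: (seq_lim_eq (c _ _) (c0 _ _ _)) => j; apply: (cc_vert (C j)).
- move=> a ta; apply: (seq_lim_eq (seq_sum (fun j _ => sq (L j) (L a))) (sq _ _)) => k.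
  exact: (cc_mid (C k)).
- move=> k kt; apply: (seq_lim_eq (seq_sum (fun j _ => sq (L k) (L j))) (seq_sum (fun j _ => sq (L j) Z))) => i.
  exact: (cc_norm (C i)).
- move=> nt; apply: (ler_cvg_to (cvg_norm (c _ _)) (seq_sum (fun i _ => seq_sum (fun j _ => cvg_norm (c (L i) (L j)))))).
  by near=> k; exact: (cc_full (C k)).
Unshelve. all: by end_near. Qed.

End ConeLimits.

(** * Classification of the rank-one limits *)

Section RankOne.
Variables (R : realType) (n : nat) (psi : 'rV[R]_n).
Implicit Types (a b c : 'I_(n + 1)) (l i j k : 'I_n).
Variables (p : 'cV[R]_(n + 1)) (q : 'rV[R]_(n + 1)).
Hypothesis n0 : (0 < n)%N.
Hypothesis C : cone_closed psi (p *m q).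
Local Notation t := (ctype psi).
Local Notation L := (lshift 1).
Local Notation Z := (rshift n (0 : 'I_1)).

Let YE a b : (p *m q) a b = p a 0 * q 0 b.
Proof. by rewrite mxE big_ord1. Qed.

Let nz a b : p a 0 != 0 -> (p *m q) a b = 0 -> q 0 b = 0.
Proof. by move=> pa; rewrite YE => /eqP; rewrite mulf_eq0 (negbTE pa) => /eqP. Qed.

Let nzq a b : q 0 b != 0 -> (p *m q) a b = 0 -> p a 0 = 0.
Proof. by move=> qb; rewrite YE => /eqP; rewrite mulf_eq0 (negbTE qb) orbF => /eqP. Qed.

(** Otherwise [cc_last] confines q to the last index, so all other columns vanish. This contradicts
    [cc_diag] if t < n and [cc_full] if t = n. *)
Lemma rank_one_last : p Z 0 * q 0 Z = 0.
Proof.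
apply/eqP; apply: contraT => pq; have [pZ qZ] : p Z 0 != 0 /\ q 0 Z != 0.
  by move: pq; rewrite mulf_eq0 negb_or => /andP.
have qL j : q 0 (L j) = 0.
  by apply: (nz pZ); apply: (cc_last C); rewrite -val_eqE /= ltn_eqF// addn0.
have [tn|nt] := ltnP t n.
  have := cc_diag C (eqxx t : Ordinal tn == t :> nat); rewrite !YE qL mulr0 => /eqP.
  by rewrite eq_sym (negbTE pq).
have := cc_full C nt; rewrite YE big1 ?normr_le0 ?(negbTE pq)// => i _.
by rewrite big1// => j _; rewrite YE qL mulr0 normr0.
Qed.

Lemma rank_one_low l b : (l < t)%N -> p (L l) 0 != 0 -> q 0 b != 0 ->
  exists2 i, b = L i /\ (i < t)%N & (forall a, a != L l -> p a 0 = 0) /\ (forall a, a != L i -> q 0 a = 0).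
Proof.
move=> lt pl qb.
have [i bi it] : exists2 i, b = L i & (i < t)%N.
  apply: contrapT => H; move/eqP: qb; apply; apply: (nz pl); apply: (cc_row C) => // i it bi.
  by apply: H; exists i.
have low a : p a 0 != 0 -> exists2 j, a = L j & (j < t)%N.
  move=> pa; apply: contrapT => H; move/eqP: pa; apply; rewrite bi in qb.
  by apply: (nzq qb); apply: (cc_col C) => // j jt aj; apply: H; exists j.
have lowq a : q 0 a != 0 -> exists2 j, a = L j & (j < t)%N.
  move=> qa; apply: contrapT => H; move/eqP: qa; apply.
  by apply: (nz pl); apply: (cc_row C) => // j jt aj; apply: H; exists j.
exists i => //; split=> a ai; apply/eqP; apply: contraT.
  move=> pa; have [j aj jt] := low _ pa; rewrite aj in pa ai.
  have lj : l != j by apply: contraNneq ai => ->.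
  have := cc_monc C i lt jt lj; rewrite !YE => /eqP; rewrite !mulf_eq0 -bi.
  by rewrite (negbTE pl) (negbTE qb) (negbTE pa).
move=> qa; have [j aj jt] := lowq _ qa; rewrite aj in qa ai.
have ij : i != j by apply: contraNneq ai => ->.
have := cc_monr C lt ij; rewrite !YE => /eqP; rewrite !mulf_eq0 -bi.
by rewrite (negbTE pl) (negbTE qb) (negbTE qa).
Qed.

Let midZ (a : 'I_n) : (t < a)%N -> forall j, (t < j)%N -> p (L j) 0 * q 0 (L a) = 0.
Proof.
move=> ta j tj; have := cc_mid C ta; rewrite YE rank_one_last expr0n /= => /eqP.
rewrite psumr_eq0 => [/allP/(_ j)|i _]; last exact: sqr_ge0.
by rewrite mem_index_enum tj YE /= sqrf_eq0 => /(_ isT)/eqP.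
Qed.

(** q p is the trace, so some diagonal entry p_a q_a is nonzero. [cc_diag] and [cc_mid] exclude the
    indices from t on, once the last diagonal entry is known to vanish. *)
Lemma rank_one_idem : q *m p = 1 -> exists2 l : 'I_n, (l < t)%N &
  (forall a, a != L l -> p a 0 = 0) /\ (forall a, a != L l -> q 0 a = 0).
Proof.
move=> qp; have [a pqa] : exists a, p a 0 * q 0 a != 0.
  apply: contrapT => H; have := congr1 (fun M : 'M_1 => M 0 0) qp; rewrite mxE big1.
    by rewrite !mxE eqxx => /eqP; rewrite eq_sym oner_eq0.
  by move=> a _; apply/eqP; apply: contraT => pq; exfalso; apply: H; exists a; rewrite mulrC.
have [pa qa] : p a 0 != 0 /\ q 0 a != 0 by move: pqa; rewrite mulf_eq0 negb_or => /andP.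
move: pa qa pqa; elim/split_ord: a => [l|]; last by rewrite rank_one_last eqxx.
move=> pl ql pql; have [lt|] := ltnP l t.
  have [i [/lshift_inj <- _] H] := rank_one_low lt pl ql; by exists l.
rewrite leq_eqVlt eq_sym => /orP[lt|tl]; last by rewrite midZ// eqxx in pql.
by have := cc_diag C lt; rewrite !YE rank_one_last => /eqP; rewrite (negbTE pql).
Qed.

(** The remaining rank-one shape is supported at one entry with both indices below t; the last
    hypothesis excludes it, and [conj_vert] supplies the reason. *)
Lemma rank_one_nil : p != 0 -> q != 0 ->
  (forall l i, (l < t)%N -> (i < t)%N -> (forall a, a != L l -> p a 0 = 0) ->
      (forall a, a != L i -> q 0 a = 0) -> False) ->
  exists2 k : 'I_n, k = t :> nat & (forall a, a != L k -> p a 0 = 0) /\ (forall a, a != Z -> q 0 a = 0).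
Proof.
move=> p0 q0 H.
have [b qb] : exists b, q 0 b != 0.
  apply: contrapT => h; move/eqP: q0; apply; apply/rowP => b; rewrite mxE; apply/eqP.
  by apply: contraT => qb; exfalso; apply: h; exists b.
have [a pa] : exists a, p a 0 != 0.
  apply: contrapT => h; move/eqP: p0; apply; apply/colP => c; rewrite mxE; apply/eqP.
  by apply: contraT => pc; exfalso; apply: h; exists c.
have pl l : (l < t)%N -> p (L l) 0 = 0.
  move=> lt; apply/eqP; apply: contraT => pl; have [i [_ it] [h1 h2]] := rank_one_low lt pl qb.
  by case: (H l i lt it).
have ql i : (i < t)%N -> q 0 (L i) = 0.
  move=> it; apply: (nz pa); apply: (cc_col C) => // j jt aj.
  by rewrite aj pl// eqxx in pa.
have pZ : p Z 0 = 0.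
  apply/eqP; apply: contraT => pZ; have [bZ|bZ] := eqVneq b Z.
    by have := rank_one_last => /eqP; rewrite mulf_eq0 (negbTE pZ) -bZ (negbTE qb).
  by move/eqP: qb; case; apply: (nz pZ); apply: (cc_last C).
have tn : (t < n)%N.
  rewrite ltnNge; apply/negP => nt; move: pa; elim/split_ord: a => [l|]; rewrite ?pZ ?eqxx//.
  by rewrite pl ?eqxx// (leq_trans (ltn_ord l)).
pose k := Ordinal tn; have kt : k = t :> nat by [].
exists k => //.
have kE j : j = t :> nat -> j = k by move=> jt; apply: val_inj.
have qk : q 0 (L k) = 0.
  apply/eqP; apply: contraT => qk.
  have pk c : c != L k -> p c 0 = 0 by move=> ck; apply: (nzq qk); apply: (cc_vert C) => //; apply/eqP.
  have ak : a = L k by apply: contraTeq pa => /pk ->; rewrite eqxx.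
  have := cc_diag C (eqxx t : k == t :> nat); rewrite !YE rank_one_last => /eqP.
  by rewrite mulf_eq0 -{1}ak (negbTE pa) (negbTE qk).
(* Equality of the norms of row t and of the last column: a nonzero p_j, j > t, would make the row
   vanish but not the column, and with these p_j gone the row vanishes too. *)
have N := cc_norm C (eqxx t : k == t :> nat).
have pj j : (t < j)%N -> p (L j) 0 = 0.
  move=> tj; apply/eqP; apply: contraT => pj.
  have qa c : c != Z -> q 0 c = 0.
    elim/split_ord: c => [c|/eqP//] _; have [ct|] := ltnP c t; first exact: ql.
    rewrite leq_eqVlt => /orP[/eqP/esym/kE ->//|tc].
    by apply/eqP; move/eqP: (midZ tc tj); rewrite mulf_eq0 (negbTE pj).
  have bZ : b = Z by apply: contraTeq qb => /qa ->; rewrite eqxx.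
  move: N; rewrite big1 => [/esym/eqP|c _]; last first.
    by rewrite YE qa ?mulr0 ?expr0n//= -val_eqE /= ltn_eqF// addn0.
  rewrite psumr_eq0 => [/allP/(_ j)|i _]; last exact: sqr_ge0.
  rewrite mem_index_enum tj YE /= sqrf_eq0 -bZ mulf_eq0 (negbTE pj) (negbTE qb).
  by move/(_ isT).
have pk c : c != L k -> p c 0 = 0.
  elim/split_ord: c => [c|_]; last exact: pZ.
  move=> ck; have [ct|] := ltnP c t; first exact: pl.
  by rewrite leq_eqVlt => /orP[/eqP/esym/kE e|/pj//]; rewrite e eqxx in ck.
split=> // c; elim/split_ord: c => [c _|/eqP//].
have [ct|] := ltnP c t; first exact: ql.
rewrite leq_eqVlt => /orP[/eqP/esym/kE ->//|tc].
have ak : a = L k by apply: contraTeq pa => /pk ->; rewrite eqxx.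
move: N; rewrite [RHS]big1 => [/eqP|j tj]; last by rewrite YE pj// mul0r expr0n.
rewrite psumr_eq0 => [/allP/(_ c)|i _]; last exact: sqr_ge0.
rewrite mem_index_enum tc YE /= sqrf_eq0 -ak mulf_eq0 (negbTE pa) => /(_ isT)/=.
by move/eqP.
Qed.

End RankOne.

(** * Matrices that conjugate translations into another group *)

Section Conjugation.
Variables (R : realType) (n : nat) (psi psi' : 'rV[R]_n).
Hypothesis Apsi : weyl psi.
Hypothesis Apsi' : weyl psi'.
Hypothesis n2 : (1 < n)%N.
Implicit Types (a b c : 'I_(n + 1)) (l i j : 'I_n).
Variables (G : 'M[R]_(n + 1)) (Delta : set 'cV[R]_n.-1).
Hypothesis uG : G \in unitmx.
Hypothesis cD : coarse_set Delta.
Hypothesis HG : forall y, Delta y -> cone psi' (G *m Tm psi y *m invmx G).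
Local Notation t := (ctype psi).
Local Notation t' := (ctype psi').
Local Notation L := (lshift 1).
Local Notation Z := (rshift n (0 : 'I_1)).
Let n0 : (0 < n)%N := ltnW n2.

Lemma cone_scale (c : R) (X : 'M[R]_(n + 1)) : c != 0 -> cone psi' X -> cone psi' (c *: X).
Proof.
move=> c0 [ka [N [v [rho [al [ka0 [A ->]]]]]]]; exists (c * ka), N, v, rho, al.
by rewrite mulf_neq0// scalerA.
Qed.

Lemma conj_limit E lam (r : nat -> R) : (forall k : nat, Delta (lam k)) -> (forall k, 0 < r k) ->
  (forall a b, (fun k => Tm psi (lam k) a b / r k) @ \oo --> (E : 'M[R]_(n + 1)) a b) ->
  let X k := (r k)^-1 *: (G *m Tm psi (lam k) *m invmx G) in
  [/\ forall k, cone_closed psi' (X k), forall a b, (fun k => X k a b) @ \oo --> (G *m E *m invmx G) a b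
    & cone_closed psi' (G *m E *m invmx G)].
Proof.
move=> Dl r0 cE X.
have C k : cone_closed psi' (X k).
  by apply: cone_is_closed => //; apply: cone_scale; rewrite ?invr_eq0 ?gt_eqF//; exact: HG.
have cX a b : (fun k => X k a b) @ \oo --> (G *m E *m invmx G) a b.
  have XE k : X k a b = \sum_j (\sum_i G a i * (Tm psi (lam k) i j / r k)) * invmx G j b.
    rewrite mxZE mxE mulr_sumr; apply: eq_bigr => j _; rewrite mulrA; congr (_ * _).
    by rewrite mxE mulr_sumr; apply: eq_bigr => i _; ring.
  rewrite (funext XE) mxE; apply: seq_sum => j _; apply: cvgM; last exact: cvg_cst.
  by rewrite mxE; apply: seq_sum => i _; apply: cvgM; [exact: cvg_cst | exact: cE].
by split=> //; exact: (cone_closed_lim C).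
Qed.

Let mxdelta (a b : 'I_(n + 1)) : G *m delta_mx a b *m invmx G = col a G *m row b (invmx G).
Proof.
have -> : delta_mx a b = delta_mx a 0 *m (delta_mx 0 b : 'rV[R]_(n + 1)) by rewrite mul_delta_mx.
by rewrite colE rowE !mulmxA.
Qed.

Let rc a b : row a (invmx G) *m col b G = (a == b)%:R%:M.
Proof.
rewrite rowE colE mulmxA -(mulmxA _ (invmx G)) mulVmx// mulmx1.
by rewrite mul_delta_mx_cond; apply/matrixP => i j; rewrite !ord1 !mxE eqxx; case: eqP; rewrite ?mxE ?eqxx.
Qed.

Let rc_neq0 a : col a G != 0 /\ row a (invmx G) != 0.
Proof.
have := rc a a; rewrite eqxx => h; split; apply: contraTneq isT => e; move: h; rewrite e ?mulmx0 ?mul0mx.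
  by move/matrixP/(_ 0 0); rewrite !mxE eqxx => /eqP; rewrite eq_sym oner_eq0.
by move/matrixP/(_ 0 0); rewrite !mxE eqxx => /eqP; rewrite eq_sym oner_eq0.
Qed.

(* If row a of [G^-1] is supported at b then row b of [G] is supported at a. *)
Let row_inv a b : (forall c, c != b -> invmx G a c = 0) ->
  invmx G a b * G b a = 1 /\ (forall c, c != a -> G b c = 0).
Proof.
move=> H; have E c : invmx G a b * G b c = (a == c)%:R.
  have := congr1 (fun M : 'M_(n + 1) => M a c) (mulVmx uG).
  rewrite !mxE (bigD1 b)//= big1 ?addr0// => i ib; by rewrite H// mul0r.
split; first by rewrite E eqxx.
move=> c ca; have := E c; rewrite eq_sym (negbTE ca) => /eqP; rewrite mulf_eq0 => /orP[/eqP e|/eqP//].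
by have := E a; rewrite e mul0r eqxx => /eqP; rewrite eq_sym oner_eq0.
Qed.

Let col_nz a b : (forall c, c != b -> col a G c 0 = 0) -> G b a != 0.
Proof.
move=> H; apply/eqP => e; have [/eqP + _] := rc_neq0 a; apply; apply/colP => c; rewrite [RHS]mxE.
by have [->|/H//] := eqVneq c b; rewrite mxE.
Qed.

Let row_nz a b : (forall c, c != b -> row a (invmx G) 0 c = 0) -> invmx G a b != 0.
Proof.
move=> H; apply/eqP => e; have [_ /eqP +] := rc_neq0 a; apply; apply/rowP => c; rewrite [RHS]mxE.
by have [->|/H//] := eqVneq c b; rewrite mxE.
Qed.

(** G E_ii G^-1 is a rescaled limit of the conjugated translations and idempotent of rank one, hence
    some E_ll with l < t'. Its two factors are the column i of G and the row i of G^-1. *)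
Lemma conj_low i : (i < t)%N -> exists2 l : 'I_n, (l < t')%N &
  [/\ G (L l) (L i) != 0, forall a, a != L l -> G a (L i) = 0 & forall a, a != L i -> G (L l) a = 0].
Proof.
move=> it; have [lam [r [Dl r0 cE]]] := Tm_limit_diag Apsi n2 cD it.
have [_ _] := conj_limit Dl r0 cE; rewrite mxdelta => C.
have [|l lt [pl ql]] := rank_one_idem C; first by rewrite rc eqxx.
exists l => //.
have [|h1 h2] := @row_inv (L i) (L l); first by move=> c cl; have := ql c cl; rewrite mxE.
by split=> //; [exact: col_nz|move=> a al; have := pl a al; rewrite mxE].
Qed.

Let Tm_vert y (k : 'I_n) : k = t :> nat -> forall a, Tm psi y a (L k) = (a == L k)%:R.
Proof.
move=> kt a; have [E1 E2 _ E4 _] := TmE psi y.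
elim/split_ord: a => [a|]; last by rewrite E4 (_ : (Z == L k) = false)// -val_eqE /= gtn_eqF// addn0.
rewrite (inj_eq (@lshift_inj _ _)); have [at_|ta] := ltnP a t.
  by rewrite E1// (_ : (a == k) = false) ?mul0r// -val_eqE /= kt ltn_eqF.
by rewrite E2// kt ltnn mulr0 mul0r addr0.
Qed.

(** The nilpotent limit, whose factors are the column t of G and the last row of G^-1, leaves each
    of them a single nonzero entry; inverting gives the last row of G. *)
Lemma conj_vert (k : 'I_n) : k = t :> nat -> exists2 l : 'I_n, l = t' :> nat &
  [/\ G (L l) (L k) != 0, forall a, a != L l -> G a (L k) = 0, G Z Z != 0 & forall a, a != Z -> G Z a = 0].
Proof.
move=> kt; have [lam [r [Dl r0 cE]]] := Tm_limit_vert Apsi n2 cD kt.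
have [CX cX] := conj_limit Dl r0 cE; rewrite mxdelta => C.
have [l lt [pl ql]] : exists2 l : 'I_n, l = t' :> nat &
   (forall a, a != L l -> col (L k) G a 0 = 0) /\ (forall a, a != Z -> row Z (invmx G) 0 a = 0).
  apply: (rank_one_nil C) => [||l i lt it pl qi]; [exact: (rc_neq0 _).1|exact: (rc_neq0 _).2|].
  have li : l != i.
    apply/negP => /eqP li; have := rc Z (L k); rewrite (_ : (Z == L k) = false); last first.
      by rewrite -val_eqE /= gtn_eqF// addn0.
    move/matrixP/(_ 0 0); rewrite !mxE (bigD1 (L l))//= big1 ?addr0 => [|a al]; last by rewrite pl// mulr0.
    rewrite mul0rn => /eqP; rewrite mulf_eq0 => /orP[] /eqP e.
      have [_ /eqP] := rc_neq0 Z; apply; apply/rowP => a; rewrite [RHS]mxE.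
      by have [->|/qi//] := eqVneq a (L i); rewrite -li.
    have [/eqP p0 _] := rc_neq0 (L k); apply: p0; apply/colP => a; rewrite [RHS]mxE.
    by have [->|/pl//] := eqVneq a (L l).
  have pln := col_nz pl.
  have qin := row_nz qi.
  (* A limit supported at the entry (l, i) is excluded before passing to the limit. Every
     translation fixes the vertical vector, so the unscaled conjugates have entry 1 at (l, l), and
     monomiality of the row makes their entry (l, i) vanish. *)
  have Xl (j : nat) : (G *m Tm psi (lam j) *m invmx G) (L l) (L l) = 1.
    have E : (G *m Tm psi (lam j) *m invmx G) *m col (L k) G = col (L k) G.
      rewrite !colE -!mulmxA; congr (_ *m _); rewrite (mulmxA (invmx G)) mulVmx// mul1mx -colE.
      by apply/colP => a; rewrite [LHS]mxE Tm_vert// mxE andbT.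
    have := congr1 (fun M : 'cV_(n + 1) => M (L l) 0) E; rewrite mxE (bigD1 (L l))//= big1 => [|a al].
      by rewrite addr0 [col _ _ _ _]mxE => /(canRL (mulfK pln)); rewrite divff.
    by rewrite pl// mulr0.
  have X0 (j : nat) : ((r j)^-1 *: (G *m Tm psi (lam j) *m invmx G)) (L l) (L i) = 0.
    have := cc_monr (CX j) lt li; rewrite mxZE Xl mulr1 => /eqP; rewrite mulf_eq0 invr_eq0 (gt_eqF (r0 j)).
    by move/eqP.
  have c0 : (fun _ : nat => 0 : R) @ \oo --> (0 : R) by exact: cvg_cst.
  have := seq_lim_eq (cX (L l) (L i)) c0 X0.
  rewrite mxdelta mxE big_ord1 !mxE => /eqP.
  by rewrite mulf_eq0 (negbTE pln) (negbTE qin).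
have [|h1 h2] := @row_inv Z Z; first by move=> c cl; have := ql c cl; rewrite mxE.
exists l => //; split=> //; first exact: col_nz.
  by move=> a al; have := pl a al; rewrite mxE.
by apply: contraTneq isT => e; move: h1; rewrite e mulr0 => /eqP; rewrite eq_sym oner_eq0.
Qed.

Let row_ind (w : 'rV[R]_(n + 1)) : w *m G = 0 -> w = 0.
Proof. by move=> wG; rewrite -[w]mulmx1 -(mulmxV uG) mulmxA wG mul0mx. Qed.

(** A linear form that vanishes on the set is bounded along every ray that the set follows, hence
    zero there. *)
Lemma coarse_vanish (f d : 'cV[R]_n) : (forall y, Delta y -> dotv f (Um psi *m y) = 0) ->
  dotv (wv psi) d = 0 -> dotv f d = 0.
Proof.
move=> fD wd; have [D [lam [Dl Hl]]] := coarse_direction Apsi n2 (fun k => k%:R) cD wd.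
have B k : k%:R * `|dotv f d| <= en f * D.
  rewrite -[k%:R]ger0_norm// -normrM -dotvZr -[_ *: d](subKr (Um psi *m lam k)) dotvDr dotvNr fD// add0r normrN.
  have CS u : dotv f u <= en f * en u by exact: dotv_CS.
  have h u : en u <= D -> `|dotv f u| <= en f * D.
    move=> uD; have fu : en f * en u <= en f * D by rewrite ler_wpM2l ?en_ge0.
    rewrite ler_norml; apply/andP; split; last exact: le_trans (CS u) fu.
    by rewrite lerNl -dotvNr; apply: le_trans (CS _) _; rewrite enN.
  exact: h.
by apply/eqP; rewrite -normr_le0; apply: (natmul_bounded_le0 B).
Qed.

Let Zl (l : 'I_n) : (Z == L l) = false.
Proof. by rewrite -val_eqE /= gtn_eqF// addn0. Qed.

Let card_low (k : nat) : (k <= n)%N -> #|[pred i : 'I_n | (i < k)%N]| = k.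
Proof. by move=> kn; rewrite -sum1_card (big_ord_narrow kn) sum1_card card_ord. Qed.

(** As the last row of G is supported at Z, comparison of the entries (Z, Z) shows that the scalar
    left free by [cone] is 1. *)
Lemma conj_rel : G Z Z != 0 -> (forall a, a != Z -> G Z a = 0) ->
  forall y, Delta y -> exists N v rho al, aff_form psi' N v rho al 1 /\
    G *m Tm psi y = aff_mx N v *m G.
Proof.
move=> c0 rZ y Dy; have [ka [N [v [rho [al [ka0 [A e]]]]]]] := HG Dy.
exists N, v, rho, al; split=> //.
have e' : G *m Tm psi y = ka *: (aff_mx N v *m G) by rewrite scalemxAl -e mulmxKV.
have [_ [_ EZL EZZ]] := aff_mxE N v; have [_ _ _ T4 T5] := TmE psi y.
have := congr1 (fun M : 'M_(n + 1) => M Z Z) e'.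
rewrite mxZE !mxE (bigD1 Z)//= big1 ?addr0 => [|a aZ]; last by rewrite rZ// mul0r.
rewrite T5 mulr1 (bigD1 Z)//= big1 ?addr0 => [|a]; last first.
  by elim/split_ord: a => [a _|/eqP//]; rewrite EZL mul0r.
rewrite EZZ mul1r -{1}[G Z Z]mul1r => /(mulIf c0) k1.
by rewrite e' -k1 scale1r.
Qed.

(** The limits E_ii give an injection of the indices below t into those below t', so t <= t'. The
    work is to exclude t < t' < = n, where some row l < t' is missed by the injection. *)
Lemma conj_type : [/\ t' = t, G Z Z != 0, forall a, a != Z -> G Z a = 0 &
  exists pi : 'I_n -> 'I_n, [/\ injective pi, forall i, (pi i < t)%N = (i < t)%N, forall i, (t <= i)%N -> pi i = i &
    forall i, (i < t)%N -> [/\ G (L (pi i)) (L i) != 0, forall a, a != L (pi i) -> G a (L i) = 0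
      & forall a, a != L i -> G (L (pi i)) a = 0]]].
Proof.
have /choice[pi Hpi] : forall i, exists l : 'I_n, if (i < t)%N then (l < t')%N /\
    [/\ G (L l) (L i) != 0, forall a, a != L l -> G a (L i) = 0 & forall a, a != L i -> G (L l) a = 0] else l = i.
  move=> i; case: (boolP (i < t)%N) => [it|_]; last by exists i.
  by have [l lt H] := conj_low it; exists l.
have piL i : (i < t)%N -> (pi i < t')%N /\
    [/\ G (L (pi i)) (L i) != 0, forall a, a != L (pi i) -> G a (L i) = 0 & forall a, a != L i -> G (L (pi i)) a = 0].
  by move=> it; have := Hpi i; rewrite it.
have piH i : (t <= i)%N -> pi i = i by move=> ti; have := Hpi i; rewrite ltnNge ti.
have pinj : {in [pred i : 'I_n | (i < t)%N] &, injective pi}.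
  move=> i j; rewrite !inE => it jt ij; have [_ [h1 h2 h3]] := piL i it; have [_ [h1' _ _]] := piL j jt.
  apply/eqP; apply: contraT => ne; move/eqP: h1'; rewrite -ij h3//.
  by rewrite (inj_eq (@lshift_inj _ _)) eq_sym.
have tt' : (t <= t')%N.
  rewrite -(card_low (ctype_le psi)) -(card_low (ctype_le psi')) -(card_in_imset pinj).
  by apply/subset_leq_card/fintype.subsetP => l /imsetP[i]; rewrite !inE => it ->; case: (piL i it).
have rows0 (l : 'I_(n + 1)) : exists a, G l a != 0.
  apply: contrapT => H; have : delta_mx 0 l *m G = 0 :> 'rV_(n + 1).
    by rewrite -rowE; apply/rowP => a; rewrite !mxE; apply/eqP; apply: contraT => ga; exfalso; apply: H; exists a.
  move/row_ind/matrixP/(_ 0 l); rewrite !mxE !eqxx => /eqP; by rewrite oner_eq0.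
have [te c0 rZ] : [/\ t' = t, G Z Z != 0 & forall a, a != Z -> G Z a = 0].
  have [tn|nt] := ltnP t n; last first.
    have te : t' = t by apply/eqP; rewrite eqn_leq tt' andbT (leq_trans (ctype_le psi')).
    have rZ a : a != Z -> G Z a = 0.
      elim/split_ord: a => [a _|/eqP//]; have [_ [_ -> //]] := piL a (leq_trans (ltn_ord a) nt).
      by rewrite Zl.
    split=> //; have [a] := rows0 Z; elim/split_ord: a => [a|//]; rewrite rZ ?eqxx//.
    by rewrite eq_sym Zl.
  pose k := Ordinal tn; have kt : k = t :> nat by [].
  have [k' kt' [h1 h2 c0 rZ]] := conj_vert kt; split=> //.
  have {tt'} : (t <= t')%N by []; rewrite leq_eqVlt => /orP[/eqP//|lt]; exfalso.
  have [l lt' lpi] : exists2 l : 'I_n, (l < t')%N & forall i, (i < t)%N -> pi i != l.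
    apply: contrapT => H; have : (t' <= t)%N; last by rewrite leqNgt lt.
    rewrite -(card_low (ctype_le psi)) -(card_low (ctype_le psi')) -(card_in_imset pinj).
    apply/subset_leq_card/fintype.subsetP => l; rewrite inE => lt'; apply: contrapT => nl; apply: H; exists l => // i it.
    by apply/eqP => e; apply: nl; apply/imsetP; exists i; rewrite ?inE.
  have Gl j : (j <= t)%N -> G (L l) (L j) = 0.
    rewrite leq_eqVlt => /orP[/eqP jt|jt].
      rewrite (_ : j = k) ?h2 ?(inj_eq (@lshift_inj _ _))//; last exact: val_inj.
      by rewrite -val_eqE /= kt' ltn_eqF.
    by have [_ [_ -> //]] := piL j jt; rewrite (inj_eq (@lshift_inj _ _)) eq_sym lpi.
  have rZL (a : 'I_n) : G Z (L a) = 0 by rewrite rZ// eq_sym Zl.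
  (* Row l cannot vanish outside the last column, since it would then be proportional to the last
     row. *)
  have nZ : ~ forall j, G (L l) (L j) = 0.
    move=> GL; have : (delta_mx 0 (L l) - (G (L l) Z / G Z Z) *: delta_mx 0 Z) *m G = 0 :> 'rV_(n + 1).
      rewrite mulmxBl -scalemxAl -!rowE; apply/rowP; elim/split_ord => [a|].
        by rewrite mxDE mxNE mxZE [row _ _ _ _]mxE [row Z _ _ _]mxE GL rZL mulr0 subrr mx0E.
      by rewrite mxDE mxNE mxZE [row _ _ _ _]mxE [row Z _ _ _]mxE divfK// subrr mx0E.
    move/row_ind/matrixP/(_ 0 (L l)); rewrite !mxE !eqxx /= eq_sym Zl mulr0 subr0 => /eqP.
    by rewrite oner_eq0.
  apply: nZ => j; have [jt|tj] := leqP j t; first exact: Gl.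
  (* Row l of G vanishes on the indices up to t, so a translation T changes it only in the last
     column. In G T = T' G it must therefore be al_l times row rho l up to a multiple of the last
     row; independence of the rows gives rho l = l and al_l = 1, and the last column says that f is
     orthogonal to the vector of T. *)
  pose f : 'cV[R]_n := \col_i G (L l) (L i).
  have : dotv f (delta_mx j 0) = 0.
    apply: coarse_vanish; last first.
      rewrite dotvE big1// => i _; rewrite !mxE tn; have [->|_] := eqVneq i j; last by rewrite mulr0.
      by rewrite gtn_eqF// mul0r.
    move=> y Dy; have [N [v [rho [al [A e]]]]] := conj_rel c0 rZ Dy.
    have [ELL [ELZ EZL EZZ]] := aff_mxE N v; have [T1 T2 T3 T4 T5] := TmE psi y.
    have e1 b : (G *m Tm psi y) (L l) b = al l * G (L (rho l)) b.
      rewrite e mxE (bigD1 (L (rho l)))//= ELL (form_N A)// eqxx mulr1 big1 ?addr0// => a.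
      elim/split_ord: a => [a|_]; last by rewrite ELZ (form_v A)// mul0r.
      by rewrite (inj_eq (@lshift_inj _ _)) ELL (form_N A)// => /negbTE ->; rewrite mulr0 mul0r.
    have e2 i : (G *m Tm psi y) (L l) (L i) = G (L l) (L i).
      rewrite mxE (bigD1 (L i))//= big1 => [|a]; last first.
        elim/split_ord: a => [a|_]; last by rewrite T4 mulr0.
        rewrite (inj_eq (@lshift_inj _ _)) => ai; have [at_|ta] := leqP a t; first by rewrite Gl ?mul0r.
        by rewrite T2 ?(ltnW ta)// (negbTE ai) (gtn_eqF ta) !mul0r addr0 mulr0.
      rewrite addr0; have [it|ti] := leqP i t; first by rewrite Gl ?mul0r.
      by rewrite T2 ?(ltnW ti)// eqxx (gtn_eqF ti) !mul0r addr0 mulr1.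
    pose s := G (L l) Z - al l * G (L (rho l)) Z.
    have : (delta_mx 0 (L l) - al l *: delta_mx 0 (L (rho l)) - (s / G Z Z) *: delta_mx 0 Z) *m G = 0 :> 'rV_(n + 1).
      rewrite !mulmxBl -!scalemxAl -!rowE; apply/rowP; elim/split_ord => [a|].
        by rewrite !mxDE !mxNE !mxZE [row _ _ _ _]mxE [row (L (rho l)) _ _ _]mxE [row Z _ _ _]mxE -e1 e2 rZL mulr0 !subrr mx0E.
      by rewrite !mxDE !mxNE !mxZE [row _ _ _ _]mxE [row (L (rho l)) _ _ _]mxE [row Z _ _ _]mxE divfK// /s subrr mx0E.
    move/row_ind/matrixP/(_ 0 (L l)); rewrite !mxE !eqxx /= [L l == Z]eq_sym Zl mulr0 subr0.
    rewrite (inj_eq (@lshift_inj _ _)); have [rl|_] := eqVneq l (rho l); last first.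
      by rewrite mulr0 subr0 => /eqP; rewrite oner_eq0.
    rewrite mulr1 => /subr0_eq a1.
    have := e1 Z; rewrite -rl -a1 mul1r mxE big_split_ord /= big_ord1 T5 mulr1 => /(canRL (addrK _)).
    rewrite subrr => e3; rewrite dotvE -[RHS]e3; apply: eq_bigr => i _; rewrite [f _ _]mxE T3.
    have [it|ti] := leqP i t; first by rewrite Gl ?mul0r.
    by rewrite ltnNge (ltnW ti) /= gtn_eqF.
  by rewrite dotvE (bigD1 j)//= big1 ?addr0 => [|i /negbTE ij]; rewrite !mxE ?eqxx ?mulr1// ij mulr0.
split=> //.
have pilt i : (pi i < t)%N = (i < t)%N.
  have [it|ti] := ltnP i t; first by have [+ _] := piL i it; rewrite te.
  by rewrite piH// ltnNge ti.
exists pi; split=> // [i j ij|i it]; last by case: (piL i it).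
have [it|ti] := ltnP i t; last first.
  have tj : (t <= j)%N by rewrite leqNgt -pilt -ij pilt -leqNgt.
  by rewrite -(piH i ti) -(piH j tj).
by apply: pinj; rewrite ?inE// -pilt -ij pilt.
Qed.


(** Beyond affinity, the conjugator turns h into a multiple of h plus a constant. The absolute
    values are there because p_i may be negative, so that the image of the domain can lie in another
    orthant. *)
Lemma conj_similarity : exists (c : R) (N : 'M[R]_n) (v : 'cV[R]_n) (pi : 'I_n -> 'I_n) (p : 'I_n -> R) (beta kappa : R),
  [/\ c != 0, G = c *: aff_mx N v, t' = t, injective pi & forall i, (pi i < t)%N = (i < t)%N] /\
  [/\ 0 < beta, forall i, (i < t)%N -> cw psi' (pi i) = beta * cw psi i,
     forall i, (i < t)%N -> p i != 0 /\ forall x, (N *m x + v) (pi i) 0 = p i * x i 0 &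
     forall x y : 'cV[R]_n, dom_h psi x ->
       (forall l, y l 0 = if (l < t)%N then `|(N *m x + v) l 0| else (N *m x + v) l 0) ->
       horo_fun psi' y = beta * horo_fun psi x + kappa].
Proof.
have [te c0 rZ [pi [pinj pilt piH piG]]] := conj_type.
pose c := G Z Z; pose N : 'M[R]_n := \matrix_(i, j) (G (L i) (L j) / c).
pose v : 'cV[R]_n := \col_i (G (L i) Z / c).
have GE : G = c *: aff_mx N v.
  have [ELL [ELZ EZL EZZ]] := aff_mxE N v; apply/matrixP => a b; rewrite mxZE.
  elim/split_ord: a => [a|]; elim/split_ord: b => [b|].
  - by rewrite ELL mxE mulrC divfK.
  - by rewrite ELZ mxE mulrC divfK.
  - by rewrite EZL mulr0 rZ// eq_sym Zl.
  - by rewrite EZZ mulr1.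
have NE i j : N i j = G (L i) (L j) / c by rewrite mxE.
have vE i : v i 0 = G (L i) Z / c by rewrite mxE.
pose F x := N *m x + v.
have uN : aff_mx N v \in unitmx.
  have -> : aff_mx N v = c^-1 *: G by rewrite GE scalerA mulVf// scale1r.
  by rewrite unitmxZ// unitfE invr_eq0.
have Fsurj y : exists x, F x = y.
  rewrite aff_mx_unit in uN; exists (invmx N *m (y - v)).
  by rewrite /F mulmxA mulmxV// mul1mx subrK.
pose p i := N (pi i) i.
have pF i : (i < t)%N -> p i != 0 /\ forall x, (N *m x + v) (pi i) 0 = p i * x i 0.
  move=> it; have [h1 h2 h3] := piG i it; split; first by rewrite /p NE mulf_neq0// invr_eq0.
  move=> x; rewrite mxDE vE h3 ?mul0r ?addr0 ?Zl// mxE (bigD1 i)//= big1 ?addr0// => j ji.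
  by rewrite NE h3 ?mul0r// (inj_eq (@lshift_inj _ _)).
have rel y : Delta y -> exists N' v' rho al, aff_form psi' N' v' rho al 1 /\
    forall x, F (tr_map psi (Um psi *m y) x) = N' *m F x + v'.
  move=> Dy; have [N' [v' [rho [al [A e]]]]] := conj_rel c0 rZ Dy.
  exists N', v', rho, al; split=> // x.
  have : aff_mx N v *m Tm psi y = aff_mx N' v' *m aff_mx N v.
    by apply: (scalerI c0); rewrite -/c scalemxAl scalemxAr -GE e.
  move/(congr1 (mulmx^~ (hc x))); rewrite -!mulmxA !aff_mx_hc => /eq_col_mx[]//.
(* The multiplier of a translation in the coordinate i is read off after conjugation in the
   coordinate pi i; testing on a basis vector shows that [rho] fixes pi i. *)
have low y N' v' rho al : Delta y -> aff_form psi' N' v' rho al 1 ->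
    (forall x, F (tr_map psi (Um psi *m y) x) = N' *m F x + v') ->
    forall i, (i < t)%N -> ln (al (pi i)) = (Um psi *m y) i 0 / sw psi i.
  move=> Dy A H i it; have pt : (pi i < t')%N by rewrite te pilt.
  have E (w : 'cV[R]_n) : al (pi i) * w (rho (pi i)) 0 = expR ((Um psi *m y) i 0 / sw psi i) * w (pi i) 0.
    have [x xw] := Fsurj w; rewrite -xw -(af_row A _ pt) -H.
    by have [p0 pE] := pF i it; rewrite /F !pE tr_mapE it; ring.
  have := E (delta_mx (pi i) 0); rewrite !mxE !eqxx andbT mulr1.
  have [_|_] := eqVneq (rho (pi i)) (pi i); first by rewrite mulr1 => ->; rewrite expRK.
  by rewrite mulr0 => /eqP; rewrite eq_sym gt_eqF// expR_gt0.
have reix (f : 'I_n -> R) : \sum_(i < n | (i < t)%N) f i = \sum_(i < n | (i < t)%N) f (pi i).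
  by rewrite (reindex_inj pinj); apply: eq_bigl => i; rewrite pilt.
have logs x (y : 'cV[R]_n) : dom_h psi x -> (forall l, y l 0 = if (l < t)%N then `|(N *m x + v) l 0| else (N *m x + v) l 0) ->
    forall i, (i < t)%N -> ln (y (pi i) 0) = ln `|p i| + ln (x i 0).
  move=> dx yE i it; have [p0 pE] := pF i it; rewrite yE pilt it pE normrM (gtr0_norm (dx i it)) lnM//.
    by rewrite posrE normr_gt0.
  by rewrite posrE dx.
have [tn|nt] := ltnP t n; last first.
  have lt (l : 'I_n) : (l < t)%N by exact: leq_trans (ltn_ord l) nt.
  (* For t = n the conjugated translations satisfy sum cw' ln al = 0. This makes f orthogonal to a
     coarse set of translations, so f is a multiple of [wv] and the weights are proportional. *)
  pose f : 'cV[R]_n := \col_i (cw psi' (pi i) / sw psi i).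
  have fz y : Delta y -> dotv f (Um psi *m y) = 0.
    move=> Dy; have [N' [v' [rho [al [A H]]]]] := rel y Dy.
    have := form_full Apsi' n2 A; rewrite te => /(_ nt) <-.
    rewrite (reindex_inj pinj) dotvE; apply: eq_bigr => i _.
    by rewrite (low y N' v' rho al)// mxE; ring.
  have fw : f = dotv (wv psi) f *: wv psi.
    pose d := f - dotv (wv psi) f *: wv psi.
    have wd : dotv (wv psi) d = 0 by rewrite /d dotvDr dotvNr dotvZr wv1// mulr1 subrr.
    apply/subr0_eq/dotv_eq0; rewrite -/d {1}/d dotvDl dotvNl dotvZl wd mulr0 subr0.
    exact: coarse_vanish.
  pose beta := dotv (wv psi) f.
  have cwE i : cw psi' (pi i) = beta * cw psi i.
    have := congr1 (fun u : 'cV_n => u i 0) fw; rewrite -/beta mxZE !mxE ltnNge nt /=.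
    by move/(canRL (divfK (lt0r_neq0 (sw_gt0 Apsi (lt i))))); rewrite -(sw_sqr Apsi (lt i)) expr2 mulrA.
  have b0 : 0 < beta.
    have := cwE (Ordinal n0); have := cw_gt0 Apsi (lt (Ordinal n0)).
    have : 0 < cw psi' (pi (Ordinal n0)) by rewrite cw_gt0// te pilt.
    by move=> h1 h2 h3; rewrite h3 pmulr_lgt0 in h1.
  exists c, N, v, pi, p, beta, (- \sum_i cw psi' (pi i) * ln `|p i|); split; first by [].
  split=> // x y dx yE; rewrite !horo_xE// te.
  have vz (w : 'cV[R]_n) : \sum_(i < n | (i == t :> nat)%N) w i 0 = 0.
    by rewrite big_pred0// => i; apply/negbTE; rewrite neq_ltn lt.
  have sz (w : 'cV[R]_n) : \sum_(i < n | (t < i)%N) w i 0 ^+ 2 = 0.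
    by rewrite big_pred0// => i; apply/negbTE; rewrite -leqNgt ltnW.
  rewrite !vz !sz.
  rewrite reix !mulr0 !addr0 !oppr0 !add0r.
  rewrite (eq_bigr (fun i => cw psi' (pi i) * ln `|p i| + beta * (cw psi i * ln (x i 0)))) => [|i it].
    rewrite big_split /= -mulr_sumr opprD mulrN addrC; congr (_ - _).
    by apply: eq_bigl => i; rewrite lt.
  by rewrite (logs x)// mulrDr cwE mulrA.
pose k := Ordinal tn; have kt : k = t :> nat by [].
have ktb : k == t' :> nat by rewrite te.
have [k' kt' [h1 h2 _ _]] := conj_vert kt.
have kk : k' = k by apply: val_inj; rewrite /= kt' te.
rewrite kk in h1 h2.
pose c1 := N k k; have c10 : c1 != 0 by rewrite /c1 NE mulf_neq0// invr_eq0.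
pose bf (x : 'cV[R]_n) j := \sum_(a < n | (t < a)%N) N j a * x a 0.
have rowE (j : 'I_n) x : (t <= j)%N -> F x j 0 = (if j == k then c1 * x k 0 else 0) + bf x j + v j 0.
  move=> tj; rewrite mxDE; congr (_ + _); rewrite mxE (bigID (fun a : 'I_n => (t < a)%N)) /= addrC; congr (_ + _).
  rewrite (bigD1 k)/= ?ltnn// big1 ?addr0 => [|a /andP[]].
    case: eqVneq => [->//|jk]; by rewrite NE h2 ?mul0r// (inj_eq (@lshift_inj _ _)).
  rewrite -leqNgt leq_eqVlt => /orP[/eqP at_|at_ _]; first by case/eqP; apply: val_inj.
  have [_ ga _] := piG a at_; rewrite NE ga ?mul0r// (inj_eq (@lshift_inj _ _)).
  by apply: contraTneq tj => ->; rewrite -ltnNge pilt.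
have F0 (j : 'I_n) : F 0 j 0 = v j 0 by rewrite /F mulmx0 add0r.
have bfD x z j : bf (x + z) j = bf x j + bf z j.
  by rewrite /bf -big_split; apply: eq_bigr => a _; rewrite mxDE mulrDr.
have jk (j : 'I_n) : (t < j)%N -> (j == k) = false by move=> tj; rewrite -val_eqE /= gtn_eqF.
(* Comparison of the quadratic and the vertical coordinates in F T = T' F. Since F is onto, the
   entries of T' can be read off by testing on basis vectors. *)
have mid y N' v' rho al (z := Um psi *m y) : Delta y -> aff_form psi' N' v' rho al 1 ->
    (forall x, F (tr_map psi z x) = N' *m F x + v') ->
    (forall j, (t < j)%N -> v' j 0 = bf z j) /\
    (forall x, \sum_(b < n | (t < b)%N) bf z b * F x b 0 + v' k 0 =
       c1 * (\sum_(a < n | (t < a)%N) x a 0 * z a 0) + c1 * hq psi z + bf z k).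
  move=> Dy A H.
  have tmid x (a : 'I_n) : (t < a)%N -> tr_map psi z x a 0 = x a 0 + z a 0.
    by move=> ta; rewrite tr_mapE ltnNge (ltnW ta) gtn_eqF.
  have bft x j : bf (tr_map psi z x) j = bf x j + bf z j.
    by rewrite -bfD; apply: eq_bigr => a ta; rewrite tmid// mxDE.
  have Ew (w : 'cV[R]_n) (j : 'I_n) : (t < j)%N -> (N' *m w) j 0 + v' j 0 = w j 0 + bf z j.
    move=> tj; have [x <-] := Fsurj w; have E := rowE j x (ltnW tj).
    have E' := rowE j (tr_map psi z x) (ltnW tj); rewrite H mxDE in E'.
    by rewrite E' E jk// bft; ring.
  have vE' (j : 'I_n) : (t < j)%N -> v' j 0 = bf z j.
    by move=> tj; have := Ew 0 j tj; rewrite mulmx0 mx0E !add0r.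
  split=> // x; have := H x; move/(congr1 (fun u : 'cV_n => u k 0)); rewrite [RHS]mxDE !rowE// eqxx bft.
  have -> : (N' *m F x) k 0 = F x k 0 + \sum_(b < n | (t < b)%N) bf z b * F x b 0.
    rewrite mxE (bigID (fun a : 'I_n => (t < a)%N)) /= addrC; congr (_ + _).
      rewrite (bigD1 k)/= ?ltnn// (af_vert A) ?te// eqxx !mul1r big1 ?addr0// => a /andP[].
      by rewrite -leqNgt => at_ /negbTE ak; rewrite (af_vert A) ?te// ak mulr0 mul0r.
    apply: eq_bigr => b tb; congr (_ * _).
    rewrite (form_shift Apsi' n2 A) ?te// (bigD1 b)//= big1 => [|j /andP[tj /negbTE jb]].
      rewrite addr0 vE'// -[RHS]mulr1; congr (_ * _).
      have := Ew (delta_mx b 0) b tb; rewrite vE'// => /addIr; rewrite -colE !mxE !eqxx.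
      by move=> ->.
    have := Ew (delta_mx b 0) j tj; rewrite vE'// => /addIr; rewrite -colE !mxE jb => ->.
    by rewrite mulr0.
  have -> : tr_map psi z x k 0 = x k 0 + hq psi z + \sum_(a < n | (t < a)%N) x a 0 * z a 0.
    by rewrite tr_mapE kt ltnn eqxx.
  by rewrite !rowE// eqxx => e; lra.
pose u j := v j 0.
have Fm (j : 'I_n) x : (t < j)%N -> F x j 0 = bf x j + u j by move=> tj; have := rowE j x (ltnW tj); rewrite jk// add0r.
have dvk (a : 'I_n) : a != k -> dotv (wv psi) (delta_mx a 0) = 0.
  move=> ak; rewrite dotvE big1// => i _; rewrite !mxE tn -kt val_eqE.
  by have [->|_] := eqVneq i a; rewrite ?mulr0// (negbTE ak) mul0r.
have dotd (f : 'cV[R]_n) (a : 'I_n) : dotv f (delta_mx a 0) = f a 0.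
  by rewrite dotvE (bigD1 a)//= big1 ?addr0 => [|i /negbTE ia]; rewrite !mxE ?eqxx ?mulr1// ia mulr0.
(* Subtracting the vertical relation of [mid] at 0 from that at x leaves an identity linear in the
   translation z. As it holds on a coarse set, the quadratic block B of N satisfies B^T B = c1. *)
have BB x (a : 'I_n) : (t < a)%N -> \sum_(b < n | (t < b)%N) N b a * bf x b = c1 * x a 0.
  move=> ta; pose f : 'cV[R]_n := \col_a if (t < a)%N then \sum_(b < n | (t < b)%N) N b a * bf x b - c1 * x a 0 else 0.
  have : dotv f (delta_mx a 0) = 0.
    apply: coarse_vanish; last by rewrite dvk// jk.
    move=> y Dy; have [N' [v' [rho [al [A H]]]]] := rel y Dy; have [m1 m2] := mid y N' v' rho al Dy A H.
    have := m2 x; have := m2 0; set z := Um psi *m y.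
    rewrite [X in c1 * X]big1 ?mulr0 ?add0r => [|i _]; last by rewrite mx0E mul0r.
    rewrite (eq_bigr (fun b : 'I_n => bf z b * u b)) => [e1|b tb]; last by rewrite F0.
    rewrite (eq_bigr (fun b : 'I_n => bf z b * bf x b + bf z b * u b)) => [e2|b tb]; last by rewrite Fm// mulrDr.
    rewrite big_split /= in e2.
    have e3 : \sum_(b < n | (t < b)%N) bf z b * bf x b = c1 * \sum_(a < n | (t < a)%N) x a 0 * z a 0 by lra.
    rewrite dotvE (bigID (fun a : 'I_n => (t < a)%N)) /= [X in _ + X]big1 => [|i /negbTE ti]; last by rewrite mxE ti mul0r.
    rewrite addr0 (eq_bigr (fun a : 'I_n => \sum_(b < n | (t < b)%N) (N b a * z a 0) * bf x b - c1 * (x a 0 * z a 0))) => [|i ti].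
      rewrite big_split /= sumrN -mulr_sumr -e3 exchange_big /= -sumrB big1// => b tb.
      by rewrite -mulr_suml subrr.
    by rewrite mxE ti mulrBl mulr_suml mulrA; congr (_ - _); apply: eq_bigr => b tb; ring.
  by rewrite dotd mxE ta => /subr0_eq.
have BBn x : \sum_(b < n | (t < b)%N) bf x b ^+ 2 = c1 * \sum_(a < n | (t < a)%N) x a 0 ^+ 2.
  rewrite (eq_bigr (fun b : 'I_n => \sum_(a < n | (t < a)%N) x a 0 * (N b a * bf x b))) => [|b tb].
    rewrite exchange_big /= mulr_sumr; apply: eq_bigr => a ta; rewrite -mulr_sumr BB//; ring.
  by rewrite expr2 {1}/bf mulr_suml; apply: eq_bigr => a _; ring.
(* The vertical relation at 0, after insertion of [form_vert_v] and cancellation of the squares by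
   [BBn], is a linear form in z with these coefficients. Their vanishing gives the weights and the
   quadratic entries of the vertical row of N. *)
pose f : 'cV[R]_n := \col_i if (i < t)%N then cw psi' (pi i) / sw psi i - c1 * sw psi i
   else if (t < i)%N then N k i - \sum_(j < n | (t < j)%N) N j i * u j else 0.
have f0 (i : 'I_n) : i != k -> f i 0 = 0.
  move=> ik; rewrite -dotd; apply: coarse_vanish; last exact: dvk.
  move=> y Dy; have [N' [v' [rho [al [A H]]]]] := rel y Dy; have [m1 m2] := mid y N' v' rho al Dy A H.
  have := m2 0; rewrite [X in c1 * X]big1 ?mulr0 ?add0r => [|a _]; last by rewrite mx0E mul0r.
  set z := Um psi *m y; rewrite (eq_bigr (fun b : 'I_n => bf z b * u b)) => [|b tb]; last by rewrite F0.
  have e0 : \sum_(i < n | (i < t)%N) cw psi' (pi i) * ln (al (pi i)) =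
      \sum_(i < n | (i < t)%N) cw psi' (pi i) / sw psi i * z i 0.
    by apply: eq_bigr => j jt; rewrite (low y N' v' rho al)// -/z; ring.
  have e2 : \sum_(j < n | (t < j)%N) v' j 0 ^+ 2 = \sum_(j < n | (t < j)%N) bf z j ^+ 2.
    by apply: eq_bigr => j tj; rewrite m1.
  rewrite (form_vert_v Apsi' n2 A ktb) te reix e0 e2.
  have hz : hq psi z = - \sum_(i < n | (i < t)%N) sw psi i * z i 0 + 2^-1 * \sum_(i < n | (t < i)%N) z i 0 ^+ 2.
    by rewrite /hq /ell [X in - (X + _)]big1 ?add0r// => j jt; rewrite /z Um_vertical.
  rewrite BBn hz => e1.
  rewrite dotvE (bigID (fun a : 'I_n => (a < t)%N)) /=.
  rewrite (eq_bigr (fun i => cw psi' (pi i) / sw psi i * z i 0 - c1 * (sw psi i * z i 0))) => [|j jt]; last first.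
    by rewrite mxE jt mulrBl mulrA.
  rewrite big_split /= sumrN -mulr_sumr.
  rewrite [X in _ + X](_ : _ = bf z k - \sum_(b < n | (t < b)%N) bf z b * u b); first lra.
  rewrite (bigD1 k)/= ?kt ?ltnn// [f k 0]mxE kt ltnn mul0r add0r.
  rewrite (eq_bigl (fun a : 'I_n => (t < a)%N)) => [|a]; last first.
    by rewrite -leqNgt leq_eqVlt -val_eqE /= [t == a]eq_sym; case: ltngtP.
  rewrite (eq_bigr (fun a : 'I_n => N k a * z a 0 - \sum_(j < n | (t < j)%N) N j a * z a 0 * u j)) => [|a ta].
    rewrite big_split /= sumrN exchange_big /=; congr (_ - _); apply: eq_bigr => j _.
    by rewrite -mulr_suml.
  by rewrite mxE ltnNge (ltnW ta) ta /= mulrBl mulr_suml; congr (_ - _); apply: eq_bigr => j _; ring.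
have cwE i : (i < t)%N -> cw psi' (pi i) = c1 * cw psi i.
  move=> it; have := f0 i; rewrite -val_eqE /= ltn_eqF// mxE it => /(_ isT)/subr0_eq.
  by move/(canRL (divfK (lt0r_neq0 (sw_gt0 Apsi it)))); rewrite -(sw_sqr Apsi it) expr2 mulrA.
have wE (i : 'I_n) : (t < i)%N -> N k i = \sum_(j < n | (t < j)%N) N j i * u j.
  by move=> ti; have := f0 i; rewrite jk// mxE ltnNge (ltnW ti) ti => /(_ isT)/subr0_eq.
(* The sign comes from a sum of squares if t = 0 and from the weights if t > 0. *)
have b0 : 0 < c1.
  have [t0|t0] := posnP t.
    pose i := Ordinal n2; have ti : (t < i)%N by rewrite t0.
    have := BBn (delta_mx i 0); rewrite [X in _ = c1 * X](bigD1 i)//= [X in c1 * (_ + X)]big1 => [|j /andP[_ /negbTE ji]]; last first.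
      by rewrite mxE ji expr0n.
    rewrite mxE !eqxx expr1n addr0 mulr1 => e; rewrite lt_neqAle eq_sym c10 -e.
    by apply: sumr_ge0 => j _; exact: sqr_ge0.
  have it : (Ordinal n0 < t)%N by [].
  have : 0 < cw psi' (pi (Ordinal n0)) by rewrite cw_gt0// te pilt.
  by rewrite cwE// pmulr_lgt0// cw_gt0.
exists c, N, v, pi, p, c1, (- v k 0 - \sum_(i < n | (i < t)%N) cw psi' (pi i) * ln `|p i| + 2^-1 * \sum_(j < n | (t < j)%N) u j ^+ 2).
split; first by []; split=> // x y dx yE; rewrite !horo_xE// te.
have yk : y k 0 = c1 * x k 0 + bf x k + v k 0 by rewrite yE kt ltnn -/(F x) rowE// eqxx.
have vert (w : 'cV[R]_n) : \sum_(i < n | (i == t :> nat)%N) w i 0 = w k 0.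
  by rewrite (eq_bigl (pred1 k)) ?big_pred1_eq// => i; rewrite /= -val_eqE.
rewrite !vert yk reix (eq_bigr (fun i => cw psi' (pi i) * ln `|p i| + c1 * (cw psi i * ln (x i 0)))) => [|i it]; last first.
  by rewrite (logs x)// mulrDr cwE// mulrA.
rewrite big_split /= -mulr_sumr.
have -> : \sum_(j < n | (t < j)%N) y j 0 ^+ 2 =
    \sum_(j < n | (t < j)%N) (bf x j ^+ 2 + 2 * (bf x j * u j) + u j ^+ 2).
  apply: eq_bigr => j tj; rewrite yE ltnNge (ltnW tj) /=.
  by have := Fm j x tj; rewrite /F => ->; ring.
rewrite !big_split /= BBn -mulr_sumr.
have -> : \sum_(j < n | (t < j)%N) bf x j * u j = bf x k.
  rewrite /bf (eq_bigr (fun j => \sum_(a < n | (t < a)%N) N j a * u j * x a 0)) => [|j _].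
    by rewrite exchange_big /=; apply: eq_bigr => a ta; rewrite wE// mulr_suml.
  by rewrite mulr_suml; apply: eq_bigr => a _; ring.
by field.
Qed.

End Conjugation.

Lemma card_ltn_ord (n k : nat) : (k <= n)%N -> #|[pred i : 'I_n | (i < k)%N]| = k.
Proof. by move=> kn; rewrite -sum1_card (big_ord_narrow kn) sum1_card card_ord. Qed.

(** * Recovering psi up to scale *)

Section SortedTypes.
Variables (R : realType) (n : nat).
Implicit Types (i j a b : 'I_n) (f g : 'I_n -> R) (psi : 'rV[R]_n).

(* If [f i > g i] then the rearrangement sends the i + 1 indices up to i to smaller ones. *)
Lemma nonincreasing_perm_le f g (pi : 'I_n -> 'I_n) : injective pi -> (forall i, f i = g (pi i)) ->
  (forall i j : 'I_n, (i <= j)%N -> f j <= f i) -> (forall i j : 'I_n, (i <= j)%N -> g j <= g i) ->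
  forall i, f i <= g i.
Proof.
move=> pinj fg fm gm i; rewrite leNgt; apply/negP => gf.
have H : (#|[pred j : 'I_n | (j < i.+1)%N]| <= #|[pred j : 'I_n | (j < i)%N]|)%N.
  rewrite -(card_imset _ pinj); apply/subset_leq_card/fintype.subsetP => l /imsetP[j]; rewrite !inE ltnS => ji ->.
  rewrite ltnNge; apply/negP => ip; have h := fm _ _ ji.
  by have := lt_le_trans (le_lt_trans (gm _ _ ip) gf) h; rewrite -fg ltxx.
by move: H; rewrite !card_ltn_ord ?ltnn// ltnW.
Qed.

Lemma nonincreasing_perm_eq f g (pi : 'I_n -> 'I_n) : injective pi -> (forall i, f i = g (pi i)) ->
  (forall i j : 'I_n, (i <= j)%N -> f j <= f i) -> (forall i j : 'I_n, (i <= j)%N -> g j <= g i) -> f =1 g.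
Proof.
move=> pinj fg fm gm i; apply/le_anti/andP; split; first exact: (nonincreasing_perm_le pinj).
have ginv j : g j = f (invF pinj j) by rewrite fg f_invF.
by apply: (nonincreasing_perm_le (pi := invF pinj)) => // a b /(congr1 pi); rewrite !f_invF.
Qed.

(** Both sequences are nonincreasing, so agreement up to a permutation is agreement. For t = n the
    weights are normalized, hence the quotient of the two sums in the scaling factor. *)
Lemma cw_perm_scale psi psi' (pi : 'I_n -> 'I_n) (beta : R) : weyl psi -> weyl psi' ->
  ctype psi' = ctype psi -> injective pi -> (forall i, (pi i < ctype psi)%N = (i < ctype psi)%N) ->
  0 < beta -> (forall i : 'I_n, (i < ctype psi)%N -> cw psi' (pi i) = beta * cw psi i) ->
  exists2 k : R, 0 < k & psi' = k *: psi.
Proof.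
move=> A A' te pinj pilt b0 H.
suff [k k0 E] : exists2 k : R, 0 < k & forall i : 'I_n, (i < ctype psi)%N -> psi' 0 (pi i) = k * psi 0 i.
  exists k => //; apply/rowP => j; rewrite mxZE; apply/esym.
  apply: (@nonincreasing_perm_eq (fun i => k * psi 0 i) (fun i => psi' 0 i) pi pinj) => [i|a b ab|a b ab].
  - have [it|ti] := ltnP i (ctype psi); first by rewrite E.
    by rewrite !psi_eq0 ?mulr0// te leqNgt pilt -leqNgt.
  - by rewrite ler_pM2l//; case: A => + _; apply.
  - by case: A' => + _; apply.
have [tn|nt] := ltnP (ctype psi) n.
  by exists beta => // i it; have := H i it; rewrite /cw te tn.
have [n0|n0] := posnP n.
  by exists 1 => // i; have := ltn_ord i; rewrite [X in (_ < X)%N]n0.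
have s0 : 0 < \sum_j psi 0 j by rewrite sum_psi_gt0// (leq_trans n0).
have s0' : 0 < \sum_j psi' 0 j by rewrite sum_psi_gt0// te (leq_trans n0).
exists (beta * (\sum_j psi' 0 j) / \sum_j psi 0 j); first by rewrite divr_gt0// mulr_gt0.
move=> i it; have := H i it; rewrite /cw te ltnNge nt /= => /(canRL (divfK (lt0r_neq0 s0'))) ->.
by field; rewrite gt_eqF.
Qed.

End SortedTypes.

Section PglMatrix.
Variables (R : realType) (n : nat).
Implicit Types (g h : PGL R n) (A B : 'M[R]_(n + 1)).

Lemma mx_of_mul g h : exists2 a : R, a != 0 & mx_of (g * h)%g = a *: (mx_of g *m mx_of h).
Proof. exact: mx_of_pgl. Qed.

Lemma mx_of_inv g : exists2 a : R, a != 0 & mx_of g^-1%g = a *: invmx (mx_of g).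
Proof. exact: mx_of_pgl. Qed.

Lemma mx_of_conj g A (uA : A \in unitmx) :
  exists2 a : R, a != 0 & mx_of (g * pgl uA * g^-1)%g = a *: (mx_of g *m A *m invmx (mx_of g)).
Proof.
have [a a0 ->] := mx_of_mul (g * pgl uA)%g g^-1%g; have [b b0 ->] := mx_of_mul g (pgl uA).
have [c c0 ->] := mx_of_inv g; have [d d0 ->] := mx_of_pgl uA.
exists (a * (b * d) * c); first by rewrite !mulf_neq0.
by rewrite -!scalemxAl -!scalemxAr -!scalemxAl !scalerA; congr (_ *: _); ring.
Qed.

Lemma mx_of_scale g A (a : R) : a != 0 -> mx_of g = a *: A -> exists u : A \in unitmx, g = pgl u.
Proof.
move=> a0 gE; have u : A \in unitmx.
  by have := mx_of_unit g; rewrite gE unitmxZ// unitfE.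
by exists u; rewrite -[LHS]pgl_mx_of; apply/pgl_eqP; exists a^-1; rewrite ?invr_eq0// gE scalerA mulVf// scale1r.
Qed.

Lemma pgl_congr A B (uA : A \in unitmx) (uB : B \in unitmx) : A = B -> pgl uA = pgl uB.
Proof. by move=> AB; apply/pgl_eqP; exists 1; rewrite ?oner_neq0// scale1r. Qed.

Lemma pgl_mulE A B (uA : A \in unitmx) (uB : B \in unitmx) :
  (pgl uA * pgl uB)%g = pgl (mulmx_unit uA uB).
Proof.
have [a a0 E] := mx_of_mul (pgl uA) (pgl uB); have [b b0 Eb] := mx_of_pgl uA; have [c c0 Ec] := mx_of_pgl uB.
have abc : a * (b * c) != 0 by rewrite !mulf_neq0.
have [|u ->] := @mx_of_scale (pgl uA * pgl uB)%g (A *m B) _ abc; last exact: pgl_congr.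
by rewrite E Eb Ec -scalemxAl -scalemxAr !scalerA; congr (_ *: _); ring.
Qed.

Lemma pgl_commute A B (uA : A \in unitmx) (uB : B \in unitmx) : A *m B = B *m A ->
  (pgl uA * pgl uB)%g = (pgl uB * pgl uA)%g.
Proof. by move=> AB; rewrite !pgl_mulE; apply: pgl_congr. Qed.

Lemma conjsetM (g h : PGL R n) X : conjset (g * h)%g X = conjset g (conjset h X).
Proof.
apply/seteqP; split=> [_ [x Xx <-]|_ [_ [x Xx <-] <-]].
  by exists (h * x * h^-1)%g; [exists x|rewrite invgM !mulgA].
by exists x => //; rewrite invgM !mulgA.
Qed.

Lemma conjset_centralizing (g : PGL R n) X : (forall x, X x -> (g * x)%g = (x * g)%g) -> conjset g X = X.
Proof.
move=> H; apply/seteqP; split=> [_ [x Xx <-]|x Xx]; first by rewrite H// mulgK.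
by exists x => //; rewrite H// mulgK.
Qed.

End PglMatrix.

Section Scaling.
Variables (R : realType) (n : nat) (psi psi' : 'rV[R]_n) (beta : R).
Hypothesis b0 : 0 < beta.

Lemma conj_Gpsi_scale g : (forall c, act g @` horosphere psi c = horosphere psi' (beta * c)) ->
  conjset g (Gpsi psi) = Gpsi psi'.
Proof.
move=> H; have H' c : act g^-1%g @` horosphere psi' c = horosphere psi (c / beta).
  rewrite -[in LHS](divfK (lt0r_neq0 b0) c) mulrC -H; apply/seteqP; split=> [_ [_ [x hx <-] <-]|x hx].
    by rewrite actVK.
  by exists (act g x); rewrite ?actVK//; exists x.
apply/seteqP; split=> [_ [k Gk <-] c|k Gk].
  rewrite -(mulfVK (lt0r_neq0 b0) c) mulrC -{2}H -Gk.
  apply/seteqP; split=> [_ [p + <-]|_ [_ [x hx <-] <-]].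
    rewrite -H => -[x hx <-]; rewrite !actM actVK; exists (act k x) => //; exists x => //.
  by exists (act g x); rewrite ?actM ?actVK// -H; exists x.
exists (g^-1 * k * g)%g; last by rewrite !mulgA mulgV mul1g mulgK.
move=> c; rewrite -{2}(mulfK (lt0r_neq0 b0) c) [c * beta]mulrC -H' -Gk -H; apply/seteqP; split=> [_ [x hx <-]|_ [_ [_ [x hx <-] <-] <-]].
  by exists (act k (act g x)); rewrite ?actM//; exists (act g x) => //; exists x.
by exists x => //; rewrite !actM.
Qed.

End Scaling.

Section Conjugate.
Variables (R : realType) (n : nat) (psi psi' : 'rV[R]_n).
Hypothesis Apsi : weyl psi.
Hypothesis Apsi' : weyl psi'.
Hypothesis n2 : (1 < n)%N.
Implicit Types (i j l : 'I_n).
Let n0 : (0 < n)%N := ltnW n2.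

Lemma conj_cone g Delta : (forall y, Delta y -> Gpsi psi' (g * tr_pgl psi y * g^-1)%g) ->
  forall y, Delta y -> cone psi' (mx_of g *m Tm psi y *m invmx (mx_of g)).
Proof.
move=> H y Dy; have [N [v [uNv [E [rho [al A]]]]]] := Gpsi_form Apsi' n2 (H y Dy).
have [a a0] := mx_of_conj g (tr_aff_unit psi y); rewrite -/(tr_pgl psi y) E.
have [b b0 ->] := mx_of_pgl uNv => e.
exists (b / a), N, v, rho, al; split; first by rewrite mulf_neq0// invr_eq0.
split=> //; by rewrite mulrC -scalerA e scalerA mulVf// scale1r.
Qed.

Lemma conj_translations_scale g Delta : coarse_set Delta ->
  (forall y, Delta y -> Gpsi psi' (g * tr_pgl psi y * g^-1)%g) ->
  exists2 k : R, 0 < k & psi' = k *: psi.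
Proof.
move=> cD /conj_cone H.
have [c [N [v [pi [p [beta [kappa [[c0 GE te pinj pilt] [b0 cwE _ _]]]]]]]]] :=
  conj_similarity Apsi Apsi' n2 (mx_of_unit g) cD H.
exact: (@cw_perm_scale _ _ psi psi' pi beta).
Qed.

Lemma ctype_scale (k : R) : 0 < k -> ctype (k *: psi) = ctype psi.
Proof. by move=> k0; apply: eq_card => i; rewrite !inE mxZE pmulr_rgt0. Qed.

(** For t = n the normalized h does not change with k and the two groups coincide. For t < n a
    diagonal matrix multiplies h by k. *)
Lemma scale_conjugate (k : R) : 0 < k -> psi' = k *: psi -> conjugate_in setT (Gpsi psi) (Gpsi psi').
Proof.
move=> k0 E; have te : ctype psi' = ctype psi by rewrite E ctype_scale.
pose t := ctype psi; have [tn|nt] := ltnP t n; last first.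
  exists 1%g => //; rewrite conjset_centralizing => [|x _]; last by rewrite mul1g mulg1.
  have hE : horo_fun psi' = horo_fun psi.
    apply/funext => x; rewrite /horo_fun te ltnNge nt /= E.
    have -> : \sum_i (k *: psi) 0 i = k * \sum_i psi 0 i.
      by rewrite mulr_sumr; apply: eq_bigr => i _; rewrite mxZE.
    have -> : \sum_i (k *: psi) 0 i * ln (x i 0) = k * \sum_i psi 0 i * ln (x i 0).
      by rewrite mulr_sumr; apply: eq_bigr => i _; rewrite mxZE mulrA.
    by rewrite invfM !mulNr mulrACA mulVf ?gt_eqF// mul1r.
  have dE : dom_h psi' = dom_h psi by rewrite /dom_h te.
  by rewrite /Gpsi /horosphere hE dE.
(* The logarithmic terms acquire the factor k from psi' itself; the linear and the quadratic terms
   get it from the diagonal entries k and sqrt k. *)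
pose d i : R := if (i < t)%N then 1 else if i == t :> nat then k else Num.sqrt k.
have d0 i : 0 < d i by rewrite /d; case: ifP => // _; case: ifP => // _; rewrite sqrtr_gt0.
pose D : 'M[R]_n := diag_mx (\row_i d i).
have Dx (x : 'cV[R]_n) i : (D *m x) i 0 = d i * x i 0 by rewrite mul_diag_mx !mxE.
have uD : aff_mx D 0 \in unitmx.
  by rewrite aff_mx_unit unitmxE det_diag unitfE prodf_seq_neq0; apply/allP => i _; rewrite mxE gt_eqF.
have hE x : horo_fun psi' (D *m x) = k * horo_fun psi x.
  rewrite /horo_fun te tn E !mulrDr !mulrN !mulr_sumr; congr (- _ - _ + _).
  - by apply: eq_bigr => i /eqP it; rewrite Dx /d it ltnn eqxx.
  - by apply: eq_bigr => i it; rewrite Dx /d it mul1r mxZE mulrA.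
  - apply: eq_bigr => i ti; rewrite Dx /d ltnNge (ltnW ti) gtn_eqF// exprMn sqr_sqrtr ?ltW//; ring.
have dE x : dom_h psi' (D *m x) <-> dom_h psi x.
  rewrite /dom_h te; split=> H i it; have := H i it; rewrite Dx; first by rewrite pmulr_rgt0.
  by move=> x0; rewrite mulr_gt0.
exists (pgl uD) => //; apply: (@conj_Gpsi_scale _ _ _ _ k) => // c.
apply/seteqP; split=> [_ [_ [x [dx hx] <-] <-]|_ [x [dx hx] <-]].
  by exists (D *m x); rewrite ?act_aff ?addr0//; split; [exact/dE|rewrite /= hE hx].
have uD' : D \in unitmx by rewrite -(aff_mx_unit _ 0).
exists (affine (invmx D *m x)); last by rewrite act_aff addr0 mulmxA mulmxV// mul1mx.
exists (invmx D *m x) => //; have Dk : D *m (invmx D *m x) = x by rewrite mulmxA mulmxV// mul1mx.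
split; first by apply/dE; rewrite Dk.
by apply: (mulfI (lt0r_neq0 k0)); rewrite -hE Dk.
Qed.

End Conjugate.

(** * Conjugators that preserve the domain *)

Section SelfConjugate.
Variables (R : realType) (n : nat) (psi : 'rV[R]_n).
Hypothesis Apsi : weyl psi.
Hypothesis n2 : (1 < n)%N.
Implicit Types (i j l : 'I_n) (x : 'cV[R]_n).
Let n0 : (0 < n)%N := ltnW n2.
Local Notation t := (ctype psi).

(** Matrix form of [flow], since the conjugator will be corrected by an element of PGL and not only
    by a map of the domain. *)
Definition flow_mx (a : R) : 'M[R]_n := if (t < n)%N then 1%:M else (expR a)%:M.
Definition flow_vec (a : R) : 'cV[R]_n := if (t < n)%N then a *: wv psi else 0.

Lemma flowE a x : dom_h psi x -> flow psi a x = flow_mx a *m x + flow_vec a.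
Proof.
move=> dx; apply/colP => i; rewrite /flow exE mxDE mxZE lgE /flow_mx /flow_vec.
case: (boolP (t < n)%N) => [tn|nt].
  rewrite mul1mx mxDE mxZE !mxE tn; case: (boolP (i < t)%N) => it //.
  rewrite [X in a * X](_ : _ = 0) ?mulr0 ?addr0; last by rewrite ltn_eqF.
  by rewrite mulrAC divff ?gt_eqF ?sw_gt0// mul1r lnK// posrE dx.
have it : (i < t)%N by rewrite (leq_trans (ltn_ord i))// leqNgt.
rewrite it addr0 mul_scalar_mx mxZE !mxE (negbTE nt) mulrDl expRD mulrAC divff ?gt_eqF ?sw_gt0//.
by rewrite mul1r lnK ?posrE ?dx// mulfK ?gt_eqF ?sw_gt0// mulrC.
Qed.

Lemma flow_unit a : aff_mx (flow_mx a) (flow_vec a) \in unitmx.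
Proof.
rewrite aff_mx_unit /flow_mx; case: ifP => _; first exact: unitmx1.
by rewrite unitmxE det_scalar unitfE expf_neq0// gt_eqF// expR_gt0.
Qed.

(** It lets a conjugator be composed with the flow, which alters the constant [kappa] of h and
    leaves the conjugation unchanged. *)
Lemma flow_centralizes a N v rho al : aff_form psi N v rho al 1 ->
  aff_mx (flow_mx a) (flow_vec a) *m aff_mx N v = aff_mx N v *m aff_mx (flow_mx a) (flow_vec a).
Proof.
move=> A; rewrite /aff_mx !mulmx_block !mulmx0 !mul0mx !mulmx1 ?mul1mx !addr0 !add0r.
rewrite /flow_mx /flow_vec; case: (boolP (t < n)%N) => [tn|nt]; last first.
  rewrite mul_scalar_mx mul_mx_scalar mul_scalar_mx mulmx0 add0r addr0; congr block_mx.
  suff -> : v = 0 by rewrite scaler0.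
  apply/colP => i; rewrite (form_v A) ?mx0E// (leq_trans (ltn_ord i))// leqNgt//.
rewrite mul1mx mulmx1; congr block_mx; rewrite mul1mx addrC; congr (_ + _).
rewrite -scalemxAr; congr (_ *: _); apply/colP => i.
have wE l : wv psi l 0 = (l == Ordinal tn)%:R by rewrite mxE tn -val_eqE.
rewrite wE mxE (bigD1 (Ordinal tn))//= wE eqxx mulr1 big1 ?addr0 => [|l /negbTE lt]; last by rewrite wE lt mulr0.
have [it|ti] := ltnP i t.
  rewrite (form_N A _ it) (_ : (Ordinal tn == rho i) = false).
    by rewrite mulr0 -val_eqE /= ltn_eqF.
  by rewrite -val_eqE /= gtn_eqF// (af_rho_lt A).
move: ti; rewrite leq_eqVlt => /orP[/eqP ti|ti]; last first.
  by rewrite (af_low A)// -val_eqE /= gtn_eqF.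
have -> : i = Ordinal tn by apply: val_inj; rewrite /= -ti.
by rewrite (af_vert A)//= !eqxx mulr1.
Qed.

(** By [conj_similarity] g turns h into beta h + kappa up to signs of the positive coordinates. A
    diagonal matrix of signs and the flow by kappa correct this; both commute with [Gamma'], and the
    corrected map preserves h <= 0 because beta > 0. *)
Lemma conjugate_PGL_Omega g Gamma Gamma' Delta : coarse_set Delta ->
  Gamma `<=` Gpsi psi -> Gamma' `<=` Gpsi psi -> conjset g Gamma = Gamma' ->
  (forall y, Delta y -> Gamma (tr_pgl psi y)) ->
  conjugate_in (PGL_of (Omega psi)) Gamma Gamma'.
Proof.
move=> cD GG GG' gE DG.
have H : forall y, Delta y -> cone psi (mx_of g *m Tm psi y *m invmx (mx_of g)).
  by apply: conj_cone => // y Dy; apply: GG'; rewrite -gE; exists (tr_pgl psi y) => //; exact: DG.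
have [c [N [v [pi [p [beta [kappa [[c0 GE _ pinj pilt] [b0 _ pE hE]]]]]]]]] :=
  conj_similarity Apsi Apsi n2 (mx_of_unit g) cD H.
have [uNv gN] := mx_of_scale c0 GE.
pose F x := N *m x + v.
have Fsurj (y : 'cV[R]_n) : exists x, F x = y.
  have uN := uNv; rewrite aff_mx_unit in uN; exists (invmx N *m (y - v)).
  by rewrite /F mulmxA mulmxV// mul1mx subrK.
pose pinv := invF pinj.
have pinvK l : pi (pinv l) = l by exact: f_invF.
have pinvlt l : (l < t)%N -> (pinv l < t)%N by move=> lt; rewrite -pilt pinvK.
pose s l : R := if (l < t)%N then Num.sg (p (pinv l)) else 1.
have ss l : s l * s l = 1.
  rewrite /s; case: ifP => lt; last by rewrite mulr1.
  by rewrite -expr2 sqr_sg (pE _ (pinvlt _ lt)).1.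
have FE x l : (l < t)%N -> F x l 0 = p (pinv l) * x (pinv l) 0.
  by move=> lt; rewrite -{1}(pinvK l) /F (pE _ (pinvlt _ lt)).2.
have sF x l : dom_h psi x -> (l < t)%N -> s l = Num.sg (F x l 0).
  by move=> dx lt; rewrite FE// sgrM (gtr0_sg (dx _ (pinvlt _ lt))) mulr1 /s lt.
pose S : 'M[R]_n := diag_mx (\row_l s l).
have SE (x : 'cV[R]_n) l : (S *m x) l 0 = s l * x l 0 by rewrite mul_diag_mx !mxE.
have SS : S *m S = 1%:M.
  apply/matrixP => i j; rewrite mul_diag_mx !mxE; case: eqVneq => [->|_]; last by rewrite mulr0n mulr0.
  exact: ss.
have uS : aff_mx S 0 \in unitmx by rewrite aff_mx_unit; case: (mulmx1_unit SS).
have SSx (x : 'cV[R]_n) : S *m (S *m x) = x by rewrite mulmxA SS mul1mx.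
have SFE x : dom_h psi x -> forall l, (S *m F x) l 0 = if (l < t)%N then `|F x l 0| else F x l 0.
  move=> dx l; rewrite SE; case: (boolP (l < t)%N) => lt.
    by rewrite (sF x)// -normrEsg.
  by rewrite /s (negbTE lt) mul1r.
have dSF x : dom_h psi x -> dom_h psi (S *m F x).
  move=> dx l lt; rewrite SFE// lt normr_gt0 FE// mulf_neq0 ?(pE _ (pinvlt _ lt)).1//.
  by rewrite gt_eqF// dx// pinvlt.
have hSF x : dom_h psi x -> horo_fun psi (S *m F x) = beta * horo_fun psi x + kappa.
  by move=> dx; apply: hE => // l; rewrite SFE.
have dom_inv x : dom_h psi (S *m F x) -> dom_h psi x.
  move=> dS i it; have pt : (pi i < t)%N by rewrite pilt.
  have iK : pinv (pi i) = i by exact: invF_f.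
  have := dS _ pt; rewrite SE FE// /s pt iK mulrA -normrEsg.
  by rewrite pmulr_rgt0// normr_gt0 (pE _ it).1.
pose f := pgl (flow_unit kappa); pose sg := pgl uS.
have actE x : dom_h psi x -> act (f * sg * g)%g (affine x) = affine (flow psi kappa (S *m F x)).
  by move=> dx; rewrite !actM gN act_aff act_aff addr0 act_aff flowE//; exact: dSF.
exists (f * sg * g)%g.
  apply/seteqP; split=> [_ [_ [x [dx hx] <-] <-]|_ [y [dy hy] <-]].
    rewrite actE//; exists (flow psi kappa (S *m F x)) => //; split; first exact: flow_dom.
    by rewrite horo_flow// hSF// addrK pmulr_rle0.
  have [x xE] := Fsurj (S *m flow psi (- kappa) y).
  have Sx : S *m F x = flow psi (- kappa) y by rewrite xE SSx.
  have dx : dom_h psi x by apply: dom_inv; rewrite Sx; exact: flow_dom.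
  exists (affine x); last by rewrite actE// Sx flow_flow// addrN flow0.
  exists x => //; split=> //; have := hSF x dx; rewrite Sx horo_flow// opprK => /addIr e.
  by rewrite -(pmulr_rle0 _ b0) -e.
rewrite !conjsetM gE; suff -> : conjset sg Gamma' = Gamma'.
  apply: conjset_centralizing => k /GG'/(Gpsi_form Apsi n2)[N' [v' [u' [-> [rho [al A]]]]]].
  by apply: pgl_commute; exact: (flow_centralizes _ A).
apply: conjset_centralizing => k Gk; have := Gk; rewrite -gE => -[k0 Gk0 kE].
have [N' [v' [u' [k'E [rho [al A]]]]]] := Gpsi_form Apsi n2 (GG' _ Gk); rewrite k'E.
(* For k = g k0 g^-1 with k0 preserving the domain, the signs of F at x and at k0 x agree. As k
   multiplies by the positive factors [al] along [rho], the signs are constant along [rho]. *)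
have srho l : (l < t)%N -> s l = s (rho l).
  move=> lt; have db : dom_h psi (basepoint psi) by exact: basepoint_dom.
  have : horosphere psi (horo_fun psi (basepoint psi)) (act k0 (affine (basepoint psi))).
    by rewrite -(GG _ Gk0); exists (affine (basepoint psi)) => //; exists (basepoint psi).
  move=> [x [dx _] /esym kx].
  have : act (k * g)%g (affine (basepoint psi)) = act g (affine x).
    by rewrite -kE -kx -actM -!mulgA mulVg mulg1.
  rewrite k'E gN !actM !act_aff => /affine_inj/(congr1 (fun u : 'cV_n => u l 0)).
  rewrite (af_row A)// -!/(F _) => e.
  by rewrite (sF x)// -e sgrM (gtr0_sg (af_al A lt)) mul1r -(sF _ _ db)// (af_rho_lt A).
apply: pgl_commute; rewrite /aff_mx !mulmx_block !mulmx0 !mul0mx !mulmx1 ?mul1mx !addr0 !add0r.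
congr block_mx; last first.
  apply/colP => l; rewrite SE; case: (boolP (l < t)%N) => lt; first by rewrite (form_v A)// mulr0.
  by rewrite /s (negbTE lt) mul1r.
apply/matrixP => l j; rewrite mul_diag_mx mul_mx_diag !mxE.
case: (boolP (l < t)%N) => lt.
  rewrite (form_N A _ lt); have [->|_] := eqVneq j (rho l); last by rewrite !mulr0 mul0r.
  by rewrite srho// mulrC.
rewrite /s (negbTE lt) mul1r; case: ifP => jt; last by rewrite mulr1.
by rewrite (form_col A)// ?mul0r// leqNgt.
Qed.

End SelfConjugate.

(** * Topology of projective space *)

Section GeneralTopology.

(** If no U k were everything, the complements would generate a proper filter without a cluster
    point. *)
Lemma compact_exhaustion (T : topologicalType) (U : nat -> set T) : compact [set: T] ->
  (forall k, open (U k)) -> (forall i j, (i <= j)%N -> U i `<=` U j) -> (forall x, exists k, U k x) ->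
  exists k, U k = setT.
Proof.
move=> cT oU mU cU; apply: contrapT => H.
pose F := filter_from [set: nat] (fun k => ~` U k).
have FF : ProperFilter F.
  apply: filter_from_proper; last first.
    move=> k _; apply/set0P/eqP => U0; apply: H; exists k.
    by rewrite -[U k]setCK U0 setC0.
  apply: filter_from_filter; first by exists 0%N.
  move=> i j _ _; exists (maxn i j) => // x nx.
  by split=> Ux; apply: nx; [apply: (mU i)|apply: (mU j)]; rewrite ?leq_maxl ?leq_maxr.
have [x [_ clx]] := cT F FF filterT.
have [k Ukx] := cU x.
have [|y [ny Uy]] := clx (~` U k) (U k) _ (open_nbhs_nbhs (conj (oU k) Ukx)); last exact: ny.
by exists k.
Qed.

Lemma sub_open (T : topologicalType) (A : set T) (U : set (set_type A)) :
  open U <-> exists2 W, open W & U = set_val @^-1` W.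
Proof. by split=> [[W oW <-]|[W oW ->]]; exists W. Qed.

Lemma sub_continuous (S T : topologicalType) (A : set T) (f : S -> set_type A) :
  continuous (set_val \o f) -> continuous f.
Proof.
move=> cf; apply/continuousP => U /sub_open[W oW ->]; rewrite -comp_preimage.
by move/continuousP: cf; apply.
Qed.

Lemma set_val_continuous (T : topologicalType) (A : set T) : continuous (@set_val T A).
Proof. by apply/continuousP => W oW; apply/sub_open; exists W. Qed.

Variables (T : topologicalType) (U : Type) (f : T -> U).

Lemma fiber_open (A : set (fiber_space f)) : open A <-> open (fiber_pi f @^-1` A).
Proof. by []. Qed.

Lemma fiber_pi_continuous : continuous (fiber_pi f).
Proof. exact/continuousP. Qed.

Lemma fiber_lift_continuous (Y : topologicalType) (g : fiber_space f -> Y) :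
  continuous (g \o fiber_pi f) -> continuous g.
Proof. by move=> /continuousP cg; apply/continuousP => A oA; exact: cg. Qed.

End GeneralTopology.

Section MatrixTopology.
Variable R : realType.

Lemma mx_cvg (T : Type) (F : set_system T) {FF : Filter F} m n (f : T -> 'M[R]_(m, n)) (M : 'M[R]_(m, n)) :
  (forall i j, (fun t => f t i j) @ F --> M i j) -> f @ F --> M.
Proof.
move=> H; apply/cvg_ballP => e e0.
have : \forall t \near F, forall p : 'I_m * 'I_n, ball (M p.1 p.2) e (f t p.1 p.2).
  by apply: filter_forall => p; have /cvg_ballP := H p.1 p.2; apply.
by apply: filterS => t Ht; split=> // i j; exact: (Ht (i, j)).
Qed.

Lemma entry_cvg (T : Type) (F : set_system T) {FF : Filter F} m n (f : T -> 'M[R]_(m, n)) (M : 'M[R]_(m, n)) i j :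
  f @ F --> M -> (fun t => f t i j) @ F --> M i j.
Proof. by move=> H; exact: (@cvg_comp _ _ _ f (fun N : 'M[R]_(m, n) => N i j) _ _ _ H (@coord_continuous R _ _ i j M)). Qed.

Lemma entry_nbhs m n (M : 'M[R]_(m, n)) i j (V : set R) :
  nbhs (M i j) V -> nbhs M [set N : 'M[R]_(m, n) | V (N i j)].
Proof. by move=> HV; have := @coord_continuous R m n i j M; apply. Qed.

Lemma sum_cvg (T : Type) (F : set_system T) {FF : Filter F} (J : finType) (P : pred J)
  (f : J -> T -> R) (l : J -> R) : (forall j, P j -> f j @ F --> l j) ->
  (fun k => \sum_(j | P j) f j k) @ F --> \sum_(j | P j) l j.
Proof. by move=> H; apply: cvg_big => //; exact: add_continuous. Qed.

Lemma mulmx_cvg (T : Type) (F : set_system T) {FF : Filter F} m n p (f : T -> 'M[R]_(m, n)) (g : T -> 'M[R]_(n, p)) (M : 'M[R]_(m, n)) (N : 'M[R]_(n, p)) :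
  f @ F --> M -> g @ F --> N -> (fun t => f t *m g t) @ F --> M *m N.
Proof.
move=> fM gN; apply: mx_cvg => i j.
rewrite (_ : (fun t => _) = fun t => \sum_k f t i k * g t k j); last by apply/funext => t; rewrite mxE.
by rewrite mxE; apply: sum_cvg => k _; apply: cvgM; exact: entry_cvg.
Qed.

Lemma mulmxr_continuous m n p (N : 'M[R]_(n, p)) : continuous (fun M : 'M[R]_(m, n) => M *m N).
Proof. by move=> M; apply: (@mulmx_cvg _ _ (nbhs_filter M) _ _ _ id (fun=> N)); [exact: cvg_id|exact: cvg_cst]. Qed.

Lemma mulmxl_continuous m n p (M : 'M[R]_(m, n)) : continuous (fun N : 'M[R]_(n, p) => M *m N).
Proof. by move=> N; apply: (@mulmx_cvg _ _ (nbhs_filter N) _ _ _ (fun=> M) id); [exact: cvg_cst|exact: cvg_id]. Qed.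

Lemma en_continuous m : continuous (@en R m).
Proof.
move=> x; have H : (fun u : 'cV[R]_m => dotv u u) @ x --> dotv x x.
  rewrite dotvE (_ : (fun u => _) = fun u : 'cV_m => \sum_i u i 0 * u i 0); last by apply/funext => u; rewrite dotvE.
  by apply: (@sum_cvg _ _ (nbhs_filter x)) => i _; apply: cvgM; exact: coord_continuous.
exact: (@cvg_comp _ _ _ (fun u : 'cV[R]_m => dotv u u) (@Num.sqrt R) _ _ _ H (@sqrt_continuous R _)).
Qed.

Lemma nbhs_en m (x : 'cV[R]_m) (U : set 'cV[R]_m) :
  nbhs x U <-> exists2 e : R, 0 < e & forall y, en (y - x) < e -> U y.
Proof.
split=> [/nbhs_ballP[e e0 H]|[e e0 H]].
  exists e => // y yx; apply: H; split=> // i j; rewrite ord1 /ball /= distrC.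
  by apply: le_lt_trans yx; have := coord_le_en (y - x) i; rewrite mxDE mxNE.
have c : (fun y => en (y - x)) @ x --> (0 : R).
  have Hc : (fun y => y - x) @ x --> (0 : 'cV[R]_m).
    apply: (@mx_cvg _ _ (nbhs_filter x)) => i j.
    rewrite (_ : (fun y => _) = fun y : 'cV_m => y i j - x i j); last by apply/funext => y; rewrite mxDE mxNE.
    by rewrite mx0E -(subrr (x i j)); apply: cvgB; [exact: coord_continuous|exact: cvg_cst].
  by rewrite -(en0 R m); exact: (@cvg_comp _ _ _ (fun y => y - x) (@en R m) _ _ _ Hc (@en_continuous m _)).
have /cvgrPdist_lt/(_ e e0) := c.
by apply: filterS => y; rewrite sub0r normrN ger0_norm ?en_ge0// => /H.
Qed.

Lemma open_neq0 m n : open [set M : 'M[R]_(m, n) | M != 0].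
Proof.
rewrite (_ : mkset _ = (fun M => `|M|) @^-1` [set x : R | x != 0]); last first.
  by apply/seteqP; split=> M /=; rewrite normr_eq0.
by move/continuousP: (@norm_continuous R 'M[R]_(m, n)); apply; exact: open_neq.
Qed.

End MatrixTopology.

Section ProjectiveTopology.
Variables (R : realType) (n : nat).
Local Notation L := (lshift 1).
Local Notation Z := (rshift n (0 : 'I_1)).
Implicit Types (v : 'cV[R]_(n + 1)) (U : set (RP R n)).

(** The cone over U in R^(n+1) minus 0. Openness in projective space is tested on it, where
    continuity of linear maps is available. *)
Definition lift_set U : set 'cV[R]_(n + 1) := [set v | exists v0 : v != 0, U (pt v0)].

Lemma lift_setE U v (v0 : v != 0) : lift_set U v <-> U (pt v0).
Proof. by split=> [[v0']|]; [rewrite (_ : v0' = v0)//; exact: bool_irrelevance|exists v0]. Qed.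

Lemma fiber_ptE v hv (v0 : v != 0) : fiber_pi (@punctured_line R n) (exist _ v hv) = pt v0.
Proof. by rewrite /pt; congr fiber_pi; apply: val_inj. Qed.

Lemma fiber_pglE (A : 'M[R]_(n + 1)) hA (uA : A \in unitmx) :
  fiber_pi (@scalar_class R n) (exist _ A hA) = pgl uA.
Proof. by rewrite /pgl; congr fiber_pi; apply: val_inj. Qed.

Lemma lift_open U : open (lift_set U) <-> open U.
Proof.
split=> [oU|/fiber_open/sub_open[W oW UW]].
  apply/fiber_open/sub_open; exists (lift_set U) => //; apply/seteqP; split=> -[v hv] /=.
    by have v0 : v != 0 := set_mem hv; rewrite (fiber_ptE _ v0) => Uv; exists v0.
  by move=> [v0]; rewrite (fiber_ptE _ v0).
have UWE v (v0 : v != 0) : U (pt v0) = W v.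
  have := congr1 (fun S : set (nonzero_vec R n) => S (exist _ v (mem_set v0))) UW.
  by rewrite /preimage /= (fiber_ptE _ v0).
have -> : lift_set U = W `&` [set v | v != 0].
  by apply/seteqP; split=> v [] => [v0|Wv v0]; [rewrite UWE|exists v0; rewrite UWE].
by apply: openI => //; exact: open_neq0.
Qed.

Lemma act_open g U : open U -> open (act g @^-1` U).
Proof.
move=> /lift_open oU; apply/lift_open.
have -> : lift_set (act g @^-1` U) = (fun v => mx_of g *m v) @^-1` (lift_set U).
  apply/seteqP; split=> v.
    by move=> [v0]; rewrite /= -{1}(pgl_mx_of g) act_pgl_pt => Ug; exists (mulmx_neq0 (mx_of_unit g) v0).
  move=> [gv0 Ug]; have v0 : v != 0 by apply/eqP => e; have := gv0; rewrite e mulmx0 eqxx.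
  exists v0; rewrite /= -{1}(pgl_mx_of g) act_pgl_pt.
  by apply/(lift_setE U); exists gv0.
by move/continuousP: (@mulmxl_continuous R _ _ 1 (mx_of g)); apply.
Qed.

Lemma act_continuous g : continuous (act g : RP R n -> RP R n).
Proof. by apply/continuousP => U; exact: act_open. Qed.

Lemma orbit_open (x : RP R n) U : open U -> open [set g : PGL R n | U (act g x)].
Proof.
move=> /lift_open oU; apply/fiber_open/sub_open.
exists ((fun A : 'M[R]_(n + 1) => A *m vec_of x) @^-1` lift_set U).
  by move/continuousP: (@mulmxr_continuous R (n + 1) _ _ (vec_of x)); apply.
apply/seteqP; split=> -[A hA] /=; have uA := set_mem hA : A \in unitmx.
  rewrite (fiber_pglE _ uA) -{1}(pt_vec_of x) act_pgl_pt => Ug.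
  by exists (mulmx_neq0 uA (vec_of_neq0 x)).
move=> [Av0]; rewrite (fiber_pglE _ uA) -{2}(pt_vec_of x) act_pgl_pt => Ug.
by apply/(lift_setE U); exists Av0.
Qed.

Lemma pgl_nbhs1 (U : set (PGL R n)) : nbhs 1%g U ->
  exists2 e : R, 0 < e & forall (A : 'M[R]_(n + 1)) (uA : A \in unitmx),
    (forall i j, `|A i j - (i == j)%:R| < e) -> U (pgl uA).
Proof.
rewrite nbhsE => -[V [/fiber_open/sub_open[W oW VW] V1] VU].
have VWE (A : 'M[R]_(n + 1)) (uA : A \in unitmx) : V (pgl uA) = W A.
  have := congr1 (fun S : set (gl_mx R n) => S (exist _ A (mem_set uA))) VW.
  by rewrite /preimage /= (fiber_pglE _ uA).
have W1 : W 1%:M by rewrite -(VWE _ (unitmx1 R (n + 1))).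
have /nbhs_ballP[e e0 H] := open_nbhs_nbhs (conj oW W1).
exists e => // A uA HA; apply: VU; rewrite VWE.
by apply: H; split=> // i j; rewrite /ball /= distrC mxE; exact: HA.
Qed.

Definition dehom v : 'cV[R]_n := (v Z 0)^-1 *: usubmx v.

Lemma dehom_hc (a : R) x : a != 0 -> dehom (a *: hc x) = x.
Proof.
move=> a0; apply/colP => i; rewrite /dehom mxZE [usubmx _ _ _]mxE !mxZE.
by rewrite /hc col_mxEu col_mxEd mxE eqxx mulr1 mulrA mulVf// mul1r.
Qed.

Lemma hc_dehom v : v Z 0 != 0 -> v = v Z 0 *: hc (dehom v).
Proof.
move=> vZ; apply/colP; elim/split_ord => [i|]; rewrite mxZE /hc.
  by rewrite col_mxEu /dehom mxZE mxE mulrA divff// mul1r.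
by rewrite col_mxEd mxE eqxx mulr1.
Qed.

Lemma dehom_cvg v : v Z 0 != 0 -> dehom @ v --> dehom v.
Proof.
move=> vZ; apply: (@mx_cvg _ _ _ (nbhs_filter v)) => i j; rewrite ord1.
rewrite (_ : (fun t => _) = fun v => (v Z 0)^-1 * v (L i) 0); last first.
  by apply/funext => u; rewrite /dehom mxZE mxE.
rewrite /dehom mxZE [usubmx _ _ _]mxE; apply: cvgM; last exact: coord_continuous.
by apply: cvgV => //; exact: coord_continuous.
Qed.

Lemma affine_lift (W : set 'cV[R]_n) : lift_set (@affine R n @` W) = [set v : 'cV[R]_(n + 1) | v Z 0 != 0 /\ W (dehom v)].
Proof.
apply/seteqP; split=> v.
  move=> [v0 [x Wx /pt_eqP[a a0 ->]]]; rewrite /= mxZE col_mxEd mxE eqxx mulr1; split=> //.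
  by rewrite -/(hc x) dehom_hc.
move=> [vZ Wv]; have v0 : v != 0 by apply: contraNneq vZ => ->; rewrite mx0E.
by exists v0, (dehom v) => //; apply/pt_eqP; exists (v Z 0) => //; exact: hc_dehom.
Qed.

Lemma affine_open (W : set 'cV[R]_n) : open W -> open (@affine R n @` W).
Proof.
move=> oW; apply/lift_open; rewrite affine_lift openE => v [vZ Wv]; rewrite /interior.
have h1 : \forall u \near v, W (dehom u) by apply: dehom_cvg => //; exact: open_nbhs_nbhs.
have h2 : nbhs v [set u : 'cV[R]_(n + 1) | u Z 0 != 0].
  apply: (@entry_nbhs _ _ _ v Z 0 [set x : R | x != 0]); apply: open_nbhs_nbhs.
  by split; [exact: open_neq|exact: vZ].
by apply: (filterS _ (filterI h2 h1)) => u [].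
Qed.

Lemma affine_continuous : continuous (@affine R n).
Proof.
apply/continuousP => U /lift_open oU.
have -> : @affine R n @^-1` U = (fun x => hc x) @^-1` lift_set U.
  by apply/seteqP; split=> x; [move=> Ux; exists (affine_neq0 x)|move=> /lift_setE; apply].
have : continuous (fun x : 'cV[R]_n => hc x).
  move=> x; apply: (@mx_cvg _ _ _ (nbhs_filter x)) => i j; elim/split_ord: i => [i|]; rewrite /hc.
    under eq_fun do rewrite col_mxEu; rewrite col_mxEu; exact: coord_continuous.
  under eq_fun do rewrite col_mxEd; rewrite col_mxEd; exact: cvg_cst.
by move/continuousP; apply.
Qed.

End ProjectiveTopology.

Section ChartContinuity.
Variables (R : realType) (n : nat) (psi : 'rV[R]_n).
Hypothesis Apsi : weyl psi.
Hypothesis n2 : (1 < n)%N.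
Implicit Types (i j l : 'I_n) (x z : 'cV[R]_n) (y : 'cV[R]_n.-1).
Local Notation t := (ctype psi).
Let n0 : (0 < n)%N := ltnW n2.

Lemma dom_open : open (dom_h psi).
Proof.
rewrite openE => x dx; rewrite /interior.
have : \forall z \near x, forall i, (i < t)%N -> 0 < (z : 'cV[R]_n) i 0.
  apply: (@filter_forall _ _ _ (nbhs x) (nbhs_filter x)) => i; case: (boolP (i < t)%N) => it; last by apply: filterE.
  have : nbhs x [set z : 'cV[R]_n | 0 < z i 0].
    apply: (@entry_nbhs _ _ _ x i 0 [set r : R | 0 < r]); apply: open_nbhs_nbhs.
    by split; [exact: open_gt|exact: dx].
  by apply: filterS.
by apply: filterS.
Qed.

Section Cvg.
Variables (T : Type) (F : set_system T).
Context {FF : Filter F}.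

Lemma lg_cvg (f : T -> 'cV[R]_n) x : dom_h psi x -> f @ F --> x -> (fun u => lg psi (f u)) @ F --> lg psi x.
Proof.
move=> dx fx; apply: mx_cvg => i j; rewrite ord1 lgE.
rewrite (_ : (fun u => _) = fun u => if (i < t)%N then sw psi i * ln (f u i 0) else f u i 0); last first.
  by apply/funext => u; rewrite lgE.
have fi : (fun u => f u i 0) @ F --> x i 0 by exact: entry_cvg.
case: ifP => it //; apply: cvgM; first exact: cvg_cst.
exact: (@cvg_comp _ _ _ (fun u => f u i 0) (@ln R) _ _ _ fi (continuous_ln (dx i it))).
Qed.

Lemma ex_cvg (f : T -> 'cV[R]_n) x : f @ F --> x -> (fun u => ex psi (f u)) @ F --> ex psi x.
Proof.
move=> fx; apply: mx_cvg => i j; rewrite ord1 exE.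
rewrite (_ : (fun u => _) = fun u => if (i < t)%N then expR (f u i 0 / sw psi i) else f u i 0); last first.
  by apply/funext => u; rewrite exE.
have fi : (fun u => f u i 0) @ F --> x i 0 by exact: entry_cvg.
case: ifP => it //.
have fs : (fun u => f u i 0 / sw psi i) @ F --> x i 0 / sw psi i by apply: cvgM; [exact: fi|exact: cvg_cst].
exact: (@cvg_comp _ _ _ _ (@expR R) _ _ _ fs (@continuous_expR R _)).
Qed.

Lemma hq_cvg (f : T -> 'cV[R]_n) x : f @ F --> x -> (fun u => hq psi (f u)) @ F --> hq psi x.
Proof.
move=> fx; have fi i : (fun u => f u i 0) @ F --> x i 0 by exact: entry_cvg.
rewrite /hq /ell; apply: cvgD.
  apply: cvgN; apply: cvgD; apply: sum_cvg => i _ //.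
  by apply: cvgM => //; exact: cvg_cst.
apply: cvgM; first exact: cvg_cst.
by apply: sum_cvg => i _; exact: (cvgM (fi i) (fi i)).
Qed.

Lemma Yc_cvg (f : T -> 'cV[R]_n) x : dom_h psi x -> f @ F --> x -> (fun u => Yc psi (f u)) @ F --> Yc psi x.
Proof. by move=> dx fx; apply: mulmx_cvg; [exact: cvg_cst|exact: lg_cvg]. Qed.

Lemma horo_cvg (f : T -> 'cV[R]_n) x : dom_h psi x -> f @ F --> x ->
  (fun u => horo_fun psi (f u)) @ F --> horo_fun psi x.
Proof.
move=> dx fx; rewrite horo_funE//.
rewrite (_ : (fun u => _) = fun u => hq psi (lg psi (f u))); last by apply/funext => u; rewrite horo_funE.
by apply: hq_cvg; exact: lg_cvg.
Qed.

Lemma Ph_cvg (f : T -> 'cV[R]_n.-1) (g : T -> R) y s : f @ F --> y -> g @ F --> s ->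
  (fun u => Ph psi (f u) (g u)) @ F --> Ph psi y s.
Proof.
move=> fy gs; have Uf : (fun u => Um psi *m f u) @ F --> Um psi *m y by apply: mulmx_cvg => //; exact: cvg_cst.
apply: ex_cvg; apply: mx_cvg => i j; rewrite ord1 !(mxDE, mxZE).
rewrite (_ : (fun u => _) = fun u => (Um psi *m f u) i 0 + (g u + hq psi (Um psi *m f u)) * wv psi i 0); last first.
  by apply/funext => u; rewrite mxDE mxZE.
apply: cvgD; first exact: entry_cvg.
by apply: cvgM; [apply: cvgD => //; exact: hq_cvg|exact: cvg_cst].
Qed.

End Cvg.

Lemma Ph_near y s (e : R) : 0 < e -> exists2 d : R, 0 < d &
  forall y', en (y' - y) < d -> forall i, `|Ph psi y' s i 0 - Ph psi y s i 0| < e.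
Proof.
move=> e0; have H : (fun y' => Ph psi y' s) @ y --> Ph psi y s.
  by apply: (@Ph_cvg _ _ (nbhs_filter y) id (fun=> s)); [exact: cvg_id|exact: cvg_cst].
have /H : nbhs (Ph psi y s) [set x | en (x - Ph psi y s) < e] by apply/nbhs_en; exists e.
move=> /nbhs_en[d d0 Hd]; exists d => // y' /Hd /= h i.
by apply: le_lt_trans h; have := coord_le_en (Ph psi y' s - Ph psi y s) i; rewrite mxDE mxNE.
Qed.

Lemma dom_basepointD (j : 'I_n) : dom_h psi (basepoint psi + delta_mx j 0).
Proof.
move=> i it; rewrite mxDE !mxE it andbT; apply: ltr_wpDr => //.
Qed.

(** An affine map is determined by its values at the basepoint and at basepoint + e_j, all of which
    lie in the domain. The explicit formulas turn closeness at these n + 1 points into closeness of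
    matrices. *)
Lemma aff_dom_cols N v (f : 'cV[R]_n -> 'cV[R]_n) : (forall x, dom_h psi x -> f x = N *m x + v) ->
  (forall i j, N i j = f (basepoint psi + delta_mx j 0) i 0 - f (basepoint psi) i 0) /\
  (forall i, v i 0 = f (basepoint psi) i 0 - \sum_j N i j * basepoint psi j 0).
Proof.
move=> H; have db : dom_h psi (basepoint psi) by exact: basepoint_dom.
split=> [i j|i]; last by rewrite H// mxDE mxE addrAC subrr add0r.
rewrite (H _ (dom_basepointD j)) H// mulmxDr -colE !mxDE [col _ _ _ _]mxE; ring.
Qed.

Lemma aff_dom_eq (N N' : 'M[R]_n) (v v' : 'cV[R]_n) : (forall x, dom_h psi x -> N *m x + v = N' *m x + v') -> N = N' /\ v = v'.
Proof.
move=> H; have [E1 E2] := aff_dom_cols (fun x _ => erefl (N *m x + v)).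
have [E1' E2'] := aff_dom_cols (f := fun x => N *m x + v) H.
have e : N = N' by apply/matrixP => i j; rewrite E1 E1'.
by split=> //; apply/colP => i; rewrite E2 E2' e.
Qed.

Lemma Gpsi_ext g h : Gpsi psi g -> Gpsi psi h ->
  (forall x, dom_h psi x -> act g (affine x) = act h (affine x)) -> g = h.
Proof.
move=> /(Gpsi_form Apsi n2)[N [v [u [-> _]]]] /(Gpsi_form Apsi n2)[N' [v' [u' [-> _]]]] H.
have [|eN ev] := @aff_dom_eq N N' v v'.
  by move=> x /H; rewrite !act_aff => /affine_inj.
by apply: pgl_congr; rewrite eN ev.
Qed.

Lemma isoP_inj g h a : isoP psi g a -> isoP psi h a -> g = h.
Proof.
move=> Hg Hh; apply: Gpsi_ext; [exact: (isoP_Gpsi Apsi n2 Hg)|exact: (isoP_Gpsi Apsi n2 Hh)|].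
by move=> x /(Ph_surj Apsi n2)[y [s ->]]; rewrite Hg Hh.
Qed.

End ChartContinuity.

(** * Lattices as discrete cocompact groups of isometries *)

Section LatticeIsometries.
Variables (R : realType) (n : nat) (psi : 'rV[R]_n).
Hypothesis Apsi : weyl psi.
Hypothesis n2 : (1 < n)%N.
Implicit Types (i j l : 'I_n) (x z : 'cV[R]_n) (y : 'cV[R]_n.-1) (a : isom R n.-1) (Gamma : set (PGL R n)).
Local Notation t := (ctype psi).
Let n0 : (0 < n)%N := ltnW n2.

Definition isoms Gamma : set (isom R n.-1) := [set a | exists2 g, Gamma g & isoP psi g a].

Lemma isoms_subgroup Gamma : is_subgroup Gamma -> is_subgroup (isoms Gamma).
Proof.
move=> [G1 GM GV]; split; first by exists 1%g => //; exact: isoP1.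
  move=> a b [g Gg ga] [h Gh hb]; exists (g * h)%g; [exact: GM|exact: isoPM].
by move=> a [g Gg ga]; exists g^-1%g; [exact: GV|exact: isoPV].
Qed.

Lemma isom_act_near (e : R) a y : near1 e a -> en (trans a) <= e -> en (isom_act a y - y) <= e * (en y + 1).
Proof.
move=> na ta; rewrite /isom_act addrAC mulrDr mulr1.
by apply: le_trans (en_triangle _ _) _; rewrite lerD// na.
Qed.

(** An isometry close to 1 moves the n + 1 test points of [aff_dom_cols] by little, so the matrix is
    close to 1 and discreteness in PGL applies. *)
Lemma isoms_discrete Gamma : is_subgroup Gamma -> discrete Gamma -> Gamma `<=` Gpsi psi ->
  metrically_discrete (isoms Gamma).
Proof.
move=> [G1 _ _] /(_ _ G1)[U nU UG] GG; have [e e0 He] := pgl_nbhs1 nU.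
(* An entry of N is off by less than 2 eta and one of v by less than (2 n + 1) eta; both are at most
   e. *)
pose eta := e / (2 * n%:R + 2).
have D0 : 0 < 2 * n%:R + 2 :> R by rewrite ltr_wpDl// mulr_ge0.
have eta0 : 0 < eta by rewrite divr_gt0.
pose P (x : 'cV[R]_n) (d : R) := forall g a, isoP psi g a -> near1 d a -> en (trans a) <= d ->
   forall x', act g (affine x) = affine x' -> forall i, `|x' i 0 - x i 0| < eta.
have HP x : dom_h psi x -> \forall d \near 0^'+, P x d.
  move=> /(Ph_surj Apsi n2)[y [s ->]]; have [r r0 Hr] := Ph_near psi y s eta0.
  have y1 : 0 < en y + 1 by rewrite ltr_wpDl// en_ge0.
  have : \forall d \near (0 : R)^'+, d < r / (en y + 1) by apply: nbhs_right_lt; rewrite divr_gt0.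
  apply: filterS => d; rewrite ltr_pdivlMr// => dr g a ga na ta x'; rewrite ga => /affine_inj <- i.
  by apply: Hr; apply: le_lt_trans dr; exact: isom_act_near.
have H1 : \forall d \near (0 : R)^'+, forall j, P (basepoint psi + delta_mx j 0) d.
  by apply: filter_forall => j; apply: HP; exact: dom_basepointD.
have H2 := HP _ (basepoint_dom (psi := psi)).
have H3 : \forall d \near (0 : R)^'+, 0 < d by exact: nbhs_right_gt.
have [d [h1 h2 d0]] : exists d : R, [/\ forall j, P (basepoint psi + delta_mx j 0) d, P (basepoint psi) d & 0 < d].
  by apply: (@filter_ex _ (0 : R)^'+); near=> d; split; near: d.
exists d => // a [g Gg ga] na ta.
suff g1 : g = 1%g by rewrite g1 in ga; apply: (isoP_uniq Apsi n2 ga); exact: isoP1.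
have : (U `&` Gamma) g; last by rewrite UG.
split=> //; have [N [v [u [gE [rho [al A]]]]]] := Gpsi_form Apsi n2 (GG _ Gg).
have gx x : act g (affine x) = affine (N *m x + v) by rewrite gE act_aff.
have [E1 E2] := aff_dom_cols (psi := psi) (fun x _ => erefl (N *m x + v)).
have hb i : `|(N *m basepoint psi + v) i 0 - basepoint psi i 0| < eta by apply: (h2 _ _ ga na ta); rewrite gx.
have hN i j : `|N i j - (i == j)%:R| < 2 * eta.
  have := h1 j _ _ ga na ta _ (gx _) i; have := hb i.
  have -> : N i j - (i == j)%:R = ((N *m (basepoint psi + delta_mx j 0) + v) i 0 -
      (basepoint psi + delta_mx j 0 : 'cV_n) i 0) - ((N *m basepoint psi + v) i 0 - basepoint psi i 0).
    rewrite (E1 i j) [(_ + delta_mx j 0 : 'cV_n) i 0]mxDE [(delta_mx j 0 : 'cV[R]_n) i 0]mxE andbT; ring.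
  have := ler_normB ((N *m (basepoint psi + delta_mx j 0) + v) i 0 -
      (basepoint psi + delta_mx j 0 : 'cV_n) i 0) ((N *m basepoint psi + v) i 0 - basepoint psi i 0).
  by clear; lra.
have hv i : `|v i 0| < e.
  have -> : v i 0 = ((N *m basepoint psi + v) i 0 - basepoint psi i 0) -
      \sum_j (N i j - (i == j)%:R) * basepoint psi j 0.
    rewrite (E2 i); under [in RHS]eq_bigr do rewrite mulrBl; rewrite sumrB.
    have -> : \sum_j (i == j)%:R * basepoint psi j 0 = basepoint psi i 0.
      rewrite (bigD1 i)//= eqxx mul1r big1 ?addr0// => j /negbTE ji; by rewrite eq_sym ji mul0r.
    ring.
  apply: le_lt_trans (ler_normB _ _) _.
  have : `|\sum_j (N i j - (i == j)%:R) * basepoint psi j 0| <= n%:R * (2 * eta).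
    apply: le_trans (ler_norm_sum _ _ _) _.
    rewrite [leRHS](_ : _ = \sum_(j < n) (2 * eta)); last by rewrite sumr_const card_ord -[RHS]mulr_natl.
    apply: ler_sum => j _; rewrite normrM; apply: le_trans (_ : `|N i j - (i == j)%:R| * 1 <= _).
      by rewrite ler_wpM2l// [basepoint _ _ _]mxE; case: (j < ctype psi)%N; rewrite ?normr1 ?normr0.
    by rewrite mulr1 ltW.
  have := hb i; have : eta * (2 * n%:R + 2) = e by rewrite divfK ?gt_eqF.
  lra.
have [ELL [ELZ EZL EZZ]] := aff_mxE N v.
have eta2 : 2 * eta <= e.
  have : eta * (2 * n%:R + 2) = e by rewrite divfK ?gt_eqF.
  have : 0 <= eta * n%:R by rewrite mulr_ge0// ltW.
  lra.
rewrite gE; apply: He => a1 b1; elim/split_ord: a1 => [i|]; elim/split_ord: b1 => [j|].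
- by rewrite ELL (inj_eq (@lshift_inj _ _)); apply: lt_le_trans (hN i j) eta2.
- by rewrite ELZ (_ : (_ == _) = false) ?subr0// -val_eqE /= ltn_eqF// addn0.
- by rewrite EZL (_ : (_ == _) = false) ?subrr ?normr0// -val_eqE /= gtn_eqF// addn0.
- by rewrite EZZ eqxx subrr normr0.
Unshelve. all: by end_near. Qed.

(** The coset space is exhausted by the open sets of cosets with a representative that moves the
    basepoint to within k of itself in the coordinate y. One of them is everything, and its index
    serves as the radius. *)
Lemma isoms_coarse Gamma : lattice (Gpsi psi) Gamma -> coarse (isoms Gamma).
Proof.
move=> [[G1 GM GV] GG dG cG].
pose x0 : RP R n := affine (Ph psi 0 0).
pose W (k : nat) := dom_h psi `&` [set x | en (Yc psi x) < k%:R].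
have oW k : open (W k).
  rewrite openE => x [dx xk]; rewrite /interior.
  have h1 : nbhs x (dom_h psi) by apply: open_nbhs_nbhs; split=> //; exact: dom_open.
  have h2 : nbhs x [set z | en (Yc psi z) < k%:R].
    have H : (fun z => Yc psi z) @ x --> Yc psi x.
      by apply: (@Yc_cvg _ _ _ _ _ (nbhs_filter x) id) => //; exact: cvg_id.
    have H' := @cvg_comp _ _ _ _ (@en R n.-1) _ _ _ H (@en_continuous R _ _).
    apply: (H' [set r : R | r < k%:R]); apply: open_nbhs_nbhs.
    by split; [exact: open_lt|exact: xk].
  exact: filterI.
pose U (k : nat) : set (coset_space (Gpsi psi) Gamma) :=
  [set c | exists (x : set_type (Gpsi psi)) g, [/\ Gamma g, c = fiber_pi _ x &
     (@affine R n @` W k) (act (val x) (act g x0))]].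
have UE k : fiber_pi _ @^-1` U k = [set x : set_type (Gpsi psi) | exists2 g, Gamma g & (@affine R n @` W k) (act (val x) (act g x0))].
  apply/seteqP; split=> x; last by move=> [g Gg H]; exists x, g.
  move=> [x' [g [Gg /fiber_piP e H]]].
  have : lcoset (val x') Gamma (val x') by exists 1%g => //; rewrite mulg1.
  rewrite -e => -[h Gh xE]; exists (h * g)%g; first exact: GM.
  by rewrite -actM mulgA xE actM.
have [|||k Uk] := @compact_exhaustion _ U cG.
- move=> k; apply/fiber_open; rewrite UE.
  rewrite (_ : mkset _ = \bigcup_(g in Gamma) (set_val @^-1` [set k' | (@affine R n @` W k) (act k' (act g x0))])); last first.
    by apply/seteqP; split=> x [g Gg H]; exists g.
  apply: bigcup_open => g Gg; apply/sub_open; eexists; last reflexivity.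
  by apply: orbit_open; exact: affine_open.
- move=> i j ij c [x [g [Gg cE [z [dz zi] e]]]]; exists x, g; split=> //; exists z => //; split=> //.
  by apply: lt_le_trans zi _; rewrite ler_nat.
- move=> c; rewrite -(fiber_reprK c); case: (fiber_repr c) => x hx.
  have [a xa] := Gpsi_isoP Apsi n2 (set_mem hx).
  exists (Num.bound (en (trans a))), (exist _ x hx), 1%g; split=> //.
  rewrite act1 /= xa; exists (Ph psi (isom_act a 0) 0) => //; split; first exact: Ph_dom.
  by rewrite /= Yc_Ph// /isom_act mulmx0 add0r archi_boundP// en_ge0.
exists k%:R => y.
(* Applied to the translation by -y: some h in Gamma moves 0 to within k of y, so its inverse moves
   y to within k of 0. *)
have : (fiber_pi _ @^-1` U k) (exist _ (tr_pgl psi (- y)) (mem_set (tr_pgl_Gpsi Apsi n0 (- y)))) by rewrite Uk.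
rewrite UE => -[h Gh]; rewrite /= -actM => -[w [dw wk] we].
have [b hb] := Gpsi_isoP Apsi n2 (GG _ Gh).
exists b^-1%g; first by exists h^-1%g; [exact: GV|exact: isoPV].
have := isoPM (isoP_tr Apsi n2 (- y)) hb => /(_ 0 0).
rewrite -/x0 -we => /affine_inj wE; move: wk; rewrite wE /= Yc_Ph//.
rewrite isom_actM isom_act_tr => bk.
rewrite -[isom_act b^-1%g y]subr0 -{1}(isom_actVK b 0) isom_act_dist enB.
exact/ltW.
Qed.

(** The double centralizer is coarse and consists of translations, and an element of Gamma that acts
    as a translation of R^(n-1) is a [tr_pgl]. *)
Lemma lattice_translations Gamma : lattice (Gpsi psi) Gamma ->
  exists2 Delta, coarse_set Delta & forall y, Delta y -> Gamma (tr_pgl psi y).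
Proof.
move=> lG; have [sG GG dG cG] := lG.
have sL := isoms_subgroup sG; have dL := isoms_discrete sG dG GG; have cL := isoms_coarse lG.
have [D HD] := bicommutant_coarse sL cL.
exists [set y | bicommutant (isoms Gamma) (tr_isom y)].
  exists D => y; have [a Ba q] := HD (- y); exists (trans a).
    by rewrite /= (_ : tr_isom _ = a)//; apply: isom_eq => //; rewrite (bicommutant_translation sL dL cL Ba).
  by move: q; rewrite /isom_act (bicommutant_translation sL dL cL Ba) mul1mx addrC enB.
move=> y [[g Gg gy] _]; rewrite (_ : tr_pgl psi y = g)//.
by apply: (isoP_inj Apsi n2 (isoP_tr Apsi n2 y)).
Qed.

End LatticeIsometries.

Section ClusterPoints.

Lemma compact_seq_cluster (T : topologicalType) (K : set T) (u : nat -> T) : compact K -> (forall k, K (u k)) ->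
  exists2 x, K x & forall (U : set T) (k : nat), nbhs x U -> exists2 l, (k <= l)%N & U (u l).
Proof.
move=> cK uK; have [|x [Kx cx]] := cK (u @ \oo) (fmap_proper_filter _ _); first by exists 0%N => // k _; exact: uK.
exists x => // U k nU; have [|_ [[l /= kl <-] Ul]] := cx [set u l | l in [set l | (k <= l)%N]] U _ nU.
  by exists k => // l /= kl; exists l.
by exists l.
Qed.

Lemma ball_compact (R : realType) m (D : R) : compact [set y : 'cV[R]_m | en y <= D].
Proof.
have cT : continuous (@trmx R 1 m) by move=> v; apply: (@mx_cvg _ _ _ (nbhs_filter v)) => i j; under eq_fun do rewrite mxE; rewrite mxE; exact: coord_continuous.
have -> : [set y : 'cV[R]_m | en y <= D] = @trmx R 1 m @` [set v : 'rV[R]_m | en v^T <= D].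
  by apply/seteqP; split=> [y yD|_ [v vD <-]//]; exists y^T; rewrite /= ?trmxK.
apply: continuous_compact; first by apply: continuous_subspaceT.
apply: bounded_closed_compact.
  exists D; split; first exact: num_real.
  move=> M DM v vD; have en0' : 0 <= M by apply: le_trans (ltW DM); apply: le_trans vD; exact: en_ge0.
  rewrite /= /Num.norm /= mx_normrE; apply/bigmax_leP; split=> // -[i j] _ /=.
  rewrite ord1; apply: le_trans (ltW DM); apply: le_trans vD.
  by have := coord_le_en v^T j; rewrite mxE.
have c : continuous (fun v : 'rV[R]_m => en v^T).
  by move=> v; exact: (@cvg_comp _ _ _ (@trmx R 1 m) (@en R m) _ _ _ (cT v) (@en_continuous R m _)).
rewrite (_ : mkset _ = (fun v : 'rV[R]_m => en v^T) @^-1` [set r | r <= D])//.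
by apply: closed_comp => [v _|]; [exact: c|exact: closed_le].
Qed.

End ClusterPoints.

(** * Proper discontinuity, torsion and a uniform displacement *)

Section ProperDiscontinuity.
Variables (R : realType) (m : nat) (L : set (isom R m)).
Hypothesis sL : is_subgroup L.
Hypothesis dL : metrically_discrete L.
Hypothesis cL : coarse L.
Implicit Types (y : 'cV[R]_m) (a b : isom R m).

(** L is covered by finitely many cosets of a group of translations, and within one coset at most
    one element brings y closer to y' than half the discreteness constant. *)
Lemma proper_discontinuity y y' : exists2 e : R, 0 < e & forall a, L a -> en (isom_act a y - y') < e -> isom_act a y = y'.
Proof.
have [s sL' sP] := bicommutant_finite_index sL; have [e e0 He] := dL.
have [LK1 LKM LKV] := bicommutant_subgroup sL.
have one g : exists2 d : R, 0 < d & forall k, bicommutant L k ->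
    en (isom_act (g * k)%g y - y') < d -> isom_act (g * k)%g y = y'.
  (* If the one element k0 that comes close misses y', its distance is a valid radius: an element
     that comes closer still would equal k0. *)
  have [[k0 [Bk0 k0e k0n]]|H] := pselect (exists k, [/\ bicommutant L k, en (isom_act (g * k)%g y - y') < e / 2 & isom_act (g * k)%g y != y']).
    exists (en (isom_act (g * k0)%g y - y')); first by rewrite en_gt0 ?subr_eq0.
    move=> k Bk ke; suff kk : k = k0 by rewrite kk ltxx in ke.
    have tk := bicommutant_translation sL dL cL Bk; have tk0 := bicommutant_translation sL dL cL Bk0.
    have B : bicommutant L (k0^-1 * k)%g by apply: LKM => //; exact: LKV.
    have : (k0^-1 * k)%g = 1%g.
      apply: He; first by case: B.
        move=> x; rewrite (bicommutant_translation sL dL cL B) mul1mx subrr en0.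
        by rewrite mulr_ge0 ?en_ge0// ltW.
      have -> : trans (k0^-1 * k)%g = isom_act k0^-1%g (isom_act k y) - y.
        by rewrite -isom_actM /isom_act (bicommutant_translation sL dL cL B) mul1mx addrC addKr.
      rewrite -{2}(isom_actVK k0 y) isom_act_dist -(isom_act_dist g) -!isom_actM.
      rewrite -(subrK y' (isom_act (g * k)%g y)) -addrA; apply: le_trans (en_triangle _ _) _.
      rewrite [X in _ + X]enB; lra.
    by move=> /(canRL (mulKg _)); rewrite invgK mulg1.
  exists (e / 2); first lra.
  by move=> k Bk ke; apply/eqP; apply: contrapT => /negP kn; apply: H; exists k.
have {sL'} [d d0 Hd] : exists2 d : R, 0 < d & forall g, g \in s -> forall k, bicommutant L k ->
    en (isom_act (g * k)%g y - y') < d -> isom_act (g * k)%g y = y'.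
  elim: s {sP sL'} => [|g s [d d0 IH]]; first by exists 1.
  have [d' d'0 H'] := one g; exists (Num.min d d'); first by rewrite lt_min d0.
  move=> g'; rewrite inE => /orP[/eqP ->|gs] k Bk; rewrite lt_min => /andP[h h']; [exact: H'|exact: (IH g')].
exists d => // a La; have [g gs Bg] := sP a La.
by rewrite -[a]mul1g -(mulgV g) -mulgA; exact: Hd.
Qed.

(** Pigeonhole: two powers of a lie in the same coset of the double centralizer, which has finite
    index. *)
Lemma bicommutant_power a : L a -> exists k, bicommutant L (a ^+ k.+1)%g.
Proof.
move=> La; have [s sL' sP] := bicommutant_finite_index sL.
have [LK1 LKM LKV] := bicommutant_subgroup sL; have [L1 LM LV] := sL.
have Lk k : L (a ^+ k)%g by elim: k => [|k IH]; rewrite ?expg0// expgS; exact: LM.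
have /choice[f Hf] : forall k : nat, exists g, g \in s /\ bicommutant L (g^-1 * a ^+ k)%g.
  by move=> k; have [g gs Bg] := sP _ (Lk k); exists g.
have [i [j [ij fij]]] : exists i j, (i < j)%N /\ f i = f j.
  apply: contrapT => H; have : uniq [seq f k | k <- iota 0 (size s).+1].
    rewrite map_inj_in_uniq ?iota_uniq// => i j _ _ fij.
    by have [ij|ij|//] := ltngtP i j; exfalso; apply: H; [exists i, j|exists j, i].
  move=> us; suff : (size [seq f k | k <- iota 0 (size s).+1] <= size s)%N.
    by rewrite size_map size_iota ltnn.
  by apply: uniq_leq_size => // _ /mapP[k _ ->]; case: (Hf k).
exists (j - i.+1)%N; have -> : (a ^+ (j - i.+1).+1)%g = (((f i)^-1 * a ^+ i)^-1 * ((f j)^-1 * a ^+ j))%g.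
  rewrite -fij invgM invgK !mulgA mulgK -{2}(subnKC (ltnW ij)) expgnDr mulgA mulVg mul1g.
  by rewrite -subSn// subSS.
by apply: LKM; [apply: LKV; case: (Hf i)|case: (Hf j)].
Qed.

(** Some power of a is a translation; as it fixes y, it is trivial. *)
Lemma fixed_point_torsion a y : L a -> isom_act a y = y -> exists k, (a ^+ k.+1)%g = 1%g.
Proof.
move=> La ay; have [k Bk] := bicommutant_power La; exists k.
have ky j : isom_act (a ^+ j)%g y = y.
  by elim: j => [|j IH]; rewrite ?expg0 ?isom_act1// expgS isom_actM IH.
have r1 := bicommutant_translation sL dL cL Bk.
apply: isom_eq; first by rewrite r1 rot1.
by have := ky k.+1; rewrite /isom_act r1 mul1mx => /(canRL (addKr _)); rewrite addNr trans1.
Qed.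

Hypothesis fL : forall a y, L a -> isom_act a y = y -> a = 1%g.

(** A sequence of nontrivial elements with displacements tending to 0 can be conjugated so that the
    displaced points lie in a fixed ball. At a cluster point y, [proper_discontinuity] makes y a
    fixed point of one of the elements. *)
Lemma uniform_radius : exists2 e : R, 0 < e & forall a y, L a -> en (isom_act a y - y) < e -> a = 1%g.
Proof.
have [L1 LM LV] := sL; have [D HD] := cL; apply: contrapT => H.
have /choice[f Hf] : forall k : nat, exists p : isom R m * 'cV[R]_m,
    [/\ L p.1, en p.2 <= D, en (isom_act p.1 p.2 - p.2) < k.+1%:R^-1 & p.1 <> 1%g].
  move=> k; apply: contrapT => nk; apply: H; exists k.+1%:R^-1; first by rewrite invr_gt0.
  move=> a y La ay; apply: contrapT => a1; apply: nk; have [b Lb by_] := HD y.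
  exists (b * a * b^-1, isom_act b y)%g => /=; split=> //; first exact: (LM _ _ (LM _ _ Lb La) (LV _ Lb)).
    by rewrite !isom_actM isom_actVK isom_act_dist.
  move=> e1; apply: a1; have := congr1 (fun x => b^-1 * x * b)%g e1.
  by rewrite mulg1 mulVg !mulgA mulVg mul1g -mulgA mulVg mulg1.
have [|y _ cy] := compact_seq_cluster (u := fun k => (f k).2) (@ball_compact R m D) _.
  by move=> k; case: (Hf k).
have [e e0 He] := proper_discontinuity y y.
pose k := Num.bound (4 / e).
(* The displacement of y by [(f l).1] is then bounded by a sum of three terms below e / 4; [k] makes
   the middle one small. *)
have [|l kl /= yl] := cy [set z | en (z - y) < e / 4] k; first by apply/nbhs_en; exists (e / 4) => //; lra.
have [La _ al a1] := Hf l; apply: a1; apply: (fL (y := y)) => //; apply: He => //.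
have : l.+1%:R^-1 < e / 4.
  rewrite invf_plt ?posrE ?divr_gt0// invf_div; apply: lt_le_trans (archi_boundP _) _; first by rewrite divr_ge0// ltW.
  by rewrite ler_nat (leq_trans kl).
have -> : isom_act (f l).1 y - y = (isom_act (f l).1 y - isom_act (f l).1 (f l).2) + ((isom_act (f l).1 (f l).2 - (f l).2) + ((f l).2 - y)).
  by mxring.
have t1 := en_triangle (isom_act (f l).1 y - isom_act (f l).1 (f l).2) ((isom_act (f l).1 (f l).2 - (f l).2) + ((f l).2 - y)).
have t2 := en_triangle (isom_act (f l).1 (f l).2 - (f l).2) ((f l).2 - y).
have e3 : en (isom_act (f l).1 y - isom_act (f l).1 (f l).2) < e / 4 by rewrite isom_act_dist enB.
move: t1 t2 e3 yl al; move: (en _) (en _) (en _) (en _) (en _) (l.+1%:R^-1) => *; lra.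
Qed.

End ProperDiscontinuity.

(** * Smooth maps *)

Section NearEqual.
Import landau.
Variable R : realType.
Implicit Types V W : normedModType R.

Lemma near_eq_differentiable V W (f g : V -> W) (x : V) :
  (\forall y \near x, f y = g y) -> differentiable f x -> differentiable g x.
Proof.
move=> fg df; have [cdf /eqaddoP Ef] := (diff_locallyP x f).1 df.
have fgx : f x = g x := nbhs_singleton fg.
have sx : (fun h : V => h + x) @ (0 : V) --> x.
  by rewrite -[X in _ --> X]add0r; apply: cvgD; [exact: cvg_id|exact: cvg_cst].
have Eg : g \o shift x = cst (g x) + 'd f x +o_ (0 : V) id.
  apply/eqaddoP => e e0; near=> h.
  have fh : f (h + x) = g (h + x) by near: h; exact: (sx _ fg).
  have Hh : `|(f \o shift x - (cst (f x) + 'd f x)) h| <= e * `|id h| by near: h; exact: Ef.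
  by move: Hh; rewrite /= !fctE /= fh fgx.
by apply/diff_locallyP; split; rewrite (diff_unique cdf Eg).
Unshelve. all: by end_near. Qed.

End NearEqual.

Section SmoothCalculus.
Variable R : realType.
Implicit Types V W : normedModType R.

Lemma CkS V W k (U : set V) (f : V -> W) :
  Ck k.+1 U f <-> (forall x, U x -> differentiable f x) /\ (forall v, Ck k U ('D_v f)).
Proof. by []. Qed.

Variable V : normedModType R.
Variable U : set V.
Hypothesis oU : open U.

Lemma Ck_ext W k (f g : V -> W) : (forall x, U x -> f x = g x) -> Ck k U f -> Ck k U g.
Proof.
elim: k f g => [|k IH] f g fg.
  move=> cf x Ux; have nfg : \forall y \near x, f y = g y.
    by apply: filterS (open_nbhs_nbhs (conj oU Ux)) => y; exact: fg.
  have := cf x Ux; rewrite /prop_for /continuous_at fg// => cfx; apply: cvg_trans cfx.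
  by apply: near_eq_cvg; apply: filterS nfg.
have nfg x : U x -> \forall y \near x, f y = g y.
  by move=> Ux; apply: filterS (open_nbhs_nbhs (conj oU Ux)) => y; exact: fg.
move=> /CkS[df ckf]; apply/CkS; split=> [x Ux|v].
  by apply: near_eq_differentiable (df x Ux); exact: nfg.
by apply: (IH ('D_v f)) => // x Ux; apply: near_eq_derive; exact: nfg.
Qed.

Lemma Ck_pred W k (f : V -> W) : Ck k.+1 U f -> Ck k U f.
Proof.
elim: k f => [|k IH] f /CkS[df ckf]; first by move=> x Ux; exact/differentiable_continuous/df.
by apply/CkS; split=> // v; exact: IH.
Qed.

Lemma Ck_cst W k (c : W) : Ck k U (fun=> c).
Proof.
elim: k c => [|k IH] c; first by move=> x _; exact: cvg_cst.
apply/CkS; split=> [x _|v]; first exact: differentiable_cst.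
by rewrite (_ : 'D_v _ = fun=> 0)//; apply/funext => x; exact: derive_cst.
Qed.

Lemma Ck_add W k (f g : V -> W) : Ck k U f -> Ck k U g -> Ck k U (fun x => f x + g x).
Proof.
elim: k f g => [|k IH] f g; first by move=> cf cg x Ux; apply: cvgD; [exact: cf|exact: cg].
move=> /CkS[df ckf] /CkS[dg ckg]; apply/CkS; split=> [x Ux|v]; first by apply: differentiableD; [exact: df|exact: dg].
apply: (@Ck_ext _ _ (fun x => 'D_v f x + 'D_v g x)); last exact: IH.
by move=> x Ux; rewrite deriveD//; apply: diff_derivable; [exact: df|exact: dg].
Qed.

Lemma Ck_mul k (f g : V -> R) : Ck k U f -> Ck k U g -> Ck k U (fun x => f x * g x).
Proof.
elim: k f g => [|k IH] f g; first by move=> cf cg x Ux; apply: cvgM; [exact: cf|exact: cg].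
move=> cf cg; have /CkS[df ckf] := cf; have /CkS[dg ckg] := cg.
apply/CkS; split=> [x Ux|v]; first by apply: differentiableM; [exact: df|exact: dg].
apply: (@Ck_ext _ _ (fun x => f x * 'D_v g x + g x * 'D_v f x)).
  by move=> x Ux; rewrite deriveM//; apply: diff_derivable; [exact: df|exact: dg].
by apply: Ck_add; apply: IH => //; exact: Ck_pred.
Qed.

Lemma Ck_sum (W : normedModType R) k (J : Type) (r : seq J) (P : pred J) (F : J -> V -> W) :
  (forall j, P j -> Ck k U (F j)) -> Ck k U (fun x => \sum_(j <- r | P j) F j x).
Proof.
move=> H; elim: r => [|j r IH].
  by under eq_fun do rewrite big_nil; exact: Ck_cst.
under eq_fun do rewrite big_cons; case: (boolP (P j)) => // Pj; apply: Ck_add => //; exact: H.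
Qed.

Lemma Ck_lin_comp W W' k (l : {linear W -> W'}) (f : V -> W) : continuous l -> Ck k U f -> Ck k U (fun x => l (f x)).
Proof.
move=> cl; elim: k f => [|k IH] f.
  by move=> cf x Ux; exact: (@cvg_comp _ _ _ f l _ _ _ (cf x Ux) (cl (f x))).
move=> /CkS[df ckf]; have dl y : differentiable l y by exact: linear_differentiable.
apply/CkS; split=> [x Ux|v]; first by apply: (@differentiable_comp _ _ _ _ f l) => //; exact: df.
apply: (@Ck_ext _ _ (fun x => l ('D_v f x))); last exact: IH.
move=> x Ux; rewrite !deriveE ?(diff_comp (f := f) (g := l))//=; try exact: df.
  by rewrite diff_lin.
by apply: (@differentiable_comp _ _ _ _ f l) => //; exact: df.
Qed.

Lemma Ck_id k : Ck k U (fun x : V => x).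
Proof.
case: k => [|k]; first by move=> x _; exact: cvg_id.
apply/CkS; split=> [x _|v]; first by apply: ex_diff.
rewrite (_ : 'D_v _ = fun=> v); first exact: Ck_cst.
by apply/funext => x; exact: derive_id.
Qed.

(** One induction on k serves exp, inverse and logarithm: the hypothesis on phi1 may assume that phi
    o f is already of class C^k, which suits exp, where phi1 = phi, and the inverse, where phi1 =
    -phi^2. *)
Lemma Ck_scalar (phi phi1 : R -> R) (D : set R) :
  (forall y, D y -> is_derive y 1 phi (phi1 y)) ->
  (forall k f, Ck k U f -> (forall x, U x -> D (f x)) -> Ck k U (phi \o f) -> Ck k U (phi1 \o f)) ->
  forall k f, Ck k U f -> (forall x, U x -> D (f x)) -> Ck k U (phi \o f).
Proof.
move=> dphi H; have dp y : D y -> differentiable phi y.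
  by move=> Dy; apply/derivable1_diffP; have [] := dphi y Dy.
elim=> [|k IH] f.
  move=> cf fD x Ux; have cp := differentiable_continuous (dp _ (fD x Ux)).
  exact: (@cvg_comp _ _ _ f phi _ _ _ (cf x Ux) cp).
move=> cf fD; have /CkS[df ckf] := cf.
apply/CkS; split=> [x Ux|v]; first by apply: differentiable_comp; [exact: df|exact/dp/fD].
apply: (@Ck_ext _ _ (fun x => (phi1 \o f) x * 'D_v f x)); last first.
  by apply: Ck_mul => //; apply: H => //; [exact: Ck_pred|apply: IH => //; exact: Ck_pred].
move=> x Ux; have dpx := dp _ (fD x Ux); have dfx := df x Ux.
rewrite (deriveE _ dfx) (deriveE _ (differentiable_comp dfx dpx)) (diff_comp dfx dpx) /=.
rewrite deriv1E; last by have [] := dphi _ (fD x Ux).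
by rewrite derive1E (derive_val (is_derive := dphi _ (fD x Ux))) mulrC.
Qed.

Lemma Ck_exp k (f : V -> R) : Ck k U f -> Ck k U (fun x => expR (f x)).
Proof. by move=> cf; apply: (@Ck_scalar expR expR setT). Qed.

Lemma Ck_inv k (f : V -> R) : Ck k U f -> (forall x, U x -> f x != 0) -> Ck k U (fun x => (f x)^-1).
Proof.
apply: (@Ck_scalar GRing.inv (fun y => - (y^-1 * y^-1)) [set y | y != 0]).
  move=> y /= y0; have := @is_deriveV R id y 1 1 y0 (is_derive_id y 1).
  suff -> : (- y ^- 2)%:A = - (y^-1 * y^-1) by [].
  by rewrite -[LHS]/(- y ^- 2 * 1) mulr1 expr2 invfM.
move=> j g cg gD cg'; rewrite (_ : _ \o g = fun x => (-1) * ((g x)^-1 * (g x)^-1)).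
  by apply: Ck_mul; [exact: Ck_cst|apply: Ck_mul].
by apply/funext => x; rewrite mulN1r.
Qed.

Lemma Ck_ln k (f : V -> R) : Ck k U f -> (forall x, U x -> 0 < f x) -> Ck k U (fun x => ln (f x)).
Proof.
apply: (@Ck_scalar (@ln R) GRing.inv [set y | 0 < y]) => j g cg gD _.
by apply: Ck_inv => // x /gD; exact: lt0r_neq0.
Qed.

(** A named linear map, so that [Ck_lin_comp] applies to the extraction of an entry. *)
Definition coordf m p (i : 'I_m) (j : 'I_p) (M : 'M[R]_(m, p)) : R := M i j.
Lemma coordf_linear m p i j : linear (@coordf m p i j).
Proof. by move=> a M N; rewrite /coordf mxDE mxZE. Qed.
HB.instance Definition _ m p i j := GRing.isLinear.Build _ _ _ _ (@coordf m p i j) (@coordf_linear m p i j).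

Lemma Ck_coord k m p (f : V -> 'M[R]_(m, p)) i j : Ck k U f -> Ck k U (fun x => f x i j).
Proof. by move=> cf; apply: (@Ck_lin_comp _ _ _ (@coordf m p i j)) => //; exact: coord_continuous. Qed.

Definition scalev W (w : W) (a : R) : W := a *: w.
Lemma scalev_linear W (w : W) : linear (scalev w).
Proof. by move=> a b c; rewrite /scalev scalerDl scalerA. Qed.
HB.instance Definition _ W (w : W) := GRing.isLinear.Build _ _ _ _ (scalev w) (scalev_linear w).

Lemma Ck_mx k m p (f : V -> 'M[R]_(m, p)) : (forall i j, Ck k U (fun x => f x i j)) -> Ck k U f.
Proof.
move=> H; apply: (@Ck_ext _ _ (fun x => \sum_i \sum_j f x i j *: delta_mx i j)).
  by move=> x _; rewrite -matrix_sum_delta.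
apply: Ck_sum => i _; apply: Ck_sum => j _.
by apply: (@Ck_lin_comp _ _ _ (scalev (delta_mx i j))) => //; exact: scalel_continuous.
Qed.

Definition inl_pair W W' (w : W) : W * W' := (w, 0).
Lemma inl_pair_linear W W' : linear (@inl_pair W W').
Proof. by move=> a u v; apply/eqP; rewrite xpair_eqE /= scaler0 addr0 !eqxx. Qed.
HB.instance Definition _ W W' := GRing.isLinear.Build _ _ _ _ (@inl_pair W W') (@inl_pair_linear W W').
Definition inr_pair W W' (w : W') : W * W' := (0, w).
Lemma inr_pair_linear W W' : linear (@inr_pair W W').
Proof. by move=> a u v; apply/eqP; rewrite xpair_eqE /= scaler0 addr0 !eqxx. Qed.
HB.instance Definition _ W W' := GRing.isLinear.Build _ _ _ _ (@inr_pair W W') (@inr_pair_linear W W').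

Lemma Ck_pair k W W' (f : V -> W) (g : V -> W') : Ck k U f -> Ck k U g -> Ck k U (fun x => (f x, g x)).
Proof.
move=> cf cg; rewrite (_ : (fun x => _) = fun x => inl_pair W' (f x) + inr_pair W (g x)); last first.
  by apply/funext => x; apply/eqP; rewrite xpair_eqE /= addr0 add0r !eqxx.
apply: Ck_add.
  by apply: (@Ck_lin_comp _ _ _ (@inl_pair W W')) => // w; apply: cvg_pair; [exact: cvg_id|exact: cvg_cst].
by apply: (@Ck_lin_comp _ _ _ (@inr_pair W W')) => // w; apply: cvg_pair; [exact: cvg_cst|exact: cvg_id].
Qed.

Definition fst_pair W W' (p : W * W') : W := p.1.
Lemma fst_pair_linear W W' : linear (@fst_pair W W'). Proof. by []. Qed.
HB.instance Definition _ W W' := GRing.isLinear.Build _ _ _ _ (@fst_pair W W') (@fst_pair_linear W W').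
Definition snd_pair W W' (p : W * W') : W' := p.2.
Lemma snd_pair_linear W W' : linear (@snd_pair W W'). Proof. by []. Qed.
HB.instance Definition _ W W' := GRing.isLinear.Build _ _ _ _ (@snd_pair W W') (@snd_pair_linear W W').

Lemma Ck_fst k W W' (f : V -> W * W') : Ck k U f -> Ck k U (fun x => (f x).1).
Proof. by move=> cf; apply: (@Ck_lin_comp _ _ _ (@fst_pair W W')) => // p; exact: cvg_fst. Qed.

Lemma Ck_snd k W W' (f : V -> W * W') : Ck k U f -> Ck k U (fun x => (f x).2).
Proof. by move=> cf; apply: (@Ck_lin_comp _ _ _ (@snd_pair W W')) => // p; exact: cvg_snd. Qed.

Lemma Ck_mulmx k m p q (M : 'M[R]_(m, p)) (f : V -> 'M[R]_(p, q)) : Ck k U f -> Ck k U (fun x => M *m f x).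
Proof.
move=> cf; apply: Ck_mx => i j; under eq_fun do rewrite mxE.
by apply: Ck_sum => l _; apply: Ck_mul; [exact: Ck_cst|exact: Ck_coord].
Qed.

Lemma Ck_exp2 k (f : V -> R) : Ck k U f -> Ck k U (fun x => f x ^+ 2).
Proof. by move=> cf; exact: Ck_mul. Qed.

Lemma Ck_opp k (f : V -> R) : Ck k U f -> Ck k U (fun x => - f x).
Proof. by move=> cf; under eq_fun do rewrite -mulN1r; apply: Ck_mul => //; exact: Ck_cst. Qed.

Variables (n : nat) (psi : 'rV[R]_n).
Hypothesis Apsi : weyl psi.

Lemma Ck_lg k (f : V -> 'cV[R]_n) : Ck k U f -> (forall x, U x -> dom_h psi (f x)) -> Ck k U (fun x => lg psi (f x)).
Proof.
move=> cf df; apply: Ck_mx => i j; rewrite ord1; under eq_fun do rewrite lgE.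
have ci : Ck k U (fun x => f x i 0) by exact: Ck_coord.
case: (boolP (i < ctype psi)%N) => // it; apply: Ck_mul; first exact: Ck_cst.
by apply: Ck_ln => // x Ux; exact: df.
Qed.

Lemma Ck_ex k (f : V -> 'cV[R]_n) : Ck k U f -> Ck k U (fun x => ex psi (f x)).
Proof.
move=> cf; apply: Ck_mx => i j; rewrite ord1; under eq_fun do rewrite exE.
have ci : Ck k U (fun x => f x i 0) by exact: Ck_coord.
by case: (boolP (i < ctype psi)%N) => // it; apply: Ck_exp; apply: Ck_mul => //; exact: Ck_cst.
Qed.

Lemma Ck_hq k (f : V -> 'cV[R]_n) : Ck k U f -> Ck k U (fun x => hq psi (f x)).
Proof.
move=> cf; have ci i : Ck k U (fun x => f x i 0) by exact: Ck_coord.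
rewrite /hq /ell; apply: Ck_add.
  apply: Ck_opp; apply: Ck_add; apply: Ck_sum => // i _.
  by apply: Ck_mul => //; exact: Ck_cst.
apply: Ck_mul; first exact: Ck_cst.
by apply: Ck_sum => i _; exact: Ck_exp2.
Qed.

Lemma Ck_Yc k (f : V -> 'cV[R]_n) : Ck k U f -> (forall x, U x -> dom_h psi (f x)) -> Ck k U (fun x => Yc psi (f x)).
Proof. by move=> cf df; apply: Ck_mulmx; exact: Ck_lg. Qed.

Lemma Ck_horo k (f : V -> 'cV[R]_n) : Ck k U f -> (forall x, U x -> dom_h psi (f x)) ->
  Ck k U (fun x => horo_fun psi (f x)).
Proof. by move=> cf df; under eq_fun do rewrite horo_funE//; apply: Ck_hq; exact: Ck_lg. Qed.

Lemma Ck_Ph k (f : V -> 'cV[R]_n.-1) (g : V -> R) : Ck k U f -> Ck k U g -> Ck k U (fun x => Ph psi (f x) (g x)).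
Proof.
move=> cf cg; have cU : Ck k U (fun x => Um psi *m f x) by exact: Ck_mulmx.
apply: Ck_ex; apply: Ck_add => //; apply: Ck_mx => i j; under eq_fun do rewrite mxZE.
by apply: Ck_mul; [apply: Ck_add => //; exact: Ck_hq|exact: Ck_cst].
Qed.

Lemma Ck_hc k (f : V -> 'cV[R]_n) : Ck k U f -> Ck k U (fun x => hc (f x)).
Proof.
move=> cf; apply: Ck_mx => i j; elim/split_ord: i => [i|]; rewrite /hc.
  by under eq_fun do rewrite col_mxEu; exact: Ck_coord.
by under eq_fun do rewrite col_mxEd; exact: Ck_cst.
Qed.

Lemma Ck_dehom k (f : V -> 'cV[R]_(n + 1)) : Ck k U f -> (forall x, U x -> f x (rshift n 0) 0 != 0) ->
  Ck k U (fun x => dehom (f x)).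
Proof.
move=> cf fZ; apply: Ck_mx => i j.
rewrite (_ : (fun x => _) = fun x => (f x (rshift n 0) 0)^-1 * f x (lshift 1 i) j); last first.
  by apply/funext => x; rewrite /dehom mxZE mxE.
by apply: Ck_mul; [apply: Ck_inv => //|]; exact: Ck_coord.
Qed.

End SmoothCalculus.

Lemma path_connected_connected (R : realType) (T : topologicalType) (A : set T) x0 : A x0 ->
  (forall x, A x -> exists f : R -> T, [/\ continuous f, f 0 = x0, f 1 = x & forall s, 0 <= s <= 1 -> A (f s)]) ->
  connected A.
Proof.
move=> A0 H; have /choice[f Hf] : forall x, exists f : R -> T, A x ->
    [/\ continuous f, f 0 = x0, f 1 = x & forall s, 0 <= s <= 1 -> A (f s)].
  move=> x; have [Ax|nAx] := pselect (A x); last by exists (fun=> x0).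
  by have [f] := H x Ax; exists f.
have -> : A = \bigcup_(x in A) (f x @` `[0, 1]).
  apply/seteqP; split=> [x Ax|z [x Ax [s s01 <-]]]; last first.
    by have [_ _ _] := Hf x Ax; apply; rewrite /= in_itv /= in s01.
  by exists x => //; exists 1; [rewrite /= in_itv /= ler01 lexx|have [_ _ ->] := Hf x Ax].
apply: bigcup_connected.
  exists x0 => x Ax; exists 0; first by rewrite /= in_itv /= lexx ler01.
  by have [_ -> _ _] := Hf x Ax.
move=> x Ax; apply: connected_continuous_connected; first exact: segment_connected.
by apply: continuous_subspaceT; have [] := Hf x Ax.
Qed.

Section ProjectiveLines.
Variables (R : realType) (n : nat).
Implicit Types (u v w : 'cV[R]_(n + 1)) (x y : 'cV[R]_n).
Local Notation Z := (rshift n (0 : 'I_1)).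

Lemma independentP u v : independent u v -> forall a b : R, a *: u + b *: v = 0 -> a = 0 /\ b = 0.
Proof.
move=> uv a b E; have rf : row_free (row_mx u v)^T by rewrite /row_free mxrank_tr; apply/eqP.
have : (col_mx a%:M b%:M : 'cV[R]_(1 + 1))^T *m (row_mx u v)^T == 0.
  by rewrite -trmx_mul mul_row_col !mul_mx_scalar E trmx0.
rewrite mulmx_free_eq0// => /eqP/(congr1 trmx); rewrite trmxK trmx0 => e.
have := congr1 (fun M : 'M_(1 + 1, 1) => usubmx M 0 0) e; have := congr1 (fun M : 'M_(1 + 1, 1) => dsubmx M 0 0) e.
by rewrite /= col_mxKu col_mxKd !mxE eqxx.
Qed.

Lemma affine_ptP x v (v0 : v != 0) : affine x = pt v0 -> exists2 c : R, c != 0 & v = c *: hc x.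
Proof. by move/pt_eqP. Qed.

Lemma hc_Z x : hc x Z 0 = 1.
Proof. by rewrite /hc col_mxEd mxE eqxx. Qed.

Lemma hc_D x w (s : R) : w Z 0 = 0 -> hc (x + s *: usubmx w) = hc x + s *: w.
Proof.
move=> wZ; apply/colP; elim/split_ord => [i|]; rewrite mxDE mxZE /hc; last by rewrite !col_mxEd wZ mulr0 addr0.
by rewrite !col_mxEu mxDE mxZE mxE.
Qed.

Lemma hc_seg x y (s : R) : hc (x + s *: (y - x)) = (1 - s) *: hc x + s *: hc y.
Proof.
apply/colP; elim/split_ord => [i|]; rewrite mxDE !mxZE /hc.
  by rewrite !col_mxEu !mxDE mxZE mxDE mxNE; ring.
by rewrite !col_mxEd mxE eqxx; ring.
Qed.

Lemma line_affine u v x : proj_line u v (affine x) <-> exists a b : R, hc x = a *: u + b *: v.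
Proof.
split=> [[a [b [h /affine_ptP[c c0 e]]]]|[a [b e]]].
  by exists (c^-1 * a), (c^-1 * b); rewrite -!scalerA -scalerDr e scalerA mulVf// scale1r.
have h : a *: u + b *: v != 0 by rewrite -e affine_neq0.
by exists a, b, h; apply/pt_eqP; exists 1; rewrite ?oner_neq0// scale1r.
Qed.

Definition aff_pt (p : RP R n) : 'cV[R]_n := dehom (vec_of p).

Lemma aff_ptK x : aff_pt (affine x) = x.
Proof. by rewrite /aff_pt; have [a a0 ->] := vec_of_pt (affine_neq0 x); rewrite -/(hc x) dehom_hc. Qed.

Lemma segment_continuous (x y : 'cV[R]_n) : continuous (fun s : R => affine (x + s *: (y - x))).
Proof.
move=> s; apply: (@cvg_comp _ _ _ (fun s : R => x + s *: (y - x)) (@affine R n) _ _ _ _ (@affine_continuous R n _)).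
by apply: cvgD; [exact: cvg_cst|apply: cvgZr_tmp; exact: cvg_id].
Qed.

End ProjectiveLines.

(** * Proper convexity of the domain and strict convexity of its boundary *)

Section ConvexDomain.
Variables (R : realType) (n : nat) (psi : 'rV[R]_n).
Hypothesis Apsi : weyl psi.
Hypothesis n2 : (1 < n)%N.
Implicit Types (i j l : 'I_n) (x z p : 'cV[R]_n) (y : 'cV[R]_n.-1) (u v w : 'cV[R]_(n + 1)).
Local Notation t := (ctype psi).
Local Notation h := (horo_fun psi).
Local Notation Z := (rshift n (0 : 'I_1)).
Let n0 : (0 < n)%N := ltnW n2.

Lemma dom_convex x z (s : R) : 0 <= s <= 1 -> dom_h psi x -> dom_h psi z -> dom_h psi (x + s *: (z - x)).
Proof.
move=> s01 dx dz i it; rewrite mxDE mxZE mxDE mxNE.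
have := dx i it; have := dz i it; have [->|s1] := eqVneq s 1; first by lra.
move=> zi xi; have : 0 < (1 - s) * x i 0 by rewrite mulr_gt0// subr_gt0 lt_neqAle s1; case/andP: s01.
have : 0 <= s * z i 0 by rewrite mulr_ge0//; [case/andP: s01|exact: ltW].
lra.
Qed.

Lemma Om_convex x z (s : R) : 0 <= s <= 1 -> Om psi x -> Om psi z -> Om psi (x + s *: (z - x)).
Proof.
move=> s01 [dx hx] [dz hz]; have dp := dom_convex s01 dx dz; split=> //.
set p := x + s *: (z - x) in dp *.
have gx := le_trans (horo_grad Apsi dp dx) hx; have gz := le_trans (horo_grad Apsi dp dz) hz.
have ex : x - p = (- s) *: (z - x) by apply/colP => i; rewrite /p !(mxDE, mxNE, mxZE); ring.
have ez : z - p = (1 - s) *: (z - x) by apply/colP => i; rewrite /p !(mxDE, mxNE, mxZE); ring.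
rewrite ex DhZ in gx; rewrite ez DhZ in gz; case/andP: s01 => s0 s1.
have := mulr_ge0_le0 s0 gz; have : (1 - s) * (h p + - s * Dh psi p (z - x)) <= 0.
  by apply: mulr_ge0_le0 => //; lra.
lra.
Qed.

(** The defect (h x + h z) / 2 - h m at the midpoint m is a sum of nonnegative terms, one for each
    coordinate other than that of index t, each zero only if the coordinates agree. The coordinate
    of index t is then determined by h. *)
Lemma strict_convex x z : dom_h psi x -> dom_h psi z -> h x = 0 -> h z = 0 -> h (2^-1 *: (x + z)) = 0 -> x = z.
Proof.
move=> dx dz hx hz hm; set m := 2^-1 *: (x + z) in hm.
have mE i : m i 0 = (x i 0 + z i 0) / 2 by rewrite /m mxZE mxDE mulrC.
pose A i := ln (m i 0) - (ln (x i 0) + ln (z i 0)) / 2.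
(* The inequality of arithmetic and geometric means with its exact defect. *)
have mxz i : m i 0 ^+ 2 = x i 0 * z i 0 + (x i 0 - z i 0) ^+ 2 / 4 by rewrite mE; field.
have AE i : (i < t)%N -> 2 * A i = ln (m i 0 ^+ 2) - ln (x i 0 * z i 0) /\ 0 < x i 0 * z i 0.
  move=> it; have xi := dx i it; have zi := dz i it; split; last exact: mulr_gt0.
  have mi : 0 < m i 0 by rewrite mE divr_gt0// addr_gt0.
  by rewrite lnM ?posrE// expr2 lnM ?posrE// /A; field.
have A0 i : (i < t)%N -> 0 <= A i.
  move=> it; have [e xz] := AE i it; rewrite -(pmulr_rge0 _ (ltr0n R 2)) e subr_ge0 ler_ln ?posrE//.
    by rewrite mxz lerDl divr_ge0// sqr_ge0.
  by rewrite mxz ltr_pwDl// divr_ge0// sqr_ge0.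
have Aeq i : (i < t)%N -> A i = 0 -> x i 0 = z i 0.
  move=> it Ai; have [e xz] := AE i it; rewrite Ai mulr0 in e; move/esym/subr0_eq: e => e1.
  have e2 : m i 0 ^+ 2 = x i 0 * z i 0.
    by apply: ln_inj => //; rewrite posrE// mxz ltr_pwDl// divr_ge0// sqr_ge0.
  have : (x i 0 - z i 0) ^+ 2 = 0 by have := mxz i; rewrite e2; lra.
  by move/eqP; rewrite sqrf_eq0 subr_eq0 => /eqP.
have sum0 : \sum_(i < n | (i < t)%N) cw psi i * A i + \sum_(i < n | (t < i)%N) (x i 0 - z i 0) ^+ 2 / 8 = 0.
  transitivity (h x / 2 + h z / 2 - h m); last by rewrite hx hz hm; ring.
  rewrite !horo_xE//.
  have -> : \sum_(i < n | (i == t :> nat)%N) m i 0 = (\sum_(i < n | (i == t :> nat)%N) x i 0 + \sum_(i < n | (i == t :> nat)%N) z i 0) / 2.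
    by rewrite -big_split /= mulr_suml; apply: eq_bigr => i _; rewrite mE.
  have -> : \sum_(i < n | (i < t)%N) cw psi i * A i = \sum_(i < n | (i < t)%N) cw psi i * ln (m i 0) -
      (\sum_(i < n | (i < t)%N) cw psi i * ln (x i 0) + \sum_(i < n | (i < t)%N) cw psi i * ln (z i 0)) / 2.
    by rewrite -big_split /= mulr_suml -sumrB; apply: eq_bigr => i _; rewrite /A; field.
  have -> : \sum_(i < n | (t < i)%N) (x i 0 - z i 0) ^+ 2 / 8 = (2^-1 * \sum_(i < n | (t < i)%N) x i 0 ^+ 2) / 2 +
      (2^-1 * \sum_(i < n | (t < i)%N) z i 0 ^+ 2) / 2 - 2^-1 * \sum_(i < n | (t < i)%N) m i 0 ^+ 2.
    by rewrite !mulr_sumr !mulr_suml -big_split -sumrB /=; apply: eq_bigr => i _; rewrite mE; field.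
  by field.
have s1 : 0 <= \sum_(i < n | (i < t)%N) cw psi i * A i.
  by apply: sumr_ge0 => i it; rewrite mulr_ge0 ?A0// ltW// cw_gt0.
have s2 : 0 <= \sum_(i < n | (t < i)%N) (x i 0 - z i 0) ^+ 2 / 8.
  by apply: sumr_ge0 => i _; rewrite divr_ge0// sqr_ge0.
have lo i : (i < t)%N -> x i 0 = z i 0.
  move=> it; apply: Aeq => //; have /eqP : \sum_(i < n | (i < t)%N) cw psi i * A i = 0 by lra.
  rewrite psumr_eq0 => [/allP/(_ i)|j jt]; last by rewrite mulr_ge0 ?A0// ltW// cw_gt0.
  by rewrite mem_index_enum it mulf_eq0 (gt_eqF (cw_gt0 Apsi it)) => /(_ isT)/eqP.
have hi i : (t < i)%N -> x i 0 = z i 0.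
  move=> ti; have /eqP : \sum_(i < n | (t < i)%N) (x i 0 - z i 0) ^+ 2 / 8 = 0 by lra.
  rewrite psumr_eq0 => [/allP/(_ i)|j jt]; last by rewrite divr_ge0// sqr_ge0.
  by rewrite mem_index_enum ti mulf_eq0 invr_eq0 pnatr_eq0 orbF sqrf_eq0 subr_eq0 => /(_ isT)/eqP.
apply/colP => i; have [it|ti|it] := ltngtP i t; [exact: lo|exact: hi|].
have E : h x = h z by rewrite hx hz.
rewrite !horo_xE// in E.
have e1 : \sum_(i < n | (i < t)%N) cw psi i * ln (x i 0) = \sum_(i < n | (i < t)%N) cw psi i * ln (z i 0).
  by apply: eq_bigr => j jt; rewrite lo.
have e2 : \sum_(i < n | (t < i)%N) x i 0 ^+ 2 = \sum_(i < n | (t < i)%N) z i 0 ^+ 2.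
  by apply: eq_bigr => j jt; rewrite hi.
rewrite e1 e2 in E.
have ev p : \sum_(j < n | (j == t :> nat)%N) p j 0 = p i 0.
  by rewrite (eq_bigl (pred1 i)) ?big_pred1_eq// => j; rewrite /= -val_eqE /= -it.
by rewrite !ev in E; lra.
Qed.

(** A full line would give two opposite recession directions, whereas the recession cone lies in an
    orthant. *)
Lemma Omega_line_exit x w : Om psi x -> w != 0 -> w Z 0 = 0 -> exists s : R, ~ Om psi (x + s *: usubmx w).
Proof.
move=> Ox w0 wZ; apply: contrapT => H; move/eqP: w0; apply.
have H' s : Om psi (x + s *: usubmx w) by apply: contrapT => nO; apply: H; exists s.
have [c1 c2] := Om_rec_cone Apsi Ox (fun s _ => H' s).
have [c3 _] : (forall l, (l <= t)%N -> 0 <= (- usubmx w) l 0) /\ (forall j, (t < j)%N -> (- usubmx w) j 0 = 0).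
  by apply: (Om_rec_cone Apsi Ox) => s _; rewrite scalerN -scaleNr; exact: H'.
apply/colP; elim/split_ord => [i|]; last by rewrite wZ mx0E.
have [it|ti] := leqP i t; last by have := c2 i ti; rewrite mxE mx0E.
by have := c1 i it; have := c3 i it; rewrite mxNE [usubmx _ _ _]mxE mx0E; lra.
Qed.

Lemma OmegaE x : Omega psi (affine x) <-> Om psi x.
Proof. by split=> [[z Oz /affine_inj <-]|Ox]//; exists x. Qed.

Lemma Omega_properly_convex : properly_convex (Omega psi).
Proof.
move=> u v uv; have ind := independentP uv; split.
  have [->|/set0P[_ [[x Ox <-] /line_affine[a [b ex]]]]] := eqVneq (Omega psi `&` proj_line u v) set0.
    exact: connected0.
  apply: (@path_connected_connected R _ _ (affine x)).
    by split; [exact/OmegaE|apply/line_affine; exists a, b].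
  move=> _ [[z Oz <-] /line_affine[a' [b' ez]]].
  exists (fun s => affine (x + s *: (z - x))); split.
  - exact: segment_continuous.
  - by rewrite scale0r addr0.
  - by rewrite scale1r addrC subrK.
  - move=> s s01; split; first by apply/OmegaE; exact: Om_convex.
    apply/line_affine; exists ((1 - s) * a + s * a'), ((1 - s) * b + s * b').
    by rewrite hc_seg ex ez !scalerDr !scalerA !scalerDl addrACA.
have u0 : u != 0 by apply/eqP => e; have [] := ind 1 0; rewrite ?e ?scaler0 ?scale0r ?addr0// => /eqP; rewrite oner_eq0.
have v0 : v != 0 by apply/eqP => e; have [] := ind 0 1; rewrite ?e ?scaler0 ?scale0r ?addr0// => _ /eqP; rewrite oner_eq0.
have [e|/set0P[_ [[x Ox <-] /line_affine[a [b ex]]]]] := eqVneq (Omega psi `&` proj_line u v) set0.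
  have nO (p : RP R n) : proj_line u v p -> (proj_line u v `\` Omega psi) p.
    by move=> lp; split=> // Op; have : (Omega psi `&` proj_line u v) p by []; rewrite e.
  exists (pt u0), (pt v0); split.
  - move=> /pt_eqP[c c0 ev]; have [] := ind c (- 1).
      by rewrite ev scaleN1r subrr.
    by move=> /eqP; rewrite (negbTE c0).
  - have h0 : 1 *: u + 0 *: v != 0 by rewrite scale1r scale0r addr0.
    by apply: nO; exists 1, 0, h0; apply: pt_congr; rewrite scale1r scale0r addr0.
  - have h0 : 0 *: u + 1 *: v != 0 by rewrite scale1r scale0r add0r.
    by apply: nO; exists 0, 1, h0; apply: pt_congr; rewrite scale1r scale0r add0r.
(* The point at infinity of the line, omitted because the domain lies in the affine chart; the
   second omitted point is affine. *)
pose w := v Z 0 *: u + (- u Z 0) *: v.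
have w0 : w != 0.
  apply/eqP => /ind[vZ /eqP]; rewrite oppr_eq0 => /eqP uZ.
  have := congr1 (fun M : 'cV_(n + 1) => M Z 0) ex; rewrite hc_Z mxDE !mxZE uZ vZ !mulr0 addr0 => /eqP.
  by rewrite oner_eq0.
have wZ : w Z 0 = 0 by rewrite /w mxDE !mxZE; ring.
have naff z : affine z <> pt w0.
  move=> /affine_ptP[c c0 e]; have := congr1 (fun M : 'cV_(n + 1) => M Z 0) e.
  by rewrite wZ mxZE hc_Z mulr1 => /esym/eqP; rewrite (negbTE c0).
have [s ns] := Omega_line_exit Ox w0 wZ.
exists (pt w0), (affine (x + s *: usubmx w)); split=> [/esym/naff//||].
  by split; [exists (v Z 0), (- u Z 0), w0|move=> [z _ /naff]].
split; last by move/OmegaE.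
apply/line_affine; exists (a + s * v Z 0), (b - s * u Z 0); rewrite hc_D// ex /w.
by rewrite scalerDr !scalerA mulrN addrACA -!scalerDl.
Qed.

Lemma horosphere_no_segment : contains_no_segment (horosphere psi 0).
Proof.
move=> u v uv; have ind := independentP uv => H.
have u0 : u != 0 by apply/eqP => e; have [] := ind 1 0; rewrite ?e ?scaler0 ?scale0r ?addr0// => /eqP; rewrite oner_eq0.
have v0 : v != 0 by apply/eqP => e; have [] := ind 0 1; rewrite ?e ?scaler0 ?scale0r ?addr0// => _ /eqP; rewrite oner_eq0.
have [x [dx hx] /affine_ptP[al al0 uE]] : horosphere psi 0 (pt u0).
  apply: H; have h0 : 1 *: u + 0 *: v != 0 by rewrite scale1r scale0r addr0.
  by exists 1, 0, h0; split=> //; apply: pt_congr; rewrite scale1r scale0r addr0.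
have [z [dz hz] /affine_ptP[be be0 vE]] : horosphere psi 0 (pt v0).
  apply: H; have h0 : 0 *: u + 1 *: v != 0 by rewrite scale1r scale0r add0r.
  by exists 0, 1, h0; split=> //; apply: pt_congr; rewrite scale1r scale0r add0r.
have nz (a b : R) : a != 0 -> a *: u + b *: v != 0.
  by move=> a0; apply/eqP => /ind[/eqP]; rewrite (negbTE a0).
have a1 : `|be| != 0 by rewrite normr_eq0.
(* With u = al hc x and v = be hc z, this combination represents the midpoint of x and z if al and
   be have the same sign, and a point at infinity otherwise; the latter is not on the boundary. *)
have [p [dp hp] /affine_ptP[c c0 e]] : horosphere psi 0 (pt (nz `|be| `|al| a1)).
  by apply: H; exists `|be|, `|al|, (nz `|be| `|al| a1); split.
rewrite uE vE !scalerA in e.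
have eZ := congr1 (fun M : 'cV_(n + 1) => M Z 0) e; rewrite mxDE !mxZE !hc_Z !mulr1 in eZ.
have [s sE] : exists s : R, s != 0 /\ `|be| * al = s /\ (`|al| * be = s \/ `|al| * be = - s).
  exists (`|be| * al); split; first by rewrite mulf_neq0.
  split=> //; have [al1|al1|] := ltrgtP al 0; have [be1|be1|] := ltrgtP be 0; try by move=> e1; rewrite e1 eqxx in be0.
  - by left; rewrite !ltr0_norm//; ring.
  - by right; rewrite ltr0_norm// gtr0_norm//; ring.
  - by right; rewrite gtr0_norm// ltr0_norm//; ring.
  - by left; rewrite !gtr0_norm//; ring.
  - by move=> e1; rewrite e1 eqxx in al0.
  - by move=> e1; rewrite e1 eqxx in al0.
case: sE => s0 [e1 [e2|e2]]; rewrite e1 e2 in e eZ; last by move/eqP: c0; apply; rewrite -eZ subrr.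
have xz : x <> z.
  move=> xz; have := ind be (- al); rewrite uE vE xz !scalerA mulNr [be * al]mulrC scaleNr subrr => /(_ erefl)[/eqP].
  by rewrite (negbTE be0).
apply: xz; apply: strict_convex => //.
suff -> : 2^-1 *: (x + z) = p by [].
have c2 : c = 2 * s by rewrite -eZ; ring.
have /hc_eq[_ ->] // : hc (2^-1 *: (x + z)) = 1 *: hc p.
rewrite scale1r; apply: (scalerI c0); rewrite -e c2 -scalerDr [2 * s]mulrC -scalerA; congr (_ *: _).
apply/colP; elim/split_ord => [i|]; rewrite mxZE mxDE /hc.
  by rewrite !col_mxEu mxZE mxDE; field.
by rewrite !col_mxEd mxE eqxx; ring.
Qed.

(** The set h < 0 is open, and from a point with h = 0 the flow line leaves the domain at once. *)
Lemma bdry_Omega : bdry (Omega psi) = horosphere psi 0.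
Proof.
apply/seteqP; split=> p.
  move=> [[x [dx hx] <-] nint]; exists x => //; split=> //; apply/eqP; rewrite eq_le hx leNgt; apply/negP => h0.
  apply: nint; have o : open [set z | dom_h psi z /\ h z < 0].
    rewrite openE => z [dz hz]; rewrite /interior.
    have h1 : nbhs z (dom_h psi) by apply: open_nbhs_nbhs; split=> //; exact: dom_open.
    have H : (fun z => h z) @ z --> h z by apply: (@horo_cvg _ _ _ Apsi _ _ (nbhs_filter z) id) => //; exact: cvg_id.
    have h2 : nbhs z [set z | h z < 0].
      by apply: (H [set r : R | r < 0]); apply: open_nbhs_nbhs; split; [exact: open_lt|].
    exact: filterI.
  rewrite /interior nbhsE; exists (@affine R n @` [set z | dom_h psi z /\ h z < 0]).
    by split; [exact: affine_open|exists x].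
  by move=> _ [z [dz hz] <-]; apply/OmegaE; split=> //; exact: ltW.
move=> [x [dx hx] <-]; split; first by apply/OmegaE; rewrite /Om /= hx.
rewrite /interior => /(@affine_continuous R n x) nx.
have [y [s xE]] := Ph_surj Apsi n2 dx.
have s0 : s = 0 by have := horo_Ph Apsi n0 y s; rewrite -xE hx => /esym/eqP; rewrite oppr_eq0 => /eqP.
rewrite xE s0 in nx; have H : (fun r : R => Ph psi y r) @ (0 : R) --> Ph psi y 0.
  by apply: (@Ph_cvg _ _ _ _ _ (nbhs_filter (0 : R)) (fun=> y) id); [exact: cvg_cst|exact: cvg_id].
have /nbhs_ballP[e /= e0 He] := H _ nx.
have : (@affine R n @^-1` Omega psi) (Ph psi y (- (e / 2))).
  by apply: He; rewrite /ball /= sub0r opprK gtr0_norm//; lra.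
by move=> /OmegaE[_]; rewrite horo_Ph//; lra.
Qed.

End ConvexDomain.

Definition point_in (T : Type) (A : set T) x (Ax : A x) : set_type A := exist _ x (mem_set Ax).

(** * Generalized cusps *)

Section OrbitSpaces.
Variables (R : realType) (n : nat).
Implicit Types (Gamma : set (PGL R n)) (X : set (RP R n)) (g k : PGL R n).

Lemma orbit_piP Gamma X (x y : set_type X) : is_subgroup Gamma ->
  orbit_pi Gamma x = orbit_pi Gamma y <-> exists2 g, Gamma g & val x = act g (val y).
Proof.
move=> [G1 GM GV]; rewrite /orbit_pi fiber_piP; split=> [E|[g Gg E]].
  have [g Gg e] : [set act g (val y) | g in Gamma] (val x) by rewrite -E; exists 1%g => //; exact: act1.
  by exists g.
apply/seteqP; split=> _ [h Gh <-].
  by exists (h * g)%g; [exact: GM|rewrite actM E].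
by exists (h * g^-1)%g; [apply: GM => //; exact: GV|rewrite actM E actVK].
Qed.

Lemma orbit_repr Gamma X (c : orbit_space Gamma X) : exists x : set_type X, c = orbit_pi Gamma x.
Proof. by exists (fiber_repr c); rewrite /orbit_pi fiber_reprK. Qed.

Lemma orbit_pi_continuous Gamma X : continuous (@orbit_pi R n Gamma X).
Proof. exact: fiber_pi_continuous. Qed.

Lemma orbit_pi_open Gamma X (U : set (RP R n)) : is_subgroup Gamma -> Gamma `<=` PGL_of X -> open U ->
  open [set c : orbit_space Gamma X | exists2 x : set_type X, c = orbit_pi Gamma x & U (val x)].
Proof.
move=> sG GX oU; apply/fiber_open/sub_open; exists (\bigcup_(g in Gamma) (act g @^-1` U)).
  by apply: bigcup_open => g _; exact: act_open.
apply/seteqP; split=> x /=.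
  move=> [y /esym/(orbit_piP _ _ sG)[g Gg e] Uy]; exists g => //=; by rewrite -e.
move=> [g Gg Ux]; have Xgx : X (act g (val x)).
  have : (act g @` X) (act g (val x)) by exists (val x) => //; exact: set_mem (valP x).
  by rewrite (_ : act g @` X = X)//; exact: GX.
exists (point_in Xgx) => //; apply/esym/orbit_piP => //.
by exists g.
Qed.

Section Conjugate.
Variables (X : set (RP R n)) (k : PGL R n) (Gamma Gamma' : set (PGL R n)).
Hypotheses (sG : is_subgroup Gamma) (sG' : is_subgroup Gamma').
Hypotheses (kX : PGL_of X k) (kG : conjset k Gamma = Gamma').

Lemma conj_act_mem (x : set_type X) : X (act k (val x)).
Proof.
have : (act k @` X) (act k (val x)) by exists (val x) => //; exact: set_mem (valP x).
by rewrite (_ : act k @` X = X).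
Qed.

Definition conj_orbit (c : orbit_space Gamma X) : orbit_space Gamma' X :=
  orbit_pi Gamma' (point_in (conj_act_mem (fiber_repr c))).

Lemma conj_orbitE (x : set_type X) : conj_orbit (orbit_pi Gamma x) = orbit_pi Gamma' (point_in (conj_act_mem x)).
Proof.
apply/orbit_piP => //=; have /(orbit_piP _ _ sG)[g Gg e] : orbit_pi Gamma (fiber_repr (orbit_pi Gamma x)) = orbit_pi Gamma x.
  exact: fiber_reprK.
exists (k * g * k^-1)%g; first by rewrite -kG; exists g.
by rewrite e -!actM mulgVK.
Qed.

Lemma conj_orbit_continuous : continuous conj_orbit.
Proof.
apply: fiber_lift_continuous.
have -> : conj_orbit \o fiber_pi _ = @orbit_pi R n Gamma' X \o (fun x => point_in (conj_act_mem x)).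
  by apply/funext => x; exact: conj_orbitE.
move=> x; apply: continuous_comp; last exact: orbit_pi_continuous.
have H : continuous (act k \o @set_val _ X).
  by move=> z; apply: continuous_comp; [exact: set_val_continuous|exact: act_continuous].
exact: sub_continuous.
Qed.

Lemma conj_orbit_smooth : smooth_map (@rep_orbit R n Gamma X) (@rep_orbit R n Gamma' X) conj_orbit.
Proof.
move=> v c _; exists setT, (fun w => mx_of k *m w); split=> //; first exact: openT.
  by move=> j; apply: Ck_mulmx; [exact: openT|apply: Ck_id; exact: openT].
move=> w q _ [x [Xx [w0 xE]] ->]; exists (point_in (conj_act_mem x)); last exact: conj_orbitE.
split=> /=; first exact: conj_act_mem.
exists (mulmx_neq0 (mx_of_unit k) w0); rewrite xE -(act_pgl_pt (mx_of_unit k)) pgl_mx_of; by [].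
Qed.

End Conjugate.

Lemma PGL_of_V X k : PGL_of X k -> PGL_of X k^-1%g.
Proof.
move=> kX; rewrite /PGL_of /= -{1}kX; apply/seteqP; split=> [_ [_ [x Xx <-] <-]|x Xx]; first by rewrite actVK.
by exists (act k x); [exists x|rewrite actVK].
Qed.

Lemma conj_orbitK X k Gamma Gamma' (sG : is_subgroup Gamma) (sG' : is_subgroup Gamma') (kX : PGL_of X k)
  (kX' : PGL_of X k^-1%g) (kG : conjset k Gamma = Gamma') (kG' : conjset k^-1%g Gamma' = Gamma) :
  cancel (@conj_orbit X k Gamma Gamma' kX) (@conj_orbit X k^-1%g Gamma' Gamma kX').
Proof.
move=> c; have [x ->] := orbit_repr c; rewrite conj_orbitE// conj_orbitE//; congr orbit_pi.
by apply: val_inj; rewrite /= actVK.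
Qed.

Lemma conj_cusp_embeds X k Gamma Gamma' : is_subgroup Gamma -> is_subgroup Gamma' -> PGL_of X k ->
  conjset k Gamma = Gamma' -> cusp_embeds X Gamma X Gamma' /\ cusp_diffeo X Gamma X Gamma'.
Proof.
move=> sG sG' kX kG; have kX' := PGL_of_V kX.
have kG' : conjset k^-1%g Gamma' = Gamma.
  by rewrite -kG -conjsetM mulVg; apply: conjset_centralizing => x _; rewrite mul1g mulg1.
have K1 := conj_orbitK sG sG' kX kX' kG kG'.
have K2 : cancel (@conj_orbit X k^-1%g Gamma' Gamma kX') (@conj_orbit X k Gamma Gamma' kX).
  move=> c; have [x ->] := orbit_repr c; rewrite conj_orbitE// conj_orbitE//; congr orbit_pi.
  by apply: val_inj; rewrite /= actKV.
have c1 := @conj_orbit_continuous X k _ _ sG sG' kX kG.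
have c2 := @conj_orbit_continuous X k^-1%g _ _ sG' sG kX' kG'.
split.
  exists (@conj_orbit X k Gamma Gamma' kX); split; [split|].
  - split=> //; first exact: can_inj K1.
    move=> U oU; exists (@conj_orbit X k^-1%g Gamma' Gamma kX' @^-1` U); first by move/continuousP: c2; apply.
    by rewrite -comp_preimage (_ : _ \o _ = id)//; apply/funext => c /=; rewrite K1.
  - move=> x; exists setT, k; split=> //; first exact: openT.
    by move=> y _; exists (point_in (conj_act_mem kX y)) => //; exact: conj_orbitE.
  - split=> //; exists (@conj_orbit X k^-1%g Gamma' Gamma kX'); split=> //.
      exists fst; split=> [|c|c] /=; rewrite ?K1//.
      by apply: continuous_subspaceT => w; exact: cvg_fst.
    exists fst; split=> [|c|c] /=; rewrite ?K2//.
    by apply: continuous_subspaceT => w; exact: cvg_fst.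
exists (@conj_orbit X k Gamma Gamma' kX), (@conj_orbit X k^-1%g Gamma' Gamma kX'); split=> [||v c _|v c _]; rewrite ?K1 ?K2//.
  exact: conj_orbit_smooth.
exact: conj_orbit_smooth.
Qed.

(** The cusp of [Gamma] itself serves as the common cusp, embedded by the identity and by the
    conjugator. *)
Lemma equivalent_of_conjugate X Gamma Gamma' : generalized_cusp X Gamma -> generalized_cusp X Gamma' ->
  conjugate_in (PGL_of X) Gamma Gamma' -> equivalent_cusps X Gamma X Gamma'.
Proof.
move=> cG cG' [k kX kG]; have sG : is_subgroup Gamma by case: cG => -[_ []].
have sG' : is_subgroup Gamma' by case: cG' => -[_ []].
have X1 : PGL_of X (1%g : PGL R n).
  by rewrite /PGL_of /=; apply/seteqP; split=> [_ [x Xx <-]|x Xx]; [rewrite act1|exists x; rewrite ?act1].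
have G1 : conjset 1%g Gamma = Gamma by apply: conjset_centralizing => x _; rewrite mul1g mulg1.
have [e1 d1] := conj_cusp_embeds sG sG X1 G1; have [e2 d2] := conj_cusp_embeds sG sG' kX kG.
by split=> //; exists X, Gamma; split.
Qed.

End OrbitSpaces.

Section CuspOfLattice.
Variables (R : realType) (n : nat) (psi : 'rV[R]_n).
Hypothesis Apsi : weyl psi.
Hypothesis n2 : (1 < n)%N.
Let n0 : (0 < n)%N := ltnW n2.
Local Notation h := (horo_fun psi).
Implicit Types (y : 'cV[R]_n.-1) (s : R) (p : RP R n).

Definition yc p := Yc psi (aff_pt p).
Definition sc p := - h (aff_pt p).

Lemma yc_Ph y s : yc (affine (Ph psi y s)) = y.
Proof. by rewrite /yc aff_ptK Yc_Ph. Qed.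

Lemma sc_Ph y s : sc (affine (Ph psi y s)) = s.
Proof. by rewrite /sc aff_ptK horo_Ph// opprK. Qed.

Lemma OmegaP p : Omega psi p <-> exists y (s : R), 0 <= s /\ p = affine (Ph psi y s).
Proof.
split=> [[x [dx hx] <-]|[y [s [s0 ->]]]].
  exists (Yc psi x), (- h x); rewrite Ph_Yc//; split=> //; by rewrite oppr_ge0.
by exists (Ph psi y s) => //; split; [exact: Ph_dom|rewrite horo_Ph// oppr_le0].
Qed.

Lemma bdryP p : bdry (Omega psi) p <-> exists y, p = affine (Ph psi y 0).
Proof.
rewrite bdry_Omega// horosphereE// oppr0; split=> [[y _ <-]|[y ->]]; first by exists y.
by exists y.
Qed.

Lemma Omega_coord p : Omega psi p -> p = affine (Ph psi (yc p) (sc p)) /\ 0 <= sc p.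
Proof. by move=> /OmegaP[y [s [s0 ->]]]; rewrite yc_Ph sc_Ph. Qed.

Lemma tube_open (P : set ('cV[R]_n.-1 * R)) : open P -> open (@affine R n @` [set x | dom_h psi x /\ P (Yc psi x, - h x)]).
Proof.
move=> oP; apply: affine_open; rewrite openE => x [dx Px]; rewrite /interior.
have h1 : nbhs x (dom_h psi) by apply: open_nbhs_nbhs; split=> //; exact: dom_open.
have h2 : (fun z => (Yc psi z, - h z)) @ x --> (Yc psi x, - h x).
  have h3 : (fun z => Yc psi z) @ x --> Yc psi x by apply: (@Yc_cvg _ _ _ _ _ (nbhs_filter x) id x dx); exact: cvg_id.
  have h4 : (fun z => h z) @ x --> h x by apply: (@horo_cvg _ _ _ Apsi _ _ (nbhs_filter x) id x dx); exact: cvg_id.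
  exact: (cvg_pair h3 (cvgN h4)).
have h3 : nbhs x [set z | P (Yc psi z, - h z)] by apply: (h2 P); exact: open_nbhs_nbhs.
exact: filterI.
Qed.

Lemma open_ball_fst y (e : R) : open [set w : 'cV[R]_n.-1 * R | en (w.1 - y) < e].
Proof.
have c : continuous (fun w : 'cV[R]_n.-1 * R => en (w.1 - y)).
  move=> w; apply: continuous_comp; last exact: en_continuous.
  by apply: cvgB; [exact: cvg_fst|exact: cvg_cst].
by move/continuousP: c => /(_ [set r : R | r < e]); apply; exact: open_lt.
Qed.

Lemma open_snd (Q : set R) : open Q -> open [set w : 'cV[R]_n.-1 * R | Q w.2].
Proof. by move=> oQ; have /continuousP/(_ Q oQ) : continuous (@snd 'cV[R]_n.-1 R) by move=> w; exact: cvg_snd. Qed.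

(** Truncation at 0 makes [omega_pt] total in s, so that it can be used without carrying a proof of
    0 <= s. *)
Lemma omega_mem y s : Omega psi (affine (Ph psi y (Num.max 0 s))).
Proof. by apply/OmegaP; exists y, (Num.max 0 s); rewrite le_max lexx. Qed.

Lemma bdry_mem y : bdry (Omega psi) (affine (Ph psi y 0)).
Proof. by apply/bdryP; exists y. Qed.

Definition omega_pt y s : set_type (Omega psi) := point_in (omega_mem y s).
Definition bdry_pt y : set_type (bdry (Omega psi)) := point_in (bdry_mem y).

Lemma bdry_pt_continuous : continuous bdry_pt.
Proof.
have H : continuous (@affine R n \o (fun y => Ph psi y 0)); last exact: sub_continuous.
move=> y; apply: continuous_comp; last exact: affine_continuous.
by apply: (@Ph_cvg _ _ _ _ _ (nbhs_filter y) id (fun=> 0)); [exact: cvg_id|exact: cvg_cst].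
Qed.

Lemma affine_chart_lift (v : 'cV[R]_(n + 1)) (v0 : v != 0) p : p = pt v0 -> (exists x, p = affine x) ->
  v (rshift n 0) 0 != 0 /\ p = affine (dehom v).
Proof.
move=> pv [x e]; have [c c0 ->] : exists2 c : R, c != 0 & v = c *: hc x by apply: (affine_ptP (v0 := v0)); rewrite -e.
by rewrite dehom_hc// mxZE hc_Z mulr1.
Qed.

Definition chart_domain : set 'cV[R]_(n + 1) := lift_set (@affine R n @` dom_h psi).

Lemma chart_domain_open : open chart_domain.
Proof. by apply/lift_open; apply: affine_open; exact: dom_open. Qed.

Lemma chart_domainE v : chart_domain v <-> v (rshift n 0) 0 != 0 /\ dom_h psi (dehom v).
Proof. by rewrite /chart_domain affine_lift. Qed.

Lemma Ck_dehom_chart k : Ck k chart_domain (fun v => dehom v).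
Proof.
have o := chart_domain_open; apply: Ck_dehom => //; first exact: Ck_id.
by move=> v /chart_domainE[].
Qed.

Lemma Ck_yc_chart k : Ck k chart_domain (fun v => Yc psi (dehom v)).
Proof.
have o := chart_domain_open; apply: Ck_Yc => //; first exact: Ck_dehom_chart.
by move=> v /chart_domainE[].
Qed.

Lemma Ck_sc_chart k : Ck k chart_domain (fun v => - h (dehom v)).
Proof.
have o := chart_domain_open; apply: Ck_opp => //; apply: Ck_horo => //; first exact: Ck_dehom_chart.
by move=> v /chart_domainE[].
Qed.

Lemma rep_proj_chart (X : set (RP R n)) v p : X `<=` Omega psi -> rep_proj X v p ->
  [/\ chart_domain v, Yc psi (dehom v) = yc p & - h (dehom v) = sc p].
Proof.
move=> XO [Xp [v0 pv]]; have [x [dx _] xp] := XO _ Xp.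
have [vZ pE] := affine_chart_lift pv (ex_intro _ x (esym xp)).
have xv : dehom v = x by apply: affine_inj; rewrite -pE.
by rewrite /yc /sc pE aff_ptK; split=> //; apply/chart_domainE; rewrite xv.
Qed.

Lemma rep_proj_Ph (X : set (RP R n)) y s : X (affine (Ph psi y s)) -> rep_proj X (hc (Ph psi y s)) (affine (Ph psi y s)).
Proof. by move=> Xp; split=> //; exists (affine_neq0 (Ph psi y s)). Qed.

Lemma Omega_manifold_chart p : Omega psi p ->
  exists (U : set (RP R n)) (W : set ('cV[R]_n.-1 * R)),
    [/\ open U, U p, open W & diffeomorphic (rep_proj (Omega psi `&` U)) (rep_half W)].
Proof.
move=> Op; exists (@affine R n @` dom_h psi), setT; split.
- by apply: affine_open; exact: dom_open.
- by have [x [dx _] <-] := Op; exists x.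
- exact: openT.
exists (fun q => (yc q, sc q)), (fun w => affine (Ph psi w.1 w.2)); split.
- move=> v q /rep_proj_chart[|cv _ _]; first by move=> ? [].
  exists chart_domain, (fun v => (Yc psi (dehom v), - h (dehom v))); split=> //; first exact: chart_domain_open.
    move=> k; apply: Ck_pair; [exact: chart_domain_open|exact: Ck_yc_chart|exact: Ck_sc_chart].
  move=> w r _ wr; have [|_ -> ->] := rep_proj_chart _ wr; first by move=> ? [].
  by split=> //; have [[Or _] _] := wr; case: (Omega_coord Or).
- move=> v q [-> _ q2]; exists setT, (fun w => hc (Ph psi w.1 w.2)); split=> //; first exact: openT.
    have oT : open [set: 'cV[R]_n.-1 * R] := openT.
    by move=> k; apply: Ck_hc => //; apply: Ck_Ph => //; [apply: Ck_fst => //|apply: Ck_snd => //]; apply: Ck_id.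
  move=> w r _ [-> _ r2]; apply: rep_proj_Ph; split; first by apply/OmegaP; exists r.1, r.2.
  by exists (Ph psi r.1 r.2) => //; exact: Ph_dom.
- by move=> v q [[Oq _] _] /=; case: (Omega_coord Oq).
- by move=> w [q1 q2] _ /=; rewrite yc_Ph sc_Ph.
Qed.

Variable Gamma : set (PGL R n).
Hypothesis latG : lattice (Gpsi psi) Gamma.
Hypothesis tfG : torsion_free Gamma.
Let sG : is_subgroup Gamma. Proof. by case: latG. Qed.
Let GG : Gamma `<=` Gpsi psi. Proof. by case: latG. Qed.
Local Notation L := (isoms psi Gamma).

Lemma lattice_isoms : [/\ is_subgroup L, metrically_discrete L & coarse L].
Proof.
split; [exact: isoms_subgroup|apply: isoms_discrete => //; by case: latG|exact: isoms_coarse].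
Qed.

(** A fixed point makes the isometry a torsion element, and [Gamma] acts faithfully on R^(n-1). *)
Lemma isoms_free a y : L a -> isom_act a y = y -> a = 1%g.
Proof.
move=> La ay; have [sL dL cL] := lattice_isoms; have [k ak] := fixed_point_torsion sL dL cL La ay.
have [g Gg ga] := La; have H j : isoP psi (g ^+ j)%g (a ^+ j)%g.
  by elim: j => [|j IH]; rewrite ?expg0; [exact: isoP1|rewrite !expgS; exact: isoPM].
have gk : (g ^+ k.+1)%g = 1%g by apply: (isoP_inj Apsi n2 (H _)); rewrite ak; exact: isoP1.
have g1 : g = 1%g by apply: (tfG (k := k.+1)).
by apply: (isoP_uniq Apsi n2 ga); rewrite g1; exact: isoP1.
Qed.

Lemma isoms_radius : exists2 e : R, 0 < e & forall a y, L a -> en (isom_act a y - y) < e -> a = 1%g.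
Proof. by have [sL dL cL] := lattice_isoms; apply: uniform_radius => //; exact: isoms_free. Qed.

Lemma Gamma_isoP g : Gamma g -> exists2 a, L a & isoP psi g a.
Proof. by move=> Gg; have [a ga] := Gpsi_isoP Apsi n2 (GG Gg); exists a => //; exists g. Qed.

Lemma Gamma_trivial g : Gamma g -> isoP psi g 1%g -> g = 1%g.
Proof. by move=> _ g1; apply: (isoP_inj Apsi n2 g1); exact: isoP1. Qed.

Lemma act_coord g a p : isoP psi g a -> Omega psi p -> yc (act g p) = isom_act a (yc p) /\ sc (act g p) = sc p.
Proof. by move=> ga /Omega_coord[pE _]; rewrite [in LHS]pE [X in sc (act _ X)]pE ga yc_Ph sc_Ph. Qed.

Lemma orbit_sc_yc (X : set (RP R n)) (x x' : set_type X) : X `<=` Omega psi -> orbit_pi Gamma x = orbit_pi Gamma x' ->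
  sc (val x) = sc (val x') /\ exists2 a, L a & yc (val x) = isom_act a (yc (val x')).
Proof.
move=> XO /(orbit_piP _ _ sG)[g Gg ->]; have [a La ga] := Gamma_isoP Gg.
have [-> ->] := act_coord ga (XO _ (set_mem (valP x'))).
by split=> //; exists a.
Qed.

(** The height s is invariant under [Gamma] and separates orbits of different heights. At equal
    height, [proper_discontinuity] provides a radius for which the tubes over two balls are disjoint
    modulo [Gamma]. *)
Lemma lattice_hausdorff : hausdorff_space (orbit_space Gamma (Omega psi)).
Proof.
rewrite open_hausdorff => c c'; have [x ->] := orbit_repr c; have [x' ->] := orbit_repr c'.
move=> /eqP ne; have [sL dL cL] := lattice_isoms; have [L1 LM LV] := sL.
have Ox := set_mem (valP x); have Ox' := set_mem (valP x').
pose Q (P : set ('cV[R]_n.-1 * R)) := [set c : orbit_space Gamma (Omega psi) | exists2 x : set_type (Omega psi),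
   c = orbit_pi Gamma x & (@affine R n @` [set x | dom_h psi x /\ P (Yc psi x, - h x)]) (val x)].
have QP P (z : set_type (Omega psi)) : P (yc (val z), sc (val z)) -> Q P (orbit_pi Gamma z).
  move=> Pz; exists z => //; have [zE _] := Omega_coord (set_mem (valP z)).
  exists (Ph psi (yc (val z)) (sc (val z))) => //; split; first exact: Ph_dom.
  by rewrite Yc_Ph// horo_Ph// opprK.
have QE P q : Q P q -> exists2 z : set_type (Omega psi), q = orbit_pi Gamma z & P (yc (val z), sc (val z)).
  by move=> [z -> [u [du Pu] uz]]; exists z => //; rewrite /yc /sc -uz aff_ptK.
have oQ P : open P -> open (Q P).
  move=> oP; apply: orbit_pi_open => //; last exact: tube_open.
  by move=> g /GG; exact: Gpsi_Omega.
have sep P P' : open P -> open P' -> P (yc (val x), sc (val x)) -> P' (yc (val x'), sc (val x')) ->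
    (forall z z' : set_type (Omega psi), orbit_pi Gamma z = orbit_pi Gamma z' -> P (yc (val z), sc (val z)) -> P' (yc (val z'), sc (val z')) -> False) ->
    exists2 AB : set_predType (orbit_space Gamma (Omega psi)) * set_predType (orbit_space Gamma (Omega psi)),
      orbit_pi Gamma x \in AB.1 /\ orbit_pi Gamma x' \in AB.2 & [/\ open AB.1, open AB.2 & AB.1 `&` AB.2 == set0].
  move=> oP oP' Px Px' H; exists (Q P, Q P') => /=; first by split; apply: mem_set; exact: QP.
  split; [exact: oQ|exact: oQ|]; apply/eqP/seteqP; split=> // q [/QE[z -> Pz] /QE[z' zz' Pz']].
  exact: H zz' Pz Pz'.
have [ss|ss] := eqVneq (sc (val x)) (sc (val x')); last first.
  pose d := `|sc (val x) - sc (val x')|; have d0 : 0 < d by rewrite normr_gt0 subr_eq0.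
  have oI (r e : R) : open [set w : 'cV[R]_n.-1 * R | r - e < w.2 /\ w.2 < r + e].
    by apply: (@open_snd [set q | r - e < q /\ q < r + e]); apply: openI; [exact: open_gt|exact: open_lt].
  apply: (sep _ _ (oI (sc (val x)) (d / 2)) (oI (sc (val x')) (d / 2))) => /=; [by split; lra|by split; lra|].
  move=> z z' /orbit_sc_yc[//|-> _] [z1 z2] [z3 z4].
  have : d < d by rewrite {1}/d ltr_norml; lra.
  by rewrite ltxx.
have [e e0 He] := proper_discontinuity sL dL cL (yc (val x)) (yc (val x')).
apply: (sep [set w | en (w.1 - yc (val x)) < e / 2] [set w | en (w.1 - yc (val x')) < e / 2]) => /=;
  [exact: open_ball_fst|exact: open_ball_fst|by rewrite subrr en0 divr_gt0|by rewrite subrr en0 divr_gt0|].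
move=> z z' /orbit_sc_yc[//|_ [a La zz']] zx zx'.
have yy : isom_act a^-1%g (yc (val x)) = yc (val x').
  apply: He; first exact: LV.
  have -> : isom_act a^-1%g (yc (val x)) - yc (val x') =
     (isom_act a^-1%g (yc (val x)) - isom_act a^-1%g (yc (val z))) + (yc (val z') - yc (val x')).
    by rewrite zz' isom_actVK; rewrite addrA subrK.
  apply: le_lt_trans (en_triangle _ _) _; rewrite isom_act_dist.
  by rewrite -[yc (val x) - _]opprB enN (splitr e); exact: ltrD zx zx'.
apply: ne; apply/orbit_piP => //; have [g Gg ga] := La; exists g => //.
have [-> _] := Omega_coord Ox; have [-> _] := Omega_coord Ox'.
by rewrite ga -yy isom_actKV ss.
Qed.

Lemma lattice_properly_convex_manifold : properly_convex_manifold (Omega psi) Gamma.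
Proof.
have [sL dL cL] := lattice_isoms; have GO : Gamma `<=` PGL_of (Omega psi) by move=> g /GG; exact: Gpsi_Omega.
split.
- exact: Omega_properly_convex.
- by split=> //; case: latG.
- move=> g p Gg Op gp; have [a La ga] := Gamma_isoP Gg; apply: Gamma_trivial => //.
  suff <- : a = 1%g by [].
  by apply: (isoms_free (y := yc p)) => //; have [<- _] := act_coord ga Op; rewrite gp.
- split; last exact: lattice_hausdorff.
  move=> p Op; have [e e0 He] := isoms_radius.
  exists (@affine R n @` [set x | dom_h psi x /\ [set w : 'cV[R]_n.-1 * R | en (w.1 - yc p) < e / 2] (Yc psi x, - h x)]); split.
  + by apply: tube_open; exact: open_ball_fst.
  + have [pE _] := Omega_coord Op; exists (Ph psi (yc p) (sc p)) => //; split; first exact: Ph_dom.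
    by rewrite /= Yc_Ph// subrr en0 divr_gt0.
  + move=> g q Gg [Oq [x [dx /= xe] xq]] [z [dz /= ze] zq]; have [a La ga] := Gamma_isoP Gg.
    apply: Gamma_trivial => //; suff <- : a = 1%g by [].
    apply: (He a (yc q)) => //; have [<- _] := act_coord ga Oq.
    rewrite -zq -xq /yc !aff_ptK -/(yc p).
    have -> : Yc psi z - Yc psi x = (Yc psi z - yc p) - (Yc psi x - yc p) by rewrite opprB addrA subrK.
    by apply: le_lt_trans (en_triangle _ _) _; rewrite enN; lra.
- exact: Omega_manifold_chart.
Qed.

Lemma lattice_virtually_abelian : virtually_abelian Gamma.
Proof.
have [sL dL cL] := lattice_isoms; have [L1 LM LV] := sL; have [G1 GM GV] := sG.
have [B1 BM BV] := bicommutant_subgroup sL.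
exists [set g | Gamma g /\ exists2 a, bicommutant L a & isoP psi g a]; split.
- split; first by split=> //; exists 1%g => //; exact: isoP1.
    move=> g k [Gg [a Ba ga]] [Gk [b Bb kb]]; split; first exact: GM.
    by exists (a * b)%g; [exact: BM|exact: isoPM].
  move=> g [Gg [a Ba ga]]; split; first exact: GV.
  by exists a^-1%g; [exact: BV|exact: isoPV].
- by move=> g [].
- move=> g k [Gg [a Ba ga]] [Gk [b Bb kb]]; apply: (isoP_inj Apsi n2 (isoPM ga kb)).
  by rewrite (bicommutant_abelian sL dL Ba Bb); exact: isoPM.
have [s sL' Hs] := bicommutant_finite_index sL.
have /choice[f Hf] : forall a, exists g, L a -> Gamma g /\ isoP psi g a.
  by move=> a; have [[g Gg ga]|nL] := pselect (L a); [exists g|exists 1%g].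
exists (map f s) => k Gk; have [b Lb kb] := Gamma_isoP Gk; have [a as_ Bab] := Hs _ Lb.
have [Gfa fa] := Hf a (sL' _ as_); exists (f a); first exact: map_f.
exists ((f a)^-1 * k)%g; last by rewrite mulgA mulgV mul1g.
split; first by apply: GM => //; exact: GV.
by exists (a^-1 * b)%g => //; apply: isoPM => //; exact: isoPV.
Qed.

Lemma lattice_bdry_compact : compact [set: orbit_space Gamma (bdry (Omega psi))] /\
  connected [set: orbit_space Gamma (bdry (Omega psi))].
Proof.
have [sL dL [D HD]] := lattice_isoms; have [L1 LM LV] := sL.
pose f y := orbit_pi Gamma (bdry_pt y).
have fc : continuous f by move=> y; apply: continuous_comp; [exact: bdry_pt_continuous|exact: orbit_pi_continuous].
have fs c : exists y, c = f y.
  have [x ->] := orbit_repr c; have /bdryP[y xy] := set_mem (valP x).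
  by exists y; congr orbit_pi; apply: val_inj.
split.
  have -> : [set: orbit_space Gamma (bdry (Omega psi))] = f @` [set y | en y <= D].
    apply/seteqP; split=> // c _; have [y ->] := fs c; have [a La ay] := HD y.
    exists (isom_act a y) => //; apply/orbit_piP => //=; have [g Gg ga] := La.
    by exists g; rewrite ?ga.
  by apply: continuous_compact; [exact: continuous_subspaceT|exact: ball_compact].
have -> : [set: orbit_space Gamma (bdry (Omega psi))] = f @` setT.
  by apply/seteqP; split=> // c _; have [y ->] := fs c; exists y.
apply: connected_continuous_connected; last exact: continuous_subspaceT.
apply: (@path_connected_connected R 'cV[R]_n.-1 setT 0) => // y _; exists (fun s => s *: y); split=> //.
- by move=> s; apply: cvgZr_tmp; exact: cvg_id.
- by rewrite scale0r.
- by rewrite scale1r.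
Qed.

(** [Gamma] acts on the coordinates (y, s) through y alone, so the product decomposition descends to
    the quotient. *)
Lemma lattice_diffeo_ray : diffeomorphic (@rep_orbit R n Gamma (Omega psi)) (@rep_orbit_ray R n Gamma (bdry (Omega psi))).
Proof.
have bO : bdry (Omega psi) `<=` Omega psi by move=> p [].
pose F (c : orbit_space Gamma (Omega psi)) := let x := val (fiber_repr c) in (orbit_pi Gamma (bdry_pt (yc x)), sc x).
pose G (w : orbit_space Gamma (bdry (Omega psi)) * R) := orbit_pi Gamma (omega_pt (yc (val (fiber_repr w.1))) w.2).
have FE (x : set_type (Omega psi)) : F (orbit_pi Gamma x) = (orbit_pi Gamma (bdry_pt (yc (val x))), sc (val x)).
  have : orbit_pi Gamma (fiber_repr (orbit_pi Gamma x)) = orbit_pi Gamma x by exact: fiber_reprK.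
  move=> /orbit_sc_yc[//|E [a La E']]; rewrite /F; congr pair; last by [].
  by apply/orbit_piP => //=; have [g Gg ga] := La; exists g; rewrite ?ga -?E'.
have GE (x : set_type (bdry (Omega psi))) s : G (orbit_pi Gamma x, s) = orbit_pi Gamma (omega_pt (yc (val x)) s).
  have : orbit_pi Gamma (fiber_repr (orbit_pi Gamma x)) = orbit_pi Gamma x by exact: fiber_reprK.
  move=> /orbit_sc_yc[//|E [a La E']]; rewrite /G.
  by apply/orbit_piP => //=; have [g Gg ga] := La; exists g; rewrite ?ga -?E'.
exists F, G; split.
- move=> v c [x vx _]; have [|cv _ _] := rep_proj_chart _ vx; first by [].
  exists chart_domain, (fun v => (hc (Ph psi (Yc psi (dehom v)) 0), - h (dehom v))); split=> //; first exact: chart_domain_open.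
    have o := chart_domain_open; move=> k; apply: Ck_pair => //; last exact: Ck_sc_chart.
    by apply: Ck_hc => //; apply: Ck_Ph => //; [exact: Ck_yc_chart|exact: Ck_cst].
  move=> w _ _ [z wz ->]; have [|_ E1 E2] := rep_proj_chart _ wz; first by [].
  rewrite FE E1 E2; split=> //=; last by have [Oz _] := wz; case: (Omega_coord Oz).
  by exists (bdry_pt (yc (val z))) => //=; apply: rep_proj_Ph; exact: bdry_mem.
- move=> [v s] [c s'] [/= [x vx cx] _ _]; have [|cv _ _] := rep_proj_chart _ vx; first exact: bO.
  have o : open [set w : 'cV[R]_(n + 1) * R | chart_domain w.1].
    have /continuousP : continuous (@fst 'cV[R]_(n + 1) R) by move=> w; exact: cvg_fst.
    by apply; exact: chart_domain_open.
  exists [set w | chart_domain w.1], (fun w => hc (Ph psi (Yc psi (dehom w.1)) w.2)); split=> //.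
    move=> k; apply: Ck_hc => //; apply: Ck_Ph => //; last by apply: Ck_snd => //; apply: Ck_id.
    apply: Ck_Yc => //; last by move=> w /chart_domainE[].
    by apply: Ck_dehom => //; [apply: Ck_fst => //; apply: Ck_id|move=> w /chart_domainE[]].
  move=> [w r] [q r'] /= cw [/= [z wz ->] -> r0]; have [|_ E1 E2] := rep_proj_chart _ wz; first exact: bO.
  rewrite E1 GE; exists (omega_pt (yc (val z)) r') => //=; rewrite max_r//.
  by apply: rep_proj_Ph; apply/OmegaP; exists (yc (val z)), r'.
- move=> v c [x _ ->]; rewrite FE GE; congr orbit_pi; apply: val_inj => /=.
  have [xE s0] := Omega_coord (set_mem (valP x)); by rewrite yc_Ph max_r// -xE.
- move=> [v s] [c s'] [/= [x _ ->] _ s0]; rewrite GE FE /= yc_Ph sc_Ph max_r//; congr pair; congr orbit_pi.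
  by apply: val_inj => /=; have /bdryP[y ->] := set_mem (valP x); rewrite yc_Ph.
Qed.

Theorem lattice_generalized_cusp : generalized_cusp (Omega psi) Gamma.
Proof.
split; [exact: lattice_properly_convex_manifold|exact: lattice_virtually_abelian|exact: lattice_bdry_compact| |exact: lattice_diffeo_ray].
by rewrite bdry_Omega//; exact: horosphere_no_segment.
Qed.

End CuspOfLattice.

(** * Equivalent cusps *)

Section PointwiseFixed.
Variables (R : realType) (n : nat).
Hypothesis n0 : (0 < n)%N.
Implicit Types (X N : set (RP R n)) (k : PGL R n).

Lemma derive_comp (V W W' : normedModType R) (f : V -> W) (g : W -> W') x v :
  differentiable f x -> differentiable g (f x) -> 'D_v (g \o f) x = 'd g (f x) ('d f x v).
Proof.
move=> df dg; rewrite deriveE; last exact: differentiable_comp.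
by rewrite (diff_comp df dg).
Qed.

Lemma derive_linear_comp (V W W' : normedModType R) (f : V -> W) (l : {linear W -> W'}) x v :
  continuous l -> differentiable f x -> 'D_v (fun z => l (f z)) x = l ('d f x v).
Proof.
move=> cl df; have dl : differentiable l (f x) by exact: linear_differentiable.
by rewrite (derive_comp (g := l))// diff_lin.
Qed.

(* The eigenvalues being finitely many, the eigenvalue of a continuous family of eigenvectors is locally constant. *)
Lemma eigenvalue_locally_constant (T : topologicalType) (M : 'M[R]_(n + 1)) (G : T -> 'cV[R]_(n + 1)) (w1 : T) :
  {for w1, continuous G} -> G w1 != 0 -> (\forall w \near w1, exists c : R, M *m G w = c *: G w) ->
  exists c1 : R, \forall w \near w1, M *m G w = c1 *: G w.
Proof.
move=> cG G0 H; have [i Gi] : exists i, G w1 i 0 != 0.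
  apply: contrapT => ni; move/eqP: G0; apply; apply/colP => i; rewrite mx0E.
  by apply/eqP; apply: contra_notT ni => ?; exists i.
pose c w := (M *m G w) i 0 / G w i 0.
have cGi : (fun w => G w i 0) @ w1 --> G w1 i 0 by apply: entry_cvg.
have cc : c w @[w --> w1] --> c w1.
  by apply: cvgM; [apply: entry_cvg; apply: mulmx_cvg => //; exact: cvg_cst|exact: cvgV].
have Gn : \forall w \near w1, G w i 0 != 0.
  by apply: (cGi [set r : R | r != 0]); apply: open_nbhs_nbhs; split=> //; exact: open_neq.
have Hc : \forall w \near w1, M *m G w = c w *: G w.
  near=> w; have [b e] : exists b : R, M *m G w = b *: G w by near: w.
  by have Gw : G w i 0 != 0 by [near: w]; rewrite /c e mxZE mulfK.
(* The characteristic polynomial is a power of X - c w1 times q, with q nonzero at c w1 and hence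
   near it, so its only root near c w1 is c w1. *)
have [m [q q0 pE]] := multiplicity_XsubC (char_poly M^T) (c w1).
have p0 : char_poly M^T != 0 by rewrite monic_neq0// char_poly_monic.
rewrite p0 /= in q0; have qn : \forall w \near w1, q.[c w] != 0.
  have qc := @cvg_comp _ _ _ c (horner q) _ _ _ cc (@continuous_horner R q (c w1)).
  by apply: (qc [set r : R | r != 0]); apply: open_nbhs_nbhs; split=> //; exact: open_neq.
exists (c w1); near=> w; have E : M *m G w = c w *: G w by near: w.
suff <- : c w = c w1 by [].
have Gw : G w i 0 != 0 by near: w.
have : root (char_poly M^T) (c w).
  rewrite -eigenvalue_root_char; apply/eigenvalueP; exists (G w)^T; first by rewrite -trmx_mul E linearZ.
  by apply: contra Gw => /eqP/(congr1 trmx); rewrite trmxK trmx0 => ->; rewrite mx0E.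
rewrite pE rootM => /orP[|]; first by rewrite rootE; apply: contraTeq => _; near: w.
case: (m) => [|m']; first by rewrite expr0 (negbTE (root1 _)).
by rewrite root_exp_XsubC => /eqP.
Unshelve. all: by end_near. Qed.

(* A chart is a left inverse F of a parametrization G of X, lifted to homogeneous coordinates; as F is constant on
   lines through 0, the derivative of G and the vector G w1 itself span. *)
Lemma chart_spans (G : 'cV[R]_n.-1 * R -> 'cV[R]_(n + 1)) (F : 'cV[R]_(n + 1) -> 'cV[R]_n.-1 * R) w1 (B : 'M[R]_(n + 1)) :
  differentiable G w1 -> differentiable F (G w1) -> G w1 != 0 ->
  (\forall w \near w1, F (G w) = w) -> (\forall c \near (1 : R), F (c *: G w1) = w1) ->
  (\forall w \near w1, B *m G w = 0) -> B = 0.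
Proof.
move=> dG dF G0 FG Fc BG.
have BG1 : B *m G w1 = 0 := nbhs_singleton BG.
have dFG u : 'd F (G w1) ('d G w1 u) = u.
  by rewrite -derive_comp// (near_eq_derive u FG) derive_id.
pose l (c : R) := c *: G w1; have lc : continuous l by move=> c; apply: cvgZr_tmp; exact: cvg_id.
have l1 : l 1 = G w1 by rewrite /l scale1r.
have dl : differentiable l (1 : R) by apply: (@linear_differentiable _ _ _ (scalev (G w1))).
have dFl : 'd F (G w1) (G w1) = 0.
  have e1 : 'd l (1 : R) 1 = G w1 by rewrite (@diff_lin _ _ _ (scalev (G w1)))// /scalev scale1r.
  have dF1 : differentiable F (l 1) by rewrite l1.
  have := derive_comp (1 : R) dl dF1; rewrite e1 l1 => <-.
  by rewrite (near_eq_derive (1 : R) Fc); exact: derive_cst.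
have dBG u : B *m 'd G w1 u = 0.
  have cB : continuous (mulmx B : 'cV[R]_(n + 1) -> 'cV[R]_(n + 1)) by exact: mulmxl_continuous.
  rewrite -(derive_linear_comp (l := mulmx B))//.
  by rewrite (near_eq_derive u BG); exact: derive_cst.
have dZ (c : R) u : 'd G w1 (c *: u) = c *: 'd G w1 u by rewrite linearZ.
pose D1 : 'M[R]_(n + 1, n.-1) := \matrix_(i, j) ('d G w1 (delta_mx j 0, 0)) i 0.
(* The n - 1 derivatives along the first factor, the one along the second and the vector itself make
   n + 1 columns, so injectivity makes A invertible. *)
pose A := row_mx (row_mx D1 ('d G w1 (0, 1))) (G w1).
have AE (x : 'cV[R]_(n.-1 + 1 + 1)) : exists u (c : R), A *m x = 'd G w1 u + c *: G w1 /\ (u = 0 -> c = 0 -> x = 0).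
  rewrite -[x]vsubmxK -[usubmx x]vsubmxK; set a := usubmx (usubmx x).
  rewrite [dsubmx (usubmx x)]mx11_scalar [dsubmx x]mx11_scalar; set b := _ 0 0; set c := _ 0 0.
  exists (a, b), c; rewrite /A !mul_row_col !mul_mx_scalar; split; last first.
    by move=> [-> ->] ->; rewrite !raddf0 !col_mx0.
  congr (_ + _); have -> : (a, b) = (a, 0) + b *: (0, 1) :> 'cV[R]_n.-1 * R.
    by apply/pair_equal_spec; split; rewrite /= ?scaler0 ?addr0// add0r /GRing.scale /= mulr1.
  rewrite raddfD /= linearZ; congr (_ + _).
  have -> : (a, 0) = \sum_j a j 0 *: (delta_mx j 0, 0) :> 'cV[R]_n.-1 * R.
    rewrite {1}[a]matrix_sum_delta; under eq_bigr do rewrite big_ord1.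
    rewrite (big_morph (fun v : 'cV[R]_n.-1 => (v, 0 : R)) (id1 := 0) (op1 := +%R))//.
      by apply: eq_bigr => j _; apply/pair_equal_spec; split; rewrite /= ?scaler0.
    by move=> v v'; apply/pair_equal_spec; split; rewrite /= ?addr0.
  rewrite raddf_sum; apply/colP => i; rewrite mxE summxE; apply: eq_bigr => j _.
  rewrite [X in _ = fun_of_matrix X _ _](_ : _ = a j 0 *: 'd G w1 (delta_mx j 0, 0)); last exact: dZ.
  by rewrite mxZE mxE mulrC.
have BA : B *m A = 0.
  apply/matrixP => i j; have : (B *m A) *m delta_mx j 0 = 0 :> 'cV_(n + 1).
    rewrite -mulmxA; have [u [c [-> _]]] := AE (delta_mx j 0).
    by rewrite mulmxDr dBG -scalemxAr BG1 scaler0 addr0.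
  by move/(congr1 (fun M : 'cV_(n + 1) => M i 0)); rewrite -colE mxE !mx0E.
have rA : row_free A^T.
  apply: inj_row_free => v vA; have [u [c [E H]]] := AE v^T.
  have E0 : 'd G w1 u + c *: G w1 = 0 by rewrite -E -[A]trmxK -trmx_mul vA trmx0.
  (* The derivative of F kills the vector G w1 and inverts that of G, so applying it to the linear
     relation leaves u = 0. *)
  have u0 : u = 0.
    have dFc : 'd F (G w1) (c *: G w1) = 0 by rewrite linearZ dFl; exact: scaler0.
    by have := congr1 ('d F (G w1)) E0; rewrite raddfD /= dFc addr0 dFG raddf0.
  have c0 : c = 0.
    by move: E0; rewrite u0 raddf0 add0r => /eqP; rewrite scaler_eq0 (negbTE G0) orbF => /eqP.
  by rewrite -[v]trmxK (H u0 c0) trmx0.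
have fA : row_free A.
  by move: rA; rewrite /row_free mxrank_tr => /eqP ->; rewrite !addn1 prednK.
by apply/eqP; rewrite -(mulmx_free_eq0 _ fA) BA.
Qed.

(** On the fixed piece of X every homogeneous vector is an eigenvector of k. The eigenvalue is
    locally constant, and the vectors given by a chart span, so k is scalar. *)
Lemma pointwise_fix X N x k :
  (exists (U : set (RP R n)) (W : set ('cV[R]_n.-1 * R)),
     [/\ open U, U x, open W & diffeomorphic (rep_proj (X `&` U)) (rep_half W)]) ->
  X x -> open N -> N x -> (forall z, X z -> N z -> act k z = z) -> k = 1%g.
Proof.
move=> [U [W [oU Ux oW [f [g [sf sg gf fg]]]]]] Xx oN Nx kfix.
have rx : rep_proj (X `&` U) (vec_of x) x.
  by split=> //; exists (vec_of_neq0 x); rewrite pt_vec_of.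
have [U0 [F0 [_ U0x _ /(_ _ _ U0x rx) [e0 Wf f0]]]] := sf _ _ rx.
set w0 := f x in Wf f0; have r0 : rep_half W w0 w0 by [].
have gw0 : g w0 = x := gf _ _ rx.
have [U1 [G [oU1 U1w sG HG]]] := sg _ _ r0.
have GP w : U1 w -> W w -> 0 <= w.2 -> rep_proj (X `&` U) (G w) (g w) by move=> U1w' Ww w2; exact: HG.
have contG w : U1 w -> {for w, continuous G} by move=> Uw; exact: (sG 0%N w Uw).
have lN : nbhs (G w0) (lift_set N).
  apply: open_nbhs_nbhs; split; first exact/lift_open.
  have [_ [v0 e]] := GP w0 U1w Wf f0; by exists v0; rewrite -e gw0.
have O0 : nbhs w0 [set w | [/\ U1 w, W w & lift_set N (G w)]].
  have h1 : nbhs w0 U1 by exact: open_nbhs_nbhs.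
  have h2 : nbhs w0 W by exact: open_nbhs_nbhs.
  have h3 := contG w0 U1w _ lN.
  by near=> w; split; near: w.
move: O0; rewrite nbhsE => -[O [oO Ow0] HO].
(* x may correspond to a boundary point of the half-space. The base point is moved inwards so that
   the chart covers a full neighbourhood of it and can be differentiated there. *)
pose curve (s : R) := (w0.1, w0.2 + s).
have [s s0 Os] : exists2 s : R, 0 < s & O (curve s).
  have cc : curve s @[s --> (0 : R)] --> w0.
    rewrite [X in _ --> X](_ : w0 = (w0.1, w0.2 + 0)); last by rewrite addr0; case: (w0).
    have a1 : (fun _ : R => w0.1) @ (0 : R) --> w0.1 by exact: cvg_cst.
    have a2 : (fun s : R => w0.2 + s) @ (0 : R) --> w0.2 + 0 by apply: cvgD; [exact: cvg_cst|exact: cvg_id].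
    exact: (cvg_pair a1 a2).
  have /nbhs_ballP[e /= e1 He] := cc _ (open_nbhs_nbhs (conj oO Ow0)).
  exists (e / 2); first by rewrite divr_gt0.
  by apply: He; rewrite /ball /= sub0r normrN gtr0_norm; lra.
pose w1 := curve s; have w12 : 0 < w1.2 by rewrite /w1 /=; lra.
have nO : nbhs w1 O by exact: open_nbhs_nbhs.
have nP : nbhs w1 [set w : 'cV[R]_n.-1 * R | 0 < w.2].
  by apply: open_nbhs_nbhs; split=> //; exact: (@open_snd _ _ [set r : R | 0 < r] (@open_gt _ 0)).
have near1 : \forall w \near w1, [/\ U1 w, W w, lift_set N (G w) & 0 <= w.2].
  near=> w; have Ow : O w by near: w.
  have [? ? ?] := HO _ Ow; split=> //; apply: ltW; by near: w.
have [U1w1 Ww1 Nw1 w1g] := nbhs_singleton near1.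
have rw1 : rep_proj (X `&` U) (G w1) (g w1) by exact: GP.
have [U2 [F [oU2 U2v sF HF]]] := sf _ _ rw1.
have rep_ptZ c : c != 0 -> rep_proj (X `&` U) (c *: G w1) (g w1).
  move=> c0; have [Xg [v0 e]] := rw1; split=> //.
  have cv : c *: G w1 != 0 by rewrite scaler_eq0 negb_or c0.
  by exists cv; rewrite e; apply/pt_eqP; exists c.
have [v10 gv1] : exists v0 : G w1 != 0, g w1 = pt v0 by case: rw1.
have FG : \forall w \near w1, F (G w) = w.
  have h2 : \forall w \near w1, U2 (G w) by apply: (contG w1 U1w1); exact: open_nbhs_nbhs.
  near=> w; have [U1w' Ww _ w2] : [/\ U1 w, W w, lift_set N (G w) & 0 <= w.2] by near: w.
  have [|-> _ _] := HF (G w) (g w) _ (GP _ U1w' Ww w2); first by near: w.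
  by apply: (fg w).
have Fc : \forall c \near (1 : R), F (c *: G w1) = w1.
  have lc : (fun c : R => c *: G w1) @ (1 : R) --> G w1.
    by rewrite -[X in _ --> X]scale1r; apply: cvgZr_tmp; exact: cvg_id.
  have h2 : \forall c \near (1 : R), U2 (c *: G w1) by apply: lc; exact: open_nbhs_nbhs.
  have h3 : \forall c \near (1 : R), c != 0.
    by apply: open_nbhs_nbhs; split; [exact: open_neq|exact: oner_neq0].
  near=> c; have [||-> _ _] := HF (c *: G w1) (g w1); first by near: c.
    by apply: rep_ptZ; near: c.
  by apply: (fg w1).
have eig : \forall w \near w1, exists c : R, mx_of k *m G w = c *: G w.
  near=> w; have [U1w' Ww [v0 Nv] w2] : [/\ U1 w, W w, lift_set N (G w) & 0 <= w.2] by near: w.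
  have [[Xg _] [v0' ge]] := GP _ U1w' Ww w2.
  have := kfix (pt v0'); rewrite -ge => /(_ Xg); rewrite ge.
  move=> /(_ (eq_ind _ N Nv _ (pt_congr v0 v0' erefl))).
  by rewrite -[k]pgl_mx_of act_pgl_pt => /esym/pt_eqP[c _ e]; exists c; move: e; rewrite pgl_mx_of.
have [c1 Hc1] := eigenvalue_locally_constant (contG w1 U1w1) v10 eig.
have B0 : mx_of k - c1%:M = 0.
  apply: (chart_spans (w1 := w1) (G := G) (F := F)) => //.
  - by have /CkS[+ _] := sG 1%N; apply.
  - by have /CkS[+ _] := sF 1%N; apply.
  - by near=> w; rewrite mulmxBl mul_scalar_mx; apply/eqP; rewrite subr_eq0; apply/eqP; near: w.
have Mk : mx_of k = c1 *: 1%:M by apply/eqP; rewrite -subr_eq0 scalemx1 B0.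
have c10 : c1 != 0.
  by apply/eqP => c10; have := mulmx_neq0 (mx_of_unit k) v10; rewrite Mk c10 scale0r mul0mx eqxx.
by rewrite -[k]pgl_mx_of; apply/esym/(pgl_eqP (unitmx1 R (n + 1)) (mx_of_unit k)); exists c1.
Unshelve. all: by end_near. Qed.

End PointwiseFixed.

(** * Lifting a projective embedding to one projective map *)

Section SingleLift.
Variables (R : realType) (n : nat).
Hypothesis n0 : (0 < n)%N.
Variables (X X'' : set (RP R n)) (G G'' : set (PGL R n)).
Hypotheses (sG : is_subgroup G) (GX : G `<=` PGL_of X).
Hypothesis cov : forall x, X x -> exists U : set (RP R n), [/\ open U, U x &
  forall g y, G g -> (X `&` U) y -> U (act g y) -> g = 1%g].
Hypothesis conv : properly_convex X''.
Hypothesis chart : forall x, X'' x -> exists (U : set (RP R n)) (W : set ('cV[R]_n.-1 * R)),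
  [/\ open U, U x, open W & diffeomorphic (rep_proj (X'' `&` U)) (rep_half W)].

Lemma act_PGL_of (A : set (RP R n)) g x : PGL_of A g -> A x -> A (act g x).
Proof.
move=> gA Ax; have : (act g @` A) (act g x) by exists x.
by rewrite (_ : act g @` A = A).
Qed.

(** The group element d relating g and h is constant near x, because an orbit meets the
    neighbourhood U in at most one point. So (d h)^-1 g fixes an open piece of X'' pointwise. *)
Lemma orbit_agreement (g h : PGL R n) x N : X'' x -> open N -> N x ->
  (forall z, X'' z -> N z -> X (act h z) /\ exists2 d, G d & act g z = act d (act h z)) ->
  exists2 d, G d & g = (d * h)%g.
Proof.
move=> Xx oN Nx H; have [Xhx [d0 Gd0 gx]] := H x Xx Nx.
have [G1 GM GV] := sG; have [U [oU Ux HU]] := cov Xhx.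
exists d0 => //; suff e : ((d0 * h)^-1 * g)%g = 1%g by rewrite -[RHS]mulg1 -e mulgA mulgV mul1g.
pose N' := N `&` (act h @^-1` U) `&` (act (d0^-1 * g)%g @^-1` U).
apply: (@pointwise_fix _ _ n0 X'' N' x _ (chart Xx)) => //.
- by apply: openI; [apply: openI => //; exact: act_open|exact: act_open].
- by split; [split|]; rewrite //= actM gx actVK.
- move=> z Xz [[Nz Uhz] Ugz]; have [Xhz [d Gd gz]] := H z Xz Nz.
  have dd : (d0^-1 * d)%g = 1%g.
    apply: (HU _ (act h z)) => //; first by apply: GM => //; exact: GV.
    by rewrite actM -gz -actM.
  have de : d = d0 by rewrite -[d]mul1g -(mulgV d0) -mulgA dd mulg1.
  by rewrite actM gz de -[act d0 (act h z)]actM actVK.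
Qed.

Lemma independent_vec_of (x y : RP R n) : x <> y -> independent (vec_of x) (vec_of y).
Proof.
move=> xy; suff : row_free (row_mx (vec_of x) (vec_of y))^T by rewrite /row_free mxrank_tr => /eqP.
apply: inj_row_free => w; rewrite tr_row_mx -[w]hsubmxK [lsubmx w]mx11_scalar [rsubmx w]mx11_scalar.
set a := _ 0 0; set b := rsubmx _ _ _; rewrite mul_row_col !mul_scalar_mx -!linearZ -linearD => /(congr1 trmx).
rewrite trmxK trmx0 => E; have [b0|b0] := eqVneq b 0.
  move/eqP: E; rewrite b0 scale0r addr0 scaler_eq0 (negbTE (vec_of_neq0 x)) orbF => /eqP ->.
  by rewrite !raddf0 row_mx0.
exfalso; apply: xy; have yE : vec_of y = (- (a / b)) *: vec_of x.
  apply: (scalerI b0); rewrite scalerA mulrN mulrCA divff// mulr1 scaleNr.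
  by apply/eqP; rewrite -addr_eq0 addrC E.
rewrite -[x]pt_vec_of -[y]pt_vec_of; apply/pt_eqP; exists (- (a / b)) => //.
by apply: contra_neq (vec_of_neq0 y) => e; rewrite yE e scale0r.
Qed.

Variable f : orbit_space G'' X'' -> orbit_space G X.
Hypothesis floc : forall x : set_type X'', exists (U : set (RP R n)) (g : PGL R n),
  [/\ open U, U (val x) & forall y : set_type X'', U (val y) ->
     exists2 z : set_type X, val z = act g (val y) & f (orbit_pi G'' y) = orbit_pi G z].

Definition local_lift (x : RP R n) (g : PGL R n) := exists N : set (RP R n), [/\ open N, N x &
  forall y : set_type X'', N (val y) ->
     exists2 z : set_type X, val z = act g (val y) & f (orbit_pi G'' y) = orbit_pi G z].

Lemma local_lift_agree x g h : X'' x -> local_lift x g -> local_lift x h -> exists2 d, G d & g = (d * h)%g.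
Proof.
move=> Xx [N [oN Nx HN]] [N' [oN' Nx' HN']].
apply: (orbit_agreement Xx (openI oN oN')) => // z Xz [Nz Nz'].
have [z1 e1 E1] := HN (point_in Xz) Nz; have [z2 e2 E2] := HN' (point_in Xz) Nz'.
move: E1; rewrite E2 => /esym/(orbit_piP _ _ sG)[d Gd e].
split; first by have := set_mem (valP z2); rewrite e2.
by exists d => //; rewrite -[z]/(val (point_in Xz)) -e1 e e2.
Qed.

Lemma local_lift_translate x d h : G d -> local_lift x h -> local_lift x (d * h)%g.
Proof.
move=> Gd [N [oN Nx HN]]; exists N; split=> // y Ny; have [z ze fz] := HN y Ny.
have Xdz : X (act d (val z)) by apply: act_PGL_of; [exact: GX|exact: set_mem (valP z)].
exists (point_in Xdz); first by rewrite /= ze actM.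
rewrite fz; apply/orbit_piP => //; have [_ _ GV] := sG; exists d^-1%g; [exact: GV|by rewrite /= actVK].
Qed.

(** The set of points at which g0 is a local lift is open and closed in X''. Connectedness is used
    on the intersection with a projective line, which is the form in which proper convexity provides
    it. *)
Lemma single_lift : exists g0, forall y : set_type X'',
  exists2 z : set_type X, val z = act g0 (val y) & f (orbit_pi G'' y) = orbit_pi G z.
Proof.
have [nx|/existsNP[x0 _]] := pselect (forall x : set_type X'', False); first by exists 1%g => y; case: (nx y).
have Xx0 := set_mem (valP x0); have [N0 [g0 [oN0 Nx0 HN0]]] := floc x0; exists g0.
have l0 : local_lift (val x0) g0 by exists N0.
have lop x : local_lift x g0 -> exists N : set (RP R n), [/\ open N, N x & forall z, N z -> local_lift z g0].
  by move=> [N [oN Nx HN]]; exists N; split=> // z Nz; exists N.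
(* If g0 is a local lift at a point z near x, the local lift at x differs from g0 by an element of
   G, which makes g0 a local lift at x as well. *)
have lcl x : X'' x -> ~ local_lift x g0 -> exists N : set (RP R n), [/\ open N, N x & forall z, X'' z -> N z -> ~ local_lift z g0].
  move=> Xx nl; have [N [g [oN Nx HN]]] := floc (point_in Xx); exists N; split=> // z Xz Nz lz; apply: nl.
  have lg : local_lift z g by exists N.
  by have [d Gd ->] := local_lift_agree Xz lz lg; apply: local_lift_translate => //; exists N.
suff H x : X'' x -> local_lift x g0.
  by move=> y; have [N [oN Ny HN]] := H _ (set_mem (valP y)); exact: HN.
move=> Xx; have [<- //|xx] := pselect (val x0 = x).
have [con _] := conv (independent_vec_of xx).
set l := proj_line _ _ in con.
have lx0 : l (val x0).
  have h0 : 1 *: vec_of (val x0) + 0 *: vec_of x != 0 by rewrite scale1r scale0r addr0 vec_of_neq0.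
  by exists 1, 0, h0; rewrite -[LHS]pt_vec_of; apply: pt_congr; rewrite scale1r scale0r addr0.
have lx : l x.
  have h0 : 0 *: vec_of (val x0) + 1 *: vec_of x != 0 by rewrite scale1r scale0r add0r vec_of_neq0.
  by exists 0, 1, h0; rewrite -[LHS]pt_vec_of; apply: pt_congr; rewrite scale1r scale0r add0r.
pose B := X'' `&` l `&` [set z | local_lift z g0].
have BE : B = X'' `&` l.
  apply: con; first by exists (val x0); split; [split|].
    exists (\bigcup_(N in [set N : set (RP R n) | open N /\ forall z, N z -> local_lift z g0]) N).
      by apply: bigcup_open => N [].
    apply/seteqP; split=> z [Xlz].
      by move=> /lop[N [oN Nz HN]]; split=> //; exists N.
    by move=> [N [oN HN] Nz]; split=> //; exact: HN.
  exists (~` \bigcup_(N in [set N : set (RP R n) | open N /\ forall z, X'' z -> N z -> ~ local_lift z g0]) N).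
    by apply: open_closedC; apply: bigcup_open => N [].
  apply/seteqP; split=> z [Xlz].
    by move=> lz; split=> // -[N [_ HN] Nz]; apply: HN lz => //; case: Xlz.
  move=> nz; split=> //; apply: contrapT => nl; apply: nz.
  by have [N [oN Nz HN]] := lcl z Xlz.1 nl; exists N.
by have [] : B x by rewrite BE.
Qed.

Hypotheses (sG'' : is_subgroup G'') (GX'' : G'' `<=` PGL_of X'').

(** g0 d and g0 induce the same map to the orbits of G, so they differ by an element of G. *)
Lemma single_lift_conj g0 : X'' !=set0 -> (forall y : set_type X'',
  exists2 z : set_type X, val z = act g0 (val y) & f (orbit_pi G'' y) = orbit_pi G z) ->
  forall d, G'' d -> G (g0 * d * g0^-1)%g.
Proof.
move=> [x Xx] H d Gd; have [|a Ga e] := @orbit_agreement (g0 * d)%g g0 x setT Xx openT I; last first.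
  by rewrite e mulgK.
move=> z Xz _; have [z1 e1 f1] := H (point_in Xz).
have Xdz : X'' (act d z) by apply: act_PGL_of => //; exact: GX''.
have [z2 e2 f2] := H (point_in Xdz).
split; first by have := set_mem (valP z1); rewrite e1.
have E : orbit_pi G'' (point_in Xdz) = orbit_pi G'' (point_in Xz) by apply/orbit_piP => //; exists d.
move: f2; rewrite E f1 => /esym/(orbit_piP _ _ sG)[a Ga ea]; exists a => //.
by rewrite actM -[z in RHS]/(val (point_in Xz)) -e1 -ea e2.
Qed.

End SingleLift.

(** * Lifting a homotopy to the universal cover *)

Section HomotopyLifting.
Variables (R : realType) (n : nat) (psi : 'rV[R]_n).
Hypothesis Apsi : weyl psi.
Hypothesis n2 : (1 < n)%N.
Let n0 : (0 < n)%N := ltnW n2.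
Variable Gamma : set (PGL R n).
Hypothesis latG : lattice (Gpsi psi) Gamma.
Hypothesis tfG : torsion_free Gamma.
Let sG : is_subgroup Gamma. Proof. by case: latG. Qed.
Let GG : Gamma `<=` Gpsi psi. Proof. by case: latG. Qed.
Local Notation L := (isoms psi Gamma).
Local Notation X := (orbit_space Gamma (Omega psi)).
Implicit Types (y z : 'cV[R]_n.-1) (c : X) (s : R) (a b : isom R n.-1).

(* In the coordinate y of the universal cover, the orbit of L lying over c. *)
Definition fiber_over c : set 'cV[R]_n.-1 :=
  [set y | exists2 x : set_type (Omega psi), c = orbit_pi Gamma x & yc psi (val x) = y].

Lemma fiber_over_pi (x : set_type (Omega psi)) : fiber_over (orbit_pi Gamma x) (yc psi (val x)).
Proof. by exists x. Qed.

Lemma fiber_over_orbit c z z' : fiber_over c z -> fiber_over c z' -> exists2 a, L a & z = isom_act a z'.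
Proof.
move=> [x -> <-] [x' e <-]; have [|_ [a La E]] := orbit_sc_yc Apsi n2 latG _ e; first by [].
by exists a.
Qed.

Lemma fiber_over_act c z a : L a -> fiber_over c z -> fiber_over c (isom_act a z).
Proof.
move=> [g Gg ga] [x -> <-]; have Ox := set_mem (valP x); have [xE s0] := Omega_coord Apsi n2 Ox.
exists (omega_pt Apsi n2 (isom_act a (yc psi (val x))) (sc psi (val x))); last by rewrite /= yc_Ph.
have [G1 GM GV] := sG; apply/orbit_piP => //; exists g^-1%g; first exact: GV.
by rewrite /= max_r// -ga -xE actVK.
Qed.

(** Continuity of the fibres for the Hausdorff distance. Whole sets of lifts are compared, which
    takes the place of path lifting. *)
Lemma fiber_over_near c (e : R) : 0 < e -> exists Q : set X, [/\ open Q, Q c & forall c', Q c' ->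
  (forall z, fiber_over c z -> exists2 z', fiber_over c' z' & en (z - z') < e) /\
  (forall z, fiber_over c' z -> exists2 z', fiber_over c z' & en (z - z') < e)].
Proof.
move=> e0; have [x ->] := orbit_repr c; have [xE _] := Omega_coord Apsi n2 (set_mem (valP x)).
pose T := @affine R n @` [set u | dom_h psi u /\ [set w : 'cV[R]_n.-1 * R | en (w.1 - yc psi (val x)) < e] (Yc psi u, - horo_fun psi u)].
exists [set c' | exists2 x' : set_type (Omega psi), c' = orbit_pi Gamma x' & T (val x')]; split.
- apply: orbit_pi_open => //; first by move=> g /GG; exact: Gpsi_Omega.
  by apply: tube_open => //; exact: open_ball_fst.
- exists x => //; exists (Ph psi (yc psi (val x)) (sc psi (val x))) => //; split; first exact: Ph_dom.
  by rewrite /= Yc_Ph// subrr en0.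
- move=> _ [x' -> [u [du /= uT] xu]].
  have near : en (yc psi (val x') - yc psi (val x)) < e.
    have xv : val x' = affine u by rewrite xu.
    by rewrite xv {1}/yc aff_ptK.
  split=> z Hz.
    have [a La ->] := fiber_over_orbit Hz (fiber_over_pi x).
    exists (isom_act a (yc psi (val x'))); first by apply: fiber_over_act => //; exact: fiber_over_pi.
    by rewrite isom_act_dist -enN opprB.
  have [a La ->] := fiber_over_orbit Hz (fiber_over_pi x').
  exists (isom_act a (yc psi (val x))); first by apply: fiber_over_act => //; exact: fiber_over_pi.
  by rewrite isom_act_dist.
Qed.

Definition cover_pt y : X := orbit_pi Gamma (omega_pt Apsi n2 y 0).

Lemma cover_pt_act a y : L a -> cover_pt (isom_act a y) = cover_pt y.
Proof. by move=> [g Gg ga]; apply/orbit_piP => //=; exists g; rewrite ?ga. Qed.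

Lemma cover_pt_fiber y : fiber_over (cover_pt y) y.
Proof. by exists (omega_pt Apsi n2 y 0) => //=; rewrite yc_Ph. Qed.

Lemma cover_pt_continuous : continuous cover_pt.
Proof.
have H : continuous (fun y => omega_pt Apsi n2 y 0).
  have H : continuous (@affine R n \o (fun y => Ph psi y (Num.max 0 0))); last exact: sub_continuous.
  move=> y; apply: continuous_comp; last exact: affine_continuous.
  by apply: (@Ph_cvg _ _ _ _ _ (nbhs_filter y) id (fun=> Num.max 0 0)); [exact: cvg_id|exact: cvg_cst].
by move=> y; apply: continuous_comp; [exact: H|exact: orbit_pi_continuous].
Qed.

Variable F : X * R -> X.
Hypothesis Fc : {within [set p | 0 <= p.2 <= 1], continuous F}.
Local Notation K y s := (F (cover_pt y, s)).

Lemma homotopy_near y s (Q : set X) : 0 <= s <= 1 -> open Q -> Q (K y s) -> exists2 r : R, 0 < r &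
  forall y' s', en (y' - y) < r -> `|s - s'| < r -> 0 <= s' <= 1 -> Q (K y' s').
Proof.
move=> s01 oQ Qys; have /subspace_continuousP/(_ (cover_pt y, s) s01) H := Fc.
have {}H : nbhs (cover_pt y, s) [set p : X * R | 0 <= p.2 <= 1 -> Q (F p)].
  by apply: (H Q); apply: open_nbhs_nbhs.
have c1 : (fun w : 'cV[R]_n.-1 * R => cover_pt w.1) @ (y, s) --> cover_pt y.
  have c0 : (fun w : 'cV[R]_n.-1 * R => w.1) @ (y, s) --> y by exact: cvg_fst.
  exact: (@cvg_comp _ _ _ _ cover_pt _ _ _ c0 (@cover_pt_continuous y)).
have c2 : (fun w : 'cV[R]_n.-1 * R => w.2) @ (y, s) --> s by exact: cvg_snd.
have [[A B] /= [nA nB] AB] := cvg_pair c1 c2 H.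
have [r1 r10 H1] := (nbhs_en _ _).1 nA; have /nbhs_ballP[r2 /= r20 H2] := nB.
exists (Num.min r1 r2); first by rewrite lt_min r10.
move=> y' s'; rewrite !lt_min => /andP[y1 _] /andP[_ y2] s'01.
by apply: (AB (y', s')) => //=; split; [exact: H1|exact: H2].
Qed.

(** Uniformity in y follows from compactness of a ball times [0, 1], since the fibres depend only on
    y modulo L. *)
Lemma homotopy_uniform (e : R) : 0 < e -> exists2 d : R, 0 < d & forall y y' s s', 0 <= s <= 1 -> 0 <= s' <= 1 ->
  en (y' - y) < d -> `|s - s'| < d -> forall z, fiber_over (K y s) z -> exists2 z', fiber_over (K y' s') z' & en (z - z') < e.
Proof.
move=> e0; have [sL dL [D HD]] := lattice_isoms Apsi n2 latG; apply: contrapT => H.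
pose bad (d : R) y y' (s s' : R) := [/\ 0 <= s <= 1, 0 <= s' <= 1, en (y' - y) < d, `|s - s'| < d &
  exists2 z, fiber_over (K y s) z & forall z', fiber_over (K y' s') z' -> ~ en (z - z') < e].
have /choice[u Hu] : forall k : nat, exists u : ('cV[R]_n.-1 * R) * ('cV[R]_n.-1 * R),
    en u.1.1 <= D /\ bad k.+1%:R^-1 u.1.1 u.2.1 u.1.2 u.2.2.
  move=> k; apply: contrapT => nk; apply: H; exists k.+1%:R^-1; first by rewrite invr_gt0.
  move=> y y' s s' s01 s'01 yy ss z Kz; apply: contrapT => nz; apply: nk; have [a La ay] := HD y.
  exists ((isom_act a y, s), (isom_act a y', s')) => /=; split=> //; split; rewrite ?isom_act_dist//.
  exists z; first by rewrite cover_pt_act.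
  by move=> z' Kz' zz'; apply: nz; exists z' => //; rewrite cover_pt_act in Kz'.
have cpt : compact ([set y : 'cV[R]_n.-1 | en y <= D] `*` `[(0 : R), 1]%classic).
  by apply: compact_setX; [exact: ball_compact|exact: segment_compact].
have uK k : ([set y : 'cV[R]_n.-1 | en y <= D] `*` `[(0 : R), 1]%classic) (u k).1.
  by have [? [? _ _ _ _]] := Hu k; split=> //=; rewrite in_itv.
have [[y s] [/= _ s01] cl] := compact_seq_cluster cpt uK; rewrite in_itv /= in s01.
have e2 : 0 < e / 2 by rewrite divr_gt0.
have [Q [oQ Qys HQ]] := fiber_over_near (K y s) e2.
have [r r0 Hr] := homotopy_near s01 oQ Qys.
have [k kr] : exists k : nat, k.+1%:R^-1 < r / 2.
  exists (Num.truncn (r / 2)^-1); rewrite -[ltRHS]invrK ltf_pV2 ?posrE ?invr_gt0 ?divr_gt0//.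
  by apply: truncnS_gt.
have r2 : 0 < r / 2 by rewrite divr_gt0.
have nU : nbhs (y, s) [set w : 'cV[R]_n.-1 * R | en (w.1 - y) < r / 2 /\ `|s - w.2| < r / 2].
  exists ([set y' | en (y' - y) < r / 2], [set s' | `|s - s'| < r / 2]) => //=.
  by split; [apply/nbhs_en; exists (r / 2)|apply/nbhs_ballP; exists (r / 2)].
have [l kl [u1 u2]] := cl _ k nU; have [_ [v1 v2 v3 v4 [z Kz nz]]] := Hu l.
have lk : l.+1%:R^-1 <= k.+1%:R^-1 :> R by rewrite lef_pV2 ?posrE ?ler_nat.
have b1 := le_lt_trans lk kr.
have Q1 : Q (K (u l).1.1 (u l).1.2) by apply: Hr => //; lra.
have Q2 : Q (K (u l).2.1 (u l).2.2).
  apply: Hr => //.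
    have -> : (u l).2.1 - y = ((u l).2.1 - (u l).1.1) + ((u l).1.1 - y) by rewrite addrA subrK.
    by apply: le_lt_trans (en_triangle _ _) _; rewrite [ltRHS](splitr r); exact: (ltrD (lt_trans v3 b1) u1).
  have -> : s - (u l).2.2 = (s - (u l).1.2) + ((u l).1.2 - (u l).2.2) by rewrite addrA subrK.
  by apply: le_lt_trans (ler_normD _ _) _; rewrite [ltRHS](splitr r); exact: (ltrD u2 (lt_trans v4 b1)).
(* z1 lies over the limit point and mediates between the fibres over the two nearby points. *)
have [z1 Kz1 z1e] := (HQ _ Q1).2 z Kz; have [z2 Kz2 z2e] := (HQ _ Q2).1 z1 Kz1.
apply: nz Kz2 _; have -> : z - z2 = (z - z1) + (z1 - z2) by rewrite addrA subrK.
by apply: le_lt_trans (en_triangle _ _) _; lra.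
Qed.

Hypothesis F1 : forall c, F (c, 1) = c.

(** The identity lifts F at time 1. The time interval is run through backwards in steps so short
    that each lift determines the next. *)
Lemma homotopy_lift : exists phi : 'cV[R]_n.-1 -> 'cV[R]_n.-1, [/\ forall y, fiber_over (K y 0) (phi y),
  forall a y, L a -> phi (isom_act a y) = isom_act a (phi y) & continuous phi].
Proof.
have [e0 e00 He0] := isoms_radius Apsi n2 latG tfG.
have uniq c z z' : fiber_over c z -> fiber_over c z' -> en (z - z') < e0 -> z = z'.
  move=> cz cz' zz; have [a La zE] := fiber_over_orbit cz cz'; rewrite zE in zz *.
  by rewrite (He0 a z' La zz) isom_act1.
(* Distinct points of one fibre are at least e0 apart, so a lift within e0 / 4 is unique; the proof
   of equivariance adds up two such errors, that of continuity four. *)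
have e4 : 0 < e0 / 4 by rewrite divr_gt0.
have [d d0 Hd] := homotopy_uniform e4.
pose N := (Num.truncn d^-1).+1; have Nd : N%:R^-1 < d.
  by rewrite -[ltRHS]invrK ltf_pV2 ?posrE ?invr_gt0// truncnS_gt.
(* Time runs from 1 at i = 0 down to 0 at i = N. *)
pose t (i : nat) : R := 1 - i%:R / N%:R.
have N0 : (0 : R) < N%:R by rewrite ltr0n.
have t01 i : (i <= N)%N -> 0 <= t i <= 1.
  move=> iN; rewrite /t subr_ge0 ler_pdivrMr// mul1r ler_nat iN gerBl divr_ge0// ler0n; by [].
suff H i : (i <= N)%N -> exists phi : 'cV[R]_n.-1 -> 'cV[R]_n.-1, [/\ forall y, fiber_over (K y (t i)) (phi y),
    forall a y, L a -> phi (isom_act a y) = isom_act a (phi y) &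
    forall y (e : R), 0 < e -> exists2 r : R, 0 < r & forall y', en (y' - y) < r -> en (phi y' - phi y) < e].
  have [phi [P1 P2 P3]] := H N (leqnn N); exists phi; split=> //.
    by move=> y; have := P1 y; rewrite /t divff ?gt_eqF// subrr.
  move=> y A /nbhs_en[e e1 He]; apply/nbhs_en; have [r r0 Hr] := P3 y e e1; exists r => // y' yy.
  by apply: He; exact: Hr.
elim: i => [_|i IH iN].
  exists id; split=> //; last by move=> y e e1; exists e.
  by move=> y; rewrite /t mul0r subr0 F1; exact: cover_pt_fiber.
have [phi [P1 P2 P3]] := IH (ltnW iN).
have /choice[phi' HP] y : exists z', fiber_over (K y (t i.+1)) z' /\ en (phi y - z') < e0 / 4.
  have tt : `|t i - t i.+1| < d.
    have -> : t i - t i.+1 = N%:R^-1 by rewrite /t -natr1; field; rewrite gt_eqF.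
    by rewrite gtr0_norm ?invr_gt0.
  have yy : en (y - y) < d by rewrite subrr en0.
  by have [z' ? ?] := Hd y y _ _ (t01 _ (ltnW iN)) (t01 _ iN) yy tt _ (P1 y); exists z'.
exists phi'; split=> [y|a y La|y e e1]; first by have [] := HP y.
  have [Q1 Q2] := HP y; have [Q3 Q4] := HP (isom_act a y).
  apply: (uniq _ _ _ Q3); first by rewrite cover_pt_act//; exact: fiber_over_act.
  have -> : phi' (isom_act a y) - isom_act a (phi' y) = - (phi (isom_act a y) - phi' (isom_act a y)) + (isom_act a (phi y) - isom_act a (phi' y)).
    by rewrite P2// opprB addrA subrK.
  by apply: le_lt_trans (en_triangle _ _) _; rewrite enN isom_act_dist; lra.
pose e' := Num.min e (e0 / 4); have e'0 : 0 < e' by rewrite lt_min e1.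
have [d' d'0 Hd'] := homotopy_uniform e'0; have [r r0 Hr] := P3 y _ e4.
exists (Num.min d' r); first by rewrite lt_min d'0.
move=> y'; rewrite lt_min => /andP[yd yr]; have [Q1 Q2] := HP y; have [Q3 Q4] := HP y'.
have tt : `|t i.+1 - t i.+1| < d' by rewrite subrr normr0.
have [z' Kz' z'e] := Hd' y y' _ _ (t01 _ iN) (t01 _ iN) yd tt _ Q1.
move: z'e; rewrite lt_min => /andP[z1 z2].
suff <- : z' = phi' y' by rewrite -enN opprB.
apply: (uniq _ _ _ Kz' Q3).
have -> : z' - phi' y' = - (phi' y - z') + (- (phi y - phi' y) + (- (phi y' - phi y) + (phi y' - phi' y'))).
  by rewrite !opprB; apply/colP => j; rewrite !(mxDE, mxNE); ring.
have yr' := Hr _ yr; apply: le_lt_trans (en_triangle _ _) _; rewrite enN.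
have T1 := en_triangle (- (phi y - phi' y)) (- (phi y' - phi y) + (phi y' - phi' y')).
have T2 := en_triangle (- (phi y' - phi y)) (phi y' - phi' y').
by rewrite !enN in T1 T2; lra.
Qed.

Variables (X'' : set (RP R n)) (G'' : set (PGL R n)) (g0 : PGL R n).
Hypotheses (sG'' : is_subgroup G'') (GX'' : G'' `<=` PGL_of X'').
Variables (f : orbit_space G'' X'' -> X) (hX : X -> orbit_space G'' X'').
Hypothesis Hg0 : forall y : set_type X'',
  exists2 z : set_type (Omega psi), val z = act g0 (val y) & f (orbit_pi G'' y) = orbit_pi Gamma z.
Hypothesis g0G : forall d, G'' d -> Gamma (g0 * d * g0^-1)%g.
Hypothesis hXc : continuous hX.
Hypothesis F0 : forall c, F (c, 0) = f (hX c).

(** phi is an equivariant lift of f o hX. Over y it equals a q(z) with z over the image of y under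
    hX and a in L. The coset of a modulo the conjugate of G'' is locally constant in y, hence
    constant, and equivariance of phi shows that this coset is all of L. *)
Lemma lift_onto : conjset g0 G'' = Gamma.
Proof.
have [phi [P1 P2 P3]] := homotopy_lift.
have [sL dL cL] := lattice_isoms Apsi n2 latG; have [L1 LM LV] := sL.
have [e0 e00 He0] := isoms_radius Apsi n2 latG tfG.
pose q (z : set_type X'') := yc psi (act g0 (val z)).
have qf (z : set_type X'') : fiber_over (f (orbit_pi G'' z)) (q z).
  by have [x xz ->] := Hg0 z; rewrite /q -xz; exact: fiber_over_pi.
have Og (z : set_type X'') : Omega psi (act g0 (val z)).
  by have [x <- _] := Hg0 z; exact: set_mem (valP x).
pose S y a := L a /\ exists2 z : set_type X'', hX (cover_pt y) = orbit_pi G'' z & phi y = isom_act a (q z).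
pose L'' a := exists2 d, G'' d & isoP psi (g0 * d * g0^-1)%g a.
have L''L a : L'' a -> L a by move=> [d Gd da]; exists (g0 * d * g0^-1)%g => //; exact: g0G.
have qM d b (z z' : set_type X'') : isoP psi (g0 * d * g0^-1)%g b -> val z = act d (val z') -> q z = isom_act b (q z').
  move=> db e; have [<- _] := act_coord Apsi n2 db (Og z').
  by rewrite /q e -!actM mulgVK.
have Sne y : exists a, S y a.
  have [z hz] := orbit_repr (hX (cover_pt y)).
  have := P1 y; rewrite F0 hz => /fiber_over_orbit /(_ (qf z))[a La e].
  by exists a; split=> //; exists z.
have Scos y a a' : S y a -> S y a' -> exists2 b, L'' b & a = (a' * b)%g.
  move=> [La [z hz e]] [La' [z' hz' e']].
  have /(orbit_piP _ _ sG'')[d Gd zd] : orbit_pi G'' z' = orbit_pi G'' z by rewrite -hz -hz'.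
  have [g Gg] := Gamma_isoP Apsi n2 latG (g0G Gd); move=> db.
  have Lb : L'' g by exists d.
  exists g => //; suff E : (a^-1 * (a' * g))%g = 1%g by rewrite -[RHS]mul1g -(mulgV a) -mulgA E mulg1.
  apply: (isoms_free Apsi n2 latG tfG (y := q z)); first exact: (LM _ _ (LV _ La) (LM _ _ La' (L''L _ Lb))).
  by rewrite !isom_actM -(qM _ _ _ _ db zd) -e' e isom_actVK.
have SM y a b : S y a -> L'' b -> S y (a * b)%g.
  move=> [La [z hz e]] [d Gd db]; split; first by apply: LM => //; apply: L''L; exists d.
  have Xz : X'' (act d^-1%g (val z)).
    by apply: act_PGL_of; [apply: GX''; have [_ _] := sG''; exact|exact: set_mem (valP z)].
  exists (point_in Xz); first by rewrite hz; apply/orbit_piP => //; exists d; rewrite //= actKV.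
  by rewrite isom_actM -(qM d b z (point_in Xz) db)//= actKV.
have Sopen a y0 : S y0 a -> \forall y \near y0, S y a.
  move=> [La [z hz e]].
  pose T := @affine R n @` [set u | dom_h psi u /\ [set w : 'cV[R]_n.-1 * R | en (w.1 - q z) < e0 / 2] (Yc psi u, - horo_fun psi u)].
  pose Q := [set c | exists2 x : set_type X'', c = orbit_pi G'' x & (act g0 @^-1` T) (val x)].
  have oQ : open Q.
    by apply: orbit_pi_open => //; apply: act_open; apply: tube_open => //; exact: open_ball_fst.
  have Tq (x : set_type X'') : T (act g0 (val x)) -> en (q x - q z) < e0 / 2.
    by move=> [u [du /= uq] ux]; rewrite {1}/q -ux /yc aff_ptK.
  have e2 : 0 < e0 / 2 by rewrite divr_gt0.
  have Qz : Q (hX (cover_pt y0)).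
    exists z => //; have [zE _] := Omega_coord Apsi n2 (Og z).
    exists (Ph psi (yc psi (act g0 (val z))) (sc psi (act g0 (val z)))) => //; split; first exact: Ph_dom.
    by rewrite /= Yc_Ph// subrr en0.
  have hc : {for y0, continuous (hX \o cover_pt)}.
    by apply: continuous_comp; [exact: cover_pt_continuous|exact: hXc].
  have N1 : \forall y \near y0, Q (hX (cover_pt y)) by apply: hc; exact: open_nbhs_nbhs.
  have N2 : \forall y \near y0, en (phi y - phi y0) < e0 / 2.
    apply: (P3 y0 [set v | en (v - phi y0) < e0 / 2]); apply/nbhs_en; by exists (e0 / 2).
  near=> y; split=> //; have [x hx xT] : Q (hX (cover_pt y)) by near: y.
  exists x => //; have px : en (phi y - phi y0) < e0 / 2 by near: y.
  have K1 := P1 y; rewrite F0 hx in K1; have K2 := fiber_over_act La (qf x).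
  have [b Lb bE] := fiber_over_orbit K1 K2; rewrite bE.
  suff -> : b = 1%g by rewrite isom_act1.
  apply: (He0 b (isom_act a (q x))) => //; rewrite -bE.
  have -> : phi y - isom_act a (q x) = (phi y - phi y0) - (isom_act a (q x) - isom_act a (q z)) by rewrite e opprB addrA subrK.
  by apply: le_lt_trans (en_triangle _ _) _; rewrite enN isom_act_dist; have := Tq _ xT; lra.
have [a S0a] := Sne 0.
have Sall y : S y a.
  have con : connected [set: 'cV[R]_n.-1].
    apply: (@path_connected_connected R 'cV[R]_n.-1 setT 0) => // v _; exists (fun s => s *: v); split=> //.
    - by move=> s; apply: cvgZr_tmp; exact: cvg_id.
    - by rewrite scale0r.
    - by rewrite scale1r.
  suff E : [set y | S y a] = setT by have : [set y | S y a] y by rewrite E.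
  apply: con; first by exists 0.
    exists [set y | S y a]; last by rewrite setTI.
    by rewrite openE => v Sv; exact: Sopen.
  exists [set y | S y a]; last by rewrite setTI.
  rewrite -[X in closed X]setCK; apply: open_closedC; rewrite openE => v nS.
  have [b Sb] := Sne v; rewrite /interior; have := Sopen _ _ Sb; apply: filterS => u Sub Sua; apply: nS.
  by have [k Lk ->] := Scos _ _ _ Sua Sub; exact: SM.
apply/seteqP; split=> [_ [d Gd <-]|d Gd]; first exact: g0G.
have [b Lb db] := Gamma_isoP Apsi n2 latG Gd; have [La _] := S0a.
(* As k a = a b^-1, constancy at the point k 0 turns a into a b at the point 0, and cancelling a
   leaves b in the conjugate of G''. *)
pose k := (a * b^-1 * a^-1)%g; have Lk : L k := LM _ _ (LM _ _ La (LV _ Lb)) (LV _ La).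
have Sk : S 0 (a * b)%g.
  have [_ [z hz e]] := Sall (isom_act k 0); split; first exact: LM.
  exists z; first by rewrite -hz cover_pt_act.
  rewrite P2// in e; have -> : (a * b)%g = (k^-1 * a)%g by rewrite /k !invgM !invgK !mulgA mulgVK.
  by rewrite isom_actM -e isom_actVK.
have [c [h Gh hc] /mulgI e] := Scos _ _ _ Sk S0a; exists h => //.
by apply: (isoP_inj Apsi n2 hc); rewrite -e.
Unshelve. all: by end_near. Qed.

End HomotopyLifting.

Section EquivalentCusps.
Variables (R : realType) (n : nat) (psi : 'rV[R]_n).
Hypothesis Apsi : weyl psi.
Hypothesis n2 : (1 < n)%N.

Lemma cusp_embeds_conj (Gamma G'' : set (PGL R n)) (X'' : set (RP R n)) :
  lattice (Gpsi psi) Gamma -> torsion_free Gamma -> generalized_cusp X'' G'' ->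
  cusp_embeds X'' G'' (Omega psi) Gamma -> exists g, conjset g G'' = Gamma.
Proof.
move=> latG tfG cX [f [[_ floc] [fc [hX [hXc _ [F [Fc F0 F1]]]]]]].
have [[_ [sG _ GO] _ [cov _] _] _ _ _ _] := lattice_generalized_cusp Apsi n2 latG tfG.
have [[conv [sG'' _ GX''] _ _ chart] _ _ _ _] := cX.
have [g0 Hg0] := single_lift (ltnW n2) sG GO cov conv chart floc.
have X0 : X'' !=set0.
  have [x _] := orbit_repr (hX (cover_pt Apsi n2 Gamma 0)).
  by exists (val x); exact: set_mem (valP x).
exists g0; apply: (lift_onto Apsi n2 latG tfG Fc F1 sG'' GX'' Hg0 _ hXc F0).
exact: (single_lift_conj (ltnW n2) sG cov chart sG'' GX'' X0 Hg0).
Qed.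

(** Both groups are conjugate to that of the third cusp. *)
Theorem equivalent_cusps_conjugate (Gamma Gamma' : set (PGL R n)) :
  lattice (Gpsi psi) Gamma -> lattice (Gpsi psi) Gamma' -> torsion_free Gamma -> torsion_free Gamma' ->
  equivalent_cusps (Omega psi) Gamma (Omega psi) Gamma' -> conjugate_in setT Gamma Gamma'.
Proof.
move=> l l' tf tf' [_ _ [X'' [G'' [cX e e' _]]]].
have [g <-] := cusp_embeds_conj l tf cX e; have [g' <-] := cusp_embeds_conj l' tf' cX e'.
exists (g' * g^-1)%g => //; rewrite conjsetM -(conjsetM g^-1%g) mulVg; congr conjset.
by apply: conjset_centralizing => x _; rewrite mul1g mulg1.
Qed.

End EquivalentCusps.

(** * Marked lattices *)

Section IsometryTopology.
Variables (R : realType) (m : nat).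
Implicit Types (a b g x : isom R m) (y : 'cV[R]_m) (L : set (isom R m)).

Lemma isom_val_continuous : continuous (fun a : isom R m => val a).
Proof. exact: set_val_continuous. Qed.

Lemma rot_cvg (a : isom R m) : @rot R m @ a --> rot a.
Proof. by apply: (@cvg_comp _ _ _ _ fst _ _ _ (@isom_val_continuous a)); exact: cvg_fst. Qed.

Lemma trans_cvg (a : isom R m) : @trans R m @ a --> trans a.
Proof. by apply: (@cvg_comp _ _ _ _ snd _ _ _ (@isom_val_continuous a)); exact: cvg_snd. Qed.

Lemma isom_continuous (T : topologicalType) (f : T -> isom R m) :
  (forall t, (fun u => rot (f u)) @ t --> rot (f t)) -> (forall t, (fun u => trans (f u)) @ t --> trans (f t)) ->
  continuous f.
Proof.
move=> Hr Ht; apply: sub_continuous => t.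
have c : (fun u => (rot (f u), trans (f u))) @ t --> (rot (f t), trans (f t)) :=
  @cvg_pair _ _ _ (nbhs t) (nbhs (rot (f t))) (nbhs (trans (f t))) (nbhs_filter _) (nbhs_filter _) (nbhs_filter _) _ _ (Hr t) (Ht t).
have E u : val (f u) = (rot (f u), trans (f u)) by rewrite /rot /trans; case: (val (f u)).
rewrite /continuous_at /= [X in _ --> X]E.
have F : set_val \o f = (fun u => (rot (f u), trans (f u))) by apply/funext => u; rewrite -E.
by rewrite F.
Qed.

Lemma isom_cvg_cst (V : topologicalType) (v : V) a : (fun _ : isom R m => v) @ a --> v.
Proof. by have ff : Filter (nbhs a) := nbhs_filter a; exact: (@cvg_cst _ _ _ _ ff). Qed.

Lemma isom_act_cvg y a : (fun x => isom_act x y) @ a --> isom_act a y.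
Proof.
have ff : Filter (nbhs a) := nbhs_filter a.
exact: (@cvgD _ _ _ _ ff _ _ _ _ (@mulmx_cvg _ _ _ ff _ _ _ _ _ _ _ (@rot_cvg a) (@isom_cvg_cst _ y a)) (@trans_cvg a)).
Qed.

Lemma isom_mull_continuous a : continuous (fun x => a * x)%g.
Proof.
apply: isom_continuous => x; have ff : Filter (nbhs x) := nbhs_filter x.
  exact: (@mulmx_cvg _ _ _ ff _ _ _ _ _ _ _ (@isom_cvg_cst _ (rot a) x) (@rot_cvg x)).
exact: (@cvgD _ _ _ _ ff _ _ _ _ (@mulmx_cvg _ _ _ ff _ _ _ _ _ _ _ (@isom_cvg_cst _ (rot a) x) (@trans_cvg x)) (@isom_cvg_cst _ (trans a) x)).
Qed.

Lemma isom_mulr_continuous a : continuous (fun x => x * a)%g.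
Proof.
apply: isom_continuous => x; have ff : Filter (nbhs x) := nbhs_filter x.
  exact: (@mulmx_cvg _ _ _ ff _ _ _ _ _ _ _ (@rot_cvg x) (@isom_cvg_cst _ (rot a) x)).
exact: isom_act_cvg.
Qed.

Lemma set_type_compact (T : topologicalType) (A K : set T) : compact K -> K `<=` A ->
  compact [set x : set_type A | K (val x)].
Proof.
move=> cK KA F PF FK; have [p [Kp cp]] : K `&` cluster (@set_val T A @ F) !=set0 by exact: cK.
have Ap := KA _ Kp; exists (point_in Ap); split=> //= B U FB nU.
move: nU; rewrite nbhsE => -[V [/sub_open[W oW ->] Wp] VU].
have [_ [[b Bb <-] Wb]] : (set_val @` B) `&` W !=set0.
  apply: cp; last exact: open_nbhs_nbhs.
  have sub : B `<=` @set_val T A @^-1` (@set_val T A @` B) by move=> b Bb; exists b.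
  exact: (filterS sub FB).
by exists b; split=> //; exact: VU.
Qed.

Lemma orthogonal_compact : compact [set A : 'M[R]_m | A^T *m A = 1%:M].
Proof.
have vc : continuous (vec_mx : 'rV[R]_(m * m) -> 'M[R]_m).
  move=> v; apply: (@mx_cvg _ _ _ (nbhs_filter v)) => i j.
  rewrite (_ : (fun w : 'rV[R]_(m * m) => vec_mx w i j) = (fun w => w 0 (mxvec_index i j))); last first.
    by apply/funext => w; rewrite mxE.
  by rewrite mxE; apply: (@entry_cvg _ _ _ (nbhs_filter v)); exact: cvg_id.
have -> : [set A : 'M[R]_m | A^T *m A = 1%:M] = vec_mx @` [set v : 'rV[R]_(m * m) | (vec_mx v)^T *m vec_mx v = 1%:M].
  by apply/seteqP; split=> [A AA|_ [v vv <-]//]; exists (mxvec A); rewrite /= mxvecK.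
apply: continuous_compact; first exact: continuous_subspaceT.
apply: bounded_closed_compact.
  exists 1; split; first exact: num_real.
  move=> M M1 v vv; rewrite /= /Num.norm /= mx_normrE.
  apply/bigmax_leP; split=> [|[i k] _] /=; first by apply: ltW; apply: lt_trans M1.
  have [[i' j'] ->] : exists p, k = mxvec_index p.1 p.2.
    by case/mxvec_indexP: k => i' j'; exists (i', j').
  have -> : v i (mxvec_index i' j') = vec_mx v i' j' by rewrite mxE ord1.
  rewrite (le_trans _ (ltW M1))// -(ler_pXn2r (n := 2)) ?nnegrE// expr1n real_normK ?num_real//.
  have := congr1 (fun A : 'M[R]_m => A j' j') vv; rewrite !mxE eqxx mulr1n => <-.
  rewrite (bigD1 i')//= !mxE -expr2 lerDl; apply: sumr_ge0 => l _; rewrite !mxE -expr2; exact: sqr_ge0.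
pose q (v : 'rV[R]_(m * m)) : 'M[R]_m := (vec_mx v)^T *m vec_mx v.
have qc : continuous q.
  have tc : continuous (fun v : 'rV[R]_(m * m) => (vec_mx v)^T).
    move=> v; apply: (@mx_cvg _ _ _ (nbhs_filter v)) => i j; under eq_fun do rewrite mxE.
    by rewrite mxE; apply: (@entry_cvg _ _ _ (nbhs_filter v)); exact: vc.
  by move=> v; exact: (@mulmx_cvg _ _ _ (nbhs_filter v) _ _ _ _ _ _ _ (tc v) (vc v)).
have -> : [set v : 'rV[R]_(m * m) | (vec_mx v)^T *m vec_mx v = 1%:M] = \bigcap_(p in [set: 'I_m * 'I_m]) [set v | q v p.1 p.2 = (1%:M : 'M[R]_m) p.1 p.2].
  apply/seteqP; split=> v; first by move=> /= vv p _ /=; rewrite /q vv.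
  by move=> H; apply/matrixP => i j; exact: (H (i, j) I).
apply: closed_bigI => -[i j] _ /=.
apply: (@closed_comp _ _ (fun v => q v i j) [set r | r = (1%:M : 'M[R]_m) i j]); last exact: closed_eq.
by move=> v _; apply: (@entry_cvg _ _ _ (nbhs_filter v)); exact: qc.
Qed.

Lemma isom_ball_compact (D : R) : compact [set a : isom R m | en (trans a) <= D].
Proof.
have := compact_setX orthogonal_compact (@ball_compact R m D).
set K := _ `*` _ => cK; have KA : K `<=` [set p : 'M[R]_m * 'cV[R]_m | p.1^T *m p.1 = 1%:M] by move=> p [].
have -> : [set a : isom R m | en (trans a) <= D] = [set a : isom R m | K (val a)]; last exact: set_type_compact.
apply/seteqP; split=> a; first by move=> aD; split=> //; exact: rotTK.
by case.
Qed.

End IsometryTopology.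

Section IsometryLattices.
Variables (R : realType) (m : nat) (G : set (isom R m)).
Hypothesis sG : is_subgroup G.
Hypothesis trG : forall v, G (tr_isom v).
Implicit Types (a b g x : isom R m) (y : 'cV[R]_m) (L : set (isom R m)).

Lemma coset_piP (K : set (isom R m)) L (x x' : set_type K) : is_subgroup L ->
  fiber_pi (fun z : set_type K => lcoset (val z) L) x = fiber_pi _ x' <-> L ((val x)^-1 * val x')%g.
Proof.
move=> [L1 LM LV]; rewrite fiber_piP; split=> [E|Lx].
  have [l Ll <-] : lcoset (val x) L (val x') by rewrite E; exists 1%g; rewrite ?mulg1.
  by rewrite mulgA mulVg mul1g.
apply/seteqP; split=> _ [l Ll <-].
  exists ((val x')^-1 * val x * l)%g; last by rewrite !mulgA mulgV mul1g.
  by apply: LM => //; have := LV _ Lx; rewrite invgM invgK.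
by exists ((val x)^-1 * val x' * l)%g; [exact: LM|rewrite !mulgA mulgV mul1g].
Qed.

Lemma lattice_coarse L : lattice G L -> coarse L.
Proof.
move=> [sL LG dL cL]; have [L1 LM LV] := sL.
pose U (k : nat) := [set c : coset_space G L | exists x : set_type G,
  c = fiber_pi _ x /\ en (isom_act (val x) 0) < k%:R].
have [k Uk] : exists k, U k = setT.
  apply: compact_exhaustion => //.
  - move=> k; apply/fiber_open/sub_open; exists (\bigcup_(l in L) [set x | en (isom_act (x * l)%g 0) < k%:R]).
      apply: bigcup_open => l _.
      have c : continuous (fun x : isom R m => en (isom_act (x * l)%g 0)).
        move=> x; apply: (@cvg_comp _ _ _ (fun x => isom_act (x * l)%g 0) (@en R m) _ _ _ _ (@en_continuous R m _)).
        by apply: (@cvg_comp _ _ _ (fun x => x * l)%g (fun x => isom_act x 0) _ _ _ (@isom_mulr_continuous R m l x)); exact: isom_act_cvg.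
      by move/continuousP: c => /(_ [set r : R | r < k%:R]); apply; exact: open_lt.
    apply/seteqP; split=> x /=.
      move=> [x' [/(coset_piP _ _ sL) Lx xk]]; exists ((val x)^-1 * val x')%g => //=.
      by rewrite mulgA mulgV mul1g.
    move=> [l Ll xk]; have Gxl : G (val x * l)%g.
      by have [_ GM _] := sG; apply: GM; [exact: set_mem (valP x)|exact: LG].
    exists (point_in Gxl); split=> //; apply/coset_piP => //=.
    by rewrite mulgA mulVg mul1g.
  - by move=> i j ij c [x [xc xi]]; exists x; split=> //; apply: lt_le_trans xi _; rewrite ler_nat.
  - move=> c; exists (Num.truncn (en (isom_act (val (fiber_repr c)) 0))).+1, (fiber_repr c); split; first by rewrite fiber_reprK.
    exact: truncnS_gt.
exists k%:R => y; pose x := point_in (trG (- y)).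
have [x' [/(coset_piP _ _ sL) Lx xk]] : U k (fiber_pi _ x) by rewrite Uk.
set l := ((val x)^-1 * val x')%g in Lx; exists l^-1%g; first exact: LV.
have xl : val x' = (tr_isom (- y) * l)%g by rewrite /l mulgA mulgV mul1g.
rewrite xl isom_actM isom_act_tr in xk; apply: ltW; apply: le_lt_trans xk.
have -> : isom_act l^-1%g y = isom_act l^-1%g y - isom_act l^-1%g (isom_act l 0) by rewrite isom_actVK subr0.
by rewrite isom_act_dist -enN opprB.
Qed.

(** The coset space of the full isometry group is the image of the isometries with bounded
    translation part, a compact set because the orthogonal matrices are compact. *)
Lemma lattice_setT L : lattice G L -> lattice setT L.
Proof.
move=> lL; have [D HD] := lattice_coarse lL; have [sL LG dL cL] := lL; have [L1 LM LV] := sL.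
split=> //; pose p (x : isom R m) : coset_space setT L := fiber_pi _ (point_in (I : [set: isom R m] x)).
have pc : continuous p.
  have H : continuous (fun x : isom R m => point_in (I : [set: isom R m] x)).
    by apply: sub_continuous => x; exact: cvg_id.
  by move=> x; apply: continuous_comp; [exact: H|exact: fiber_pi_continuous].
have -> : [set: coset_space setT L] = p @` [set a | en (trans a) <= D].
  apply/seteqP; split=> // c _; have [a La ay] := HD (isom_act (val (fiber_repr c))^-1%g 0).
  exists (val (fiber_repr c) * a^-1)%g => /=.
    have -> : trans (val (fiber_repr c) * a^-1)%g = isom_act (val (fiber_repr c) * a^-1)%g 0 by rewrite /isom_act mulmx0 add0r.
    move: ay; set x := val (fiber_repr c); rewrite -isom_actM => ay.
    have -> : (x * a^-1)%g = (a * x^-1)^-1%g by rewrite invgM invgK.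
    have := isom_act_dist (a * x^-1)%g (isom_act (a * x^-1)^-1%g 0) 0.
    by rewrite isom_actKV sub0r enN subr0 => <-.
  rewrite -[RHS]fiber_reprK; apply/coset_piP => //=.
  by rewrite invgM invgK mulgVK.
by apply: continuous_compact; [exact: continuous_subspaceT|exact: isom_ball_compact].
Qed.

Lemma lattice_conj L g : G g -> lattice G L -> lattice G [set (g^-1 * x * g)%g | x in L].
Proof.
move=> Gg [sL LG dL cL]; have [L1 LM LV] := sL; have [G1 GM GV] := sG.
set L' := [set _ | _ in L]; have sL' : is_subgroup L'.
  split; first by exists 1%g; rewrite // mulg1 mulVg.
    move=> _ _ [x Lx <-] [y Ly <-]; exists (x * y)%g; first exact: LM.
    by rewrite !mulgA mulgK.
  by move=> _ [x Lx <-]; exists x^-1%g; [exact: LV|rewrite !invgM invgK mulgA].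
split=> //.
- by move=> _ [x Lx <-]; exact: (GM _ _ (GM _ _ (GV _ Gg) (LG _ Lx)) Gg).
- move=> _ [x Lx <-]; have [U nU UL] := dL _ Lx; exists [set y | U (g * y * g^-1)%g].
    have c : continuous (fun y : isom R m => g * y * g^-1)%g.
      move=> y; apply: (@cvg_comp _ _ _ (fun y : isom R m => g * y)%g (fun y : isom R m => y * g^-1)%g _ _ _ (@isom_mull_continuous R m g y)).
      exact: isom_mulr_continuous.
    by apply: c; rewrite !mulgA mulgV mul1g -mulgA mulgV mulg1.
  have E z : (g * (g^-1 * z * g) * g^-1)%g = z by rewrite !mulgA mulgV mul1g -mulgA mulgV mulg1.
  apply/seteqP; split=> [y [/= Uy [z Lz zy]]|_ ->].
    rewrite -zy E in Uy; have : (U `&` L) z by [].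
    by rewrite UL => <-; rewrite zy.
  split; last by exists x.
  rewrite /= E; have : [set x] x by [].
  by rewrite -UL => -[].
pose f (c : coset_space G L) : coset_space G L' := fiber_pi _ (point_in (GM _ _ (set_mem (valP (fiber_repr c))) Gg)).
have fE (x : set_type G) : f (fiber_pi _ x) = fiber_pi _ (point_in (GM _ _ (set_mem (valP x)) Gg)).
  apply/coset_piP => //=; have /(coset_piP _ _ sL) Lx : fiber_pi (fun z : set_type G => lcoset (val z) L) (fiber_repr (fiber_pi (fun z : set_type G => lcoset (val z) L) x)) = fiber_pi _ x.
    exact: fiber_reprK.
  by eexists; [exact: Lx|rewrite invgM !mulgA].
have fc : continuous f.
  apply: fiber_lift_continuous.
  rewrite (_ : f \o fiber_pi _ = fiber_pi (fun z : set_type G => lcoset (val z) L') \o (fun x : set_type G => point_in (GM _ _ (set_mem (valP x)) Gg))).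
    have H : continuous (fun x : set_type G => point_in (GM _ _ (set_mem (valP x)) Gg)).
      have H : continuous ((fun y : isom R m => y * g)%g \o @set_val _ G).
        by move=> x; apply: continuous_comp; [exact: set_val_continuous|exact: isom_mulr_continuous].
      exact: sub_continuous.
    by move=> x; apply: continuous_comp; [exact: H|exact: fiber_pi_continuous].
  by apply/funext => x; exact: fE.
have -> : [set: coset_space G L'] = f @` setT.
  apply/seteqP; split=> // c _.
  have Gx : G (val (fiber_repr c) * g^-1)%g := GM _ _ (set_mem (valP (fiber_repr c))) (GV _ Gg).
  exists (fiber_pi _ (point_in Gx)) => //; rewrite fE -[RHS]fiber_reprK; congr fiber_pi.
  by apply: val_inj; rewrite /= mulgVK.
by apply: continuous_compact => //; exact: continuous_subspaceT.
Qed.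

End IsometryLattices.

(** * The bijection between classes of markings *)

Section Teichmueller.
Variables (R : realType) (m : nat) (G O : set (isom R m)).
Hypothesis sG : is_subgroup G.
Hypothesis trG : forall v, G (tr_isom v).
Hypothesis OE : forall a, O a <-> G a /\ orth a.
Variables (I : Type) (H : I -> groupType).
Local Notation marking := (marking H (isom R m)).
Implicit Types (a b g k w : isom R m) (th : marking).

Lemma conj_markingM g k th : conj_marking (g * k)%g th = conj_marking k (conj_marking g th).
Proof. by rewrite /conj_marking /=; congr existT; apply/funext => x; rewrite /= invgM !mulgA. Qed.

Lemma conj_marking1 th : conj_marking 1%g th = th.
Proof.
by case: th => i f; rewrite /conj_marking /=; congr existT; apply/funext => x; rewrite invg1 mul1g mulg1.
Qed.

Lemma conj_classM g th : G g -> conj_class G (conj_marking g th) = conj_class G th.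
Proof.
have [G1 GM GV] := sG; move=> Gg; apply/seteqP; split=> _ [k Gk <-].
  by exists (g * k)%g; [exact: GM|rewrite conj_markingM].
by exists (g^-1 * k)%g; [apply: GM => //; exact: GV|rewrite -conj_markingM mulgA mulgV mul1g].
Qed.

Lemma marked_lattices_conj g th : G g -> marked_lattices G th -> marked_lattices G (conj_marking g th).
Proof.
move=> Gg [hth ith lth]; split.
- by move=> x y; rewrite /= /mfun /= -/(mfun th) hth !mulgA mulgK.
- by move=> x y /= /mulIg/mulgI/ith.
- have -> : range (mfun (conj_marking g th)) = [set (g^-1 * x * g)%g | x in range (mfun th)].
    by apply/seteqP; split=> [_ [x _ <-]|_ [_ [x _ <-] <-]]; [exists (mfun th x) => //; exists x|exists x].
  exact: lattice_conj.
Qed.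

Lemma marked_lattices_setT th : marked_lattices G th -> marked_lattices setT th.
Proof. by move=> [hth ith lth]; split=> //; exact: (lattice_setT sG trG). Qed.

Lemma conj_marking_fixed w th : conj_marking w th = th -> forall x, (w^-1 * mfun th x * w)%g = mfun th x.
Proof.
(* The equality of dependent pairs lies over a loop i = i, which proof irrelevance replaces by
   reflexivity. *)
case: th => i f e x; have := projT2_eq e; rewrite (Prop_irrelevance (projT1_eq e) erefl) /= => E.
by rewrite -{2}E.
Qed.

Lemma rot_tr_decomposition w : w = (rotational_part w * tr_isom ((rot w)^T *m trans w))%g.
Proof.
apply: isom_eq; first by rewrite rotM rot_tr mulmx1.
rewrite /trans /= -/(rot _) -/(trans w) addr0 /rotational_part /rot /= -/(rot w).
by rewrite mulmxA rotKT mul1mx.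
Qed.

(** G contains all translations, so an isometry and its rotational part lie in G together. *)
Lemma G_rotational_part a : G a <-> O (rotational_part a).
Proof.
have [G1 GM GV] := sG; split=> [Ga|/OE[Ga _]]; last by rewrite [a]rot_tr_decomposition; exact: GM.
apply/OE; split=> //; have -> : rotational_part a = (a * (tr_isom ((rot a)^T *m trans a))^-1)%g.
  by rewrite {2}[a]rot_tr_decomposition mulgK.
by apply: GM => //; exact: GV.
Qed.

Lemma lcoset_O g g' : O (g^-1 * g')%g -> lcoset g O = lcoset g' O.
Proof.
have [G1 GM GV] := sG.
have OM a b : O a -> O b -> O (a * b)%g.
  move=> /OE[Ga oa] /OE[Gb ob]; apply/OE; split; first exact: GM.
  by move: oa ob; rewrite /orth /= transM => -> ->; rewrite mulmx0 addr0.
have OV a : O a -> O a^-1%g.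
  move=> /OE[Ga oa]; apply/OE; split; first exact: GV.
  by move: oa; rewrite /orth /= /trans /= -/(trans a) => ->; rewrite mulmx0 oppr0.
move=> Og; apply/seteqP; split=> _ [o Oo <-].
  exists (g'^-1 * g * o)%g; last by rewrite !mulgA mulgV mul1g.
  by apply: OM => //; have := OV _ Og; rewrite invgM invgK.
by exists (g^-1 * g' * o)%g; [exact: OM|rewrite !mulgA mulgV mul1g].
Qed.

Lemma lcoset_O_eq g g' : lcoset g O = lcoset g' O -> O (g^-1 * g')%g.
Proof.
have [G1 GM GV] := sG => E; have [o Oo <-] : lcoset g O g'.
  by rewrite E; exists 1%g; rewrite ?mulg1//; apply/OE; split.
by rewrite mulgA mulVg mul1g.
Qed.

Definition teich_rot : set (set marking) :=
  conj_class setT @` [set th : marking | marked_lattices setT th /\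
     exists2 k, orth k & forall x, O (k^-1 * rotational_part (mfun th x) * k)%g].

Variable sigma : set marking -> marking.
Hypothesis Hsigma : forall c, teich_rot c -> marked_lattices G (sigma c) /\ conj_class setT (sigma c) = c.

Definition orth_coset : set (set (isom R m)) := [set lcoset g O | g in orth].
Definition theta_dom : set (set marking * set (isom R m)) :=
  [set p | (teich_rot `*` orth_coset) p /\
     forall g, orth g -> p.2 = lcoset g O -> marked_lattices G (conj_marking g (sigma p.1))].

(** Injectivity: equal classes produce w = g k g'^-1 with k in G that centralizes a lattice; w is a
    translation, so g^-1 g' is the rotational part of k and lies in O. Surjectivity: a marking of a
    lattice in G is conjugate to a value of sigma by a rotation times a translation, and the
    translation belongs to G. *)
Lemma theta_bijection : exists2 Theta : set marking * set (isom R m) -> set marking,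
  (forall c g, orth g -> theta_dom (c, lcoset g O) -> Theta (c, lcoset g O) = conj_class G (conj_marking g (sigma c))) &
  set_bij theta_dom (teich H G) Theta.
Proof.
have [G1 GM GV] := sG.
(* An orthogonal representative of each coset; on sets that are not cosets the default 1 is
   taken. *)
pose rp (X : set (isom R m)) := xget 1%g [set g | orth g /\ X = lcoset g O].
have rpE g : orth g -> orth (rp (lcoset g O)) /\ lcoset g O = lcoset (rp (lcoset g O)) O.
  by move=> og; rewrite /rp; case: xgetP => [x _ //|/(_ g)[]].
pose Theta p := conj_class G (conj_marking (rp p.2) (sigma p.1)).
have TE c g : orth g -> Theta (c, lcoset g O) = conj_class G (conj_marking g (sigma c)).
  move=> og; have [_ /lcoset_O_eq/OE[Gg _]] := rpE g og; rewrite /Theta /=.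
  have -> : rp (lcoset g O) = (g * (g^-1 * rp (lcoset g O)))%g by rewrite mulgA mulgV mul1g.
  by rewrite conj_markingM conj_classM.
exists Theta; first by move=> c g og _; exact: TE.
split.
- move=> [c X] [[/= Tc [g og gX]] Hg]; rewrite -gX TE//; exists (conj_marking g (sigma c)) => //.
  by apply: Hg; rewrite ?gX.
- move=> [c X] [c' X'] /set_mem[[/= Tc [g og gX]] Hg] /set_mem[[/= Tc' [g' og' gX']] Hg'].
  rewrite -gX -gX' !TE// => E.
  have : conj_class G (conj_marking g' (sigma c')) (conj_marking g' (sigma c')) by exists 1%g; rewrite ?conj_marking1.
  rewrite -E => -[k Gk e].
  have e' : sigma c' = conj_marking (g * k * g'^-1)%g (sigma c).
    by rewrite !conj_markingM e -conj_markingM mulgV conj_marking1.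
  have [[hs is_ ls] sc] := Hsigma Tc; have [_ sc'] := Hsigma Tc'.
  have cc : c = c'.
    rewrite -sc -sc' e'; apply/seteqP; split=> _ [a _ <-].
      by exists ((g * k * g'^-1)^-1 * a)%g => //; rewrite -conj_markingM mulgA mulgV mul1g.
    by exists ((g * k * g'^-1) * a)%g => //; exact: conj_markingM.
  move: e'; rewrite -cc => /esym/conj_marking_fixed; set w := (g * k * g'^-1)%g => fw.
  have rw : rot w = 1%:M.
    apply: (coarse_centralizer (lattice_coarse sG trG ls)) => _ [x _ <-].
    by rewrite -{2}(fw x) !mulgA mulgV mul1g.
  congr pair; apply: lcoset_O.
  have -> : (g^-1 * g')%g = rotational_part k; last exact/G_rotational_part.
  apply: isom_eq.
    rewrite rotM; have -> : rot (rotational_part k) = rot k by [].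
    have : (rot g)^T *m rot w *m rot g' = rot k.
      rewrite /w !rotM !mulmxA rotTK mul1mx -mulmxA; have -> : rot g'^-1%g = (rot g')^T by [].
      by rewrite rotTK mulmx1.
    by rewrite rw mulmx1.
  move: og og'; rewrite /orth /= transM => og ->; rewrite mulmx0 add0r.
  by rewrite /trans /= -/(trans g) og mulmx0 oppr0.
- move=> _ [th mth <-]; pose c := conj_class setT th.
  have Tc : teich_rot c.
    exists th => //; split; first exact: marked_lattices_setT.
    exists 1%g; first by rewrite /orth /=.
    move=> x; rewrite invg1 mul1g mulg1; apply/G_rotational_part.
    by have [_ _ [_ sub _ _]] := mth; apply: sub; exists x.
  have [ms sc] := Hsigma Tc.
  have [w _ wE] : conj_class setT (sigma c) th by rewrite sc; exists 1%g; rewrite ?conj_marking1.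
  pose g := rotational_part w; pose tau := tr_isom ((rot w)^T *m trans w).
  have og : orth g by [].
  have gE : conj_marking g (sigma c) = conj_marking tau^-1%g th.
    have -> : th = conj_marking tau (conj_marking g (sigma c)) by rewrite -conj_markingM -rot_tr_decomposition.
    by rewrite -conj_markingM mulgV conj_marking1.
  exists (c, lcoset g O); last by rewrite TE// gE conj_classM//; exact: (GV _ (trG _)).
  split; first by split=> //=; exists g.
  (* Another representative of the coset differs by an element of G, and conjugation by G preserves
     [marked_lattices G]. *)
  move=> g' og' /= /lcoset_O_eq/OE[Go _].
  have -> : g' = (g * (g^-1 * g'))%g by rewrite mulgA mulgV mul1g.
  rewrite conj_markingM gE -conj_markingM; apply: marked_lattices_conj => //.
  exact: (GM _ _ (GV _ (trG _)) Go).
Qed.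

End Teichmueller.

(** * Second derivatives and local isometries *)

Section SecondDerivatives.
Variable R : realType.
Implicit Types V : normedModType R.

Lemma derive_line V (f : V -> R) (a u : V) (r : R) : differentiable f (r *: u + a) ->
  is_derive r (1 : R) (fun s : R => f (s *: u + a)) ('D_u f (r *: u + a)).
Proof.
move=> df; pose l (s : R) := s *: u + a.
have cs : continuous (scalev u) by move=> s; apply: cvgZr_tmp; exact: cvg_id.
have dl0 : differentiable (scalev u) r by exact: linear_differentiable.
have dl : differentiable l r by apply: differentiableD => //; exact: differentiable_cst.
have e : 'd l r 1 = u.
  rewrite -deriveE// (_ : l = scalev u + cst a)// deriveD; last exact: derivable_cst; last exact: diff_derivable.
  rewrite derive_cst addr0 deriveE// (diff_lin _ cs); exact: scale1r.
have dfl : differentiable (f \o l) r by exact: differentiable_comp.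
have dd : derivable (f \o l) r (1 : R) by exact: diff_derivable.
by have := derivableP dd; rewrite derive_comp// e -deriveE.
Qed.

Lemma line_MVT V (f : V -> R) (a u : V) (s : R) : 0 < s -> (forall x, differentiable f x) ->
  exists c : R, [/\ 0 < c, c < s & f (s *: u + a) - f a = s * 'D_u f (c *: u + a)].
Proof.
move=> s0 df; have H (r : R) := derive_line (df (r *: u + a)).
have [|c] := @MVT R (fun r => f (r *: u + a)) (fun r => 'D_u f (r *: u + a)) 0 s s0 (fun r _ => H r).
  apply: continuous_subspaceT => r; apply: differentiable_continuous; apply/derivable1_diffP.
  by have [] := H r.
rewrite in_itv /= => /andP[c0 cs]; rewrite scale0r add0r subr0 mulrC => E.
by exists c.
Qed.

Lemma square_near V (x u v : V) (U : set V) : nbhs x U ->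
  exists2 s : R, 0 < s & forall c d : R, 0 < c < s -> 0 < d < s -> U (d *: v + (c *: u + x)).
Proof.
move=> nU; have H : (fun w : R * R => w.2 *: v + (w.1 *: u + x)) @ ((0 : R), (0 : R)) --> x.
  rewrite -[X in _ --> X](_ : (0 : R) *: v + ((0 : R) *: u + x) = x); last by rewrite !scale0r !add0r.
  apply: cvgD; first by apply: cvgZr_tmp; exact: cvg_snd.
  by apply: cvgD; [apply: cvgZr_tmp; exact: cvg_fst|exact: cvg_cst].
have [[A B] /= [/nbhs_ballP[a /= a0 Ha] /nbhs_ballP[b /= b0 Hb]] AB] := H _ nU.
exists (Num.min a b); first by rewrite lt_min a0.
move=> c d; rewrite !lt_min => /andP[c0 /andP[ca _]] /andP[d0 /andP[_ db]].
by apply: (AB (c, d)); split; [apply: Ha|apply: Hb]; rewrite /ball /= sub0r normrN gtr0_norm.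
Qed.

(** The mean value theorem in the direction u for the increment of f along s v, and once more in the
    direction v for the derivative of f along u. *)
Lemma second_difference V (f : V -> R) (u v x : V) (s : R) : Ck 2 setT f -> 0 < s ->
  exists c d : R, [/\ 0 < c < s, 0 < d < s &
    f (s *: v + (s *: u + x)) - f (s *: u + x) - (f (s *: v + x) - f x) = s ^+ 2 * 'D_v ('D_u f) (d *: v + (c *: u + x))].
Proof.
move=> /CkS[df /(_ u)/CkS[ddf _]] s0.
pose G y := f (s *: v + y) - f y.
have dsh (y : V) : differentiable (fun y => f (s *: v + y)) y.
  apply: (@differentiable_comp _ _ _ _ (fun y => s *: v + y) f); last exact: df.
  by apply: differentiableD; [exact: differentiable_cst|].
have dG y : differentiable G y by apply: differentiableB; [exact: dsh|exact: df].
have DG y : 'D_u G y = 'D_u f (s *: v + y) - 'D_u f y.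
  rewrite deriveB; [|exact: diff_derivable|by apply: diff_derivable; exact: df].
  congr (_ - _); pose t (z : V) := s *: v + z.
  have dt : differentiable t y by apply: differentiableD; [exact: differentiable_cst|].
  have e : 'd t y u = u.
    rewrite -deriveE// (_ : t = cst (s *: v) + id)// deriveD; [|exact: derivable_cst|exact: derivable_id].
    by rewrite derive_cst add0r derive_id.
  rewrite (@derive_comp R V V R^o t f)//; last exact: df.
  by rewrite e -deriveE//; exact: df.
have [c [c0 cs E]] := line_MVT x u s0 dG.
have [d [d0 ds E']] := line_MVT (c *: u + x) v s0 (fun y => ddf y I).
exists c, d; rewrite c0 cs d0 ds; split=> //.
by move: E; rewrite {1 2}/G DG E' => ->; rewrite mulrA expr2.
Qed.

(** The second difference is symmetric in u and v, so the two mixed derivatives agree at some pair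
    of points arbitrarily close to x, and by continuity at x. *)
Lemma derive_symmetric V (f : V -> R) (u v x : V) : Ck 2 setT f -> 'D_u ('D_v f) x = 'D_v ('D_u f) x.
Proof.
move=> cf; apply/eqP; rewrite -subr_eq0 -normr_eq0; apply/negPn/negP => n0.
set A := 'D_u ('D_v f); set B := 'D_v ('D_u f) in n0 *; rewrite -/A in n0.
set e := `|A x - B x| in n0; have e0 : 0 < e by rewrite lt_neqAle eq_sym n0 normr_ge0.
have cA : {for x, continuous A} by case/CkS: (cf) => _ /(_ v)/CkS[_ /(_ u)]; apply.
have cB : {for x, continuous B} by case/CkS: (cf) => _ /(_ u)/CkS[_ /(_ v)]; apply.
have e2 : 0 < e / 2 by rewrite divr_gt0.
have nA : nbhs x [set y | `|A x - A y| < e / 2].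
  by apply: (cA [set r | `|A x - r| < e / 2]); apply/nbhs_ballP; exists (e / 2).
have nB : nbhs x [set y | `|B x - B y| < e / 2].
  by apply: (cB [set r | `|B x - r| < e / 2]); apply/nbhs_ballP; exists (e / 2).
have [s1 s10 H1] := square_near v u nA; have [s2 s20 H2] := square_near u v nB.
have [s s0 sub] : exists2 s : R, 0 < s & forall r, 0 < r < s -> 0 < r < s1 /\ 0 < r < s2.
  exists (Num.min s1 s2); first by rewrite lt_min s10.
  by move=> r; rewrite lt_min => /andP[-> /andP[-> ->]].
have [c [d [c0 d0 E]]] := second_difference u v x cf s0.
have [c' [d' [c0' d0' E']]] := second_difference v u x cf s0.
have a1 := H1 _ _ (sub _ c0').1 (sub _ d0').1; have b1 := H2 _ _ (sub _ c0).2 (sub _ d0).2.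
rewrite -/A in E'; rewrite -/B in E; rewrite /= in a1 b1.
have D (a b p q : R) : a - b - (p - q) = a - p - (b - q) by ring.
have AB : A (d' *: u + (c' *: v + x)) = B (d *: v + (c *: u + x)).
  have s2n : s ^+ 2 != 0 by rewrite expf_neq0// gt_eqF.
  have swap : s *: u + (s *: v + x) = s *: v + (s *: u + x) by rewrite addrCA.
  rewrite swap in E'; have EE := etrans (esym E') (etrans (D _ _ _ _) E).
  exact: (mulfI s2n EE).
rewrite -AB in b1; have : `|A x - B x| < e.
  rewrite -[A x](subrK (A (d' *: u + (c' *: v + x)))) -addrA -[X in _ + X]opprB.
  by apply: le_lt_trans (ler_normB _ _) _; rewrite [ltRHS](splitr e); exact: (ltrD a1 b1).
by rewrite ltxx.
Qed.

Lemma is_derive_coord V m (k : V -> 'cV[R]_m) x u j : differentiable k x ->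
  is_derive x u (fun y => k y j 0) ('D_u k x j 0).
Proof.
move=> dk; have cl : continuous (@coordf R m 1 j 0) by exact: coord_continuous.
have dl : differentiable (@coordf R m 1 j 0) (k x) by exact: linear_differentiable.
have dc : differentiable (@coordf R m 1 j 0 \o k) x by exact: differentiable_comp.
have dd : derivable (@coordf R m 1 j 0 \o k) x u by exact: diff_derivable.
by have := derivableP dd; rewrite (derive_linear_comp (l := @coordf R m 1 j 0))// deriveE.
Qed.

Lemma derive_dotv V m (k l : V -> 'cV[R]_m) x u : differentiable k x -> differentiable l x ->
  'D_u (fun y => dotv (k y) (l y)) x = dotv ('D_u k x) (l x) + dotv (k x) ('D_u l x).
Proof.
move=> dk dl.
have -> : (fun y => dotv (k y) (l y)) = \sum_i ((fun y => k y i 0) * (fun y => l y i 0)).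
  by apply/funext => y; rewrite fct_sumE dotvE.
have H := @is_derive_sum R V R^o m (fun i => (fun y => k y i 0) * (fun y => l y i 0)) x u _
  (fun i => is_deriveM (is_derive_coord u i dk) (is_derive_coord u i dl)).
have [_ ->] := H; rewrite big_split /= addrC !dotvE; congr (_ + _); apply: eq_bigr => i _.
by rewrite /GRing.scale /= mulrC.
Qed.

End SecondDerivatives.

Section LocalIsometries.
Variables (R : realType) (V : normedModType R) (m : nat) (k : V -> 'cV[R]_m) (B : V -> V -> R) (e : 'I_m -> V).
Hypothesis ck : Ck 2 setT k.
Hypothesis ok : forall y u v, dotv ('D_u k y) ('D_v k y) = B u v.
Hypothesis eB : forall i j, B (e i) (e j) = (i == j)%:R.
Implicit Types (y u v w : V).

Let dk y : differentiable k y. Proof. by have [+ _] := (CkS _ _ _).1 ck; apply. Qed.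
Let ddk v y : differentiable ('D_v k) y. Proof. by have [_ /(_ v)/CkS[+ _]] := (CkS _ _ _).1 ck; apply. Qed.

Lemma derive_coord u y j : 'D_u k y j 0 = 'D_u (fun z => k z j 0) y.
Proof. by have [_ ->] := is_derive_coord u j (dk y). Qed.

Lemma second_derive_symmetric u v y : 'D_u ('D_v k) y = 'D_v ('D_u k) y.
Proof.
have oT : open [set: V] := openT.
apply/colP => j; have E a b : 'D_a ('D_b k) y j 0 = 'D_a ('D_b (fun z => k z j 0)) y.
  have [_ <-] := is_derive_coord a j (ddk b y); congr ('D_a _ y).
  by apply/funext => z; exact: derive_coord.
have cj : Ck 2 setT (fun z => k z j 0) := @Ck_coord R _ _ oT 2 m 1 k j 0 ck.
exact: (etrans (E u v) (etrans (@derive_symmetric R _ (fun z => k z j 0) u v y cj) (esym (E v u)))).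
Qed.

(* <D_u D_v k, D_w k> is symmetric in (u, v) and skew in (v, w), hence zero. *)
Lemma second_derive_eq0 u v y : 'D_u ('D_v k) y = 0.
Proof.
pose c u v w := dotv ('D_u ('D_v k) y) ('D_w k y).
have sym a b d : c a b d = c b a d by rewrite /c second_derive_symmetric.
have skew a b d : c a b d = - c a d b.
  have := derive_dotv a (ddk b y) (ddk d y).
  rewrite (_ : (fun z => dotv ('D_b k z) ('D_d k z)) = cst (B b d)); last by apply/funext => z; exact: ok.
  rewrite derive_cst => /esym/eqP; rewrite addr_eq0 => /eqP E0.
  exact: (etrans E0 (congr1 -%R (dotvC ('D_b k y) ('D_a ('D_d k) y)))).
have c0 a b d : c a b d = 0.
  (* Three exchanges of the last two arguments, each with a sign, interleaved with exchanges of the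
     first two, return to the same triple. *)
  have : c a b d = - c a b d by rewrite {1}skew sym skew opprK sym skew sym.
  by lra.
(* The derivatives along the family e are orthonormal and as many as the dimension, so a vector
   orthogonal to all of them is zero. *)
pose J : 'M[R]_m := \matrix_(i, j) 'D_(e j) k y i 0.
have JJ : J^T *m J = 1%:M.
  apply/matrixP => i j; rewrite !mxE -eB -(ok y) dotvE.
  by apply: eq_bigr => l _; rewrite !mxE.
have JJ' : J *m J^T = 1%:M by exact: mulmx1C.
rewrite -['D_u _ y]mul1mx -JJ' -mulmxA (_ : J^T *m _ = 0) ?mulmx0//.
apply/colP => j; rewrite !mxE; have := c0 u v (e j); rewrite /c dotvE => E.
by rewrite -[RHS]E; apply: eq_bigr => l _; rewrite !mxE mulrC.
Qed.

Lemma increment_derive y : k y = k 0 + 'D_y k 0.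
Proof.
have mvt (f : V -> R) (u : V) : (forall x, differentiable f x) -> exists c : R, f u - f 0 = 'D_u f (c *: u).
  move=> df; have [c [_ _]] := line_MVT 0 u ltr01 df; rewrite scale1r !addr0 mul1r => E.
  by exists c.
have cc j : continuous (@coordf R m 1 j 0) by exact: coord_continuous.
have dcoord (f : V -> 'cV[R]_m) j : (forall x, differentiable f x) -> forall x, differentiable (fun z => f z j 0) x.
  move=> df x; apply: (@differentiable_comp _ _ _ _ f (@coordf R m 1 j 0)) => //.
  by apply: linear_differentiable; exact: cc.
have Dconst v z : 'D_v k z = 'D_v k 0.
  apply/colP => j; apply/eqP; rewrite -subr_eq0; apply/eqP.
  have [c ->] := mvt _ z (dcoord _ j (ddk v)); have [_ ->] := is_derive_coord z j (ddk v (c *: z)).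
  by rewrite second_derive_eq0 mx0E.
apply/colP => j; have [c] := mvt _ y (dcoord _ j dk).
by rewrite -derive_coord Dconst mxDE => <-; rewrite addrC subrK.
Qed.

End LocalIsometries.

Lemma local_isometry_affine (R : realType) m (k : 'cV[R]_m -> 'cV[R]_m) : Ck 2 setT k ->
  (forall y u v, dotv ('D_u k y) ('D_v k y) = dotv u v) ->
  exists2 Q : 'M[R]_m, Q^T *m Q = 1%:M & forall y, k y = Q *m y + k 0.
Proof.
move=> ck ok; have key (M : 'M[R]_m) i j : ((delta_mx i 0 : 'cV[R]_m)^T *m M *m (delta_mx j 0 : 'cV[R]_m)) 0 0 = M i j.
  by rewrite trmx_delta -rowE -colE !mxE.
have eB (i j : 'I_m) : dotv (delta_mx i 0 : 'cV[R]_m) (delta_mx j 0) = (i == j)%:R.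
  by have := key 1%:M i j; rewrite mulmx1 /dotv => ->; rewrite mxE.
have K := increment_derive ck ok eB.
pose J : 'M[R]_m := \matrix_(i, j) 'D_(delta_mx j 0) k 0 i 0.
have dk : differentiable k 0 by have [+ _] := (CkS _ _ _).1 ck; apply.
have DJ y : 'D_y k 0 = J *m y.
  rewrite deriveE// {1}[y]matrix_sum_delta; under eq_bigr do rewrite big_ord1.
  rewrite raddf_sum; apply/colP => i; rewrite summxE mxE; apply: eq_bigr => j _.
  rewrite [X in fun_of_matrix X _ _](_ : _ = y j 0 *: 'd k 0 (delta_mx j 0)); last exact: linearZ.
  by rewrite mxZE !mxE deriveE// mulrC.
exists J; last by move=> y; rewrite K DJ addrC.
apply/matrixP => i j; rewrite -[LHS]key [RHS]mxE -eB; have := ok 0 (delta_mx i 0) (delta_mx j 0).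
by rewrite !DJ /dotv trmx_mul !mulmxA => ->.
Qed.

(** * Euclidean charts of the boundary *)

Section EuclideanCharts.
Variables (R : realType) (n : nat) (psi : 'rV[R]_n).
Hypothesis Apsi : weyl psi.
Hypothesis n2 : (1 < n)%N.
Local Notation t := (ctype psi).
Local Notation h := (horo_fun psi).
Let n0 : (0 < n)%N := ltnW n2.
Implicit Types (x q u v : 'cV[R]_n) (i : 'I_n) (y : 'cV[R]_n.-1).

(** h is a sum of functions of one coordinate each, so its Hessian is diagonal, with the entries
    [hterm2]. *)
Definition hterm i (r : R) : R :=
  if (i == t :> nat)%N then - r else if (i < t)%N then - cw psi i * ln r else 2^-1 * (r * r).
Definition hterm1 i (r : R) : R :=
  if (i == t :> nat)%N then - 1 else if (i < t)%N then - cw psi i * r^-1 else r.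
Definition hterm2 i (r : R) : R :=
  if (i == t :> nat)%N then 0 else if (i < t)%N then cw psi i * (r^-1 * r^-1) else 1.

Lemma horo_sum x : h x = \sum_i hterm i (x i 0).
Proof.
have E (P : pred 'I_n) F : \sum_(i | P i) F i = \sum_i (if P i then F i else 0) :> R by rewrite big_mkcond.
rewrite horo_xE// (E (fun i : 'I_n => i == t :> nat)) (E (fun i : 'I_n => (i < t)%N)) (E (fun i : 'I_n => (t < i)%N)).
rewrite mulr_sumr -!sumrN -!big_split /=; apply: eq_bigr => i _.
by rewrite /hterm; case: ltngtP => _; rewrite /= ?expr2; ring.
Qed.

Lemma is_derive_hterm i (r : R) : ((i < t)%N -> 0 < r) -> is_derive r (1 : R) (hterm i) (hterm1 i r).
Proof.
rewrite /hterm /hterm1; case: (ltngtP i t) => it r0.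
- apply: (is_derive_eq (@is_deriveZ R R^o R^o (@ln R) (- cw psi i) r 1 _ (is_derive1_ln (r0 isT)))).
  by [].
- have H := @is_deriveZ R R^o R^o _ 2^-1 r 1 _ (@is_deriveM R R^o id id r 1 _ _ (is_derive_id r 1) (is_derive_id r 1)).
  by apply: (is_derive_eq H); rewrite /GRing.scale /=; field.
- exact: (is_deriveN (is_derive_id r (1 : R^o))).
Qed.

Lemma is_derive_hterm1 i (r : R) : ((i < t)%N -> 0 < r) -> is_derive r (1 : R) (hterm1 i) (hterm2 i r).
Proof.
rewrite /hterm1 /hterm2; case: (ltngtP i t) => it r0.
- have r1 : r != 0 by rewrite gt_eqF// r0.
  have H := @is_deriveZ R R^o R^o _ (- cw psi i) r 1 _ (@is_deriveV R id r 1 1 r1 (is_derive_id r 1)).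
  by apply: (is_derive_eq H); rewrite /GRing.scale /= mulr1 expr2 invfM; ring.
- exact: is_derive_id.
- exact: is_derive_cst.
Qed.

Lemma derive_coord_sum (T T1 : 'I_n -> R -> R) x v : (forall i, is_derive (x i 0) (1 : R) (T i) (T1 i (x i 0))) ->
  'D_v (fun z : 'cV[R]_n => \sum_i T i (z i 0)) x = \sum_i T1 i (x i 0) * v i 0.
Proof.
move=> HT.
have H i : is_derive x v (fun z : 'cV[R]_n => T i (z i 0)) (T1 i (x i 0) * v i 0).
  have cl : continuous (@coordf R n 1 i 0) by exact: coord_continuous.
  have dl : differentiable (@coordf R n 1 i 0) x by exact: linear_differentiable.
  have [dT eT] := HT i; have dT' : differentiable (T i) (coordf i 0 x) by exact/derivable1_diffP.
  have dc : derivable (T i \o @coordf R n 1 i 0) x v by apply: diff_derivable; exact: differentiable_comp.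
  have := derivableP dc; rewrite derive_comp// diff_lin//.
  rewrite (_ : 'd (T i) _ _ = T1 i (x i 0) * v i 0)//.
  rewrite [X in 'd _ _ X](_ : _ = v i 0 *: (1 : R^o)); last by rewrite /= /coordf /GRing.scale /= mulr1.
  by rewrite linearZ -deriveE// eT /GRing.scale /= mulrC.
have [_ <-] := is_derive_sum H; congr ('D_v _ x).
by apply/funext => z; rewrite fct_sumE.
Qed.

Lemma hessianE q u v : dom_h psi q -> hessian psi q u v = \sum_i hterm2 i (q i 0) * u i 0 * v i 0.
Proof.
move=> dq; have D1 x : dom_h psi x -> 'D_v h x = \sum_i hterm1 i (x i 0) * v i 0.
  move=> dx; have H : forall i, is_derive (x i 0) (1 : R) (hterm i) (hterm1 i (x i 0)).
    by move=> i; apply: is_derive_hterm; exact: dx.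
  rewrite -(derive_coord_sum v H).
  by congr ('D_v _ x); apply/funext => z; exact: horo_sum.
rewrite /hessian; have N : \forall x \near q, 'D_v h x = \sum_i hterm1 i (x i 0) * v i 0.
  have : nbhs q (dom_h psi) by apply: open_nbhs_nbhs; split=> //; exact: dom_open.
  by apply: filterS => x; exact: D1.
rewrite (near_eq_derive u N).
have H i : is_derive (q i 0) (1 : R) (fun r => hterm1 i r * v i 0) (hterm2 i (q i 0) * v i 0).
  have [H1 H2] := @is_deriveZ R R^o R^o _ (v i 0) (q i 0) 1 _ (is_derive_hterm1 (dq i)).
  have E : (fun r => hterm1 i r * v i 0) = v i 0 \*: hterm1 i by apply/funext => r; rewrite mulrC.
  by rewrite E; split=> //; rewrite H2 mulrC.
rewrite (derive_coord_sum (T := fun i r => hterm1 i r * v i 0) (T1 := fun i r => hterm2 i r * v i 0) u H).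
by apply: eq_bigr => i _; rewrite mulrAC.
Qed.

(** w and w' are p and p' in logarithmic coordinates. If t < n, the coordinate of index t is the
    component along [wv] and contributes nothing to the Hessian; if t = n, tangency to the boundary
    makes the component along [wv] zero. *)
Lemma chart_gram (q p p' w w' : 'cV[R]_n) : (forall i, w i 0 = (if (i < t)%N then sw psi i * (q i 0)^-1 else 1) * p i 0) ->
  (forall i, w' i 0 = (if (i < t)%N then sw psi i * (q i 0)^-1 else 1) * p' i 0) ->
  ((t < n)%N = false -> dotv (wv psi) w = 0) -> ((t < n)%N = false -> dotv (wv psi) w' = 0) ->
  dotv w w' - dotv (wv psi) w' * dotv w (wv psi) = \sum_i hterm2 i (q i 0) * p i 0 * p' i 0.
Proof.
move=> wE wE' w0 w0'; case: (boolP (t < n)%N) => tn; last first.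
  rewrite w0' ?(negbTE tn)// mul0r subr0 dotvE; apply: eq_bigr => i _; rewrite wE wE' /hterm2.
  have it : (i < t)%N by apply: leq_trans (ltn_ord i) _; rewrite leqNgt.
  by rewrite it ltn_eqF// -(sw_sqr Apsi it); ring.
pose l := Ordinal tn; have wvE z : dotv (wv psi) z = z l 0.
  rewrite dotvE (bigD1 l)//= big1 ?addr0 => [|i il]; first by rewrite /wv mxE tn eqxx mul1r.
  rewrite /wv mxE tn; case: eqVneq => [e|_]; last by rewrite mul0r.
  by move/eqP: il; case; exact: val_inj.
rewrite [dotv w (wv psi)]dotvC !wvE dotvE (bigD1 l)//= [RHS](bigD1 l)//= [hterm2 l _]/hterm2 eqxx !mul0r add0r.
rewrite [w' l 0 * _]mulrC addrAC subrr add0r; apply: eq_bigr => i il.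
have ilt : (i == t :> nat)%N = false by apply: negbTE; apply: contra il => /eqP e; apply/eqP/val_inj.
rewrite wE wE' /hterm2 ilt; case: (boolP (i < t)%N) => it; last by rewrite !mul1r.
by rewrite -(sw_sqr Apsi it); ring.
Qed.

Variable phi : 'cV[R]_n.-1 -> 'cV[R]_n.
Hypothesis chart : euclidean_chart psi phi.

Lemma chart_bdry y : dom_h psi (phi y) /\ h (phi y) = 0.
Proof.
have [_ _ im _ _] := chart; have : bdry (Omega psi) ((@affine R n \o phi) y) by rewrite -im; exists y.
by rewrite bdry_Omega// => -[x [dx hx]] /affine_inj <-.
Qed.

(** In logarithmic coordinates the Hessian metric of the boundary is the Euclidean metric of the
    projection to the hyperplane orthogonal to [wv]. *)
Lemma chart_metric y (u v : 'cV[R]_n.-1) : dotv ('D_u (fun z => Yc psi (phi z)) y) ('D_v (fun z => Yc psi (phi z)) y) = dotv u v.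
Proof.
have [sp _ _ _ gram] := chart; have oT : open [set: 'cV[R]_n.-1] := openT.
have dphi z : differentiable phi z by have [+ _] := (CkS _ _ _).1 (sp 1%N); apply.
have dlg z : differentiable (fun z => lg psi (phi z)) z.
  have c1 : Ck 1 setT (fun z => lg psi (phi z)).
    by apply: Ck_lg => // x _; have [] := chart_bdry x.
  by have [+ _] := (CkS _ _ _).1 c1; apply.
pose w a := 'D_a (fun z => lg psi (phi z)) y.
have YE a : 'D_a (fun z => Yc psi (phi z)) y = (Um psi)^T *m w a.
  rewrite (derive_linear_comp (l := mulmx (Um psi)^T) (f := fun z => lg psi (phi z)))//; first by rewrite /w deriveE.
  exact: mulmxl_continuous.
have wE a i : w a i 0 = (if (i < t)%N then sw psi i * (phi y i 0)^-1 else 1) * 'D_a phi y i 0.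
  have [_ <-] := is_derive_coord a i (dlg y).
  have [dy _] := chart_bdry y; have Hc := is_derive_coord a i (dphi y).
  case: (boolP (i < t)%N) => it; last first.
    have [_ <-] := Hc; rewrite mul1r; congr ('D_a _ y); apply/funext => z; by rewrite lgE (negbTE it).
  have dl : differentiable (@ln R) (phi y i 0).
    by apply/derivable1_diffP; have [] := is_derive1_ln (dy i it).
  have dci : differentiable (fun z => phi z i 0) y.
    apply: (@differentiable_comp _ _ _ _ phi (@coordf R n 1 i 0)) => //.
    by apply: linear_differentiable; exact: coord_continuous.
  have dln : derivable (@ln R \o (fun z => phi z i 0)) y a by apply: diff_derivable; exact: differentiable_comp.
  have -> : (fun z => lg psi (phi z) i 0) = sw psi i \*: (@ln R \o (fun z => phi z i 0)).
    by apply/funext => z; rewrite lgE it.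
  have e : 'd (fun z => phi z i 0) y a = 'D_a phi y i 0 by rewrite -deriveE//; have [_ ->] := Hc.
  have [_ lnE] := is_derive1_ln (dy i it).
  rewrite deriveZ// -[RHS]mulrA; apply: (congr1 (fun r => sw psi i * r)); rewrite derive_comp// e.
  rewrite [X in 'd _ _ X](_ : _ = 'D_a phi y i 0 *: (1 : R^o)); last by rewrite /GRing.scale /= mulr1.
  by rewrite linearZ -deriveE// lnE /GRing.scale /= mulrC.
rewrite !YE /dotv trmx_mul trmxK -mulmxA UmKT// mulmxBr mxDE mxNE -scalemxAr mxZE -!/(dotv _ _).
transitivity (hessian psi (phi y) ('D_u phi y) ('D_v phi y)); last exact: gram.
have [dy _] := chart_bdry y; rewrite hessianE//.
have w0 a : (t < n)%N = false -> dotv (wv psi) (w a) = 0.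
  move=> tn; have E : (fun z => dotv (wv psi) (lg psi (phi z))) = cst 0.
    apply/funext => z; have [_] := chart_bdry z; rewrite horo_funE// /hq.
    rewrite [X in _ + _ * X]big1 => [|i ti]; last by have := ltn_ord i; rewrite ltnNge (leq_trans _ (ltnW ti))// leqNgt tn.
    rewrite mulr0 addr0 => /eqP; rewrite oppr_eq0 => /eqP; rewrite /= => <-.
    have e0 : \sum_(i < n | (i == t :> nat)%N) lg psi (phi z) i 0 = 0.
      by apply: big1 => i /eqP it; have := ltn_ord i; rewrite it tn.
    rewrite /= /ell e0 add0r dotvE [RHS]big_mkcond; apply: eq_bigr => i _; rewrite /wv mxE tn.
    by case: ifP => // /negbT; rewrite -leqNgt => ti; have := ltn_ord i; rewrite ltnNge (leq_trans _ ti)// leqNgt tn.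
  have := derive_dotv a (differentiable_cst (wv psi) y) (dlg y).
  by rewrite E !derive_cst /dotv trmx0 mul0mx mx0E add0r => <-.
exact: (chart_gram (wE u) (wE v) (w0 u) (w0 v)).
Qed.

Lemma euclidean_chart_Ph : exists2 Q : 'M[R]_n.-1, Q^T *m Q = 1%:M & forall y, phi y = Ph psi (Q *m y) 0.
Proof.
have [sp _ _ p0 _] := chart; have oT : open [set: 'cV[R]_n.-1] := openT.
have c2 : Ck 2 setT (fun z => Yc psi (phi z)).
  by apply: Ck_Yc => // x _; have [] := chart_bdry x.
have [Q QQ HQ] := local_isometry_affine c2 chart_metric; exists Q => // y.
have [dy hy] := chart_bdry y; rewrite -[LHS](Ph_Yc Apsi n0 dy) hy oppr0.
by rewrite HQ p0 Yc_basepoint// addr0.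
Qed.

(** Conjugation by the orthogonal matrix that relates the chart to [Ph] transports the statements
    about [isoP] to the chart. *)
Lemma euclidean_chart_group : [/\ is_subgroup (GE psi phi), (forall v : 'cV[R]_n.-1, GE psi phi (tr_isom v)) &
  forall a, OE psi phi a <-> GE psi phi a /\ orth a].
Proof.
have [Q QQ HQ] := euclidean_chart_Ph; pose k := mk_isom 0 QQ.
have kE y : phi y = Ph psi (isom_act k y) 0 by rewrite HQ /isom_act addr0.
have conj_act a y : isom_act (k * a * k^-1)%g (isom_act k y) = isom_act k (isom_act a y).
  by rewrite -!isom_actM mulgVK.
have GP g a : Gpsi psi g -> (forall y, act g (affine (phi y)) = affine (phi (isom_act a y))) -> isoP psi g (k * a * k^-1)%g.
  move=> Gg H; have [b gb] := Gpsi_isoP Apsi n2 Gg; suff -> : (k * a * k^-1)%g = b by [].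
  apply: isom_act_inj => y; rewrite -[y](isom_actKV k) conj_act.
  have := H (isom_act k^-1%g y); rewrite !kE gb => /(affine_Ph_inj Apsi n2)[-> _].
  by [].
have PG g a : isoP psi g (k * a * k^-1)%g -> forall y, act g (affine (phi y)) = affine (phi (isom_act a y)).
  by move=> ga y; rewrite !kE ga conj_act.
have GEP a : GE psi phi a <-> exists g, isoP psi g (k * a * k^-1)%g.
  split=> [[g Gg H]|[g ga]]; first by exists g; exact: GP.
  by exists g; [exact: (isoP_Gpsi Apsi n2 ga)|exact: PG].
split.
- split.
  + by apply/GEP; exists 1%g; rewrite mulg1 mulgV; exact: isoP1.
  + move=> a b /GEP[g ga] /GEP[g' gb]; apply/GEP; exists (g * g')%g.
    have -> : (k * (a * b) * k^-1)%g = ((k * a * k^-1) * (k * b * k^-1))%g by rewrite !mulgA mulgVK.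
    exact: isoPM.
  + move=> a /GEP[g ga]; apply/GEP; exists g^-1%g.
    have -> : (k * a^-1 * k^-1)%g = (k * a * k^-1)^-1%g by rewrite !invgM invgK mulgA.
    exact: isoPV.
- move=> v; apply/GEP; exists (tr_pgl psi (Q *m v)).
  suff -> : (k * tr_isom v * k^-1)%g = tr_isom (Q *m v) by exact: isoP_tr.
  apply: isom_act_inj => y; rewrite -[y](isom_actKV k) conj_act !isom_act_tr.
  have tk : trans k = 0 by [].
  by move: (isom_act k^-1%g y) => x; rewrite /isom_act tk !addr0 mulmxDr.
- have tE a : trans (k * a * k^-1)%g = 0 <-> trans a = 0.
    have E : trans (k * a * k^-1)%g = Q *m trans a.
      have -> : trans (k * a * k^-1)%g = isom_act (k * a * k^-1)%g (isom_act k 0).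
        by rewrite /isom_act /trans /= mulmx0 addr0 mulmx0 add0r.
      by rewrite conj_act /isom_act /trans /= mulmx0 add0r addr0.
    rewrite E; split=> [Q0|->]; last by rewrite mulmx0.
    by rewrite -[trans a]mul1mx -QQ -mulmxA Q0 mulmx0.
  move=> a; split=> [[g [Gg gb] H]|[[g Gg H] oa]].
    split; first by exists g.
    have ga := GP _ _ Gg H; rewrite -Ph00// ga in gb.
    have [E _] := affine_Ph_inj Apsi n2 gb; apply/tE; move: E.
    by rewrite /isom_act mulmx0 add0r.
  exists g => //; split=> //; have ga := GP _ _ Gg H; rewrite -Ph00// ga.
  by move/tE: oa; rewrite /isom_act mulmx0 add0r => ->.
Qed.

End EuclideanCharts.

Theorem theorem0p2 (R : realType) (n : nat) (n_ge2 : (2 <= n)%N)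
    (psi psi' : 'rV[R]_n) (Apsi : weyl psi) (Apsi' : weyl psi') :
  [/\
   (forall Gamma Gamma' : set (PGL R n),
      lattice (Gpsi psi) Gamma -> lattice (Gpsi psi) Gamma' ->
      (torsion_free Gamma -> torsion_free Gamma' ->
        (equivalent_cusps (Omega psi) Gamma (Omega psi) Gamma' <->
         conjugate_in setT Gamma Gamma')) /\
      (conjugate_in setT Gamma Gamma' <->
       conjugate_in (PGL_of (Omega psi)) Gamma Gamma')),
   (forall Gamma : set (PGL R n), lattice (Gpsi psi) Gamma ->
      ((exists g, conjset g Gamma `<=` Gpsi psi') <->
       conjugate_in setT (Gpsi psi) (Gpsi psi'))),
   (conjugate_in setT (Gpsi psi) (Gpsi psi') <->
      exists2 t : R, 0 < t & psi' = t *: psi),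
   (psi != 0 -> PGL_of (Omega psi) = Gpsi psi) &
   (psi != 0 ->
      forall (phi : 'cV[R]_n.-1 -> 'cV[R]_n)
             (I : Type) (H : I -> groupType)
             (sigma : set (marking H (isom R n.-1)) ->
                      marking H (isom R n.-1)),
      euclidean_chart psi phi ->
      represents_lattices H (isom R n.-1) ->
      right_inverse_pi psi phi sigma ->
      exists2 Theta : set (marking H (isom R n.-1)) * set (isom R n.-1) ->
                      set (marking H (isom R n.-1)),
        is_Theta psi phi sigma Theta &
        set_bij (Theta_dom psi phi sigma) (teich H (GE psi phi)) Theta)].
Proof.
have n2 : (1 < n)%N := n_ge2; have n0 : (0 < n)%N := ltnW n2.
have bc Gamma Gamma' : lattice (Gpsi psi) Gamma -> lattice (Gpsi psi) Gamma' ->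
    conjugate_in setT Gamma Gamma' -> conjugate_in (PGL_of (Omega psi)) Gamma Gamma'.
  move=> l l' [g _ gG]; have [Delta cD HD] := lattice_translations Apsi n2 l.
  have [_ GG _ _] := l; have [_ GG' _ _] := l'.
  exact: (conjugate_PGL_Omega Apsi n2 cD GG GG' gG HD).
have iii : conjugate_in setT (Gpsi psi) (Gpsi psi') <-> exists2 t : R, 0 < t & psi' = t *: psi.
  split=> [[g _ gG]|[k k0 e]]; last exact: (scale_conjugate k0 e).
  (* For the full group every translation is available, so the argument for (ii) applies with the
     whole space as coarse set. *)
  have cT : coarse_set [set: 'cV[R]_n.-1].
    by exists 0 => y; exists y => //; rewrite subrr en0.
  apply: (conj_translations_scale Apsi Apsi' n2 (g := g) cT) => y _.
  by rewrite -gG; exists (tr_pgl psi y) => //; exact: tr_pgl_Gpsi.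
split=> //.
- move=> Gamma Gamma' l l'; split; last first.
    by split; [exact: bc|move=> [g _ gG]; exists g].
  move=> tf tf'; split; first exact: equivalent_cusps_conjugate.
  move=> /(bc _ _ l l'); apply: equivalent_of_conjugate; exact: lattice_generalized_cusp.
- move=> Gamma l; split=> [[g gG]|[g _ <-]]; last first.
    by have [_ GG _ _] := l; exists g => _ [x Gx <-]; exists x => //; exact: GG.
  apply/iii; have [Delta cD HD] := lattice_translations Apsi n2 l.
  apply: (conj_translations_scale Apsi Apsi' n2 (g := g) cD) => y Dy.
  by apply: gG; exists (tr_pgl psi y) => //; exact: HD.
- exact: PGL_Omega_eq_Gpsi.
- move=> _ phi I H sigma chart _ Hs; have [sG trG OEP] := euclidean_chart_group Apsi n2 chart.
  have [Theta T1 T2] := theta_bijection sG trG OEP Hs.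
  by exists Theta.
Qed.
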